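(* Let $b>0$, and suppose that $\gamma\in\mathbb{R}\setminus\{0\}$, $\sigma>0$, and $n\ge3$. Let $s=\lfloor n/2\rfloor+1\in\mathbb{N}$. There exists $r>0$ such that if $\eta\in X^{s+5/2}(\mathbb{R}^{n-1})$, $v\in{}_0H^{s+2}(\Omega_{b+\eta};\mathbb{R}^n)$, and $q\in Y^{s+1}(\Omega_{b+\eta})$ satisfy $\inf_{\mathbb{R}^{n-1}}\eta>-b$, $q-\eta\in H^{s+1}(\Omega_{b+\eta})$, and $$\begin{cases}(v-\gamma e_1)\cdot\nabla v-\Delta v+\nabla q=0&\text{in }\Omega_{b+\eta}\\ \operatorname{div}v=0&\text{in }\Omega_{b+\eta}\\ (qI-\mathbb{D}v)\mathcal{N}=(\eta-\sigma\mathcal{H}(\eta))\mathcal{N}&\text{on }\Sigma_{b+\eta}\\ -\gamma\partial_1\eta=v\cdot\mathcal{N}&\text{on }\Sigma_{b+\eta}\\ v=0&\text{on }\Sigma_0,\end{cases}$$ then either $v=0$, $q=0$, and $\eta=0$, or else $$\|v\|_{{}_0H^{s+2}}+\|q\|_{Y^{s+1}}+\|\eta\|_{X^{s+5/2}}+\|q-\eta\|_{H^{s+1}}\ge r.$$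
   Context: Points of $\mathbb{R}^n$ are written $x=(x',x_n)\in\mathbb{R}^{n-1}\times\mathbb{R}$. For $\zeta:\mathbb{R}^{n-1}\to(0,\infty)$ set $\Omega_\zeta=\{x:0<x_n<\zeta(x')\}$, $\Sigma_\zeta=\{x:x_n=\zeta(x')\}$; $\Sigma_0=\{x_n=0\}$. $H^s$ are the usual $L^2$-based (real) Sobolev spaces and ${}_0H^s(\Omega_\zeta;\mathbb{R}^n)=\{u\in H^s(\Omega_\zeta;\mathbb{R}^n):u=0\text{ on }\Sigma_0\}$ (trace sense). $\mathbb{D}v=\nabla v+(\nabla v)^{\intercal}$; $\nabla',\operatorname{div}'$ are the gradient and divergence in $\mathbb{R}^{n-1}$; $\mathcal{N}=(-\nabla'\eta,1)\in\mathbb{R}^n$; $\mathcal{H}(\eta)=\operatorname{div}'\big(\nabla'\eta/\sqrt{1+|\nabla'\eta|^2}\big)$. In conditions on $\Omega_{b+\eta}$ and $\Sigma_{b+\eta}$, $\eta$ is viewed as the function $x\mapsto\eta(x')$. Specialized spaces: with $\hat f(\xi)=\int_{\mathbb{R}^d}f(x)e^{-2\pi ix\cdot\xi}dx$, for $s\ge0$ let $\omega_s(\xi)=\frac{\xi_1^2+|\xi|^4}{|\xi|^2}$ for $|\xi|<1$ and $\omega_s(\xi)=(1+|\xi|^2)^s$ for $|\xi|\ge1$. $X^s(\mathbb{R}^d)$ is the space of real-valued tempered distributions $f$ with $\hat f\in L^1_{loc}$ and $\|f\|_{X^s}^2=\int\omega_s|\hat f|^2d\xi<\infty$. For bounded Lipschitz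 $\zeta:\mathbb{R}^{n-1}\to\mathbb{R}$ with $\inf\zeta>0$, $Y^s(\Omega_\zeta)=H^s(\Omega_\zeta)+X^s(\mathbb{R}^{n-1})$ is the space of $f\in L^1_{loc}(\Omega_\zeta)$ with $f(x)=g(x)+h(x')$ a.e. for some $g\in H^s(\Omega_\zeta)$, $h\in X^s(\mathbb{R}^{n-1})$, with norm $\|f\|_{Y^s}=\inf\{\|g\|_{H^s}+\|h\|_{X^s}:f=g+h\}$. *)

(* Defs.v *)
From HB Require Import structures.
From mathcomp Require Import all_boot all_order all_algebra.
From mathcomp Require Import all_classical all_reals all_analysis.
Set Implicit Arguments.
Unset Strict Implicit.
Unset Printing Implicit Defensive.
Import Order.TTheory GRing.Theory Num.Theory.
Import numFieldNormedType.Exports.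
Local Open Scope classical_set_scope.
Local Open Scope ring_scope.

Section coordinates.
Context {R : realType}.

(* The norm that 'rV[R]_n carries in the library is the sup norm, so the
   Euclidean structure is spelled out. *)
Definition dot n (x y : 'rV[R]_n) : R := \sum_(i < n) x 0 i * y 0 i.
Definition sqnorm n (x : 'rV[R]_n) : R := dot x x.

Definition e1 n : 'rV[R]_n := \row_(i < n) (i == 0 :> nat)%:R.

(* x = (x', x_n), with R^n written 'rV[R]_d.+1, so that d = n - 1. *)
Definition pt d (y : 'rV[R]_d) (t : R) : 'rV[R]_d.+1 :=
  \row_i (if unlift ord_max i is Some j then y 0 j else t).
Definition hpart d (x : 'rV[R]_d.+1) : 'rV[R]_d := \row_j x 0 (lift ord_max j).
Definition vpart d (x : 'rV[R]_d.+1) : R := x 0 ord_max.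

End coordinates.

Section lebesgue.
Context {R : realType}.

(* The sigma-algebra generated by the coordinates, i.e. the Borel sets. *)
Let coors n (i : 'I_n) (x : 'rV[R]_n) : measurableTypeR R := x 0 i.

Let rV_set0 n : g_sigma_preimage (@coors n) set0.
Proof. exact: sigma_algebra0. Qed.

Let rV_setC n A : g_sigma_preimage (@coors n) A ->
  g_sigma_preimage (@coors n) (~` A).
Proof. exact: sigma_algebraC. Qed.

Let rV_bigcup n (F : (set 'rV[R]_n)^nat) :
  (forall i, g_sigma_preimage (@coors n) (F i)) ->
  g_sigma_preimage (@coors n) (\bigcup_i (F i)).
Proof. exact: sigma_algebra_bigcup. Qed.

HB.instance Definition _ n :=
  @isMeasurable.Build default_measure_display 'rV[R]_n
    (g_sigma_preimage (@coors n)) (@rV_set0 n) (@rV_setC n) (@rV_bigcup n).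

Definition pair_pt n (p : 'rV[R]_n * measurableTypeR R) : 'rV[R]_n.+1 :=
  pt p.1 p.2.

Lemma measurable_coor n (i : 'I_n) : measurable_fun setT (@coors n i).
Proof.
move=> _ Y mY; rewrite setTI; apply: sub_sigma_algebra => /=.
rewrite -bigcup_seq/=; exists i => /=; first by rewrite mem_index_enum.
by exists Y => //; rewrite setTI.
Qed.

Lemma measurable_pair_pt n : measurable_fun setT (@pair_pt n).
Proof.
have mc (i : 'I_n.+1) :
    measurable_fun setT (fun p => coors i (@pair_pt n p)).
  rewrite /coors /pair_pt /pt.
  case: (unliftP ord_max i) => [j ->|->].
    rewrite [X in measurable_fun _ X](_ : _ = @coors n j \o fst).
      by apply: measurableT_comp; [exact: measurable_coor|exact: measurable_fst].
    by apply/funext => p /=; rewrite mxE liftK.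
  rewrite [X in measurable_fun _ X](_ : _ = snd); first exact: measurable_snd.
  by apply/funext => p /=; rewrite mxE unlift_none.
move=> _ A mA; rewrite setTI.
suff : g_sigma_preimage (@coors n.+1) `<=`
    [set B | measurable (@pair_pt n @^-1` B)] by exact.
apply: smallest_sub.
  split => /=.
  - by rewrite preimage_set0.
  - by move=> B mB; rewrite setTD preimage_setC; exact: measurableC.
  - by move=> F mF; rewrite preimage_bigcup; exact: bigcupT_measurable.
move=> B; rewrite -bigcup_seq => -[i _ [C mC <-]] /=; rewrite setTI.
by have := mc i measurableT C mC; rewrite setTI.
Qed.

Definition leb_step n (mu : {measure set 'rV[R]_n -> \bar R}) :=
  pushforward (mu \x (@lebesgue_measure R))%E (@pair_pt n).

HB.instance Definition _ n (mu : {measure set 'rV[R]_n -> \bar R}) :=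
  Measure.copy (leb_step mu)
    (measure_function_pushforward__canonical__measure_function_Measure
       (mu \x (@lebesgue_measure R))%E (@measurable_pair_pt n)).

(* Lebesgue measure on R^n, restricted to Borel sets. *)
Fixpoint leb n : {measure set 'rV[R]_n -> \bar R} :=
  match n with
  | 0 => \d_(0 : 'rV[R]_0)
  | m.+1 => leb_step (leb m)
  end.

End lebesgue.

Section sobolev.
Context {R : realType} {n : nat}.
Implicit Types (Om : set 'rV[R]_n) (u g f : 'rV[R]_n -> R) (l : seq 'I_n).

Definition pD l f : 'rV[R]_n -> R :=
  foldr (fun i h x => 'D_(delta_mx 0 i) h x) f l.

Definition smooth f : Prop := forall l,
  continuous (pD l f) /\
  forall i x, derivable (pD l f) x (delta_mx 0 i : 'rV[R]_n).

Definition test_fun Om f : Prop :=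
  [/\ smooth f, compact (closure [set x | f x != 0])
    & closure [set x | f x != 0] `<=` Om].

Definition L1loc Om f : Prop := measurable_fun Om f /\
  forall K, compact K -> K `<=` Om -> (leb n).-integrable K (EFin \o f).

Definition sqint Om f : \bar R := (\int[leb n]_(x in Om) (f x ^+ 2)%:E)%E.

Definition in_L2 Om f : Prop := measurable_fun Om f /\ (sqint Om f < +oo)%E.

Definition weak_deriv Om l u g : Prop :=
  [/\ L1loc Om u, L1loc Om g & forall phi, test_fun Om phi ->
    \int[leb n]_(x in Om) (u x * pD l phi x) =
    (-1) ^+ size l * \int[leb n]_(x in Om) (g x * phi x)].

(* A representative of the weak derivative, which is unique up to null sets
   when it exists. *)
Definition wD Om l u : 'rV[R]_n -> R := xget (fun=> 0) [set g | weak_deriv Om l u g].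

(* The multi-indices of length at most k are the functions a below with
   mlen a <= k; mseq a lists each index i exactly a i times. *)
Definition mlen k (a : {ffun 'I_n -> 'I_k.+1}) : nat := (\sum_(i < n) a i)%N.
Definition mseq k (a : {ffun 'I_n -> 'I_k.+1}) : seq 'I_n :=
  flatten [seq nseq (a i) i | i <- enum 'I_n].

Definition in_H k Om u : Prop := in_L2 Om u /\
  forall a : {ffun 'I_n -> 'I_k.+1}, (mlen a <= k)%N ->
    exists g, weak_deriv Om (mseq a) u g /\ in_L2 Om g.

Definition H_norm k Om u : \bar R :=
  poweR (\sum_(a : {ffun 'I_n -> 'I_k.+1} | (mlen a <= k)%N)
           sqint Om (wD Om (mseq a) u))%E 2^-1.

End sobolev.

Section specialized.
Context {R : realType} {n : nat}.
Implicit Types (f phi : 'rV[R]_n -> R) (T : ('rV[R]_n -> R) -> R).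

Definition schwartz f : Prop := smooth f /\
  forall p l : seq 'I_n, exists C : R, forall x : 'rV[R]_n,
    `|(\prod_(i <- p) x 0 i) * pD l f x| <= C.

(* A real-valued tempered distribution is determined by its values on real
   Schwartz functions; continuity is a bound by a Schwartz seminorm. *)
Definition tempered T : Prop :=
  (forall (a : R) phi psi, schwartz phi -> schwartz psi ->
     T (fun x => a * phi x + psi x) = a * T phi + T psi) /\
  exists (N : nat) (C : R), forall phi (M : R), schwartz phi ->
    (forall (p l : seq 'I_n) (x : 'rV[R]_n), (size p <= N)%N -> (size l <= N)%N ->
       `|(\prod_(i <- p) x 0 i) * pD l phi x| <= M) ->
    `|T phi| <= C * M.

Definition fcos phi (xi : 'rV[R]_n) : R :=
  \int[leb n]_x (phi x * cos (2 * pi * dot x xi)).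
Definition fsin phi (xi : 'rV[R]_n) : R :=
  \int[leb n]_x (phi x * sin (2 * pi * dot x xi)).

(* F.1 + i F.2 is a locally integrable function equal to the Fourier transform
   of T: as phi is real, its own transform is fcos phi - i fsin phi, and
   <T^, phi> = <T, phi^> separates into the two identities below. *)
Definition is_fourier T (F : ('rV[R]_n -> R) * ('rV[R]_n -> R)) : Prop :=
  [/\ L1loc setT F.1, L1loc setT F.2 & forall phi, test_fun setT phi ->
    T (fcos phi) = \int[leb n]_x (F.1 x * phi x) /\
    - T (fsin phi) = \int[leb n]_x (F.2 x * phi x)].

Definition omega (s : R) (xi : 'rV[R]_n) : R :=
  if sqnorm xi < 1 then (dot xi (e1 n) ^+ 2 + sqnorm xi ^+ 2) / sqnorm xi
  else (1 + sqnorm xi) `^ s.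

Definition omega_int (s : R) (F : ('rV[R]_n -> R) * ('rV[R]_n -> R)) : \bar R :=
  (\int[leb n]_xi (omega s xi * (F.1 xi ^+ 2 + F.2 xi ^+ 2))%:E)%E.

Definition distr_in_X (s : R) T : Prop := tempered T /\
  exists F, is_fourier T F /\ (omega_int s F < +oo)%E.

Definition distr_X_norm (s : R) T : \bar R :=
  poweR (omega_int s (xget (fun=> 0, fun=> 0) [set F | is_fourier T F])) 2^-1.

(* A locally integrable function is identified with this distribution. *)
Definition distr f : ('rV[R]_n -> R) -> R :=
  fun phi => \int[leb n]_x (f x * phi x).

Definition in_X (s : R) f : Prop :=
  [/\ L1loc setT f,
      forall phi, schwartz phi ->
        (leb n).-integrable setT (fun x => (f x * phi x)%:E)
    & distr_in_X s (distr f)].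

Definition X_norm (s : R) f : \bar R := distr_X_norm s (distr f).

End specialized.

Section domains.
Context {R : realType} {d : nat}.
Implicit Types (zeta eta h : 'rV[R]_d -> R) (u q g : 'rV[R]_d.+1 -> R)
  (v : 'rV[R]_d.+1 -> 'rV[R]_d.+1) (Om : set 'rV[R]_d.+1).

Definition Omega zeta : set 'rV[R]_d.+1 :=
  [set x | 0 < vpart x < zeta (hpart x)].

(* The trace of u on the boundary portion {x_n = top (x')} of Om is t, written
   as a function of x': the continuous extension of the restriction map from
   smooth functions, for the H^1 norm near bounded parts of the boundary and
   the L^2 norm on them. *)
Definition has_trace Om (top : 'rV[R]_d -> R) u (t : 'rV[R]_d -> R) : Prop :=
  measurable_fun setT t /\
  exists w : nat -> 'rV[R]_d.+1 -> R, (forall k, smooth (w k)) /\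
    forall rho : R, 0 < rho ->
      let D := Om `&` [set x | sqnorm (hpart x) < rho ^+ 2] in
      [/\ (fun k => sqint D (fun x => w k x - u x)) @ \oo --> 0%E,
          forall i, (fun k =>
            sqint D (fun x => pD [:: i] (w k) x - wD Om [:: i] u x))
            @ \oo --> 0%E
        & (fun k => sqint [set y | sqnorm y < rho ^+ 2]
            (fun y => w k (pt y (top y)) - t y)) @ \oo --> 0%E].

Definition in_0H k Om v : Prop := forall i : 'I_d.+1,
  in_H k Om (fun x => v x 0 i) /\
  has_trace Om (fun=> 0) (fun x => v x 0 i) (fun=> 0).

Definition Hvec_norm k Om v : \bar R :=
  poweR (\sum_(i < d.+1) poweR (H_norm k Om (fun x => v x 0 i)%R) 2)%E 2^-1.

Definition Y_dec k Om q g h : Prop :=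
  [/\ in_H k Om g, in_X k%:R h
    & {ae leb d.+1, forall x, Om x -> q x = g x + h (hpart x)}].

Definition in_Y k Om q : Prop := L1loc Om q /\ exists g h, Y_dec k Om q g h.

Definition Y_norm k Om q : \bar R :=
  ereal_inf [set r | exists g h, Y_dec k Om q g h /\
    r = (H_norm k Om g + X_norm k%:R h)%E].

Definition hgrad eta (y : 'rV[R]_d) : 'rV[R]_d :=
  \row_j 'D_(delta_mx 0 j) eta y.

Definition normal eta (y : 'rV[R]_d) : 'rV[R]_d.+1 := pt (- hgrad eta y) 1.

Definition curvature eta (y : 'rV[R]_d) : R :=
  \sum_(j < d) 'D_(delta_mx 0 j)
    (fun z => hgrad eta z 0 j / Num.sqrt (1 + sqnorm (hgrad eta z))) y.

(* wgrad Om v x i j is the weak derivative of the i-th component of v in the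
   direction j. *)
Definition wgrad Om v (x : 'rV[R]_d.+1) : 'M[R]_d.+1 :=
  \matrix_(i, j) wD Om [:: j] (fun z => v z 0 i) x.

Definition symgrad Om v (x : 'rV[R]_d.+1) : 'M[R]_d.+1 :=
  wgrad Om v x + (wgrad Om v x)^T.

End domains.

(* Main.v *)
Require Import Defs.
From HB Require Import structures.
From mathcomp Require Import all_boot all_order all_algebra.
From mathcomp Require Import all_classical all_reals all_analysis.
From mathcomp Require Import measurable_realfun ring lra zify.
Set Implicit Arguments.
Unset Strict Implicit.
Unset Printing Implicit Defensive.
Import Order.TTheory GRing.Theory Num.Theory.
Import numFieldNormedType.Exports.
Local Open Scope classical_set_scope.
Local Open Scope ring_scope.

(* The system has no nontrivial solution at all in this class, so any r > 0 works
   and the norms play no role.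

   Fourier inversion shows that eta is a bounded C^2 function with bounded
   derivatives, a C^1-uniform limit of smooth functions, and that it vanishes if
   d_1 eta does. Put p = q - eta and S = p I - Dv, so that the momentum equation
   is h - Lap v + grad p + grad eta = 0 with h = (v - gamma e_1) . grad v; it
   implies that grad eta is in L^2. Multiply by v and integrate. The convective
   term gives 0, as v - gamma e_1 is divergence free and tangent to the free
   surface. The stress gives the integral of |Dv|^2 / 2 plus a boundary term
   proportional to the integral of H(eta) d_1 eta, which is 0 because H(eta) d_1 eta
   is a divergence. The gravity term, the integral of v . grad eta, is 0 because
   its flux is - gamma eta d_1 eta (after replacing eta by its second differences,
   eta itself not being in L^2). Hence Dv = 0, so v = 0; the kinematic condition
   gives d_1 eta = 0, so eta = 0, and then q = 0. *)

(** * Integration on row vectors *)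

Section rowvectors.
Context {R : realType}.

(** Two obstacles shape the argument. The surface function [eta] is known only through its Fourier
    transform, whose weight degenerates at low frequency, so neither [eta] nor [q] need be in L^2;
    only p = q - eta and, once the momentum equation has been used, grad eta can be paired with v.
    This route to grad eta in L^2 spares Plancherel's identity: from the transform only absolutely
    convergent integrals are taken. Next, boundary values exist only as limits of smooth
    approximants, and the equations hold only against test functions supported inside the domain.
    Integration by parts is therefore done with plateau functions, equal to a horizontal cutoff away
    from thin boundary layers, and a boundary condition enters as the smallness of an integral over
    such a layer. The layers follow smooth functions close to [zeta] together with their gradients,
    whence the C^1 approximation. Sobolev embeddings are avoided as well: v_i^2 is replaced by a
    function of v_i with bounded derivative, and the convective term is square integrable by the
    momentum equation itself. *)

Lemma mx_norm_lt n (x : 'rV[R]_n) (e : R) : 0 < e ->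
  (forall i, `|x 0 i| < e) -> `|x| < e.
Proof.
move=> e0 H; rewrite /Num.Def.normr/= mx_normrE.
apply/bigmax_ltP; split=> // -[i j] _ /=; rewrite (ord1 i); exact: H.
Qed.

Lemma coord_le_norm n (x : 'rV[R]_n) i : `|x 0 i| <= `|x|.
Proof.
rewrite [in leRHS]/Num.Def.normr/= mx_normrE.
exact: (le_bigmax_cond _ (fun p : 'I_1 * 'I_n => `|x p.1 p.2|) (j := (0, i))).
Qed.

Lemma mx_norm_le n (x : 'rV[R]_n) (e : R) : 0 <= e ->
  (forall i, `|x 0 i| <= e) -> `|x| <= e.
Proof.
move=> e0 H; rewrite /Num.Def.normr/= mx_normrE.
apply/bigmax_leP; split=> // -[i j] _ /=; rewrite (ord1 i); exact: H.
Qed.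

(** The sigma-algebra is generated by the coordinates. An open set belongs to it because it is the
    union of the countably many rational cubes that it contains. *)
Lemma open_measurable_rV n (A : set 'rV[R]_n) : open A -> measurable A.
Proof.
move=> oA.
pose B (p : 'rV[rat]_n * nat) :=
  [set x : 'rV[R]_n | forall i, `|x 0 i - ratr (p.1 0 i)| < p.2.+1%:R^-1].
have mB p : measurable (B p).
  have -> : B p = \bigcap_(i in [set: 'I_n])
      ((fun x : 'rV[R]_n => x 0 i) @^-1`
        [set t | `|t - ratr (p.1 0 i)| < p.2.+1%:R^-1]).
    by apply/seteqP; split=> x /= H i; [move=> _|]; exact: H.
  apply: fin_bigcap_measurable => // i _.
  rewrite -[X in measurable X]setTI; apply: measurable_coor => //.
  have -> : [set t : R | `|t - ratr (p.1 0 i)| < p.2.+1%:R^-1] =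
      ball (ratr (p.1 0 i) : R) p.2.+1%:R^-1.
    by apply/seteqP; split=> t /=; rewrite /ball/= distrC.
  by apply: open_measurable; exact: ball_open.
have -> : A = \bigcup_p (if `[< B p `<=` A >] then B p else set0).
  apply/seteqP; split; last first.
    by move=> x [p _] /=; case: asboolP => // H Bx; exact: H.
  move=> x Ax.
  have /nbhs_ballP[e /= e0 He] : nbhs x A by exact: open_nbhs_nbhs.
  (* Both x and any point of the chosen cube are within one half-width of the rational centre, so
     two half-widths must fit into [e]. *)
  have [k /= k2] : exists k : nat, (2 * k.+1%:R^-1 : R) < e.
    exists (Num.truncn (2 / e)).
    rewrite ltr_pdivrMr ?ltr0n// mulrC -ltr_pdivrMr//.
    exact: truncnS_gt.
  have Hq i : exists q : rat, `|x 0 i - ratr q| < k.+1%:R^-1.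
    have k0 : 0 < k.+1%:R^-1 :> R by rewrite invr_gt0 ltr0n.
    have lt2 (a c : R) : 0 < c -> a - c < a + c by move=> c0; lra.
    have [q] := rat_in_itvoo (lt2 (x 0 i) _ k0).
    rewrite in_itv/= => /andP[q1 q2]; exists q.
    by rewrite distrC ltr_distl q1 q2.
  have [q qP] := choice Hq.
  exists (\row_i q i, k) => //=.
  case: asboolP => [_ /= i|]; first by rewrite /= mxE.
  case=> y /= By; apply: He; rewrite -ball_normE /=.
  apply: mx_norm_lt => // i; rewrite !mxE.
  rewrite (le_lt_trans (ler_distD (ratr (q i)) _ _))// (lt_trans _ k2)//.
  rewrite mulr_natl mulr2n ltrD//; have := By i; rewrite /= mxE// distrC//.
apply: countable_bigcupT_measurable; first exact: countableP.
by move=> p; case: asboolP.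
Qed.

Lemma continuous_measurable_rV n (f : 'rV[R]_n -> R) :
  continuous f -> measurable_fun setT f.
Proof.
move=> cf; apply: (measurability _ (measurable_realfun.RGenOpens.measurableE R)).
move=> _ [_ [a [b ->] <-]]; rewrite setTI; apply: open_measurable_rV.
by apply: open_comp; [move=> x _; exact: cf|exact: interval_open].
Qed.

Lemma closed_measurable_rV n (A : set 'rV[R]_n) : closed A -> measurable A.
Proof.
by move=> cA; rewrite -(setCK A); apply: measurableC; apply: open_measurable_rV;
  exact: closed_openC.
Qed.

Lemma measurable_to_rV d (T : measurableType d) n (f : T -> 'rV[R]_n) :
  (forall i, measurable_fun setT (fun x => f x 0 i)) -> measurable_fun setT f.
Proof.
move=> mf _ A mA; rewrite setTI.
pose G := [set B | measurable (f @^-1` B)].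
suff : @measurable _ 'rV[R]_n `<=` G by exact.
apply: smallest_sub.
  split => /=.
  - by rewrite /G/= preimage_set0.
  - by move=> B mB; rewrite /G/= setTD preimage_setC; exact: measurableC.
  - by move=> F mF; rewrite /G/= preimage_bigcup; exact: bigcupT_measurable.
move=> B; rewrite -bigcup_seq => -[i _ [C mC <-]] /=; rewrite setTI.
by have := mf i measurableT C mC; rewrite setTI.
Qed.

Local Notation mu := (@lebesgue_measure R).

Definition cube n (r : R) : set 'rV[R]_n := [set x | forall i, `|x 0 i| <= r].
Arguments cube : clear implicits.

Lemma closed_cube n r : closed (cube n r).
Proof.
have -> : cube n r = \bigcap_(i in [set: 'I_n])
    ((fun x : 'rV[R]_n => `|x 0 i|) @^-1` [set t | t <= r]).
  by apply/seteqP; split=> x /= H i; [move=> _|]; exact: H.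
apply: closed_bigI => i _; apply: closed_comp; last exact: closed_le.
by move=> x _; apply: continuous_comp;
  [exact: coord_continuous|exact: norm_continuous].
Qed.

Lemma measurable_cube n r : measurable (cube n r).
Proof. by apply: closed_measurable_rV; exact: closed_cube. Qed.

Lemma pt_ord_max d (y : 'rV[R]_d) t : pt y t 0 ord_max = t.
Proof. by rewrite mxE unlift_none. Qed.

Lemma pt_lift d (y : 'rV[R]_d) t j : pt y t 0 (lift ord_max j) = y 0 j.
Proof. by rewrite mxE liftK. Qed.

Lemma ptP d (P : 'I_d.+1 -> Prop) :
  P ord_max -> (forall j, P (lift ord_max j)) -> forall i, P i.
Proof. by move=> P1 P2 i; case: (unliftP ord_max i) => [j ->|->]. Qed.

Lemma leb_cube n (r : R) : 0 <= r -> leb n (cube n r) = ((2 * r) ^+ n)%:E.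
Proof.
move=> r0; elim: n => [|n IH].
  rewrite /= diracE mem_set//.
  by move=> [].
rewrite -[LHS]/((leb n \x mu)%E (@pair_pt R n @^-1` cube n.+1 r)).
have -> : @pair_pt R n @^-1` cube n.+1 r = cube n r `*` `[- r, r]%classic.
  apply/seteqP; split=> -[y t] /=; rewrite /pair_pt /cube/= in_itv/= -ler_norml.
    move=> H; split=> [i|]; first by have := H (lift ord_max i); rewrite pt_lift.
    by have := H ord_max; rewrite pt_ord_max.
  by move=> [H1 H2]; apply: ptP => [|j]; rewrite ?pt_ord_max ?pt_lift.
rewrite product_measure1E//; last exact: measurable_cube.
have E : (mu `[(- r)%R, r]%classic = (2 * r)%:E)%E.
  rewrite lebesgue_measure_itv/= lte_fin.
  have [r1|r1] := ltP (- r) r; first by rewrite -EFinB; congr (_%:E); lra.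
  by have -> : r = 0 by [apply/eqP; rewrite eq_le r0 andbT; lra]; rewrite mulr0.
by rewrite [X in (_ * X)%E]E IH -EFinM exprSr.
Qed.

Lemma cube_cover n : \bigcup_k cube n k%:R = setT.
Proof.
apply/seteqP; split=> // x _; exists (Num.truncn `|x|).+1 => //= i.
by rewrite (le_trans (coord_le_norm _ _))// ltW// truncnS_gt.
Qed.

Lemma sigma_finite_leb n : sigma_finite setT (@leb R n).
Proof.
exists (fun k => cube n k%:R); first by rewrite cube_cover.
by move=> k; split; [exact: measurable_cube|rewrite leb_cube ?ler0n// ltry].
Qed.

(** An alias of [leb n] on which sigma-finiteness is registered, as the theorems of Tonelli and
    Fubini ask of a factor. The two are convertible, so integrals pass silently from one to the
    other. *)
Definition sleb n : set 'rV[R]_n -> \bar R := leb n.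
Arguments sleb : clear implicits.
HB.instance Definition _ n := Measure.copy (sleb n) (leb n).
HB.instance Definition _ n :=
  @Measure_isSigmaFinite.Build _ _ _ (sleb n) (sigma_finite_leb n).
Definition slebm n : {sigma_finite_measure set 'rV[R]_n -> \bar R} := sleb n.

Lemma measurable_pt n : measurable_fun setT (@pair_pt R n).
Proof. exact: measurable_pair_pt. Qed.

Lemma tonelli n (f : 'rV[R]_n.+1 -> \bar R) : measurable_fun setT f ->
  (forall x, 0 <= f x)%E ->
  (\int[leb n.+1]_x f x = \int[leb n]_y \int[mu]_t f (pt y t))%E.
Proof.
move=> mf f0.
have -> : (\int[leb n.+1]_x f x = \int[leb n \x mu]_p f (pair_pt p))%E.
  by rewrite (ge0_integral_pushforward (@measurable_pt n)).
rewrite (@fubini_tonelli1 _ _ _ _ _ (slebm n) mu)//.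
by apply: measurableT_comp => //; exact: measurable_pt.
Qed.

Lemma tonelli_sym n (f : 'rV[R]_n.+1 -> \bar R) : measurable_fun setT f ->
  (forall x, 0 <= f x)%E ->
  (\int[leb n.+1]_x f x = \int[mu]_t \int[leb n]_y f (pt y t))%E.
Proof.
move=> mf f0; rewrite tonelli//.
apply: (@fubini_tonelli _ _ _ _ _ (slebm n) mu (fun p => f (pair_pt p))) => //.
by apply: measurableT_comp => //; exact: measurable_pt.
Qed.

Lemma integrable_pt n (f : 'rV[R]_n.+1 -> \bar R) :
  (leb n.+1).-integrable setT f ->
  (leb n \x mu)%E.-integrable setT (f \o @pair_pt R n).
Proof.
move=> /integrableP[mf fi]; apply/integrableP; split.
  by apply: measurableT_comp => //; exact: measurable_pt.
rewrite -(ge0_integral_pushforward (@measurable_pt n) _ (D := setT)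
  (f := fun x => `|f x|%E))//.
exact: measurableT_comp.
Qed.

Lemma fubini n (f : 'rV[R]_n.+1 -> \bar R) : (leb n.+1).-integrable setT f ->
  (\int[leb n.+1]_x f x = \int[leb n]_y \int[mu]_t f (pt y t))%E.
Proof.
move=> fi; have fp := integrable_pt fi.
have -> : (\int[leb n.+1]_x f x = \int[leb n \x mu]_p f (pair_pt p))%E.
  rewrite (integral_pushforward (@measurable_pt n))//.
  exact: measurable_int fi.
by rewrite -(@integral12_prod_meas1 _ _ _ _ _ (slebm n) mu (f \o @pair_pt R n)).
Qed.

Lemma fubini_sym n (f : 'rV[R]_n.+1 -> \bar R) : (leb n.+1).-integrable setT f ->
  (\int[leb n.+1]_x f x = \int[mu]_t \int[leb n]_y f (pt y t))%E.
Proof.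
move=> fi; have fp := integrable_pt fi; rewrite fubini//.
exact: (@Fubini _ _ _ _ _ (slebm n) mu (f \o @pair_pt R n)).
Qed.

End rowvectors.

Arguments cube {R} n r.
Arguments sleb {R} n.
Arguments slebm {R} n.

(** * Integrals of real functions over a measure space *)

Section meas.
Context d (T : measurableType d) (R : realType) (mu : {measure set T -> \bar R}).
Implicit Types (D : set T) (f g h : T -> R).

Definition intg D f := mu.-integrable D (EFin \o f).

Lemma intg_meas D f : intg D f -> measurable_fun D f.
Proof. by move=> /measurable_int /measurable_EFinP. Qed.

Lemma le_intg D f g : measurable D -> measurable_fun D f ->
  (forall x, D x -> `|f x| <= g x) -> intg D g -> intg D f.
Proof.
move=> mD mf fg ig; apply: le_integrable ig => //; first exact/measurable_EFinP.
move=> x Dx /=; rewrite lee_fin (le_trans (fg _ Dx))//; exact: ler_norm.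
Qed.

Lemma intgD D f g : measurable D -> intg D f -> intg D g ->
  intg D (fun x => f x + g x).
Proof. by move=> mD i1 i2; exact (integrableD mD i1 i2). Qed.

Lemma intgB D f g : measurable D -> intg D f -> intg D g ->
  intg D (fun x => f x - g x).
Proof. by move=> mD i1 i2; exact (integrableB mD i1 i2). Qed.

Lemma intgN D f : measurable D -> intg D f -> intg D (fun x => - f x).
Proof. by move=> mD i1; exact (integrableN i1). Qed.

Lemma intgZ D f k : measurable D -> intg D f -> intg D (fun x => k * f x).
Proof. by move=> mD i1; exact (integrableZl mD k i1). Qed.

Lemma intg0 D : intg D (fun=> 0).
Proof. exact: integrable0. Qed.

Lemma intg_sum I (s : seq I) (P : pred I) (F : I -> T -> R) D : measurable D ->
  (forall i, P i -> intg D (F i)) -> intg D (fun x => \sum_(i <- s | P i) F i x).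
Proof.
move=> mD H; elim: s => [|i s IH].
  by under eq_fun do rewrite big_nil; exact: intg0.
under eq_fun do rewrite big_cons.
by case E: (P i) => //; apply: intgD => //; exact: H.
Qed.

Lemma Rintegral_sum I (s : seq I) (P : pred I) (F : I -> T -> R) D :
  measurable D -> (forall i, P i -> intg D (F i)) ->
  \int[mu]_(x in D) (\sum_(i <- s | P i) F i x) =
  \sum_(i <- s | P i) \int[mu]_(x in D) F i x.
Proof.
move=> mD H; elim: s => [|i s IH].
  rewrite big_nil; under eq_Rintegral do rewrite big_nil.
  by rewrite Rintegral_cst// mul0r.
rewrite big_cons; under eq_Rintegral do rewrite big_cons.
case: ifP => // Pi; rewrite RintegralD ?IH//; first exact: H.
exact: intg_sum.
Qed.

Lemma intgMb D f h C : measurable D -> measurable_fun D h ->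
  (forall x, D x -> `|h x| <= C) -> intg D f -> intg D (fun x => h x * f x).
Proof.
move=> mD mh hC fi; have mf := intg_meas fi.
apply: (@le_intg _ _ (fun x => C * `|f x|)) => //.
- exact: measurable_funM.
- by move=> x Dx; rewrite normrM ler_wpM2r// hC.
- by apply: intgZ => //; exact: integrable_norm.
Qed.

Lemma intgS D E f : measurable D -> measurable E -> E `<=` D ->
  intg D f -> intg E f.
Proof. by move=> mD mE ED; exact: integrableS. Qed.

Lemma intg_abs D f : measurable D -> intg D f -> intg D (fun x => `|f x|).
Proof. by move=> mD; exact: integrable_norm. Qed.

Lemma intg_ge0P D f : measurable_fun D f -> (forall x, D x -> 0 <= f x) ->
  intg D f <-> (\int[mu]_(x in D) (f x)%:E < +oo)%E.
Proof.
move=> mf f0; rewrite /intg; split.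
  move=> /integrableP[_]; under eq_integral => x /set_mem Dx.
    rewrite /= ger0_norm ?f0//; over.
  by [].
move=> H; apply/integrableP; split; first exact/measurable_EFinP.
under eq_integral => x /set_mem Dx do rewrite /= ger0_norm ?f0//.
by [].
Qed.

Lemma ler_norm_Rint D f g : measurable D -> intg D f -> intg D g ->
  (forall x, D x -> `|f x| <= g x) ->
  `|\int[mu]_(x in D) f x| <= \int[mu]_(x in D) g x.
Proof.
move=> mD fi gi fg; apply: le_trans (le_normr_Rintegral mD fi) _.
by apply: le_Rintegral => //; exact: intg_abs.
Qed.

Lemma Rdct D (f_ : nat -> T -> R) f g : measurable D ->
  (forall k, measurable_fun D (f_ k)) -> intg D g ->
  (forall k x, D x -> `|f_ k x| <= g x) ->
  (forall x, D x -> f_ k x @[k --> \oo] --> f x) ->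
  (fun k => \int[mu]_(x in D) f_ k x) @ \oo --> \int[mu]_(x in D) f x.
Proof.
move=> mD mf gi fg ff.
have mF : measurable_fun D f by exact: (measurable_fun_cvg mf).
have fi : intg D f.
  apply: le_intg gi => // x Dx.
  have : (fun k => `|f_ k x|) @ \oo --> `|f x| by apply: cvg_norm; exact: ff.
  by move=> cf; apply: (ler_cvg_to cf (@cvg_cst _ (g x) _ _ _)); apply: nearW => k; exact: fg.
apply: fine_cvg; rewrite fineK; last exact: integrable_fin_num.
apply: (dominated_cvg mD _ _ _ gi) => //.
  by move=> n; exact/measurable_EFinP.
by move=> x Dx; apply: cvg_EFin; [exact: nearW|exact: ff].
Qed.

Lemma ae_Rint D f g : measurable D -> measurable_fun D f -> measurable_fun D g ->
  {ae mu, forall x, D x -> f x = g x} ->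
  \int[mu]_(x in D) f x = \int[mu]_(x in D) g x.
Proof.
move=> mD mf mg fg; rewrite /Rintegral; congr fine.
apply: ae_eq_integral => //; [exact/measurable_EFinP..|].
by apply: filterS fg => x fg Dx; rewrite /= fg.
Qed.

Lemma ae_intg D f g : measurable D -> measurable_fun D g -> intg D f ->
  {ae mu, forall x, D x -> f x = g x} -> intg D g.
Proof.
move=> mD mg fi fg; have mf := intg_meas fi.
move/integrableP: fi => [_ fi].
apply/integrableP; split; first exact/measurable_EFinP.
rewrite (_ : (\int[mu]_(x in D) _)%E =
  (\int[mu]_(x in D) `|(EFin \o f) x|)%E)//.
apply: ae_eq_integral => //; [by apply: measurableT_comp => //; exact/measurable_EFinP..|].
by apply: filterS fg => x fg Dx; rewrite /= fg.
Qed.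

Lemma Rint_ge0_eq0 D f : measurable D -> intg D f ->
  (forall x, D x -> 0 <= f x) -> \int[mu]_(x in D) f x = 0 ->
  {ae mu, forall x, D x -> f x = 0}.
Proof.
move=> mD fi f0 I0.
have mf : measurable_fun D (EFin \o f) by exact: measurable_int fi.
have : (\int[mu]_(x in D) `|(EFin \o f) x| = 0)%E.
  under eq_integral => x /set_mem Dx do rewrite /= ger0_norm ?f0//.
  rewrite -[LHS]fineK; last exact: integrable_fin_num.
  by rewrite [fine _]I0.
move/(ae_eq_integral_abs mu mD mf).
by apply: filterS => x /[apply] -[].
Qed.

End meas.

(** * Square integrable functions *)

Section L2.
Context d (T : measurableType d) (R : realType) (mu : {measure set T -> \bar R}).
Context (D : set T) (mD : measurable D).
Implicit Types (f g h : T -> R).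

Definition L2 f := measurable_fun D f /\ intg mu D (fun x => f x ^+ 2).
Definition N2 f : R := Num.sqrt (\int[mu]_(x in D) f x ^+ 2).

Lemma L2_intM f g : L2 f -> L2 g -> intg mu D (fun x => f x * g x).
Proof.
move=> [mf fi] [mg gi].
apply: (@le_intg _ _ _ _ _ _ (fun x => f x ^+ 2 + g x ^+ 2)) => //.
- exact: measurable_funM.
- move=> x Dx; rewrite normrM -(real_normK (num_real (f x))).
  rewrite -(real_normK (num_real (g x))).
  by have := sqr_ge0 (`|f x| - `|g x|); nra.
- exact: intgD.
Qed.

Lemma L2_dom f g : measurable_fun D f -> L2 g ->
  (forall x, D x -> `|f x| <= `|g x|) -> L2 f.
Proof.
move=> mf [mg gi] fg; split => //.
apply: le_intg gi => //; first exact: measurable_funX.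
move=> x Dx; rewrite normrX -(real_normK (num_real (g x))).
by rewrite lerXn2r ?nnegrE// fg.
Qed.

Lemma L2Z f k : L2 f -> L2 (fun x => k * f x).
Proof.
move=> [mf fi]; split; first exact: measurable_funM.
by under eq_fun do rewrite exprMn; exact: intgZ.
Qed.

Lemma L2D f g : L2 f -> L2 g -> L2 (fun x => f x + g x).
Proof.
move=> [mf fi] [mg gi]; split; first exact: measurable_funD.
apply: (@le_intg _ _ _ _ _ _ (fun x => 2 * f x ^+ 2 + 2 * g x ^+ 2)) => //.
- by apply: measurable_funX; exact: measurable_funD.
- move=> x Dx; rewrite ger0_norm ?sqr_ge0//.
  by have := sqr_ge0 (f x - g x); nra.
- by apply: intgD => //; exact: intgZ.
Qed.

Lemma L2N f : L2 f -> L2 (fun x => - f x).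
Proof. by move=> /(@L2Z _ (-1)); under eq_fun do rewrite mulN1r. Qed.

Lemma L2B f g : L2 f -> L2 g -> L2 (fun x => f x - g x).
Proof. by move=> ? ?; apply: L2D => //; exact: L2N. Qed.

Lemma L20 : L2 (fun=> 0).
Proof. by split => //; under eq_fun do rewrite expr0n/=; exact: intg0. Qed.

Lemma L2_sum I (s : seq I) (P : pred I) (F : I -> T -> R) :
  (forall i, P i -> L2 (F i)) -> L2 (fun x => \sum_(i <- s | P i) F i x).
Proof.
move=> H; elim: s => [|i s IH].
  by under eq_fun do rewrite big_nil; exact: L20.
under eq_fun do rewrite big_cons.
by case E: (P i) => //; apply: L2D => //; exact: H.
Qed.

Lemma L2Mb f h C : measurable_fun D h -> (forall x, D x -> `|h x| <= C) ->
  L2 f -> L2 (fun x => h x * f x).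
Proof.
move=> mh hC Hf; have [mf _] := Hf.
apply: (L2_dom _ (L2Z C Hf)) => [|x Dx]; first exact: measurable_funM.
rewrite !normrM ler_wpM2r//; apply: le_trans (hC _ Dx) _; exact: ler_norm.
Qed.

Lemma N2_ge0 f : 0 <= N2 f. Proof. exact: sqrtr_ge0. Qed.

Lemma N2_sq f : N2 f ^+ 2 = \int[mu]_(x in D) f x ^+ 2.
Proof. by rewrite sqr_sqrtr// Rintegral_ge0// => x _; exact: sqr_ge0. Qed.

(** The integral of (|f| t - |g|)^2 is a nonnegative polynomial in t of degree at most two, and
    suitable values of t give the discriminant inequality. *)
Lemma CS f g : L2 f -> L2 g ->
  \int[mu]_(x in D) `|f x * g x| <= N2 f * N2 g.
Proof.
move=> Hf Hg; set c := (X in X <= _).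
have c0 : 0 <= c by apply: Rintegral_ge0 => x _; exact: normr_ge0.
set a := N2 f ^+ 2; set b := N2 g ^+ 2.
have q (t : R) : 0 <= a * t ^+ 2 - 2 * c * t + b.
  have -> : a * t ^+ 2 - 2 * c * t + b =
      \int[mu]_(x in D) (`|f x| * t - `|g x|) ^+ 2.
    have E x : (`|f x| * t - `|g x|) ^+ 2 =
        (t ^+ 2 * f x ^+ 2 - (2 * t) * `|f x * g x|) + g x ^+ 2.
      rewrite normrM -[f x ^+ 2]real_normK ?num_real//.
      by rewrite -[g x ^+ 2]real_normK ?num_real//; ring.
    under eq_Rintegral do rewrite E.
    have i1 : intg mu D (fun x => t ^+ 2 * f x ^+ 2) by apply: intgZ => //; case: Hf.
    have i2 : intg mu D (fun x => 2 * t * `|f x * g x|).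
      by apply: intgZ => //; apply: intg_abs => //; exact: L2_intM.
    have i3 : intg mu D (fun x => g x ^+ 2) by case: Hg.
    rewrite RintegralD//; last exact: intgB.
    rewrite RintegralB// !RintegralZl//.
    - by rewrite -/c /a /b !N2_sq; ring.
    - by apply: intg_abs => //; exact: L2_intM.
    - by case: Hf.
  by apply: Rintegral_ge0 => x _; exact: sqr_ge0.
have a0 : 0 <= a by exact: sqr_ge0.
have b0 : 0 <= b by exact: sqr_ge0.
have cab : c ^+ 2 <= a * b.
  have [an0|an0] := eqVneq a 0.
    rewrite an0 mul0r.
    have [->|cn0] := eqVneq c 0; first by rewrite expr0n.
    (* If the leading coefficient vanishes while [c] does not, the polynomial is affine and takes
       the value -1 here. *)
    have := q ((b + 1) / (2 * c)).
    rewrite [X in X - _](_ : _ = 0); last by rewrite an0 mul0r.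
    have -> : 2 * c * ((b + 1) / (2 * c)) = b + 1 by field.
    by lra.
  (* The minimum of the polynomial. *)
  have := q (c / a).
  have -> : a * (c / a) ^+ 2 - 2 * c * (c / a) + b = b - c ^+ 2 / a by field.
  have ap : 0 < a by rewrite lt_neqAle eq_sym an0.
  by rewrite subr_ge0 ler_pdivrMr// mulrC.
rewrite -(@ler_pXn2r _ 2) ?nnegrE// ?mulr_ge0 ?N2_ge0//.
by rewrite exprMn.
Qed.

Lemma CS' f g : L2 f -> L2 g -> `|\int[mu]_(x in D) (f x * g x)| <= N2 f * N2 g.
Proof.
move=> Hf Hg; apply: le_trans (CS Hf Hg).
by apply: le_normr_Rintegral => //; exact: L2_intM.
Qed.

Lemma N2D f g : L2 f -> L2 g -> N2 (fun x => f x + g x) <= N2 f + N2 g.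
Proof.
move=> Hf Hg; rewrite -(@ler_pXn2r _ 2) ?nnegrE// ?addr_ge0 ?N2_ge0//.
rewrite sqrrD !N2_sq.
have E x : (f x + g x) ^+ 2 = f x ^+ 2 + 2 * (f x * g x) + g x ^+ 2 by ring.
under eq_Rintegral do rewrite E.
have i2 := L2_intM Hf Hg.
case: (Hf) => mf i1; case: (Hg) => mg i3.
rewrite RintegralD//; last by apply: intgD => //; exact: intgZ.
rewrite RintegralD//; last exact: intgZ.
rewrite RintegralZl// lerD2r lerD2l -[leRHS]mulr_natl.
rewrite ler_pM2l ?ltr0n//; apply: le_trans (CS' Hf Hg); exact: ler_norm.
Qed.

Lemma N2Z f k : L2 f -> N2 (fun x => k * f x) = `|k| * N2 f.
Proof.
move=> [mf fi]; rewrite /N2; under eq_Rintegral do rewrite exprMn.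
by rewrite RintegralZl// sqrtrM ?sqr_ge0// sqrtr_sqr.
Qed.

Lemma N2_le f g : L2 f -> L2 g -> (forall x, D x -> `|f x| <= `|g x|) ->
  N2 f <= N2 g.
Proof.
move=> [mf fi] [mg gi] fg; apply: ler_wsqrtr; apply: le_Rintegral => // x Dx.
rewrite -[leLHS]real_normK ?num_real// -[leRHS]real_normK ?num_real//.
by rewrite lerXn2r ?nnegrE// fg.
Qed.

End L2.

Lemma L2S d (T : measurableType d) (R : realType) (mu : {measure set T -> \bar R})
  (D E : set T) (f : T -> R) : measurable D -> measurable E -> E `<=` D ->
  L2 mu D f -> L2 mu E f.
Proof.
move=> mD mE ED [mf fi]; split; first exact: measurable_funS mf.
exact: intgS fi.
Qed.

Lemma Rint_subset d (T : measurableType d) (R : realType)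
  (mu : {measure set T -> \bar R})
  (D E : set T) (f : T -> R) : measurable D -> measurable E -> E `<=` D ->
  intg mu D f -> (forall x, D x -> 0 <= f x) ->
  \int[mu]_(x in E) f x <= \int[mu]_(x in D) f x.
Proof.
move=> mD mE ED fi f0; rewrite /Rintegral fine_le//.
- by apply: integrable_fin_num => //; exact: intgS fi.
- by apply: integrable_fin_num => //.
- apply: ge0_subset_integral => //; first exact: measurable_int fi.
Qed.

(** * Translations, reflection, lines and slices *)

Section coordmaps.
Context {R : realType}.
Local Notation mu := (@lebesgue_measure R).

Definition rowmap n (tau : 'I_n -> R -> R) (x : 'rV[R]_n) : 'rV[R]_n :=
  \row_i tau i (x 0 i).

Lemma measurable_rowmap n (tau : 'I_n -> R -> R) :
  (forall i, measurable_fun setT (tau i)) -> measurable_fun setT (rowmap tau).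
Proof.
move=> mt; apply: measurable_to_rV => i; under eq_fun do rewrite mxE.
apply: (measurableT_comp (mt i)); exact: measurable_coor.
Qed.

Lemma rV0_eq (x y : 'rV[R]_0) : x = y.
Proof. by apply/rowP => -[]. Qed.

Lemma measurable_pt_slice n (y : 'rV[R]_n) : measurable_fun setT (fun t : R => pt y t).
Proof.
apply: measurable_to_rV; apply: ptP => [|j].
  rewrite (_ : (fun t => _) = id); first exact: measurable_id.
  by apply/funext => t; rewrite pt_ord_max.
rewrite (_ : (fun t => _) = cst (y 0 j)); first exact: measurable_cst.
by apply/funext => t; rewrite pt_lift.
Qed.

Lemma measurable_int_slice n (f : 'rV[R]_n.+1 -> \bar R) :
  measurable_fun setT f -> (forall x, 0 <= f x)%E ->
  measurable_fun setT (fun y : 'rV[R]_n => (\int[mu]_t f (pt y t))%E).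
Proof.
move=> mf f0.
exact: (@measurable_fun_fubini_tonelli_F _ _ _ _ _ mu (f \o @pair_pt R n)
  (measurableT_comp mf (@measurable_pt R n)) (fun p => f0 (pair_pt p))).
Qed.

Lemma rowmap_pt n (tau : 'I_n.+1 -> R -> R) y t :
  rowmap tau (pt y t) =
  pt (rowmap (fun i => tau (lift ord_max i)) y) (tau ord_max t).
Proof.
apply/rowP; apply: ptP => [|j]; first by rewrite mxE !pt_ord_max.
by rewrite mxE !pt_lift mxE.
Qed.

(** Tonelli and induction on the dimension reduce invariance under a coordinatewise map to
    invariance in one variable. Translations and the reflection x -> -x are the instances needed. *)
Lemma ge0_integral_rowmap n (tau : 'I_n -> R -> R) (f : 'rV[R]_n -> \bar R) :
  (forall i, measurable_fun setT (tau i)) ->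
  (forall i (g : R -> \bar R), measurable_fun setT g -> (forall t, 0 <= g t)%E ->
     (\int[mu]_t g (tau i t) = \int[mu]_t g t)%E) ->
  measurable_fun setT f -> (forall x, 0 <= f x)%E ->
  (\int[leb n]_x f (rowmap tau x) = \int[leb n]_x f x)%E.
Proof.
elim: n tau f => [|n IH] tau f mt pt_ mf f0.
  by congr integral; apply/funext => x; congr f; exact: rV0_eq.
have mft := measurableT_comp mf (measurable_rowmap mt).
have mg := measurable_int_slice mf f0.
have g0 (y : 'rV[R]_n) : (0 <= \int[mu]_t f (pt y t))%E by exact: integral_ge0.
rewrite (tonelli mft (fun x => f0 (rowmap tau x))) (tonelli mf f0).
rewrite -(IH (fun i => tau (lift ord_max i)) _ _ _ mg g0).
- apply: eq_integral => y _.
  rewrite -(pt_ ord_max _ (measurableT_comp mf (measurable_pt_slice _)) (fun t => f0 (pt _ t))).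
  by apply: eq_integral => t _ /=; rewrite rowmap_pt.
- by move=> i; exact: mt.
- by move=> i; exact: pt_.
Qed.

Lemma Rintegral_rowmap n (tau : 'I_n -> R -> R) (f : 'rV[R]_n -> R) :
  (forall i, measurable_fun setT (tau i)) ->
  (forall i (g : R -> \bar R), measurable_fun setT g -> (forall t, 0 <= g t)%E ->
     (\int[mu]_t g (tau i t) = \int[mu]_t g t)%E) ->
  measurable_fun setT f ->
  \int[leb n]_x f (rowmap tau x) = \int[leb n]_x f x.
Proof.
move=> mt H mf; rewrite /Rintegral; congr fine.
have mEf : measurable_fun setT (EFin \o f) by exact/measurable_EFinP.
rewrite integralE [in RHS]integralE; congr (_ - _)%E.
  rewrite -(ge0_integral_rowmap mt H (measurable_funepos mEf))//.
  by apply: eq_integral => x _; rewrite !funeposE.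
rewrite -(ge0_integral_rowmap mt H (measurable_funeneg mEf))//.
by apply: eq_integral => x _; rewrite !funenegE.
Qed.

(** The image of Lebesgue measure under the translation agrees with it on half-open intervals, and
    these determine it. *)
Lemma ge0_integral_shift (g : R -> \bar R) a : measurable_fun setT g ->
  (forall t, 0 <= g t)%E -> (\int[mu]_t g (t + a)%R = \int[mu]_t g t)%E.
Proof.
move=> mg g0.
have ms : measurable_fun setT (fun t : R => t + a : measurableTypeR R).
  by apply: measurable_funD.
rewrite -(@ge0_integral_pushforward _ _ (measurableTypeR R) (measurableTypeR R) R _ ms mu setT g)//.
apply: eq_measure_integral => /= A mA _.
apply/esym; apply: (lebesgue_measure_unique (mu := pushforward mu (fun t : R =>
  t + a : measurableTypeR R))) => // X [[u v] _ <-].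
rewrite /= /pushforward.
have -> : (fun t : R => t + a) @^-1` `]u, v]%classic = `](u - a), (v - a)]%classic.
  by apply/seteqP; split => t /=; rewrite !in_itv/= ltrBlDr lerBrDr.
rewrite !lebesgue_measure_itv/= !lte_fin ltrD2r.
by case: ifP => // _; rewrite -!EFinB; congr EFin; ring.
Qed.

Lemma ge0_integral_opp (g : R -> \bar R) : measurable_fun setT g ->
  (forall t, 0 <= g t)%E -> (\int[mu]_t g (- t)%R = \int[mu]_t g t)%E.
Proof.
move=> mg g0.
have ms : measurable_fun setT (fun t : R => - t : measurableTypeR R).
  by apply: measurable_funN.
rewrite -(@ge0_integral_pushforward _ _ (measurableTypeR R) (measurableTypeR R) R _ ms mu setT g)//.
apply: eq_measure_integral => /= A mA _.
exact: lebesgue_measureN.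
Qed.

Lemma rowmap_shift n (a : 'rV[R]_n) x : rowmap (fun i t => t + a 0 i) x = x + a.
Proof. by apply/rowP => i; rewrite !mxE. Qed.

Lemma rowmap_opp n (x : 'rV[R]_n) : rowmap (fun _ t => - t) x = - x.
Proof. by apply/rowP => i; rewrite !mxE. Qed.

Lemma Rintegral_shift n (f : 'rV[R]_n -> R) (a : 'rV[R]_n) : measurable_fun setT f ->
  \int[leb n]_x f (x + a) = \int[leb n]_x f x.
Proof.
move=> mf; rewrite -[RHS](@Rintegral_rowmap n (fun i t => t + a 0 i))//.
- by under [in RHS]eq_Rintegral do rewrite rowmap_shift.
- by move=> i; apply: measurable_funD.
- by move=> i g mg g0; exact: ge0_integral_shift.
Qed.

Lemma ge0_integral_shift_rV n (f : 'rV[R]_n -> \bar R) (a : 'rV[R]_n) : measurable_fun setT f ->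
  (forall x, 0 <= f x)%E -> (\int[leb n]_x f (x + a)%R = \int[leb n]_x f x)%E.
Proof.
move=> mf f0; rewrite -[RHS](@ge0_integral_rowmap n (fun i t => t + a 0 i))//.
- by under [in RHS]eq_integral do rewrite rowmap_shift.
- by move=> i; apply: measurable_funD.
- by move=> i g mg g0; exact: ge0_integral_shift.
Qed.

Lemma Rintegral_opp n (f : 'rV[R]_n -> R) : measurable_fun setT f ->
  \int[leb n]_x f (- x) = \int[leb n]_x f x.
Proof.
move=> mf; rewrite -[RHS](@Rintegral_rowmap n (fun _ t => - t))//.
- by under [in RHS]eq_Rintegral do rewrite rowmap_opp.
- by move=> i; apply: measurable_funN.
- by move=> i g mg g0; exact: ge0_integral_opp.
Qed.

Lemma measurable_shift n (a : 'rV[R]_n) : measurable_fun setT (fun x : 'rV[R]_n => x + a).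
Proof.
apply: measurable_to_rV => i; under eq_fun do rewrite mxE.
by apply: measurable_funD => //; exact: measurable_coor.
Qed.

Lemma intg_shift n (f : 'rV[R]_n -> R) (a : 'rV[R]_n) : intg (leb n) setT f ->
  intg (leb n) setT (fun x : 'rV[R]_n => f (x + a)).
Proof.
move=> fi; have mf := intg_meas fi.
have mfa : measurable_fun setT (fun x : 'rV[R]_n => f (x + a)).
  by apply: (measurableT_comp mf); exact: measurable_shift.
move: fi => /integrableP[_ fi]; apply/integrableP; split; first exact/measurable_EFinP.
rewrite (ge0_integral_shift_rV (f := fun x => `|(EFin \o f) x|%E))//.
by apply: measurableT_comp => //; exact/measurable_EFinP.
Qed.

Lemma L2_shift n (f : 'rV[R]_n -> R) (a : 'rV[R]_n) : L2 (leb n) setT f ->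
  L2 (leb n) setT (fun x : 'rV[R]_n => f (x + a)).
Proof.
move=> [mf fi]; split; last exact: (intg_shift a fi).
by apply: (measurableT_comp mf); exact: measurable_shift.
Qed.

Lemma N2_shift n (f : 'rV[R]_n -> R) (a : 'rV[R]_n) : L2 (leb n) setT f ->
  N2 (leb n) setT (fun x => f (x + a)) = N2 (leb n) setT f.
Proof.
move=> [mf fi]; rewrite /N2 (Rintegral_shift (f := fun x => f x ^+ 2))//.
exact: measurable_funX.
Qed.

(** The hyperplane is either a product over a null hyperplane of one dimension less or the product
    of the whole space with a point. *)
Lemma leb_hyperplane n (i : 'I_n) : leb n [set x : 'rV[R]_n | x 0 i = 0] = 0%E.
Proof.
have mH m (j : 'I_m) : measurable [set x : 'rV[R]_m | x 0 j = 0].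
  apply: closed_measurable_rV.
  have -> : [set x : 'rV[R]_m | x 0 j = 0] = (fun x => x 0 j) @^-1` [set 0] by [].
  apply: closed_comp; first by move=> x _; exact: coord_continuous.
  exact: closed_eq.
elim: n i => [[]//|n IH] i.
rewrite -[LHS]/((leb n \x mu)%E (@pair_pt R n @^-1` _)).
case: (unliftP ord_max i) => [j ->|->].
  have -> : @pair_pt R n @^-1` [set x | x 0 (lift ord_max j) = 0] =
      [set y : 'rV[R]_n | y 0 j = 0] `*` setT.
    apply/seteqP; split=> -[y t] /=; rewrite /pair_pt/= pt_lift//.
    by case.
  have E1 : leb n [set y : 'rV[R]_n | y 0 j = 0] = 0%E := IH j.
  by rewrite product_measure1E//; [rewrite [X in (X * _)%E]E1 mul0e|exact: mH].
have -> : @pair_pt R n @^-1` [set x | x 0 ord_max = 0] = (setT : set 'rV[R]_n) `*` [set 0].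
  apply/seteqP; split=> -[y t] /=; rewrite /pair_pt/= pt_ord_max//.
  by case.
rewrite product_measure1E//.
have E : (mu [set 0%R] = 0)%E by exact: lebesgue_measure_set1.
by rewrite [X in (_ * X)%E]E mule0.
Qed.

(** The two difference quotients coincide before any limit is taken. Hence derivability and the
    derivative pass between f and its restriction to a line without any regularity assumption;
    slices are treated in the same way below. *)
Lemma line_quotient n (f : 'rV[R]_n -> R) (x v : 'rV[R]_n) (t : R) :
  (fun h : R => h^-1 *: (f (x + (h *: 1 + t) *: v) - f (x + t *: v))) =
  (fun h : R => h^-1 *: (f (h *: v + (x + t *: v)) - f (x + t *: v))).
Proof.
apply/funext => h; congr (_ *: (f _ - _)).
by rewrite scalerDl -[h *: 1]/(h * 1) mulr1 addrCA.
Qed.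

Lemma derivable_line n (f : 'rV[R]_n -> R) (x v : 'rV[R]_n) (t : R) :
  derivable (fun t : R => f (x + t *: v)) t 1 <-> derivable f (x + t *: v) v.
Proof. by rewrite /derivable line_quotient. Qed.

Lemma derive_line n (f : 'rV[R]_n -> R) (x v : 'rV[R]_n) (t : R) :
  'D_1 (fun t : R => f (x + t *: v)) t = 'D_v f (x + t *: v).
Proof. by rewrite /derive line_quotient. Qed.

Lemma pt_line n (y : 'rV[R]_n) t : pt y t = pt y 0 + t *: delta_mx 0 ord_max.
Proof.
apply/rowP; apply: ptP => [|j]; rewrite !mxE ?unlift_none ?liftK ?eqxx/=.
  by rewrite mulr1 add0r.
by rewrite eq_sym (negbTE (neq_lift _ _)) mulr0 addr0.
Qed.

Lemma pt_shift n (y z : 'rV[R]_n) t : pt (y + z) t = pt y t + pt z 0.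
Proof.
apply/rowP; apply: ptP => [|j]; rewrite !mxE ?unlift_none ?liftK ?addr0//.
by rewrite !mxE.
Qed.

Lemma pt_delta n (j : 'I_n) : pt (delta_mx 0 j) 0 = delta_mx 0 (lift ord_max j) :> 'rV[R]_n.+1.
Proof.
apply/rowP; apply: ptP => [|k]; rewrite !mxE ?unlift_none ?liftK ?eqxx/=.
  by rewrite (negbTE (neq_lift _ _)).
by rewrite mxE eqxx/= (inj_eq (@lift_inj _ _)).
Qed.

Lemma pt_scale n a (z : 'rV[R]_n) : pt (a *: z) 0 = a *: pt z 0.
Proof.
apply/rowP; apply: ptP => [|j]; rewrite !mxE ?unlift_none ?liftK ?mulr0//.
by rewrite !mxE.
Qed.

Lemma slice_quotient n (f : 'rV[R]_n.+1 -> R) t (y : 'rV[R]_n) j :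
  (fun h : R => h^-1 *: (f (pt (h *: delta_mx 0 j + y) t) - f (pt y t))) =
  (fun h : R => h^-1 *: (f (h *: delta_mx 0 (lift ord_max j) + pt y t) - f (pt y t))).
Proof.
by apply/funext => h; rewrite [h *: _ + y]addrC pt_shift pt_scale pt_delta [pt y t + _]addrC.
Qed.

Lemma derivable_slice n (f : 'rV[R]_n.+1 -> R) t (y : 'rV[R]_n) j :
  derivable (fun y => f (pt y t)) y (delta_mx 0 j) <->
  derivable f (pt y t) (delta_mx 0 (lift ord_max j)).
Proof. by rewrite /derivable slice_quotient. Qed.

Lemma derive_slice n (f : 'rV[R]_n.+1 -> R) t (y : 'rV[R]_n) j :
  'D_(delta_mx 0 j) (fun y => f (pt y t)) y =
  'D_(delta_mx 0 (lift ord_max j)) f (pt y t).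
Proof. by rewrite /derive slice_quotient. Qed.

Lemma ftc (F : R -> R) a b : a <= b -> (forall x, derivable F x 1) ->
  continuous (fun x => 'D_1 F x) ->
  \int[mu]_(x in `[a, b]) 'D_1 F x = F b - F a.
Proof.
rewrite le_eqVlt => /predU1P[<- _ _|ab dF cF].
  by rewrite subrr set_itv1 Rintegral_set1.
have cF0 : continuous F.
  by move=> x; apply: differentiable_continuous; exact/derivable1_diffP.
rewrite /Rintegral (continuous_FTC2 (F := F) ab)//.
- exact: continuous_subspaceT.
- split; [by move=> x _|apply: cvg_at_right_filter; exact: cF0|
    apply: cvg_at_left_filter; exact: cF0].
- by move=> x _; rewrite derive1E.
Qed.

Lemma intg_itv_cont (f : R -> R) a b : continuous f -> intg mu `[a, b] f.
Proof.
move=> cf; apply: continuous_compact_integrable; first exact: segment_compact.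
exact: continuous_subspaceT.
Qed.

End coordmaps.

(** * Compact supports and integration by parts on the whole space *)

Section ibp.
Context {R : realType}.
Local Notation mu := (@lebesgue_measure R).

Definition supported n (r : R) (f : 'rV[R]_n -> R) := forall x, ~ cube n r x -> f x = 0.

Lemma near0_shift n (A : set 'rV[R]_n) (x v : 'rV[R]_n) : open A -> A x ->
  \forall h \near (0 : R), A (h *: v + x).
Proof.
move=> oA Ax.
have : (fun h : R => h *: v + x) @ (0 : R) --> (0 : R) *: v + x.
  by apply: cvgD; [apply: cvgZr_tmp; exact: cvg_id|exact: cvg_cst].
rewrite scale0r add0r; apply; exact: open_nbhs_nbhs.
Qed.

Lemma derive_locally0 n (A : set 'rV[R]_n) (f : 'rV[R]_n -> R) x v : open A -> A x ->
  (forall y, A y -> f y = 0) -> 'D_v f x = 0.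
Proof.
move=> oA Ax fA; rewrite /derive; apply: lim_near_cst => //.
have H := @near0_shift n A x v oA Ax.
have : \forall h \near (0:R)^', A (h *: v + x) by exact: cvg_within H.
apply: filterS => h /fA; rewrite /= => ->; by rewrite (fA _ Ax) subrr scaler0.
Qed.

Lemma supported_derive n (r : R) (f : 'rV[R]_n -> R) v : supported r f ->
  supported r (fun x => 'D_v f x).
Proof.
move=> sf x nx; apply: (derive_locally0 (A := ~` cube n r)) => //.
exact/closed_openC/closed_cube.
Qed.

Lemma compact_cube n (r : R) : compact (cube n r : set 'rV[R]_n).
Proof.
apply: bounded_closed_compact; last exact: closed_cube.
exists (Num.max 0 r); split; first exact: num_real.
move=> M rM x cx; apply: mx_norm_le.
  by rewrite ltW// (le_lt_trans _ rM)// le_max lexx.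
by move=> i; rewrite (le_trans (cx i))// ltW// (le_lt_trans _ rM)// le_max lexx orbT.
Qed.

Lemma cont_compact_bounded n (K : set 'rV[R]_n) (f : 'rV[R]_n -> R) :
  compact K -> continuous f -> exists2 C, 0 < C & forall x, K x -> `|f x| <= C.
Proof.
move=> cK cf.
have := continuous_compact (continuous_subspaceT (A := K) cf) cK.
move=> /compact_bounded /pinfty_ex_gt0[C C0 HC]; exists C => // x Kx.
by apply: HC; exists x.
Qed.

Lemma cont_supp_bounded n (r : R) (f : 'rV[R]_n -> R) : continuous f -> supported r f ->
  exists2 C, 0 < C & forall x, `|f x| <= C.
Proof.
move=> cf sf; have [C C0 HC] := cont_compact_bounded (@compact_cube n r) cf.
exists C => // x; have [|nx] := pselect (cube n r x); first exact: HC.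
by rewrite sf// normr0 ltW.
Qed.

Lemma compact_sub_cube n (K : set 'rV[R]_n) : compact K ->
  exists2 r, 0 < r & K `<=` cube n r.
Proof.
move=> /compact_bounded /pinfty_ex_gt0[C C0 HC]; exists C => // x Kx i.
by apply: le_trans (coord_le_norm _ _) _; exact: HC.
Qed.

Lemma leb_cube_lty n (r : R) : (leb n (cube n r : set 'rV[R]_n) < +oo)%E.
Proof.
apply: (@le_lt_trans _ _ (leb n (cube n `|r|))).
  apply: le_measure; rewrite ?inE; [exact: measurable_cube..|].
  by move=> x cx i; apply: le_trans (cx i) _; exact: ler_norm.
by rewrite leb_cube// ltry.
Qed.

Lemma leb_compact_lty n (K : set 'rV[R]_n) : compact K -> (leb n K < +oo)%E.
Proof.
move=> cK; have [r r0 Kr] := compact_sub_cube cK.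
apply: le_lt_trans (leb_cube_lty n r); apply: le_measure => //; rewrite ?inE.
  by apply: closed_measurable_rV; apply: compact_closed => //; exact: norm_hausdorff.
exact: measurable_cube.
Qed.

Lemma intg_cst_fin d (T : measurableType d) (nu : {measure set T -> \bar R})
  (D : set T) (C : R) : measurable D -> (nu D < +oo)%E -> intg nu D (fun=> C).
Proof.
move=> mD fD; apply/integrableP; split; first exact/measurable_EFinP.
by rewrite integral_cst//= lte_mul_pinfty// ?lee_fin.
Qed.

Lemma intg_bounded_fin d (T : measurableType d) (nu : {measure set T -> \bar R})
  (D : set T) (f : T -> R) (C : R) : measurable D -> (nu D < +oo)%E ->
  measurable_fun D f -> (forall x, D x -> `|f x| <= C) -> intg nu D f.
Proof.
by move=> mD fD mf fC; apply: (le_intg mD mf fC); exact: intg_cst_fin.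
Qed.

Lemma intg_restr d (T : measurableType d) (nu : {measure set T -> \bar R})
  (D : set T) (f : T -> R) : measurable D -> measurable_fun setT f ->
  (forall x, ~ D x -> f x = 0) -> intg nu D f -> intg nu setT f.
Proof.
move=> mD mf f0 fi; rewrite /intg.
have -> : EFin \o f = (EFin \o f) \_ D.
  apply/funext => x; rewrite patchE; case: ifPn => // /negP xD /=.
  by rewrite f0// => Dx; apply: xD; rewrite inE.
by apply/(integrable_mkcond _ mD).
Qed.

Lemma Rint_restr d (T : measurableType d) (nu : {measure set T -> \bar R})
  (D : set T) (f : T -> R) :
  (forall x, ~ D x -> f x = 0) -> \int[nu]_x f x = \int[nu]_(x in D) f x.
Proof.
move=> f0; rewrite [RHS]Rintegral_mkcond; apply: eq_Rintegral => x _.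
rewrite patchE; case: ifPn => // /negP xD; rewrite f0// => Dx.
by apply: xD; rewrite inE.
Qed.

Lemma intg_cube n (r C : R) (f : 'rV[R]_n -> R) : measurable_fun setT f ->
  (forall x, `|f x| <= C) -> supported r f -> intg (leb n) setT f.
Proof.
move=> mf fC sf; apply: (intg_restr (@measurable_cube _ n r) mf sf).
apply: (@intg_bounded_fin _ _ _ _ _ C) => //; first exact: measurable_cube.
  exact: leb_cube_lty.
exact: measurable_funS mf.
Qed.

Lemma cont_intg n (r : R) (f : 'rV[R]_n -> R) : continuous f -> supported r f ->
  intg (leb n) setT f.
Proof.
move=> cf sf; have [C C0 fC] := cont_supp_bounded cf sf.
exact: (intg_cube (continuous_measurable_rV cf) fC sf).
Qed.

Lemma cont_comp (T U V : topologicalType) (f : T -> U) (g : U -> V) :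
  continuous f -> continuous g -> continuous (fun x => g (f x)).
Proof. by move=> cf cg x; apply: continuous_comp; [exact: cf|exact: cg]. Qed.

Lemma cont_to_rV (T : topologicalType) n (f : T -> 'rV[R]_n) :
  (forall i, continuous (fun x => f x 0 i)) -> continuous f.
Proof.
move=> cf x; apply/cvgrPdist_lt => e e0.
have H : \forall z \near x, forall i, `|f x 0 i - f z 0 i| < e.
  by apply: filter_forall => i; apply: cvgr_dist_lt => //; exact: cf.
apply: filterS H => z H; apply: mx_norm_lt => // i.
by rewrite !mxE; exact: H.
Qed.

Lemma cont_coord n (i : 'I_n) : continuous (fun x : 'rV[R]_n => x 0 i).
Proof. exact: coord_continuous. Qed.

Lemma continuous_pt (T : topologicalType) n (f : T -> 'rV[R]_n) (g : T -> R) :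
  continuous f -> continuous g -> continuous (fun x => pt (f x) (g x)).
Proof.
move=> cf cg; apply: cont_to_rV; apply: ptP => [|j].
  by rewrite (_ : (fun x => _) = g)//; apply/funext => x; rewrite pt_ord_max.
rewrite (_ : (fun x => _) = (fun x => f x 0 j)); last first.
  by apply/funext => x; rewrite pt_lift.
exact: (cont_comp cf (@cont_coord _ j)).
Qed.

Lemma continuous_pt_l n (t : R) : continuous (fun y : 'rV[R]_n => pt y t).
Proof.
apply: (@continuous_pt _ _ id (fun=> t)) => x; first exact: cvg_id.
exact: cst_continuous.
Qed.

Lemma continuous_pt_r n (y : 'rV[R]_n) : continuous (fun t : R => pt y t).
Proof. by apply: continuous_pt; [by move=> x; exact: cvg_cst|by move=> x; exact: cvg_id]. Qed.

Lemma derive1_supp0 (F : R -> R) (r t : R) : (forall t, r < `|t| -> F t = 0) ->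
  ~ `[- (`|r| + 1), `|r| + 1]%classic t -> 'D_1 F t = 0.
Proof.
move=> sF; rewrite /= => /negP; rewrite in_itv/= -ler_norml -ltNge => at_.
pose A := [set x : R | r < `|x|].
have oA : open A.
  apply: (@open_comp _ _ (fun x : R => `|x|) [set y | r < y]); last exact: open_gt.
  by move=> x _; exact: norm_continuous.
have At : A t.
  by rewrite /A/=; apply: lt_trans at_; apply: le_lt_trans (ler_norm r) _; rewrite ltrDl.
rewrite /derive; apply: lim_near_cst => //.
have : (fun h : R => h *: 1 + t : R) @ (0 : R) --> (0 : R) *: 1 + t.
  by apply: cvgD; [apply: cvgZr_tmp; exact: cvg_id|exact: cvg_cst].
rewrite scale0r add0r => /(_ A); move/(_ (open_nbhs_nbhs (conj oA At))) => H0.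
have H : \forall h \near (0 : R), A (h *: 1 + t) by exact: H0.
have : \forall h \near (0:R)^', A (h *: 1 + t) by exact: cvg_within H.
apply: filterS => h Ah /=; rewrite (sF _ Ah) (sF _ At) subrr.
by rewrite scaler0.
Qed.

Lemma Rint_derive1_supp (F : R -> R) (r : R) : (forall x, derivable F x 1) ->
  continuous (fun x => 'D_1 F x) -> (forall t, r < `|t| -> F t = 0) ->
  \int[mu]_x 'D_1 F x = 0.
Proof.
(* Nothing is known about the sign of [r]; radius [|r| + 1] gives a nondegenerate interval with [F]
   zero at its ends. *)
move=> dF cF sF; pose a : R := `|r| + 1.
have a0 : 0 < a by rewrite ltr_pwDr.
have aN : - a <= a by rewrite -subr_ge0 opprK addr_ge0// ltW.
rewrite (@Rint_restr _ (measurableTypeR R) mu `[- a, a]%classic).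
  rewrite ftc// !sF ?subr0//; rewrite ?normrN ger0_norm ?ltW//;
  by apply: le_lt_trans (ler_norm r) _; rewrite ltrDl.
by move=> t; exact: derive1_supp0.
Qed.

(** Fubini is used in the order adapted to the direction. For a horizontal derivative, each slice at
    fixed height falls under the induction hypothesis; for the vertical one, each vertical line
    carries the derivative of a compactly supported function. *)
Lemma ibp0 n (f : 'rV[R]_n -> R) (r : R) i : continuous f ->
  (forall x, derivable f x (delta_mx 0 i)) ->
  continuous (fun x => 'D_(delta_mx 0 i) f x) -> supported r f ->
  \int[leb n]_x 'D_(delta_mx 0 i) f x = 0.
Proof.
elim: n f i => [f []//|n IH] f i cf df cDf sf.
have iD : intg (leb n.+1) setT (fun x => 'D_(delta_mx 0 i) f x).
  by apply: cont_intg (supported_derive _ sf).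
case: (unliftP ord_max i) => [j E|E]; subst i.
- rewrite /Rintegral fubini_sym//.
  rewrite (_ : (fun t => _) = (fun=> 0%E)) ?integral0//; apply/funext => t.
  under eq_integral do rewrite -derive_slice.
  rewrite -[LHS]fineK.
    rewrite [fine _]IH//.
    + exact: (cont_comp (@continuous_pt_l _ t) cf).
    + by move=> y; apply/derivable_slice; exact: df.
    + rewrite (_ : (fun x => _) =
          (fun x => 'D_(delta_mx 0 (lift ord_max j)) f (pt x t))); last first.
        by apply/funext => x; rewrite derive_slice.
      exact: (cont_comp (@continuous_pt_l _ t) cDf).
    + move=> y ny; apply: sf => c; apply: ny => k; have := c (lift ord_max k).
      by rewrite pt_lift.
  apply: integrable_fin_num => //.
  apply: (@cont_intg n r).
    rewrite (_ : (fun x => _) =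
          (fun x => 'D_(delta_mx 0 (lift ord_max j)) f (pt x t))); last first.
        by apply/funext => x; rewrite derive_slice.
    exact: (cont_comp (@continuous_pt_l _ t) cDf).
  apply: (@supported_derive n (r : R) (fun y => f (pt y t))) => y ny.
  apply: sf => c; apply: ny => k; have := c (lift ord_max k).
  by rewrite pt_lift.
- rewrite /Rintegral fubini//.
  rewrite (_ : (fun y => _) = (fun=> 0%E)) ?integral0//; apply/funext => y.
  pose F t := f (pt y t).
  have FE : F = (fun t => f (pt y 0 + t *: delta_mx 0 ord_max)).
    by apply/funext => t; rewrite /F pt_line.
  have DFE : (fun t => 'D_(delta_mx 0 ord_max) f (pt y t)) = (fun t => 'D_1 F t).
    by apply/funext => t; rewrite FE derive_line -pt_line.
  have cDF : continuous (fun t => 'D_1 F t).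
    rewrite -DFE; exact: (cont_comp (@continuous_pt_r _ y) cDf).
  have dF t : derivable F t 1.
    by rewrite FE; apply/derivable_line; exact: df.
  have sF t : r < `|t| -> F t = 0.
    move=> rt; apply: sf => c; have := c ord_max; rewrite pt_ord_max.
    by rewrite leNgt rt.
  have DFE' t : 'D_(delta_mx 0 ord_max) f (pt y t) = 'D_1 F t.
    by have := congr1 (fun g => g t) DFE.
  under eq_integral do rewrite DFE'.
  have I0 := Rint_derive1_supp dF cDF sF.
  rewrite -[LHS]fineK ?[fine _]I0//.
  apply: integrable_fin_num => //.
  apply: (@intg_restr _ (measurableTypeR R) mu `[- (`|r| + 1), `|r| + 1]%classic) => //.
  + exact: continuous_measurable_fun.
  + by move=> t; exact: derive1_supp0.
  + exact: intg_itv_cont.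
Qed.
End ibp.

(** * Smooth functions and cutoffs *)

Section smoothness.
Context {R : realType}.
Notation ee i := (delta_mx 0 i : 'rV[R]_ _).

(** Only derivability in the single direction [v] is assumed of f; on the line through x in that
    direction this is the chain rule in one variable. *)
Lemma chain_rule n (phi : R -> R) (f : 'rV[R]_n -> R) x v :
  derivable f x v -> derivable phi (f x) 1 ->
  derivable (fun x => phi (f x)) x v /\
  'D_v (fun x => phi (f x)) x = 'D_1 phi (f x) * 'D_v f x.
Proof.
move=> df dphi.
pose g (h : R) := f (x + h *: v).
have g0 : g 0 = f x by rewrite /g scale0r addr0.
have dg : derivable g 0 1 by apply/derivable_line; rewrite scale0r addr0.
have dphi' : derivable phi (g 0) 1 by rewrite g0.
have dc : derivable (phi \o g) 0 1.
  apply/derivable1_diffP; apply: differentiable_comp; apply/derivable1_diffP.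
    exact: dg.
  exact: dphi'.
split.
  have := (derivable_line (fun x => phi (f x)) x v 0).1 dc.
  by rewrite scale0r addr0.
have := derive_line (fun x => phi (f x)) x v 0.
rewrite scale0r addr0 => <-.
rewrite -[LHS]derive1E (derive1_comp dg dphi') g0 !derive1E derive_line.
by rewrite scale0r addr0.
Qed.

Definition d1 (phi : R -> R) : R -> R := fun x => 'D_1 phi x.

Definition smooth1 (phi : R -> R) := forall k x, derivable (iter k d1 phi) x 1.

Lemma smooth1_derive phi : smooth1 phi -> smooth1 (d1 phi).
Proof. by move=> s k x; have := s k.+1 x; rewrite iterSr. Qed.

Lemma smooth1_continuous phi : smooth1 phi -> continuous phi.
Proof.
move=> s x; apply: differentiable_continuous; apply/derivable1_diffP.
exact: (s 0%N x).
Qed.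

(* Being stable under differentiation, this class consists of smooth functions,
   which gives all the closure properties of smoothness at once. *)
Inductive alg n : ('rV[R]_n -> R) -> Prop :=
| alg_smooth f : smooth f -> alg f
| alg_cst c : alg (fun=> c)
| alg_coord i : alg (fun x => x 0 i)
| alg_add f g : alg f -> alg g -> alg (fun x => f x + g x)
| alg_mul f g : alg f -> alg g -> alg (fun x => f x * g x)
| alg_inv f : (forall x, f x != 0) -> alg f -> alg (fun x => (f x)^-1)
| alg_comp phi f : smooth1 phi -> alg f -> alg (fun x => phi (f x)).

Lemma smooth_der n (f : 'rV[R]_n -> R) i : smooth f -> smooth (fun x => 'D_(ee i) f x).
Proof.
move=> sf l; have := sf (rcons l i).
by rewrite /pD foldr_rcons.
Qed.

Lemma derive_coord n (i j : 'I_n) (x : 'rV[R]_n) :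
  derivable (fun x : 'rV[R]_n => x 0 i) x (ee j) /\
  'D_(ee j) (fun x : 'rV[R]_n => x 0 i) x = (j == i)%:R.
Proof.
have E : (fun h : R => h^-1 *: ((h *: ee j + x) 0 i - x 0 i)) =
    (fun h : R => h^-1 * h * (j == i)%:R).
  apply/funext => h; rewrite !mxE eqxx/= addrK -mulrA [i == j]eq_sym.
  by rewrite -[_ *: _]/(_ * _).
have H : (fun h : R => h^-1 * h * (j == i)%:R) @ 0^' --> ((j == i)%:R : R).
  apply: (cvg_trans _ (@cvg_cst _ ((j == i)%:R : R) _ (0^' : set_system R) _)).
  apply: near_eq_cvg; near=> h.
  by rewrite mulVf ?mul1r//; near: h; exact: nbhs_dnbhs_neq.
split; first by apply/cvg_ex; exists (j == i)%:R; rewrite /= E.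
by rewrite /derive E; exact/cvg_lim.
Unshelve. all: by end_near. Qed.

Lemma alg_good n (f : 'rV[R]_n -> R) : alg f ->
  [/\ continuous f, forall i x, derivable f x (ee i) &
    forall i, alg (fun x => 'D_(ee i) f x)].
Proof.
elim=> {f}.
- move=> f sf; have := sf [::] => -[cf df]; split => // i.
  by apply: alg_smooth; exact: smooth_der.
- move=> c; split; first exact: cst_continuous.
  + by move=> i x; exact: derivable_cst.
  + move=> i; under eq_fun do rewrite derive_cst; exact: alg_cst.
- move=> i; split; first exact: cont_coord.
  + by move=> j x; case: (derive_coord i j x).
  + move=> j; under eq_fun do rewrite (derive_coord i j _).2; exact: alg_cst.
- move=> f g af [cf df Af] ag [cg dg Ag]; split.
  + by move=> x; apply: continuousD; [exact: cf|exact: cg].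
  + by move=> i x; apply: derivableD.
  + move=> i; under eq_fun do rewrite deriveD//; exact: alg_add.
- move=> f g af [cf df Af] ag [cg dg Ag]; split.
  + by move=> x; apply: continuousM; [exact: cf|exact: cg].
  + by move=> i x; apply: derivableM.
  + move=> i; under eq_fun do rewrite deriveM//.
    by apply: alg_add; exact: alg_mul.
- move=> f f0 af [cf df Af]; split.
  + by move=> x; apply: continuousV => //; exact: cf.
  + by move=> i x; apply: derivableV.
  + move=> i; under eq_fun do rewrite deriveV//.
    rewrite (_ : (fun x => _) =
        (fun x => (-1 : R) * (((f x)^-1 * (f x)^-1) * 'D_(ee i) f x))); last first.
      apply/funext => x; rewrite -[_ *: _]/(_ * _) expr2 invfM; ring.
    apply: alg_mul; first exact: alg_cst.
    by apply: alg_mul => //; apply: alg_mul; exact: alg_inv.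
- move=> phi f sphi af [cf df Af]; split.
  + exact: (cont_comp cf (smooth1_continuous sphi)).
  + move=> i x; apply: (chain_rule (df i x) _).1.
    exact: (sphi 0%N (f x)).
  + move=> i; rewrite (_ : (fun x => _) = (fun x => d1 phi (f x) * 'D_(ee i) f x)).
      by apply: alg_mul => //; apply: alg_comp => //; exact: smooth1_derive.
    apply/funext => x; apply: (chain_rule (df i x) _).2.
    exact: (sphi 0%N (f x)).
Qed.

Lemma algP n (f : 'rV[R]_n -> R) : alg f <-> smooth f.
Proof.
split; last exact: alg_smooth.
move=> af l.
have H : alg (pD l f) by elim: l => //= i l IH; have [_ _] := alg_good IH; exact.
by have [? ? _] := alg_good H.
Qed.

(** Smoothness as a greatest fixed point: to prove it, exhibit a class of continuous derivable
    functions that is stable under differentiation. *)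
Lemma smooth_coinduction n (C : ('rV[R]_n -> R) -> Prop) f :
  (forall f, C f -> [/\ continuous f, forall i x, derivable f x (ee i) &
     forall i, C (fun x => 'D_(ee i) f x)]) -> C f -> smooth f.
Proof.
move=> HC Cf l.
have H : C (pD l f) by elim: l => //= i l /HC[_ _]; exact.
by have [? ? _] := HC _ H.
Qed.

Lemma smooth_cont n (f : 'rV[R]_n -> R) : smooth f -> continuous f.
Proof. by move=> /(_ [::]) []. Qed.

Lemma smooth_drv n (f : 'rV[R]_n -> R) i x : smooth f -> derivable f x (ee i).
Proof. by move=> /(_ [::]) [_]; exact. Qed.

(** Carries smoothness from row vectors of length one to the line, so that a function of one
    variable can be treated with the closure properties of [alg]. *)
Lemma smooth1_of (g : 'rV[R]_1 -> R) : smooth g ->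
  smooth1 (fun t => g (const_mx t)).
Proof.
move=> sg k.
have cE t : const_mx t = 0 + t *: ee (0 : 'I_1) :> 'rV[R]_1.
  by apply/rowP => i; rewrite !mxE (ord1 i) !eqxx/= add0r mulr1.
have dE (h : 'rV[R]_1 -> R) : smooth h ->
    forall t, derivable (fun t => h (const_mx t)) t 1 /\
      'D_1 (fun t => h (const_mx t)) t = 'D_(ee (0 : 'I_1)) h (const_mx t).
  move=> sh t.
  have E : (fun t : R => h (const_mx t)) = (fun t => h (0 + t *: ee (0 : 'I_1))).
    by apply/funext => u; rewrite cE.
  split; first by rewrite E; apply/derivable_line; exact: smooth_drv.
  by rewrite E derive_line -cE.
have -> : iter k d1 (fun t => g (const_mx t)) =
    (fun t => pD (nseq k (0 : 'I_1)) g (const_mx t)).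
  elim: k => [//|k IH]; rewrite iterS IH; apply/funext => t; rewrite /d1.
  rewrite (dE _ _ t).2//= => l; have := sg (l ++ nseq k 0).
  by rewrite /pD foldr_cat.
move=> x; apply: (dE _ _ x).1 => l; have := sg (l ++ nseq k 0).
by rewrite /pD foldr_cat.
Qed.

End smoothness.

(** * A smooth step on the line *)

Section bump.
Context {R : realType}.

Lemma expn_le_exp n (u : R) : 0 <= u -> u ^+ n <= n`!%:R * expR u.
Proof.
move=> u0; case: n => [|n].
  by rewrite expr0 fact0 mul1r -expR0 ler_expR.
have := expR_ge1Dxn n u0; set a := u ^+ n.+1 => H.
have : a / n.+1`!%:R <= expR u by apply: le_trans H; rewrite lerDr.
by rewrite ler_pdivrMr ?ltr0n ?fact_gt0// mulrC.
Qed.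

Lemma poly_exp_bound (p : {poly R}) :
  exists2 C, 0 <= C & forall u, 0 <= u -> `|p.[u]| <= C * expR u.
Proof.
exists (\sum_(i < size p) `|p`_i| * i`!%:R).
  by apply: sumr_ge0 => i _; rewrite mulr_ge0.
move=> u u0; rewrite horner_coef (le_trans (ler_norm_sum _ _ _))// mulr_suml.
apply: ler_sum => i _; rewrite normrM -mulrA ler_wpM2l//.
by rewrite ger0_norm ?exprn_ge0// expn_le_exp.
Qed.

(** The functions p(1/t) exp(-1/t), extended by 0 to t <= 0. The family is stable under
    differentiation, with p replaced by [dpexp p], so that all derivatives of the classical flat
    function are handled together. *)
Definition pexp (p : {poly R}) (t : R) : R :=
  if 0 < t then p.[t^-1] * expR (- t^-1) else 0.

(** With u = 1/t this says that u^2 p(u) = O(exp u). A function that is O(t^2) has derivative 0 at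
    the origin, the only point where the derivative of [pexp] is not given by the usual rules. *)
Lemma pexp_bound p : exists2 C, 0 <= C & forall t, `|pexp p t| <= C * t ^+ 2.
Proof.
have [C C0 HC] := poly_exp_bound ('X^2 * p); exists C => // t.
rewrite /pexp; case: ifPn => [t0|]; last by rewrite normr0 mulr_ge0// sqr_ge0.
have u0 : 0 <= t^-1 by rewrite invr_ge0 ltW.
have := HC _ u0; rewrite hornerM hornerXn normrM => H.
rewrite normrM (ger0_norm (expR_ge0 _)) expRN ler_pdivrMr ?expR_gt0//.
rewrite mulrAC -ler_pdivrMr ?exprn_gt0// mulrC.
by move: H; rewrite ger0_norm ?exprn_ge0// exprVn.
Qed.

Definition dpexp (p : {poly R}) := 'X^2 * (p - p^`()).

Lemma is_derive_pexp p (t : R) : is_derive t 1 (pexp p) (pexp (dpexp p) t).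
Proof.
have [t0|t0|t0] := ltgtP t 0.
- have -> : pexp (dpexp p) t = 0 by rewrite /pexp ltNge (ltW t0).
  apply: (near_eq_is_derive _ (is_derive_cst (0 : R) t 1)).
  near=> s; rewrite /pexp ifF//; apply/negbTE; rewrite -leNgt ltW//.
  by near: s; exact: lt_nbhsl.
- have tn0 : t != 0 by rewrite gt_eqF.
  have dV : is_derive t 1 (fun s : R => s^-1) (- t ^- 2).
    have := @is_deriveV R id t 1 1 tn0 (is_derive_id _ _).
    by rewrite -[_ *: _]/(_ * _) mulr1.
  have dP := @is_derive1_comp _ (horner p) (fun s : R => s^-1) t _ _ (is_derive_poly _ _) dV.
  have dE := @is_derive1_comp _ expR (fun s : R => - s^-1) t _ _ (is_derive_expR _)
    (@is_deriveN _ _ _ _ _ _ _ dV).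
  have := @is_deriveM _ _ _ _ _ _ _ _ dP dE.
  move=> H; have E : p.[t^-1] *: (expR (- t^-1) *: - (- t ^- 2)) +
      expR (- t^-1) *: (p^`().[t^-1] *: - t ^- 2) = pexp (dpexp p) t; last first.
    apply: (near_eq_is_derive _ (is_derive_eq H E)).
    by near=> s; rewrite /pexp ifT//; near: s; exact: lt_nbhsr.
  rewrite /pexp t0 /dpexp hornerM hornerXn hornerD hornerN -![_ *: _]/(_ * _) /=.
  by rewrite exprVn; field.
- rewrite t0; have -> : pexp (dpexp p) 0 = 0 by rewrite /pexp ltxx.
  have [C C0 HC] := pexp_bound p.
  have H : (fun h : R => h^-1 *: (pexp p (h *: 1 + 0) - pexp p 0)) @ 0^' --> (0 : R).
    apply/cvgrPdist_lt => e e0; near=> h.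
    rewrite sub0r normrN addr0 -[h *: 1]/(h * 1) mulr1 [pexp p 0]/pexp ltxx subr0.
    rewrite -[_ *: _]/(_ * _) normrM normfV.
    have hn0 : 0 < `|h| by rewrite normr_gt0; near: h; exact: nbhs_dnbhs_neq.
    rewrite mulrC ltr_pdivrMr//; apply: le_lt_trans (HC h) _.
    rewrite -real_normK ?num_real// expr2 mulrA ltr_pM2r//.
    apply: le_lt_trans (_ : (C + 1) * `|h| < e); first by rewrite ler_wpM2r// lerDl.
    rewrite mulrC -ltr_pdivlMr ?ltr_wpDl//.
    by near: h; apply: dnbhs0_lt; rewrite divr_gt0// ltr_wpDl.
  split; first by apply/cvg_ex; exists 0.
  exact/cvg_lim.
Unshelve. all: by end_near. Qed.

Lemma smooth1_pexp p : smooth1 (pexp p).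
Proof.
have H k : iter k d1 (pexp p) = pexp (iter k dpexp p).
  elim: k => [//|k IH]; rewrite iterS IH; apply/funext => t.
  by rewrite /d1 (derive_val (is_derive := is_derive_pexp _ t)).
move=> k x; rewrite H.
exact: (ex_derive (is_derive := is_derive_pexp _ x)).
Qed.

Definition esm : R -> R := pexp 1.

Lemma esm_gt0 t : 0 < t -> 0 < esm t.
Proof. by move=> t0; rewrite /esm /pexp t0 hornerC mul1r expR_gt0. Qed.

Lemma esm_le0 t : t <= 0 -> esm t = 0.
Proof. by move=> t0; rewrite /esm /pexp ltNge t0. Qed.

Lemma esm_ge0 t : 0 <= esm t.
Proof. by have [/esm_le0 ->//|/esm_gt0/ltW] := leP t 0. Qed.

(** Rises from 0 on t <= 1 to 1 on t >= 2. Since the rise begins at 1 and not at 0, [step (t * K)]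
    vanishes up to distance 1/K from the origin, as a test function supported inside the domain
    requires. *)
Definition step (t : R) : R := esm (t - 1) / (esm (t - 1) + esm (2 - t)).

Lemma step_den t : esm (t - 1) + esm (2 - t) != 0.
Proof.
rewrite gt_eqF//; have [t1|t1] := ltP 1 t.
  by rewrite ltr_pwDl ?esm_ge0// esm_gt0// subr_gt0.
by rewrite ltr_wpDl ?esm_ge0// esm_gt0// subr_gt0 (le_lt_trans t1)// ltr1n.
Qed.

Lemma step_le1 t : t <= 1 -> step t = 0.
Proof. by move=> t1; rewrite /step esm_le0 ?mul0r// subr_le0. Qed.

Lemma step_ge2 t : 2 <= t -> step t = 1.
Proof.
move=> t2; rewrite /step (@esm_le0 (2 - t)) ?subr_le0// addr0 divff//.
by have := step_den t; rewrite (@esm_le0 (2 - t)) ?subr_le0// addr0.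
Qed.

Lemma step_ge0 t : 0 <= step t.
Proof. by rewrite /step divr_ge0// ?addr_ge0 ?esm_ge0. Qed.

Lemma step_le t : step t <= 1.
Proof.
rewrite /step ler_pdivrMr ?mul1r ?lerDl ?esm_ge0//.
by rewrite lt_neqAle eq_sym step_den/= addr_ge0 ?esm_ge0.
Qed.

Lemma smooth1_step : smooth1 step.
Proof.
pose f (x : 'rV[R]_1) := x 0 0.
have E : step = (fun t => (fun x => step (f x)) (const_mx t)).
  by apply/funext => t; rewrite /f mxE.
rewrite E; apply: (@smooth1_of _ (fun x => step (f x))); apply/algP.
have af : alg f by exact: alg_coord.
have a1 : alg (fun x => esm (f x - 1)).
  apply: (alg_comp (phi := esm) (f := fun x => f x - 1)); first exact: smooth1_pexp.
  by apply: alg_add => //; exact: alg_cst.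
apply: alg_mul => //; apply: alg_inv => [x|]; first exact: step_den.
apply: alg_add => //.
apply: (alg_comp (phi := esm) (f := fun x => 2 - f x)); first exact: smooth1_pexp.
apply: alg_add; first exact: alg_cst.
rewrite (_ : (fun x => _) = (fun x => (-1) * f x)); last first.
  by apply/funext => x; rewrite mulN1r.
by apply: alg_mul => //; exact: alg_cst.
Qed.

Lemma derivable_step (t : R) : derivable (step : R -> R) t 1.
Proof. by have H : smooth1 step := smooth1_step; exact: (H 0%N t). Qed.

Lemma continuous_step : continuous step.
Proof. exact: smooth1_continuous smooth1_step. Qed.

Lemma continuous_dstep : continuous (d1 step).
Proof. exact/smooth1_continuous/smooth1_derive/smooth1_step. Qed.

Lemma derive1_locally_cst (f : R -> R) (c x : R) :
  (\forall y \near x, f y = c) -> 'D_1 f x = 0.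
Proof.
move=> H; have -> : 'D_1 f x = 'D_1 (cst c) x by apply: near_eq_derive => //; rewrite oner_neq0.
by rewrite derive_cst.
Qed.

Lemma dstep0 t : ~~ (1 <= t <= 2) -> d1 step t = 0.
Proof.
rewrite negb_and -!ltNge => /orP[t1|t2].
  apply: (@derive1_locally_cst _ 0); near=> s; apply: step_le1; apply: ltW.
  by near: s; exact: lt_nbhsl.
apply: (@derive1_locally_cst _ 1); near=> s; apply: step_ge2; apply: ltW.
by near: s; exact: lt_nbhsr.
Unshelve. all: by end_near. Qed.

Lemma dstep_bound : exists2 C : R, 0 < C & forall t, `|d1 step t| <= C.
Proof.
have := continuous_compact (continuous_subspaceT (A := `[1 : R, 2]%classic) continuous_dstep)
  (@segment_compact R 1 2).
move=> /compact_bounded /pinfty_ex_gt0[C C0 HC]; exists C => // t.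
have [t12|t12] := boolP (1 <= t <= 2); last by rewrite dstep0// normr0 ltW.
by apply: HC; exists t => //=; rewrite in_itv.
Qed.

End bump.

(** * Radial cutoffs and test functions *)

Section cutoffs.
Context {R : realType}.
Local Opaque smooth.
Notation ee i := (delta_mx 0 i : 'rV[R]_ _).

Lemma smoothP n (f : 'rV[R]_n -> R) : alg f -> smooth f. Proof. by move/algP. Qed.

Lemma smooth_cst n (c : R) : smooth (fun _ : 'rV[R]_n => c).
Proof. exact/smoothP/alg_cst. Qed.
Lemma smooth_coord n i : smooth (fun x : 'rV[R]_n => x 0 i).
Proof. exact/smoothP/alg_coord. Qed.
Lemma smoothD n (f g : 'rV[R]_n -> R) : smooth f -> smooth g -> smooth (fun x => f x + g x).
Proof. by move=> /algP sf /algP sg; apply/smoothP/alg_add. Qed.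
Lemma smoothM n (f g : 'rV[R]_n -> R) : smooth f -> smooth g -> smooth (fun x => f x * g x).
Proof. by move=> /algP sf /algP sg; apply/smoothP/alg_mul. Qed.
Lemma smoothN n (f : 'rV[R]_n -> R) : smooth f -> smooth (fun x => - f x).
Proof.
move=> sf; rewrite (_ : (fun x => _) = (fun x => (-1) * f x)).
  by apply: smoothM; [exact: smooth_cst|exact: sf].
by apply/funext => x; rewrite mulN1r.
Qed.
Lemma smoothB n (f g : 'rV[R]_n -> R) : smooth f -> smooth g -> smooth (fun x => f x - g x).
Proof. by move=> sf sg; apply: smoothD; [exact: sf|exact: (smoothN sg)]. Qed.
Lemma smooth_comp n phi (f : 'rV[R]_n -> R) : smooth1 phi -> smooth f ->
  smooth (fun x => phi (f x)).
Proof. by move=> sp /algP sf; apply/smoothP; exact: alg_comp. Qed.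
Lemma smooth_sum n (I : Type) (s : seq I) (P : pred I) (F : I -> 'rV[R]_n -> R) :
  (forall i, P i -> smooth (F i)) -> smooth (fun x => \sum_(i <- s | P i) F i x).
Proof.
move=> H; elim: s => [|i s IH].
  by under eq_fun do rewrite big_nil; exact: smooth_cst.
under eq_fun do rewrite big_cons.
by case E: (P i); [apply: smoothD; [exact: H|exact: IH]|exact: IH].
Qed.

Lemma smooth_sqnorm n : smooth (fun x : 'rV[R]_n => sqnorm x).
Proof. by apply: smooth_sum => i _; apply: smoothM; exact: smooth_coord. Qed.

(** Functions of x' alone form a class stable under differentiation: the vertical derivative is 0
    and a horizontal one again depends on x' only. *)
Lemma smooth_hpart n (f : 'rV[R]_n -> R) : smooth f ->
  smooth (fun x : 'rV[R]_n.+1 => f (hpart x)).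
Proof.
have hpt (x : 'rV[R]_n.+1) h j :
    hpart (h *: ee (lift ord_max j) + x) = h *: ee j + hpart x.
  apply/rowP => k; rewrite !mxE !eqxx/=.
  by rewrite (inj_eq (@lift_inj _ _)).
have hpm (x : 'rV[R]_n.+1) h : hpart (h *: ee ord_max + x) = hpart x.
  apply/rowP => k; rewrite !mxE !eqxx/=.
  by rewrite eq_sym (negbTE (neq_lift _ _)) mulr0 add0r.
move=> sf; apply: (@smooth_coinduction _ _ (fun g =>
  (exists2 f, smooth f & g = (fun x => f (hpart x))))); last by exists f.
move=> _ [{sf}g sg ->]; split.
- apply: (cont_comp _ (smooth_cont sg)).
  by apply: cont_to_rV => i; under eq_fun do rewrite mxE; exact: cont_coord.
- apply: ptP => [x|j x].
    rewrite /derivable (_ : (fun h => _) = cst 0); first exact: is_cvg_cst.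
    by apply/funext => h /=; rewrite hpm subrr scaler0.
  rewrite /derivable (_ : (fun h => _) =
    (fun h => h^-1 *: (g (h *: ee j + hpart x) - g (hpart x)))).
    exact: smooth_drv.
  by apply/funext => h /=; rewrite hpt.
- apply: ptP => [|j].
    exists (fun=> 0); first exact: smooth_cst.
    apply/funext => x; rewrite /derive (_ : (fun h => _) = cst 0); first exact: lim_cst.
    by apply/funext => h /=; rewrite hpm subrr scaler0.
  exists (fun y => 'D_(ee j) g y); first exact: smooth_der.
  apply/funext => x; rewrite /derive (_ : (fun h => _) =
    (fun h => h^-1 *: (g (h *: ee j + hpart x) - g (hpart x))))//.
  by apply/funext => h /=; rewrite hpt.
Qed.

Lemma derive_hpart n (f : 'rV[R]_n -> R) (x : 'rV[R]_n.+1) (j : 'I_n) :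
  'D_(ee (lift ord_max j)) (fun x => f (hpart x)) x = 'D_(ee j) f (hpart x).
Proof.
rewrite /derive (_ : (fun h => _) =
  (fun h => h^-1 *: (f (h *: ee j + hpart x) - f (hpart x))))//.
apply/funext => h /=; congr (_ *: (f _ - _)).
apply/rowP => k; rewrite !mxE !eqxx/=.
by rewrite (inj_eq (@lift_inj _ _)).
Qed.

Lemma derivable_hpart n (f : 'rV[R]_n -> R) (x : 'rV[R]_n.+1) (j : 'I_n) :
  derivable f (hpart x) (ee j) ->
  derivable (fun x => f (hpart x)) x (ee (lift ord_max j)).
Proof.
move=> H; rewrite /derivable (_ : (fun h => _) =
  (fun h => h^-1 *: (f (h *: ee j + hpart x) - f (hpart x))))//.
apply/funext => h /=; congr (_ *: (f _ - _)).
apply/rowP => k; rewrite !mxE !eqxx/=.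
by rewrite (inj_eq (@lift_inj _ _)).
Qed.

Lemma derive_hpart_max n (f : 'rV[R]_n -> R) (x : 'rV[R]_n.+1) :
  derivable (fun x => f (hpart x)) x (ee ord_max) /\
  'D_(ee ord_max) (fun x => f (hpart x)) x = 0.
Proof.
have E : (fun h : R => h^-1 *: (f (hpart (h *: ee ord_max + x)) - f (hpart x))) = cst 0.
  apply/funext => h; rewrite (_ : hpart (_ + _) = hpart x) ?subrr ?scaler0//.
  apply/rowP => k; rewrite !mxE !eqxx/=.
  by rewrite eq_sym (negbTE (neq_lift _ _)) mulr0 add0r.
split; first by rewrite /derivable E; exact: is_cvg_cst.
by rewrite /derive E; exact: lim_cst.
Qed.

(** The constant 3 places the transition on r^2 <= |x|^2 <= 2 r^2; the squared norm keeps the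
    function smooth at the origin. *)
Definition cutoff n (r : R) (x : 'rV[R]_n) : R := step (3 - sqnorm x / r ^+ 2).

Lemma smooth_cutoff n r : smooth (@cutoff n r).
Proof.
apply: smooth_comp; first exact: smooth1_step.
apply: smoothB; first exact: smooth_cst.
by apply: smoothM; [exact: smooth_sqnorm|exact: smooth_cst].
Qed.

Lemma cutoff_ge0 n r (x : 'rV[R]_n) : 0 <= cutoff r x. Proof. exact: step_ge0. Qed.
Lemma cutoff_le1 n r (x : 'rV[R]_n) : cutoff r x <= 1. Proof. exact: step_le. Qed.

Lemma cutoff1 n r (x : 'rV[R]_n) : 0 < r -> sqnorm x <= r ^+ 2 -> cutoff r x = 1.
Proof.
move=> r0 xr; apply: step_ge2.
have : sqnorm x / r ^+ 2 <= 1 by rewrite ler_pdivrMr ?mul1r ?exprn_gt0.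
by move=> ?; lra.
Qed.

Lemma cutoff0 n r (x : 'rV[R]_n) : 0 < r -> 2 * r ^+ 2 <= sqnorm x -> cutoff r x = 0.
Proof.
move=> r0 xr; apply: step_le1.
have : 2 <= sqnorm x / r ^+ 2 by rewrite ler_pdivlMr ?exprn_gt0.
by move=> ?; lra.
Qed.

Lemma sqnorm_ge0 n (x : 'rV[R]_n) : 0 <= sqnorm x.
Proof. by apply: sumr_ge0 => i _; rewrite -expr2 sqr_ge0. Qed.

Lemma coord_sqnorm n (x : 'rV[R]_n) i : x 0 i ^+ 2 <= sqnorm x.
Proof.
rewrite /sqnorm /dot (bigD1 i)//= -expr2 lerDl.
by apply: sumr_ge0 => j _; rewrite -expr2 sqr_ge0.
Qed.

Lemma derive_sqnorm n (x : 'rV[R]_n) i : 'D_(ee i) (fun x => sqnorm x) x = 2 * x 0 i.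
Proof.
rewrite /sqnorm /dot.
rewrite (_ : (fun x => _) = \sum_(j < n) (fun x : 'rV[R]_n => x 0 j * x 0 j)); last first.
  by apply/funext => y; rewrite fct_sumE.
have dc j : derivable (fun x : 'rV[R]_n => x 0 j) x (ee i) by case: (derive_coord j i x).
rewrite derive_sum; last first.
  by move=> j; apply: (@derivableM _ _ (fun x : 'rV[R]_n => x 0 j) (fun x : 'rV[R]_n => x 0 j)).
rewrite (bigD1 i)//= big1 ?addr0.
  rewrite (@deriveM _ _ (fun x : 'rV[R]_n => x 0 i) (fun x : 'rV[R]_n => x 0 i))//.
  rewrite (derive_coord i i x).2 eqxx.
  have -> : x 0 i *: (true%:R : R) = x 0 i by exact: mulr1.
  by rewrite mulr_natl mulr2n.
move=> j ji; rewrite (@deriveM _ _ (fun x : 'rV[R]_n => x 0 j) (fun x : 'rV[R]_n => x 0 j))//.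
by rewrite (derive_coord j i x).2 eq_sym (negbTE ji) scaler0 addr0.
Qed.

Lemma derive_cutoff n : exists2 C : R, 0 < C &
  forall r i (x : 'rV[R]_n), 0 < r -> `|'D_(ee i) (cutoff r) x| <= C / r.
Proof.
have [C C0 HC] := @dstep_bound R.
exists (4 * C) => [|r i x r0]; first by rewrite mulr_gt0.
have ss : smooth (fun x : 'rV[R]_n => 3 - sqnorm x / r ^+ 2).
  apply: smoothB; first exact: smooth_cst.
  by apply: smoothM; [exact: smooth_sqnorm|exact: smooth_cst].
have [_ ->] := chain_rule (smooth_drv (i:=i) (x:=x) ss) (@derivable_step _ _).
have -> : 'D_(ee i) (fun x : 'rV[R]_n => 3 - sqnorm x / r ^+ 2) x = - (2 * x 0 i / r ^+ 2).
  have E : (fun x : 'rV[R]_n => 3 - sqnorm x / r ^+ 2) =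
      cst 3 - (fun x => (r ^- 2) *: sqnorm x).
    by apply/funext => y; rewrite -[in RHS]/(3 - r ^- 2 * sqnorm y) mulrC.
  have ds : derivable (fun x : 'rV[R]_n => sqnorm x) x (ee i).
    exact: smooth_drv (@smooth_sqnorm n).
  rewrite E (deriveB (@derivable_cst _ _ _ _ _ _) (@derivableZ _ _ _ _ (r ^- 2) x (ee i) ds)).
  rewrite derive_cst sub0r (deriveZ _ ds) derive_sqnorm.
  by congr (- _); rewrite -[LHS]/(_ * _) mulrC.
have [d0|dn0] := eqVneq (d1 step (3 - sqnorm x / r ^+ 2)) 0.
  by rewrite [X in X * _]d0 mul0r normr0 divr_ge0// ?mulr_ge0// ltW.
(* Where the derivative of [step] does not vanish, |x|^2 <= 2 r^2; this turns the factor 2 x_i / r^2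
   into O(1/r). *)
have /andP[t1 t2] : 1 <= 3 - sqnorm x / r ^+ 2 <= 2.
  by apply: contraNT dn0 => /dstep0 ->.
have xr : `|x 0 i| <= 2 * r.
  have : sqnorm x / r ^+ 2 <= 2 by lra.
  rewrite ler_pdivrMr ?exprn_gt0// => xr.
  rewrite -(@ler_pXn2r _ 2) ?nnegrE ?mulr_ge0 ?(ltW r0)//.
  rewrite real_normK ?num_real// exprMn (le_trans (coord_sqnorm x i))//.
  by rewrite (le_trans xr)// ler_wpM2r ?sqr_ge0//; lra.
rewrite normrM normrN normrM normrM (ger0_norm (_ : 0 <= 2))// normfV.
rewrite (ger0_norm (_ : 0 <= r ^+ 2)) ?sqr_ge0//.
have -> : 4 * C / r = C * (2 * (2 * r) / r ^+ 2) by field; rewrite gt_eqF.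
apply: ler_pM => //; first by rewrite !mulr_ge0// invr_ge0 sqr_ge0.
  exact: HC.
by rewrite ler_wpM2r ?invr_ge0 ?sqr_ge0// ler_wpM2l.
Qed.

Lemma mk_test n (Om K : set 'rV[R]_n) f : smooth f -> compact K -> K `<=` Om ->
  (forall x, ~ K x -> f x = 0) -> test_fun Om f.
Proof.
move=> sf cK KO f0.
have cl : closure [set x | f x != 0] `<=` K.
  have clK : closed K by apply: compact_closed => //; exact: norm_hausdorff.
  rewrite [X in _ `<=` X](closure_id K).1//; apply: closure_subset => x /= fx.
  by apply: contrapT => /f0 fx0; rewrite fx0 eqxx in fx.
split => //; last exact: subset_trans cl KO.
by apply: (subclosed_compact _ cK) => //; exact: closed_closure.
Qed.

Lemma test0 n (Om : set 'rV[R]_n) f x : test_fun Om f -> ~ Om x -> f x = 0.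
Proof.
move=> [_ _ fO] nx; apply/eqP; apply: contraPT (nx) => fx; apply.
by apply: fO; exact: subset_closure.
Qed.

Lemma test_supp n (Om : set 'rV[R]_n) f : test_fun Om f ->
  exists2 r, 0 < r & supported r f.
Proof.
move=> [_ /compact_sub_cube[r r0 Kr] _]; exists r => // x nx.
apply/eqP; apply: contraPT (nx) => fx; apply; apply: Kr.
exact: subset_closure.
Qed.

Lemma test_mulr n (Om : set 'rV[R]_n) f g : test_fun Om f -> smooth g ->
  test_fun Om (fun x => f x * g x).
Proof.
move=> [sf cf fO] sg.
apply: (mk_test (smoothM sf sg) cf fO) => x nx.
suff -> : f x = 0 by rewrite mul0r.
by apply/eqP; apply: contraPT (nx) => fx; apply; exact: subset_closure.
Qed.

Lemma test_der n (Om : set 'rV[R]_n) f i : test_fun Om f ->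
  test_fun Om (fun x => 'D_(ee i) f x).
Proof.
move=> [sf cf fO].
apply: (mk_test (smooth_der i sf) cf fO) => x nx.
apply: (derive_locally0 (A := ~` closure [set x | f x != 0])) => //.
  by apply: closed_openC; exact: closed_closure.
move=> y ny; apply/eqP; apply: contraPT (ny) => fy; apply.
exact: subset_closure.
Qed.

Lemma test_smooth n (Om : set 'rV[R]_n) f : test_fun Om f -> smooth f.
Proof. by case. Qed.

End cutoffs.

(** * Symmetry of second derivatives *)

Section schwarz.
Context {R : realType}.
Notation ee i := (delta_mx 0 i : 'rV[R]_ _).

Lemma cvg_line0 n (x u v : 'rV[R]_n) (s t : nat -> R) :
  s @ \oo --> (0 : R) -> t @ \oo --> (0 : R) ->
  (fun k => x + s k *: u + t k *: v) @ \oo --> x.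
Proof.
move=> s0 t0; have : (fun k => x + s k *: u + t k *: v) @ \oo --> x + (0 : R) *: u + (0 : R) *: v.
  by apply: cvgD; [apply: cvgD; [exact: cvg_cst|exact: cvgZr_tmp]|exact: cvgZr_tmp].
by rewrite !scale0r !addr0.
Qed.

(* The second difference of f over the square of side h, divided by h^2, is a
   value of either mixed derivative nearby. *)
Lemma mixed_diff n (f : 'rV[R]_n -> R) (i j : 'I_n) x (h : R) : smooth f -> 0 < h ->
  exists s t, [/\ 0 <= s <= h, 0 <= t <= h &
   f (x + h *: ee i + h *: ee j) - f (x + h *: ee i) - f (x + h *: ee j) + f x =
   h ^+ 2 * 'D_(ee j) (fun y => 'D_(ee i) f y) (x + s *: ee i + t *: ee j)].
Proof.
move=> sf h0.
have dl (g : 'rV[R]_n -> R) k y : smooth g -> forall t : R,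
    is_derive t 1 (fun t => g (y + t *: ee k)) ('D_(ee k) g (y + t *: ee k)).
  move=> sg t; apply: DeriveDef; last by rewrite derive_line.
  by apply/derivable_line; exact: smooth_drv.
pose F (t : R) := f (x + h *: ee j + t *: ee i) - f (x + t *: ee i).
have dF (t : R) : is_derive t 1 F ('D_(ee i) f (x + h *: ee j + t *: ee i) -
    'D_(ee i) f (x + t *: ee i)).
  apply: is_deriveB; exact: dl.
have cF : continuous F.
  by move=> t; apply: differentiable_continuous; apply/derivable1_diffP; case: (dF t).
have [s s0h Fs] := MVT h0 (fun t _ => dF t) (continuous_subspaceT cF).
pose G (t : R) := 'D_(ee i) f (x + s *: ee i + t *: ee j).
have sD := smooth_der i sf.
have dG (t : R) := dl _ j (x + s *: ee i) sD t.
have cG : continuous G.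
  by move=> t; apply: differentiable_continuous; apply/derivable1_diffP; case: (dG t).
have [t t0h Gt] := MVT h0 (fun t _ => dG t) (continuous_subspaceT cG).
exists s, t; split.
- by move: s0h; rewrite in_itv/= => /andP[? ?]; rewrite !ltW.
- by move: t0h; rewrite in_itv/= => /andP[? ?]; rewrite !ltW.
- have -> : h ^+ 2 * 'D_(ee j) (fun y => 'D_(ee i) f y) (x + s *: ee i + t *: ee j) =
    h * ('D_(ee j) (fun y => 'D_(ee i) f y) (x + s *: ee i + t *: ee j) * (h - 0)).
    by ring.
  rewrite -Gt /G scale0r addr0.
  have -> : x + s *: ee i + h *: ee j = x + h *: ee j + s *: ee i by rewrite addrAC.
  move: Fs; rewrite /F !scale0r !addr0 subr0 mulrC => <-.
  have -> : x + h *: ee j + h *: ee i = x + h *: ee i + h *: ee j by rewrite addrAC.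
  by ring.
Qed.

(** The second difference over a square does not depend on the order of i and j. Divided by h^2 with
    h = 1/(k+1), it tends to both mixed derivatives. *)
Lemma schwarz n (f : 'rV[R]_n -> R) (i j : 'I_n) x : smooth f ->
  'D_(ee j) (fun y => 'D_(ee i) f y) x = 'D_(ee i) (fun y => 'D_(ee j) f y) x.
Proof.
move=> sf; pose h k : R := k.+1%:R^-1.
have h0 k : 0 < h k by rewrite invr_gt0 ltr0n.
have [s sP] := choice (fun k => mixed_diff i j x sf (h0 k)).
have [t tP] := choice sP.
have [s' sP'] := choice (fun k => mixed_diff j i x sf (h0 k)).
have [t' tP'] := choice sP'.
have hc : h @ \oo --> (0 : R) by exact: cvg_harmonic.
have sq (u : nat -> R) : (forall k, 0 <= u k <= h k) -> u @ \oo --> (0 : R).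
  move=> uP; apply: (squeeze_cvgr _ (@cvg_cst _ _ _ _ _) hc).
  by apply: nearW => k; exact: uP.
have sP1 k : 0 <= s k <= h k by case: (tP k).
have tP1 k : 0 <= t k <= h k by case: (tP k).
have sP1' k : 0 <= s' k <= h k by case: (tP' k).
have tP1' k : 0 <= t' k <= h k by case: (tP' k).
have c1 := @cvg_line0 _ x (ee i) (ee j) s t (sq s sP1) (sq t tP1).
have c2 := @cvg_line0 _ x (ee j) (ee i) s' t' (sq s' sP1') (sq t' tP1').
pose fij (y : 'rV[R]_n) : R := 'D_(ee j) (fun y => 'D_(ee i) f y) y.
pose fji (y : 'rV[R]_n) : R := 'D_(ee i) (fun y => 'D_(ee j) f y) y.
have cij : continuous fij by exact: smooth_cont (smooth_der j (smooth_der i sf)).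
have cji : continuous fji by exact: smooth_cont (smooth_der i (smooth_der j sf)).
have C1 : (fun k => fij (x + s k *: ee i + t k *: ee j)) @ \oo --> fij x.
  exact: (cvg_comp _ _ c1 (cij x)).
have C2 : (fun k => fji (x + s' k *: ee j + t' k *: ee i)) @ \oo --> fji x.
  exact: (cvg_comp _ _ c2 (cji x)).
have E : (fun k => fij (x + s k *: ee i + t k *: ee j)) =
         (fun k => fji (x + s' k *: ee j + t' k *: ee i)).
  apply/funext => k; case: (tP k) => _ _ E1; case: (tP' k) => _ _ E2.
  have h20 : h k ^+ 2 != 0 by rewrite gt_eqF// exprn_gt0.
  have A12 : f (x + h k *: ee i + h k *: ee j) - f (x + h k *: ee i) -
      f (x + h k *: ee j) + f x =
      f (x + h k *: ee j + h k *: ee i) - f (x + h k *: ee j) -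
      f (x + h k *: ee i) + f x.
    have -> : x + h k *: ee j + h k *: ee i = x + h k *: ee i + h k *: ee j by exact: addrAC.
    by congr (_ + _); exact: addrAC.
  exact: (mulfI h20 (etrans (esym E1) (etrans A12 E2))).
rewrite E in C1; exact: (cvg_unique (@Rhausdorff R) C1 C2).
Qed.

End schwarz.

(** * Weak derivatives *)

Section dubois.
Context {R : realType}.

Definition below (o : option R) (t : R) : bool :=
  if o is Some a then t < a else true.

Definition hbox n (c : 'I_n -> option R) : set 'rV[R]_n :=
  [set x : 'rV[R]_n | forall j, below (c j) (x 0 j)].

Definition hboxes n : set (set 'rV[R]_n) := [set A | exists c, A = hbox c].

(* The boxes \prod_j ]-oo, c_j[ (some c_j possibly +oo) form a pi-system generating
   the Borel sets, and their indicators are limits of smooth functions. *)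
Lemma hbox_setI n : setI_closed (@hboxes n).
Proof.
move=> _ _ [c ->] [c' ->]; exists (fun j => match c j, c' j with
  | Some a, Some a' => Some (Num.min a a') | Some a, None => Some a
  | None, o => o end).
apply/seteqP; split=> x /=.
  move=> [H H'] j; have := H j; have := H' j; rewrite /below.
  case: (c j) (c' j) => [a|] [a'|]//= h1 h2.
  by rewrite lt_min h1 h2.
move=> H; split=> j; have := H j; rewrite /below; case: (c j) (c' j) => [a|] [a'|]//=.
  by rewrite lt_min => /andP[].
by rewrite lt_min => /andP[].
Qed.

Lemma open_hbox n (c : 'I_n -> option R) : open (hbox c).
Proof.
have -> : hbox c = \big[setI/setT]_(j < n)
    [set x : 'rV[R]_n | below (c j) (x 0 j)].
  by rewrite -bigcap_seq; apply/seteqP; split=> x /= H j; [move=> _;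
    exact: H|exact: (H j (mem_index_enum j))].
elim/big_ind: _ => [|A B oA oB|j _]; [exact: openT|exact: openI|].
rewrite /below; case: (c j) => [a|]; last first.
  by rewrite (_ : [set x | _] = setT); [exact: openT|apply/seteqP; split].
apply: (@open_comp _ _ (fun x : 'rV[R]_n => x 0 j) [set y | y < a]); last exact: open_lt.
by move=> x _; exact: cont_coord.
Qed.

Lemma hbox_generate n (A : set 'rV[R]_n) : measurable A -> <<s @hboxes n >> A.
Proof.
suff : @measurable _ 'rV[R]_n `<=` <<s @hboxes n >> by exact.
apply: smallest_sub; first exact: smallest_sigma_algebra.
move=> B; rewrite -bigcup_seq => -[i _ [C mC <-]].
have H : measurable_fun (setT : set (g_sigma_algebraType (@hboxes n)))
    (fun x : g_sigma_algebraType (@hboxes n) => (x : 'rV[R]_n) 0 i).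
  apply: (measurability _ (measurable_realfun.RGenInftyO.measurableE R)).
  move=> _ [_ [a ->] <-]; rewrite setTI; apply: sub_sigma_algebra.
  exists (fun j => if j == i then Some a else None).
  apply/seteqP; split=> x /=; rewrite in_itv/=.
    by move=> xa j; rewrite /below; case: eqP => // ->.
  by move=> /(_ i); rewrite /below eqxx.
by have := H measurableT C mC.
Qed.

(** The measurable sets on which [nu] integrates to 0 form a lambda-system that contains the boxes,
    hence all Borel sets; in particular the sets nu >= 0 and nu <= 0. *)
Lemma intg_zero_sets n (nu : 'rV[R]_n -> R) : intg (leb n) setT nu ->
  (forall c, \int[leb n]_(x in hbox c) nu x = 0) ->
  {ae leb n, forall x, nu x = 0}.
Proof.
move=> inu H0.
pose M := [set A : set 'rV[R]_n | measurable A /\ \int[leb n]_(x in A) nu x = 0].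
have sub (A : set 'rV[R]_n) : measurable A -> intg (leb n) A nu.
  by move=> mA; exact: (intgS measurableT mA).
have lM : lambda_system setT M.
  split.
  - by [].
  - split => //.
    rewrite -(H0 (fun=> None)); congr (Rintegral _ _ _).
    by apply/seteqP; split.
  - move=> A B BA [mA A0] [mB B0]; split; first exact: measurableD.
    have : \int[leb n]_(x in A) nu x =
        \int[leb n]_(x in A `\` B) nu x + \int[leb n]_(x in B) nu x.
      have E : A = (A `\` B) `|` B by rewrite setDKU.
      rewrite {1}E Rintegral_setU//.
      + exact: measurableD.
      + by rewrite -E; exact: sub.
      + by apply/disj_setPS => x [[_ nB] Bx].
    by rewrite A0 B0 addr0 => <-.
  - move=> F ndF MF; split.
      by apply: bigcupT_measurable => k; case: (MF k).
    have mF k : measurable (F k) by case: (MF k).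
    have c : (fun k => \int[leb n]_x (nu x * \1_(F k) x)) @ \oo -->
        \int[leb n]_x (nu x * \1_(\bigcup_k F k) x).
      apply: (@Rdct _ _ _ _ setT _ _ (fun x => `|nu x|)) => //.
      + move=> k; apply: measurable_funM; first exact: (intg_meas inu).
        exact: measurable_indic.
      + exact: intg_abs.
      + move=> k x _; rewrite normrM ler_piMr// indicE.
        by case: (x \in F k); rewrite ?normr1// normr0.
      + move=> x _; apply: cvgM; first exact: cvg_cst.
        have [[k _ Fkx]|nF] := pselect ((\bigcup_k F k) x).
          rewrite indicE mem_set; last by exists k.
          apply: (cvg_trans _ (@cvg_cst _ (1 : R) _ \oo _)).
          apply: near_eq_cvg; near=> m.
          rewrite indicE mem_set//; apply: (_ : F k `<=` F m) Fkx.
          by apply/subsetPset/ndF; near: m; exact: nbhs_infty_ge.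
        rewrite indicE memNset//.
        apply: (cvg_trans _ (@cvg_cst _ (0 : R) _ \oo _)).
        apply: near_eq_cvg; near=> m.
        by rewrite indicE memNset// => Fm; apply: nF; exists m.
    have E A : measurable A -> \int[leb n]_x (nu x * \1_A x) = \int[leb n]_(x in A) nu x.
      move=> mA; rewrite [RHS]Rintegral_mkcond; apply: eq_Rintegral => x _.
      by rewrite patchE indicE; case: (x \in A); rewrite ?mulr1 ?mulr0.
    move: c; under eq_fun do rewrite E// (MF _).2.
    rewrite E; last exact: bigcupT_measurable.
    by move=> c; apply/esym; apply: (cvg_unique (@Rhausdorff R) _ c); exact: cvg_cst.
have mM A : measurable A -> M A.
  move=> mA; apply: (lambda_system_subset (@hbox_setI n) lM) => //.
  + by move=> _ [c ->]; split; [apply: open_measurable_rV; exact: open_hbox|exact: H0].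
  + exact: hbox_generate.
have mnu := intg_meas inu.
have mP : measurable [set x | 0 <= nu x].
  rewrite (_ : [set x | _] = setT `&` nu @^-1` `[0, +oo[%classic); last first.
    by apply/seteqP; split=> x /=; rewrite in_itv/= andbT//; case.
  by apply: mnu.
have mN : measurable [set x | nu x <= 0].
  rewrite (_ : [set x | _] = setT `&` nu @^-1` `]-oo, 0]%classic); last first.
    by apply/seteqP; split=> x /=; rewrite in_itv/=//; case.
  by apply: mnu.
have P := Rint_ge0_eq0 mP (sub _ mP) (fun x Hx => Hx) (mM _ mP).2.
have N : {ae leb n, forall x, [set x | nu x <= 0] x -> - nu x = 0}.
  apply: Rint_ge0_eq0 => //.
  - by apply: intgN => //; exact: sub.
  - by move=> x /=; rewrite oppr_ge0.
  - under eq_Rintegral do rewrite -mulN1r.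
    by rewrite RintegralZl ?(mM _ mN).2 ?mulr0//; exact: sub.
apply: filterS2 P N => x P N; have [/P//|/ltW/N/eqP] := leP 0 (nu x).
by rewrite oppr_eq0 => /eqP.
Unshelve. all: by end_near. Qed.

(** A smooth function tending to the indicator of the box from inside: a bounded direction
    contributes 0 as soon as x_j >= a, and 1 once m (a - x_j) >= 1. *)
Definition ramp n (c : 'I_n -> option R) (m : nat) (x : 'rV[R]_n) : R :=
  \prod_(j < n) (if c j is Some a then step (m%:R * (a - x 0 j) + 1) else 1).

Lemma smooth_prod n (I : Type) (s : seq I) (F : I -> 'rV[R]_n -> R) :
  (forall i, smooth (F i)) -> smooth (fun x => \prod_(i <- s) F i x).
Proof.
move=> H; elim: s => [|i s IH].
  by under eq_fun do rewrite big_nil; exact: smooth_cst.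
by under eq_fun do rewrite big_cons; apply: smoothM; [exact: H|exact: IH].
Qed.

Lemma smooth_ramp n (c : 'I_n -> option R) m : smooth (ramp c m).
Proof.
apply: smooth_prod => j; case: (c j) => [a|]; last exact: smooth_cst.
apply: smooth_comp; first exact: smooth1_step.
apply: smoothD; last exact: smooth_cst.
apply: smoothM; first exact: smooth_cst.
by apply: smoothB; [exact: smooth_cst|exact: smooth_coord].
Qed.

Lemma ramp_bound n (c : 'I_n -> option R) m x : 0 <= ramp c m x <= 1.
Proof.
have H j : 0 <= (if c j is Some a then step (m%:R * (a - x 0 j) + 1) else 1 : R) <= 1.
  by case: (c j) => [a|]; rewrite ?ler01 ?lexx// step_ge0 step_le.
apply/andP; split; first by apply: prodr_ge0 => j _; case/andP: (H j).
by apply: prodr_ile1 => j _; exact: H.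
Qed.

Lemma cvg_ramp n (c : 'I_n -> option R) x :
  ramp c m x @[m --> \oo] --> (\1_(hbox c) x : R).
Proof.
have [xc|nxc] := pselect (hbox c x).
  rewrite indicE mem_set//=; apply: (cvg_trans _ (@cvg_cst _ (1 : R) _ \oo _)).
  apply: near_eq_cvg.
  have H : \forall m \near \oo, forall j, (if c j is Some a
      then step (m%:R * (a - x 0 j) + 1) else 1) = 1 :> R.
    apply: filter_forall => j; have := xc j; rewrite /below; case: (c j) => [a|] xa;
      last exact: nearW.
    near=> m; apply: step_ge2; rewrite -lerBlDr (_ : 2 - 1 = 1 :> R); last by ring.
    rewrite -ler_pdivrMr ?subr_gt0//.
    by near: m; exact: nbhs_infty_ger.
  by apply: filterS H => m H /=; rewrite /ramp big1.
rewrite indicE memNset//=; apply: (cvg_trans _ (@cvg_cst _ (0 : R) _ \oo _)).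
apply: near_eq_cvg; near=> m.
have [j /=] : exists j, ~ (below (c j) (x 0 j)).
  apply: contrapT => nE; apply: nxc => j; apply: contrapT => nj.
  by apply: nE; exists j.
rewrite /ramp (bigD1 j)//= /below; case: (c j) => [a|//] /negP; rewrite -leNgt => xa.
rewrite step_le1 ?mul0r// gerDr mulr_ge0_le0// subr_le0//.
Unshelve. all: by end_near. Qed.

Lemma intg_zero_test n (nu : 'rV[R]_n -> R) : intg (leb n) setT nu ->
  (forall g, smooth g -> \int[leb n]_x (nu x * g x) = 0) ->
  {ae leb n, forall x, nu x = 0}.
Proof.
move=> inu H; apply: (intg_zero_sets inu) => c.
have mbox : measurable (hbox c) by apply: open_measurable_rV; exact: open_hbox.
have : (fun m => \int[leb n]_x (nu x * ramp c m x)) @ \oo -->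
    \int[leb n]_x (nu x * \1_(hbox c) x).
  apply: (@Rdct _ _ _ _ setT _ _ (fun x => `|nu x|)) => //.
  - move=> k; apply: measurable_funM; first exact: (intg_meas inu).
    by apply: continuous_measurable_rV; exact: smooth_cont (smooth_ramp c k).
  - exact: intg_abs.
  - move=> k x _; rewrite normrM ler_piMr//.
    by have /andP[r0 r1] := ramp_bound c k x; rewrite ger0_norm.
  - by move=> x _; apply: cvgM; [exact: cvg_cst|exact: cvg_ramp].
under eq_fun do rewrite (H _ (smooth_ramp c _)).
move=> c0; rewrite Rintegral_mkcond.
rewrite (_ : \int[leb n]_x _ = \int[leb n]_x (nu x * \1_(hbox c) x)).
  by apply/esym; apply: (cvg_unique (@Rhausdorff R) _ c0); exact: cvg_cst.
apply: eq_Rintegral => x _.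
by rewrite patchE indicE; case: (x \in hbox c); rewrite ?mulr1 ?mulr0.
Qed.

(** A bump equal to 1 on the cube of half-side r about q and to 0 off the cube of half-side 2r. It
    is even in each coordinate of x - q, hence symmetric in x and q and with real Fourier transform
    when q = 0, which the inversion formula exploits. *)
Definition tile n (q : 'rV[R]_n) (r : R) (x : 'rV[R]_n) : R :=
  \prod_(i < n) step (3 - (x 0 i - q 0 i) ^+ 2 / r ^+ 2).

Lemma smooth_tile n (q : 'rV[R]_n) r : smooth (tile q r).
Proof.
apply: smooth_prod => i; apply: smooth_comp; first exact: smooth1_step.
apply: smoothB; first exact: smooth_cst.
apply: smoothM; last exact: smooth_cst.
have s1 : smooth (fun x : 'rV[R]_n => x 0 i - q 0 i).
  by apply: smoothB; [exact: smooth_coord|exact: smooth_cst].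
by under eq_fun do rewrite expr2; apply: smoothM.
Qed.

Lemma tile_ge0 n (q : 'rV[R]_n) r x : 0 <= tile q r x <= 1.
Proof.
apply/andP; split; first by apply: prodr_ge0 => j _; exact: step_ge0.
by apply: prodr_ile1 => j _; rewrite step_ge0 step_le.
Qed.

Lemma tile1 n (q : 'rV[R]_n) r x : 0 < r -> cube n r (x - q) -> tile q r x = 1.
Proof.
move=> r0 c; rewrite /tile big1// => i _; apply: step_ge2.
have : (x 0 i - q 0 i) ^+ 2 / r ^+ 2 <= 1; last by move=> ?; lra.
rewrite ler_pdivrMr ?exprn_gt0// mul1r -real_normK ?num_real//.
by rewrite lerXn2r ?nnegrE ?(ltW r0)//; have := c i; rewrite !mxE.
Qed.

Lemma tile0 n (q : 'rV[R]_n) r x : 0 < r -> ~ cube n (2 * r) (x - q) -> tile q r x = 0.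
Proof.
move=> r0 /existsNP[i]; rewrite !mxE => /negP; rewrite -ltNge => xr.
rewrite /tile (bigD1 i)//= step_le1 ?mul0r//.
suff : 2 <= (x 0 i - q 0 i) ^+ 2 / r ^+ 2 by move=> ?; lra.
rewrite ler_pdivlMr ?exprn_gt0//.
have : (2 * r) ^+ 2 <= `|x 0 i - q 0 i| ^+ 2.
  by rewrite lerXn2r ?nnegrE ?mulr_ge0 ?(ltW r0) ?(ltW xr).
rewrite real_normK ?num_real// => H; apply: le_trans H.
by have := sqr_ge0 r; nra.
Qed.

Lemma compact_cube_shift n (q : 'rV[R]_n) r : compact [set x | cube n r (x - q)].
Proof.
have -> : [set x | cube n r (x - q)] = (fun y => y + q) @` cube n r.
  apply/seteqP; split=> x /=.
    by move=> c; exists (x - q) => //; rewrite subrK.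
  by move=> [y cy <-]; rewrite addrK.
apply: continuous_compact; last exact: compact_cube.
apply: continuous_subspaceT => x; apply: (@continuousD _ _ _ id (cst q)).
  exact: cvg_id.
exact: cst_continuous.
Qed.

Lemma test_tile n (Om : set 'rV[R]_n) (q : 'rV[R]_n) r : 0 < r ->
  [set x | cube n (2 * r) (x - q)] `<=` Om -> test_fun Om (tile q r).
Proof.
move=> r0 H; apply: (mk_test (smooth_tile q r) (@compact_cube_shift n q (2 * r)) H).
by move=> x; exact: tile0.
Qed.

(** The product of h with a tile inside [Om] is integrable on the whole space and orthogonal to
    every smooth g, because the tile times g is a test function. So h vanishes almost everywhere on
    the inner cube, and rational inner cubes cover [Om]. *)
Lemma dubois_reymond n (Om : set 'rV[R]_n) h : open Om -> L1loc Om h ->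
  (forall phi, test_fun Om phi -> \int[leb n]_(x in Om) (h x * phi x) = 0) ->
  {ae leb n, forall x, Om x -> h x = 0}.
Proof.
move=> oO [mh ih] H.
have mO : measurable Om by exact: open_measurable_rV.
have loc (q : 'rV[R]_n) r : 0 < r -> [set x | cube n (2 * r) (x - q)] `<=` Om ->
    {ae leb n, forall x, cube n r (x - q) -> h x = 0}.
  move=> r0 qO; pose K := [set x | cube n (2 * r) (x - q)].
  have cK : compact K by exact: compact_cube_shift.
  have mK : measurable K.
    by apply: closed_measurable_rV; apply: compact_closed => //; exact: norm_hausdorff.
  have tb := test_tile r0 qO.
  pose nu x := if x \in Om then h x * tile q r x else 0.
  have mnu : measurable_fun setT nu.
    have := (measurable_restrictT (fun x => h x * tile q r x) mO).1.
    apply; apply: measurable_funM => //;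
      apply: measurable_funS (continuous_measurable_rV (smooth_cont (smooth_tile q r))) => //.
  have inu : intg (leb n) setT nu.
    apply: (intg_restr mK mnu).
      by move=> x /(tile0 r0) b0; rewrite /nu b0 mulr0 if_same.
    apply: (@le_intg _ _ _ _ _ _ (fun x => `|h x|)) => //.
    - exact: measurable_funS mnu.
    - move=> x Kx; rewrite /nu mem_set; last exact: qO.
      rewrite normrM ler_piMr//; have /andP[b0 b1] := tile_ge0 q r x.
      by rewrite ger0_norm.
    - by apply: intg_abs => //; exact: ih.
  have nu0 : {ae leb n, forall x, nu x = 0}.
    apply: intg_zero_test => // g sg.
    rewrite -(H _ (test_mulr tb sg)) [RHS]Rintegral_mkcond.
    apply: eq_Rintegral => x _; rewrite patchE /nu.
    by case: ifP; rewrite ?mul0r// mulrA.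
  apply: filterS nu0 => x; rewrite /nu => + cx.
  rewrite mem_set; first by rewrite tile1// mulr1.
  by apply: qO => i; apply: le_trans (cx i) _; rewrite ler_peMl ?(ltW r0) ?ler1n.
pose B (p : 'rV[rat]_n * nat) : set 'rV[R]_n :=
  [set x | cube n (p.2.+1%:R^-1) (x - map_mx ratr p.1)].
pose P (p : 'rV[rat]_n * nat) :=
  [set x : 'rV[R]_n | cube n (2 * p.2.+1%:R^-1) (x - map_mx ratr p.1)] `<=` Om.
(* The rational cubes are enumerated through [pickle], so that countably many null sets are
   discarded at once. *)
have aep : {ae leb n, forall x, forall k, if unpickle k is Some p then
     (P p -> B p x -> h x = 0) else True}.
  apply: ae_foralln => k; case: (unpickle k) => [p|]; last exact: aeW.
  have [Pp|nP] := pselect (P p); last by apply: aeW.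
  have k0 : 0 < p.2.+1%:R^-1 :> R by rewrite invr_gt0 ltr0n.
  by apply: filterS (loc _ _ k0 Pp) => x H' _; exact: H'.
apply: filterS aep => x Hx Ox.
have /nbhs_ballP[e /= e0 He] : nbhs x Om by exact: open_nbhs_nbhs.
(* The doubled cube about a rational point at distance less than 1/(k+1) from x must lie in the ball
   of radius [e]: 1 + 2 = 3. *)
have [k /= k2] : exists k : nat, (3 * k.+1%:R^-1 : R) < e.
  exists (Num.truncn (3 / e)).
  rewrite ltr_pdivrMr ?ltr0n// mulrC -ltr_pdivrMr//.
  exact: truncnS_gt.
have k0 : 0 < k.+1%:R^-1 :> R by rewrite invr_gt0 ltr0n.
have Hq i : exists q : rat, `|x 0 i - ratr q| < k.+1%:R^-1.
  have lt2 (a c : R) : 0 < c -> a - c < a + c by move=> c0; lra.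
  have [q] := rat_in_itvoo (lt2 (x 0 i) _ k0).
  by rewrite in_itv/= => /andP[q1 q2]; exists q; rewrite distrC ltr_distl q1 q2.
have [q qP] := choice Hq.
pose p : 'rV[rat]_n * nat := (\row_i q i, k).
have := Hx (pickle p); rewrite pickleK; apply.
- move=> y cy; apply: He; rewrite -ball_normE /=.
  apply: mx_norm_lt => // i; rewrite !mxE.
  rewrite (le_lt_trans (ler_distD (ratr (q i)) _ _))// (lt_trans _ k2)//.
  rewrite (_ : 3 * _ = k.+1%:R^-1 + 2 * k.+1%:R^-1); last by ring.
  by rewrite ltr_leD//; have := cy i; rewrite !mxE distrC.
- by move=> i; rewrite !mxE; exact: ltW.
Qed.

End dubois.

(** * Uniqueness and calculus of weak derivatives *)

Section weak.
Context {R : realType} {n : nat}.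
Implicit Types (Om : set 'rV[R]_n) (u g f phi : 'rV[R]_n -> R) (l : seq 'I_n).
Local Notation mu := (leb n).
Notation ee i := (delta_mx 0 i : 'rV[R]_ _).

Lemma in_L2P Om f : measurable Om -> in_L2 Om f <-> L2 mu Om f.
Proof.
move=> mO; rewrite /in_L2 /L2 /sqint; split=> -[mf H]; split=> //.
  by apply/intg_ge0P => //; [exact: measurable_funX|move=> x _; exact: sqr_ge0].
by apply/intg_ge0P => //; [exact: measurable_funX|move=> x _; exact: sqr_ge0].
Qed.

Lemma intg_supp (D K : set 'rV[R]_n) (F : 'rV[R]_n -> R) :
  measurable D -> measurable K -> K `<=` D ->
  (forall x, D x -> ~ K x -> F x = 0) -> intg mu K F -> intg mu D F.
Proof.
move=> mD mK KD F0 /(integrable_mkcond _ mK) H; apply/(integrable_mkcond _ mD).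
suff <- : ((EFin \o F) \_ K) = ((EFin \o F) \_ D) by [].
apply/funext => x; rewrite !patchE; case: ifPn => [/set_mem Kx|/negP nK].
  by rewrite mem_set//; exact: KD.
case: ifPn => [/set_mem Dx|//]; rewrite /= F0// => Kx; apply: nK.
exact: mem_set.
Qed.

Lemma compact_measurable (K : set 'rV[R]_n) : compact K -> measurable K.
Proof.
by move=> cK; apply: closed_measurable_rV; apply: compact_closed => //;
  exact: norm_hausdorff.
Qed.

Lemma test_compact Om phi : test_fun Om phi ->
  exists K, [/\ compact K, K `<=` Om & forall x, ~ K x -> phi x = 0].
Proof.
move=> [_ c KO]; exists (closure [set x | phi x != 0]); split=> // x nx.
by apply/eqP; apply: contraPT (nx) => fx; apply; exact: subset_closure.
Qed.

Lemma test_cont Om phi : test_fun Om phi -> continuous phi.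
Proof. by move=> /test_smooth/smooth_cont. Qed.

Lemma test_meas Om phi D : test_fun Om phi -> measurable_fun D phi.
Proof.
by move=> /test_cont/continuous_measurable_rV; exact: measurable_funS.
Qed.

Lemma test_bounded Om phi : test_fun Om phi ->
  exists2 C, 0 < C & forall x, `|phi x| <= C.
Proof.
move=> t; have [r r0 sr] := test_supp t.
exact: cont_supp_bounded (test_cont t) sr.
Qed.

Lemma test_pD Om phi l : test_fun Om phi -> test_fun Om (pD l phi).
Proof. by move=> t; elim: l => [//|i l IH] /=; exact: test_der. Qed.

Lemma loc_intgM Om f phi : measurable Om -> L1loc Om f -> test_fun Om phi ->
  intg mu Om (fun x => f x * phi x).
Proof.
move=> mO [mf lf] t; have [K [cK KO K0]] := test_compact t.
have [C C0 bC] := test_bounded t.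
have mK := compact_measurable cK.
apply: (intg_supp mO mK KO) => [x _ /K0 ->|]; first by rewrite mulr0.
under eq_fun do rewrite mulrC.
apply: (intgMb (C := C)) => //; [exact: test_meas t|exact: lf].
Qed.

Lemma L1locB Om f g : L1loc Om f -> L1loc Om g -> L1loc Om (fun x => f x - g x).
Proof.
move=> [mf lf] [mg lg]; split; first exact: measurable_funB.
move=> K cK KO; apply: intgB; [exact: compact_measurable|exact: lf|exact: lg].
Qed.

Lemma L1locD Om f g : L1loc Om f -> L1loc Om g -> L1loc Om (fun x => f x + g x).
Proof.
move=> [mf lf] [mg lg]; split; first exact: measurable_funD.
move=> K cK KO; apply: intgD; [exact: compact_measurable|exact: lf|exact: lg].
Qed.

Lemma weak_unique Om l u g g' : open Om -> weak_deriv Om l u g ->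
  weak_deriv Om l u g' -> {ae mu, forall x, Om x -> g x = g' x}.
Proof.
move=> oO [_ lg Hg] [_ lg' Hg'].
have mO : measurable Om by exact: open_measurable_rV.
have : {ae mu, forall x, Om x -> g x - g' x = 0}.
  apply: dubois_reymond => //; first exact: L1locB.
  move=> phi t; under eq_Rintegral do rewrite mulrBl.
  rewrite RintegralB//; [|exact: loc_intgM|exact: loc_intgM].
  apply/eqP; rewrite subr_eq0; apply/eqP.
  have := Hg _ t; rewrite Hg'// => /(mulfI _) ->//.
  by rewrite signr_eq0.
by apply: filterS => x H /H/eqP; rewrite subr_eq0 => /eqP.
Qed.

Lemma L2_L1loc Om f : measurable Om -> L2 mu Om f -> L1loc Om f.
Proof.
move=> mO [mf if2]; split=> // K cK KO; have mK := compact_measurable cK.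
apply: (@le_intg _ _ _ _ _ _ (fun x => 1 + f x ^+ 2)) => //.
- exact: measurable_funS mf.
- move=> x _; rewrite -(real_normK (num_real (f x))).
  by have := sqr_ge0 (`|f x| - 1); nra.
- apply: intgD => //; last exact: intgS if2.
  by apply: intg_cst_fin => //; exact: leb_compact_lty.
Qed.

Lemma wDP Om l u g : weak_deriv Om l u g -> weak_deriv Om l u (wD Om l u).
Proof. by move=> H; rewrite /wD; case: xgetP => [h -> //|/(_ g)]. Qed.

Lemma wD_ae Om l u g : open Om -> weak_deriv Om l u g ->
  {ae mu, forall x, Om x -> wD Om l u x = g x}.
Proof. by move=> oO H; exact: weak_unique (wDP H) H. Qed.

Lemma wD_meas Om l u : measurable_fun Om (wD Om l u).
Proof. by rewrite /wD; case: xgetP => [g _ [_ [] //]|_]; exact: measurable_cst. Qed.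

Lemma wD_L2 Om l u g : open Om -> weak_deriv Om l u g -> L2 mu Om g ->
  L2 mu Om (wD Om l u).
Proof.
move=> oO H [mg ig]; have mO : measurable Om by exact: open_measurable_rV.
split; first exact: wD_meas.
apply: (ae_intg mO _ ig).
  by apply: measurable_funX; exact: wD_meas.
by apply: filterS (wD_ae oO H) => x /[apply] ->.
Qed.

(** The multi-index m e_j, whose list repeats j exactly m times. Only pure derivatives, of orders
    one and two, will be read off the Sobolev hypotheses. *)
Lemma mseq_single k m (j : 'I_n) : (m <= k)%N ->
  mlen ([ffun i => if i == j then inord m else ord0] : {ffun 'I_n -> 'I_k.+1}) = m /\
  mseq ([ffun i => if i == j then inord m else ord0] : {ffun 'I_n -> 'I_k.+1}) =
  nseq m j.
Proof.
move=> mk; set a := (X in mlen X); split.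
  rewrite /mlen (bigD1 j)//= ffunE eqxx inordK// big1 ?addn0// => i ij.
  by rewrite ffunE (negbTE ij).
rewrite /mseq; suff H s : uniq s ->
    flatten [seq nseq (a i) i | i <- s] = if j \in s then nseq m j else [::].
  by rewrite H ?enum_uniq// mem_enum.
elim: s => [//|i s IH] /= /andP[is_ us]; rewrite IH// in_cons ffunE.
case: (eqVneq i j) => [ij|ij].
  by rewrite -ij (negbTE is_) inordK// cats0.
by [].
Qed.

Lemma in_H_weak k m Om u j : open Om -> (m <= k)%N -> in_H k Om u ->
  weak_deriv Om (nseq m j) u (wD Om (nseq m j) u) /\ L2 mu Om (wD Om (nseq m j) u).
Proof.
move=> oO mk [_ H]; have mO : measurable Om by exact: open_measurable_rV.
have [e1 e2] := mseq_single j mk.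
have [|g [wg /in_L2P]] := H [ffun i => if i == j then inord m else ord0].
  by rewrite e1.
move=> /(_ mO) lg; rewrite e2 in wg; split; first exact: wDP wg.
exact: wD_L2 wg lg.
Qed.

Lemma weak_derivD Om l u u' g g' : open Om -> weak_deriv Om l u g ->
  weak_deriv Om l u' g' ->
  weak_deriv Om l (fun x => u x + u' x) (fun x => g x + g' x).
Proof.
move=> oO [lu lg H] [lu' lg' H'].
have mO : measurable Om by exact: open_measurable_rV.
split; [exact: L1locD|exact: L1locD|] => phi t.
under eq_Rintegral do rewrite mulrDl.
under [in RHS]eq_Rintegral do rewrite mulrDl.
rewrite !RintegralD//; try exact: loc_intgM.
- by rewrite mulrDr H// H'.
- by apply: loc_intgM => //; exact: test_pD.
- by apply: loc_intgM => //; exact: test_pD.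
Qed.

Lemma cont_L1loc Om f : measurable Om -> continuous f -> L1loc Om f.
Proof.
move=> mO cf; have mf := continuous_measurable_rV cf.
split; first exact: measurable_funS mf.
move=> K cK KO; have [C _ bC] := cont_compact_bounded cK cf.
apply: (intg_bounded_fin (C := C)) => //.
- exact: compact_measurable.
- exact: leb_compact_lty.
- exact: measurable_funS mf.
Qed.

Lemma weak_deriv_C1 Om i f : open Om -> continuous f ->
  (forall x, derivable f x (ee i)) -> continuous (fun x => 'D_(ee i) f x) ->
  weak_deriv Om [:: i] f (fun x => 'D_(ee i) f x).
Proof.
move=> oO cf df cdf; have mO : measurable Om by exact: open_measurable_rV.
split; [exact: cont_L1loc|exact: cont_L1loc|] => phi t.
have cphi := test_cont t.
have dphi x : derivable phi x (ee i) by exact: smooth_drv (test_smooth t).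
have cdphi : continuous (fun x => 'D_(ee i) phi x) by exact: test_cont (test_der i t).
have D x : 'D_(ee i) (fun x => f x * phi x) x =
    f x * 'D_(ee i) phi x + 'D_(ee i) f x * phi x.
  rewrite (deriveM (df x) (dphi x)) /GRing.scale/=.
  by rewrite [X in _ + X]mulrC.
have [r r0 sr] := test_supp t.
have := @ibp0 R n (fun x => f x * phi x) r i.
rewrite (_ : (fun x => 'D_(ee i) (fun x => f x * phi x) x) =
  (fun x => f x * 'D_(ee i) phi x + 'D_(ee i) f x * phi x)); last exact/funext.
move=> ibp; have {ibp} : \int[mu]_x (f x * 'D_(ee i) phi x + 'D_(ee i) f x * phi x) = 0.
  apply: ibp.
  - move=> x; apply: continuousM; [exact: cf|exact: cphi].
  - move=> x; exact: (derivableM (df x) (dphi x)).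
  - move=> x; apply: (@continuousD _ _ _ (fun x => f x * 'D_(ee i) phi x) (fun x =>
    'D_(ee i) f x * phi x)).
      apply: continuousM; [exact: cf|exact: cdphi].
    apply: continuousM; [exact: cdf|exact: cphi].
  - move=> x /sr ->; exact: mulr0.
rewrite (@Rint_restr _ _ _ mu Om); last first.
  by move=> x nx; rewrite (test0 t nx) (test0 (test_der i t) nx) !mulr0 addr0.
have i1 := loc_intgM mO (cont_L1loc mO cf) (test_der i t).
have i2 := loc_intgM mO (cont_L1loc mO cdf) t.
rewrite (RintegralD mO i1 i2).
by rewrite /= expr1 mulN1r => /eqP; rewrite addr_eq0 => /eqP.
Qed.

End weak.

(** * Fourier integrals and the regularity of eta *)

Section trig.
Context {R : realType}.
Notation ee i := (delta_mx 0 i : 'rV[R]_ _).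

Lemma contM (T : topologicalType) (f g : T -> R) : continuous f -> continuous g ->
  continuous (fun x => f x * g x).
Proof. by move=> cf cg x; apply: continuousM; [exact: cf|exact: cg]. Qed.

Lemma contD (T : topologicalType) (f g : T -> R) : continuous f -> continuous g ->
  continuous (fun x => f x + g x).
Proof. by move=> cf cg x; apply: (@continuousD _ _ _ f g); [exact: cf|exact: cg]. Qed.

Lemma contB (T : topologicalType) (f g : T -> R) : continuous f -> continuous g ->
  continuous (fun x => f x - g x).
Proof. by move=> cf cg x; apply: (@continuousB _ _ _ f g); [exact: cf|exact: cg]. Qed.

Lemma cont_cst (T : topologicalType) (c : R) : continuous (fun _ : T => c).
Proof. by move=> x; exact: cst_continuous. Qed.

Lemma mvt_dist (f df : R -> R) a b : (forall x : R, is_derive x 1 f (df x)) ->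
  exists2 c, `|c - a| <= `|b - a| & f b - f a = df c * (b - a).
Proof.
move=> H.
have W u v : {within `[u, v], continuous f}.
  apply: continuous_subspaceT => x; apply: differentiable_continuous.
  by apply/derivable1_diffP; exact: (@ex_derive _ _ _ _ _ _ _ (H x)).
have [ab|/ltW ba] := leP a b.
  have [c cI E] := MVT_segment ab (fun x _ => H x) (W a b).
  exists c => //; move: cI; rewrite in_itv/= => /andP[ac cb].
  by rewrite !ger0_norm ?subr_ge0// lerD2r.
have [c cI E] := MVT_segment ba (fun x _ => H x) (W b a).
exists c; last by rewrite -[LHS]opprB E -mulrN opprB.
move: cI; rewrite in_itv/= => /andP[bc ca].
by rewrite (distrC c) (distrC b) !ger0_norm ?subr_ge0// lerD2l lerN2.
Qed.

Lemma sin_lip (u v : R) : `|sin v - sin u| <= `|v - u|.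
Proof.
have [c _ ->] := mvt_dist u v (@is_derive_sin R).
by rewrite normrM ler_piMl// cos_max.
Qed.

Lemma cos_lip (u v : R) : `|cos v - cos u| <= `|v - u|.
Proof.
have [c _ ->] := mvt_dist u v (@is_derive_cos R).
by rewrite normrM ler_piMl// normrN sin_max.
Qed.

(** The mean value theorem applied to cos y + y sin u, whose derivative sin u - sin y is at most |y
    - u|. The constant is not sharp; only the order matters. *)
Lemma cos_taylor (u t : R) : `|cos (u + t) - cos u + t * sin u| <= t ^+ 2.
Proof.
have D (x : R) : is_derive x 1 (fun y : R => cos y + y * sin u) (- sin x + sin u).
  apply: is_deriveD; rewrite (_ : (fun y : R => y * sin u) = (sin u) *: (id : R -> R)).
    by apply: is_derive_eq; rewrite /GRing.scale/= mulr1.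
  by apply/funext => y; rewrite mulrC.
have [c cu E] := mvt_dist u (u + t) D.
have -> : cos (u + t) - cos u + t * sin u = (- sin c + sin u) * t.
  by have := E; rewrite (_ : u + t - u = t); [move=> <-; ring|ring].
move: cu; rewrite (_ : u + t - u = t); last by ring.
move=> cu; rewrite normrM -(real_normK (num_real t)) expr2 ler_wpM2r//.
by rewrite addrC; apply: le_trans (sin_lip _ _) _; rewrite distrC.
Qed.

Lemma lip_cont n (f : 'rV[R]_n -> R) (C : R) :
  (forall x y, `|f x - f y| <= C * `|x - y|) -> continuous f.
Proof.
move=> H x A /nbhs_ballP[e /= e0 eA].
have C0 : 0 < `|C| + 1 by have := normr_ge0 C; lra.
apply/nbhs_ballP; exists (e / (`|C| + 1)); first by rewrite /= divr_gt0.
move=> y; rewrite -ball_normE /= => xy; apply: eA; rewrite -ball_normE /=.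
apply: le_lt_trans (H _ _) _.
rewrite ltr_pdivlMr// in xy; apply: le_lt_trans xy.
rewrite mulrC ler_wpM2l//; apply: le_trans (ler_norm _) _.
by rewrite lerDl.
Qed.

Lemma quad_der n (f : 'rV[R]_n -> R) (x v : 'rV[R]_n) (D C : R) :
  (forall h : R, `|f (h *: v + x) - f x - h * D| <= C * h ^+ 2) ->
  derivable f x v /\ 'D_v f x = D.
Proof.
move=> H.
have C0 : 0 < `|C| + 1 by have := normr_ge0 C; lra.
suff c : (fun h : R => h^-1 *: (f (h *: v + x) - f x)) @ 0^' --> D.
  by split; [apply: cvgP c|apply/cvg_lim].
apply/cvgrPdist_lt => e e0; near=> h.
have h0 : h != 0 by near: h; exact: nbhs_dnbhs_neq.
have he : `|h| < e / (`|C| + 1) by near: h; apply: dnbhs0_lt; rewrite divr_gt0.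
move: (H h); set k := f _ - f x => Hk.
have -> : D - h^-1 *: (k : R^o) = - (h^-1 * (k - h * D)).
  by rewrite (_ : h^-1 *: (k : R^o) = h^-1 * k)//; field.
rewrite normrN normrM normfV.
rewrite ltr_pdivlMr// in he; apply: le_lt_trans he.
rewrite ler_pdivrMl ?normr_gt0//; apply: le_trans Hk _.
rewrite -(real_normK (num_real h)) mulrA -expr2 mulrC ler_wpM2l// ?sqr_ge0//.
by apply: le_trans (ler_norm _) _; rewrite lerDl.
Unshelve. all: by end_near. Qed.

Section dim.
Variable n : nat.
Local Notation mu := (leb n).
Implicit Types (f : 'rV[R]_n -> R) (x y xi : 'rV[R]_n).

Definition wgt xi : R := 1 + \sum_i `|xi 0 i|.

Lemma wgt_ge1 xi : 1 <= wgt xi.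
Proof. by rewrite lerDl sumr_ge0. Qed.

Lemma wgt_ge0 xi : 0 <= wgt xi.
Proof. exact: le_trans (wgt_ge1 xi). Qed.

Lemma coord_wgt xi i : `|xi 0 i| <= wgt xi.
Proof.
rewrite /wgt (bigD1 i)//= addrCA lerDl addr_ge0//; exact: sumr_ge0.
Qed.

Lemma dot_wgt xi x : `|dot xi x| <= wgt xi * `|x|.
Proof.
apply: le_trans (ler_norm_sum _ _ _) _; rewrite mulrDl mul1r mulr_suml.
apply: ler_wpDl => //; apply: ler_sum => i _; rewrite normrM ler_wpM2l//.
exact: coord_le_norm.
Qed.

Lemma coord_meas i : measurable_fun setT (fun xi : 'rV[R]_n => xi 0 i).
Proof. exact: continuous_measurable_rV (@cont_coord _ _ i). Qed.

Lemma wgt_cont : continuous wgt.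
Proof.
apply: (@lip_cont _ _ n%:R) => x y; rewrite /wgt.
rewrite (_ : _ - _ = \sum_i (`|x 0 i| - `|y 0 i|)); last by rewrite sumrB; ring.
apply: le_trans (ler_norm_sum _ _ _) _.
apply: (@le_trans _ _ (\sum_(i < n) `|x - y|)).
  apply: ler_sum => i _; apply: le_trans (ler_dist_dist _ _) _.
  by have := coord_le_norm (x - y) i; rewrite !mxE.
by rewrite sumr_const card_ord mulr_natl.
Qed.

Lemma wgt_meas : measurable_fun setT wgt.
Proof. exact: continuous_measurable_rV wgt_cont. Qed.

Lemma dot_meas x : measurable_fun setT (fun xi => dot xi x).
Proof.
apply: measurable_sum => i; apply: measurable_funM; first exact: coord_meas.
exact: measurable_cst.
Qed.

(** Integrability of moments up to order m. Each derivative of the transform [trig] costs one moment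
    ([decay_mul]), and continuity of the result costs one more. *)
Definition decay m f := measurable_fun setT f /\
  intg mu setT (fun xi => wgt xi ^+ m * f xi).

Lemma decay_le m k f : (m <= k)%N -> decay k f -> decay m f.
Proof.
move=> mk [mf fi]; split=> //; have ai := intg_abs measurableT fi.
apply: (le_intg _ _ _ ai) => //.
  by apply: measurable_funM => //; apply: measurable_funX; exact: wgt_meas.
move=> xi _; rewrite !normrM ler_wpM2r// !ger0_norm ?exprn_ge0 ?wgt_ge0//.
by rewrite ler_weXn2l// wgt_ge1.
Qed.

Lemma decay_intg m f : decay m f -> intg mu setT f.
Proof.
move=> /(decay_le (leq0n m)) [_]; rewrite /intg.
by rewrite (_ : (fun xi => _) = f)//; apply/funext => xi; rewrite expr0 mul1r.
Qed.

Lemma decay_abs m f : decay m f -> intg mu setT (fun xi => wgt xi ^+ m * `|f xi|).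
Proof.
move=> [mf fi]; have := intg_abs measurableT fi; rewrite /intg.
rewrite (_ : (fun xi => `|_|) = (fun xi => wgt xi ^+ m * `|f xi|))//.
by apply/funext => xi; rewrite normrM ger0_norm// exprn_ge0// wgt_ge0.
Qed.

Lemma decay_mul m f i : decay m.+1 f ->
  decay m (fun xi => f xi * (2 * pi * xi 0 i)).
Proof.
move=> df; have [mf _] := df; have ai := decay_abs df.
have mg : measurable_fun setT (fun xi => f xi * (2 * pi * xi 0 i)).
  apply: measurable_funM => //; apply: measurable_funM; first exact: measurable_cst.
  exact: coord_meas.
split=> //; apply: (le_intg _ _ _ (intgZ (2 * pi) measurableT ai)) => //.
  by apply: measurable_funM => //; apply: measurable_funX; exact: wgt_meas.
move=> xi _; rewrite !normrM (ger0_norm (exprn_ge0 _ (wgt_ge0 xi))).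
rewrite (ger0_norm (@pi_ge0 R)) (ger0_norm (ler0n _ 2)).
rewrite [leRHS](_ : _ = wgt xi ^+ m * (`|f xi| * (2 * pi * wgt xi))); last first.
  by rewrite exprS; ring.
rewrite ler_wpM2l ?exprn_ge0 ?wgt_ge0// ler_wpM2l// ler_wpM2l ?coord_wgt//.
by rewrite mulr_ge0// pi_ge0.
Qed.

(** A Fourier integral with a real phase: th = 0 is the cosine transform and th = pi/2 is minus the
    sine transform. Differentiation and multiplication by x_i add pi/2 to the phase, so a single
    family covers both transforms and all their derivatives. *)
Definition trig f (th : R) x : R := \int[mu]_xi (f xi * cos (2 * pi * dot xi x + th)).

Lemma cosarg_meas x (th : R) : measurable_fun setT (fun xi => cos (2 * pi * dot xi x + th)).
Proof.
apply: (@measurableT_comp _ _ _ _ _ _ (@cos R)).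
  by apply: continuous_measurable_fun; exact: continuous_cos.
apply: measurable_funD => //; apply: measurable_funM => //; exact: dot_meas.
Qed.

Lemma trig_intg f th x : intg mu setT f ->
  intg mu setT (fun xi => f xi * cos (2 * pi * dot xi x + th)).
Proof.
move=> fi; under eq_fun do rewrite mulrC.
by apply: (intgMb (C := 1)) => //; [exact: cosarg_meas|move=> xi _; exact: cos_max].
Qed.

Lemma trig_bound f th x : intg mu setT f ->
  `|trig f th x| <= \int[mu]_xi `|f xi|.
Proof.
move=> fi; apply: ler_norm_Rint => //; [exact: trig_intg|exact: intg_abs|].
by move=> xi _; rewrite normrM ler_piMr// cos_max.
Qed.

Lemma trig_lip f th x y : decay 1 f ->
  `|trig f th x - trig f th y| <=
  2 * pi * (\int[mu]_xi (wgt xi ^+ 1 * `|f xi|)) * `|x - y|.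
Proof.
move=> df; have fi := decay_intg df.
rewrite /trig -RintegralB//; try exact: trig_intg.
rewrite [leRHS]mulrAC -RintegralZl//; last exact: decay_abs df.
apply: ler_norm_Rint => //.
- by apply: intgB => //; exact: trig_intg.
- by apply: intgZ => //; exact: decay_abs df.
move=> xi _; rewrite -mulrBr normrM expr1.
rewrite [leRHS](_ : _ = `|f xi| * (2 * pi * (wgt xi * `|x - y|))); last by ring.
rewrite ler_wpM2l//; apply: le_trans (cos_lip _ _) _.
rewrite opprD addrACA subrr addr0 -mulrBr normrM ger0_norm; last first.
  by rewrite mulr_ge0// pi_ge0.
rewrite ler_wpM2l//; first by rewrite mulr_ge0// pi_ge0.
rewrite (_ : _ - _ = dot xi (x - y)); first exact: dot_wgt.
by rewrite /dot -sumrB; apply: eq_bigr => i _; rewrite !mxE mulrBr.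
Qed.

Lemma trig_cont f th : decay 1 f -> continuous (trig f th).
Proof. by move=> df; apply: lip_cont => x y; exact: trig_lip. Qed.

Lemma dot_delta xi i : dot xi (ee i) = xi 0 i.
Proof.
rewrite /dot (bigD1 i)//= mxE !eqxx mulr1 big1 ?addr0// => j ji.
by rewrite mxE eqxx (negbTE ji) mulr0.
Qed.

Lemma dotDr xi x y : dot xi (x + y) = dot xi x + dot xi y.
Proof. by rewrite /dot -big_split; apply: eq_bigr => i _; rewrite !mxE mulrDr. Qed.

Lemma dotZr xi a x : dot xi (a *: x) = a * dot xi x.
Proof. by rewrite /dot mulr_sumr; apply: eq_bigr => i _; rewrite !mxE mulrCA. Qed.

Lemma dotBr xi x y : dot xi (x - y) = dot xi x - dot xi y.
Proof. by rewrite dotDr -scaleN1r dotZr mulN1r. Qed.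

Lemma dotC xi x : dot xi x = dot x xi.
Proof. by apply: eq_bigr => i _; rewrite mulrC. Qed.

(** [cos_taylor] with increment h (2 pi xi_i) bounds the remainder of the integral by h^2 times the
    second moment of f, which yields the derivative directly. *)
Lemma trig_der f th x i : decay 2 f ->
  derivable (trig f th) x (ee i) /\
  'D_(ee i) (trig f th) x = trig (fun xi => f xi * (2 * pi * xi 0 i)) (th + pi / 2) x.
Proof.
move=> df; have fi := decay_intg df; have dgi := decay_mul i df.
have gi := decay_intg dgi; have a2 := decay_abs df.
apply: (@quad_der _ _ _ _ _ ((2 * pi) ^+ 2 * \int[mu]_xi (wgt xi ^+ 2 * `|f xi|))) => h.
have -> : trig f th (h *: ee i + x) - trig f th x -
    h * trig (fun xi => f xi * (2 * pi * xi 0 i)) (th + pi / 2) x =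
  \int[mu]_xi (f xi * (cos (2 * pi * dot xi x + th + h * (2 * pi * xi 0 i)) -
     cos (2 * pi * dot xi x + th)
     + h * (2 * pi * xi 0 i) * sin (2 * pi * dot xi x + th))).
  rewrite /trig -RintegralZl//; last exact: trig_intg.
  rewrite -RintegralB//; [|exact: trig_intg|exact: trig_intg].
  rewrite -RintegralB//; last 2 first.
  - by apply: intgB => //; exact: trig_intg.
  - by apply: intgZ => //; exact: trig_intg.
  apply: eq_Rintegral => xi _; rewrite addrA cosDpihalf dotDr dotZr dot_delta.
  rewrite (_ : 2 * pi * (h * xi 0 i + dot xi x) + th =
    2 * pi * dot xi x + th + h * (2 * pi * xi 0 i)); ring.
rewrite mulrAC -RintegralZl//.
apply: ler_norm_Rint => //.
- apply: (le_intg _ _ _ (intgZ ((2 * pi) ^+ 2 * h ^+ 2) measurableT a2)) => //.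
    apply: measurable_funM; first by case: df.
    have mc : measurable_fun setT (fun xi : 'rV[R]_n => h * (2 * pi * xi 0 i)).
      by do 2 (apply: measurable_funM; first exact: measurable_cst); exact: coord_meas.
    have ma : measurable_fun setT (fun xi : 'rV[R]_n => 2 * pi * dot xi x + th).
      apply: measurable_funD; last exact: measurable_cst.
      by apply: measurable_funM; [exact: measurable_cst|exact: dot_meas].
    apply: measurable_funD; first apply: measurable_funB.
    + apply: (@measurableT_comp _ _ _ _ _ _ (@cos R)).
        by apply: continuous_measurable_fun; exact: continuous_cos.
      exact: measurable_funD.
    + exact: cosarg_meas.
    + apply: measurable_funM => //.
      apply: (@measurableT_comp _ _ _ _ _ _ (@sin R)) => //.
      by apply: continuous_measurable_fun; exact: continuous_sin.
  move=> xi _; rewrite normrM.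
  rewrite [leRHS](_ : _ = `|f xi| * ((2 * pi * h) ^+ 2 * wgt xi ^+ 2)); last by ring.
  rewrite ler_wpM2l//; apply: le_trans (cos_taylor _ _) _.
  rewrite (_ : (h * _) ^+ 2 = (2 * pi * h) ^+ 2 * xi 0 i ^+ 2); last by ring.
  rewrite ler_wpM2l ?sqr_ge0// -(real_normK (num_real (xi 0 i))).
  by rewrite lerXn2r ?nnegrE ?wgt_ge0// coord_wgt.
- exact: intgZ.
move=> xi _; rewrite normrM.
rewrite [leRHS](_ : _ = `|f xi| * ((2 * pi * h) ^+ 2 * wgt xi ^+ 2)); last by ring.
rewrite ler_wpM2l//; apply: le_trans (cos_taylor _ _) _.
rewrite (_ : (h * _) ^+ 2 = (2 * pi * h) ^+ 2 * xi 0 i ^+ 2); last by ring.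
rewrite ler_wpM2l ?sqr_ge0// -(real_normK (num_real (xi 0 i))).
by rewrite lerXn2r ?nnegrE ?wgt_ge0// coord_wgt.
Qed.

Lemma trig_smooth f th : (forall m, decay m f) -> smooth (trig f th).
Proof.
move=> df.
apply: (@smooth_coinduction _ _ (fun h => exists f th, (forall m, decay m f) /\ h = trig f th));
  last by exists f, th.
move=> h [g [t [dg ->]]]; split.
- exact: trig_cont.
- by move=> i x; exact: (trig_der t x i (dg 2%N)).1.
- move=> i; exists (fun xi => g xi * (2 * pi * xi 0 i)), (t + pi / 2); split.
    by move=> m; exact: decay_mul.
  by apply/funext => x; exact: (trig_der t x i (dg 2%N)).2.
Qed.

Lemma test_decay m f : test_fun setT f -> decay m f.
Proof.
move=> tf; split; first exact: test_meas tf.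
have [r r0 sr] := test_supp tf.
apply: (@cont_intg _ _ r); last by move=> x /sr ->; rewrite mulr0.
have cf := test_cont tf.
elim: m => [|m IH].
  by under eq_fun do rewrite expr0 mul1r.
under eq_fun do rewrite exprS -mulrA.
move=> x; exact: (@continuousM _ _ wgt (fun x => wgt x ^+ m * f x) x (@wgt_cont x) (IH x)).
Qed.

(** The integral of d_i (f sin(2 pi xi . x + th)) is 0, and the derivative of the sine brings out
    the factor x_i. *)
Lemma trig_mulx f th x i : test_fun setT f ->
  x 0 i * trig f th x = trig (fun xi => 'D_(ee i) f xi * (2 * pi)^-1) (th + pi / 2) x.
Proof.
move=> tf.
have p0 : (2 * pi)^-1 != 0 :> R by rewrite invr_neq0// mulf_neq0// gt_eqF// pi_gt0.
have p1 : 2 * pi != 0 :> R by rewrite mulf_neq0// gt_eqF// pi_gt0.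
have Da xi : derivable (fun xi => 2 * pi * dot xi x + th) xi (ee i) /\
    'D_(ee i) (fun xi => 2 * pi * dot xi x + th) xi = 2 * pi * x 0 i.
  apply: (@quad_der _ _ _ _ _ 0) => h.
  rewrite dotC dotDr dotZr dot_delta (dotC x xi) mul0r.
  by rewrite (_ : _ - _ = 0) ?normr0//; ring.
have Ds xi := chain_rule (Da xi).1 (@derivable_sin R (2 * pi * dot xi x + th)).
have df xi : derivable f xi (ee i) by exact: smooth_drv (test_smooth tf).
have tdf := test_der i tf.
have D xi : 'D_(ee i) (fun xi => f xi * sin (2 * pi * dot xi x + th)) xi =
    2 * pi * (x 0 i * (f xi * cos (2 * pi * dot xi x + th)) -
      ('D_(ee i) f xi * (2 * pi)^-1) * cos (2 * pi * dot xi x + (th + pi / 2))).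
  rewrite (deriveM (df xi) (Ds xi).1) /GRing.scale/= (Ds xi).2 (Da xi).2.
  rewrite (@derive_val _ _ _ _ _ _ _ (is_derive_sin (2 * pi * dot xi x + th))).
  rewrite addrA cosDpihalf; move: (cos _) (sin _) ('D_ _ _ _) => c s D.
  by move: (2 * pi) p1 => P p1; field.
have cs : continuous (fun xi => sin (2 * pi * dot xi x + th)).
  apply: (@lip_cont _ _ (2 * pi * \sum_i `|x 0 i|)) => y z.
  apply: le_trans (sin_lip _ _) _.
  rewrite (_ : _ - _ = 2 * pi * dot x (y - z)); last first.
    rewrite dotBr (dotC x y) (dotC x z); ring.
  rewrite normrM ger0_norm ?mulr_ge0 ?pi_ge0// -mulrA ler_wpM2l ?mulr_ge0 ?pi_ge0//.
  apply: le_trans (ler_norm_sum _ _ _) _; rewrite mulr_suml.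
  by apply: ler_sum => j _; rewrite normrM ler_wpM2l// coord_le_norm.
have [r r0 sr] := test_supp tf.
have fi : intg mu setT f := decay_intg (test_decay 0 tf).
have tdf' : test_fun setT (fun xi => 'D_(ee i) f xi * (2 * pi)^-1).
  by apply: test_mulr tdf _; exact: smooth_cst.
have dfi : intg mu setT (fun xi => 'D_(ee i) f xi * (2 * pi)^-1).
  exact: decay_intg (test_decay 0 tdf').
have cf := test_cont tf; have cdf' := test_cont tdf'.
have := @ibp0 R n (fun xi => f xi * sin (2 * pi * dot xi x + th)) r i.
rewrite (funext D) => ibp.
have {ibp} : \int[mu]_xi (2 * pi * (x 0 i * (f xi * cos (2 * pi * dot xi x + th)) -
      ('D_(ee i) f xi * (2 * pi)^-1) * cos (2 * pi * dot xi x + (th + pi / 2)))) = 0.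
  apply: ibp.
  - move=> y; apply: continuousM; [exact: cf|exact: cs].
  - move=> y; exact: (derivableM (df y) (Ds y).1).
  - apply: contM; first exact: cont_cst.
    have cc (t : R) : continuous (fun xi => cos (2 * pi * dot xi x + t)).
      have -> : (fun xi => cos (2 * pi * dot xi x + t)) =
          (fun xi => sin (2 * pi * dot xi x + th + (t + pi / 2 - th))).
        by apply/funext => xi; rewrite -sinDpihalf; congr sin; ring.
      under eq_fun do rewrite sinD.
      have cs' : continuous (fun xi => cos (2 * pi * dot xi x + th)).
        apply: (@lip_cont _ _ (2 * pi * \sum_i `|x 0 i|)) => u z.
        apply: le_trans (cos_lip _ _) _.
        rewrite (_ : _ - _ = 2 * pi * dot x (u - z)); last first.
          rewrite dotBr (dotC x u) (dotC x z); ring.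
        rewrite normrM ger0_norm ?mulr_ge0 ?pi_ge0// -mulrA ler_wpM2l ?mulr_ge0 ?pi_ge0//.
        apply: le_trans (ler_norm_sum _ _ _) _; rewrite mulr_suml.
        by apply: ler_sum => j _; rewrite normrM ler_wpM2l// coord_le_norm.
      apply: contD; apply: contM; [exact: cs|exact: cont_cst|exact: cs'|exact: cont_cst].
    apply: contB; last by apply: contM; [exact: cdf'|exact: cc].
    apply: contM; first exact: cont_cst.
    by apply: contM; [exact: cf|exact: cc].
  - move=> y /sr ->; exact: mul0r.
have i1 := trig_intg th x fi.
have i2 := trig_intg (th + pi / 2) x dfi.
have i3 := intgZ (x 0 i) measurableT i1.
rewrite (RintegralZl _ measurableT (intgB measurableT i3 i2)).
rewrite (RintegralB measurableT i3 i2) (RintegralZl _ measurableT i1).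
move=> /eqP; rewrite mulf_eq0 (negbTE p1)/= subr_eq0 => /eqP; exact.
Qed.

(** Transforms of test functions are stable under differentiation and under multiplication by
    coordinates, and each of them is bounded by the L^1 norm of its density. *)
Lemma trig_schwartz f th : test_fun setT f -> schwartz (trig f th).
Proof.
pose S h := exists f th, test_fun setT f /\ h = trig f th.
have SD h i : S h -> S (fun x => 'D_(ee i) h x).
  move=> [g [t [tg ->]]]; exists (fun xi => g xi * (2 * pi * xi 0 i)), (t + pi / 2); split.
    apply: test_mulr tg _; apply: smoothM; [exact: smooth_cst|exact: smooth_coord].
  by apply/funext => x; exact: (trig_der t x i (test_decay 2 tg)).2.
have SM h i : S h -> S (fun x => x 0 i * h x).
  move=> [g [t [tg ->]]]; exists (fun xi => 'D_(ee i) g xi * (2 * pi)^-1), (t + pi / 2); split.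
    by apply: test_mulr (test_der i tg) _; exact: smooth_cst.
  by apply/funext => x; exact: trig_mulx.
move=> tf; split; first by apply: trig_smooth => m; exact: test_decay.
move=> p l.
have Sl : S (pD l (trig f th)) by elim: l => [|i l IH] /=; [exists f, th|exact: SD].
have [g [t [tg E]]] : S (fun x => (\prod_(i <- p) x 0 i) * pD l (trig f th) x).
  elim: p => [|i p IH].
    by rewrite (_ : (fun x => _) = pD l (trig f th))//; apply/funext => x; rewrite big_nil mul1r.
  rewrite (_ : (fun x => _) = fun x => x 0 i * (\prod_(i <- p) x 0 i * pD l (trig f th) x)).
    exact: SM.
  by apply/funext => x; rewrite big_cons mulrA.
exists (\int[mu]_xi `|g xi|) => x.
by rewrite (congr1 (fun h => h x) E); apply: trig_bound; exact: decay_intg (test_decay 0 tg).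
Qed.

Lemma fcosE f : fcos f = trig f 0.
Proof. by apply/funext => x; apply: eq_Rintegral => xi _; rewrite addr0. Qed.

End dim.
End trig.

(** * Integral kernels, dilations and power decay *)

Section kernels.
Context {R : realType}.
Local Notation lam := (@lebesgue_measure R).
Implicit Types (n m : nat).

Lemma EFin_Rint d (T : measurableType d) (mu : {measure set T -> \bar R}) D f :
  measurable D -> intg mu D f -> (\int[mu]_(x in D) (f x)%:E)%E = (\int[mu]_(x in D) f x)%:E.
Proof.
by move=> mD fi; rewrite /Rintegral fineK//; exact: integrable_fin_num fi.
Qed.

(** The measurability half of Tonelli's theorem is applied to the positive and negative parts
    separately, so the integrals may be undefined for some [a]. *)
Lemma meas_ker n m (h : 'rV[R]_m -> R) (K : 'rV[R]_n -> 'rV[R]_m -> R) :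
  measurable_fun setT h ->
  measurable_fun setT (fun z : 'rV[R]_n * 'rV[R]_m => K z.1 z.2) ->
  measurable_fun setT (fun a => \int[leb m]_xi (h xi * K a xi)).
Proof.
move=> mh mK.
pose f (z : 'rV[R]_n * 'rV[R]_m) := (h z.2 * K z.1 z.2)%:E.
have mf : measurable_fun setT f.
  apply/measurable_EFinP; apply: measurable_funM => //.
  by apply: measurableT_comp => //; exact: measurable_snd.
have P : measurable_fun setT (fubini_F (slebm m) (funepos f)).
  apply: measurable_fun_fubini_tonelli_F; [exact: measurable_funepos|].
  by move=> x; exact: funepos_ge0.
have N : measurable_fun setT (fubini_F (slebm m) (funeneg f)).
  apply: measurable_fun_fubini_tonelli_F; [exact: measurable_funeneg|].
  by move=> x; exact: funeneg_ge0.
apply: (@measurableT_comp _ _ _ _ _ _ (@fine R)) => //.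
rewrite (_ : (fun a => _) =
  (fubini_F (slebm m) (funepos f) \- fubini_F (slebm m) (funeneg f))%E).
  exact: emeasurable_funB.
apply/funext => a; rewrite /fubini_F integralE; congr (_ - _)%E.
  by apply: eq_integral => x _; rewrite !funeposE.
by apply: eq_integral => x _; rewrite !funenegE.
Qed.

Lemma swap_ker n m (p : 'rV[R]_n -> R) (h : 'rV[R]_m -> R)
    (K : 'rV[R]_n -> 'rV[R]_m -> R) C :
  intg (leb n) setT p -> intg (leb m) setT h ->
  measurable_fun setT (fun z : 'rV[R]_n * 'rV[R]_m => K z.1 z.2) ->
  (forall a xi, `|K a xi| <= C) ->
  \int[leb n]_a (p a * \int[leb m]_xi (h xi * K a xi)) =
  \int[leb m]_xi (h xi * \int[leb n]_a (p a * K a xi)).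
Proof.
move=> ip ih mK bK; have mp := intg_meas ip; have mh := intg_meas ih.
have mKa a : measurable_fun setT (K a).
  exact: (measurableT_comp mK (pair1_measurable a)).
have mKx xi : measurable_fun setT (K ^~ xi).
  exact: (measurableT_comp mK (pair2_measurable xi)).
pose f (z : 'rV[R]_n * 'rV[R]_m) := (p z.1 * h z.2 * K z.1 z.2)%:E.
have mf : measurable_fun setT f.
  apply/measurable_EFinP; apply: measurable_funM => //; apply: measurable_funM.
    by apply: (measurableT_comp mp); exact: measurable_fst.
  by apply: (measurableT_comp mh); exact: measurable_snd.
have ihK a : intg (leb m) setT (fun xi => h xi * K a xi).
  by under eq_fun do rewrite mulrC; exact: (intgMb (C := C)).
have ipK xi : intg (leb n) setT (fun a => p a * K a xi).
  by under eq_fun do rewrite mulrC; exact: (intgMb (C := C)).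
have ah := intg_abs measurableT ih; have ap := intg_abs measurableT ip.
have C0 : 0 <= C by exact: le_trans (bK 0 0).
have fi : (slebm n \x slebm m)%E.-integrable setT f.
  apply/(integrable12ltyP _ _ mf).
  apply: (@le_lt_trans _ _ (\int[leb n]_a ((`|p a|)%:E * (C * \int[leb m]_xi `|h xi|)%:E))%E).
    apply: ge0_le_integral => //.
    - by move=> a _; exact: integral_ge0.
    - apply: (@measurable_fun_fubini_tonelli_F _ _ _ _ R (slebm m) (fun z => `|f z|%E)) => //.
      exact: measurableT_comp.
    - by apply: emeasurable_funM => //; apply/measurable_EFinP; exact: (intg_meas ap).
    move=> a _; rewrite -EFinM.
    rewrite -RintegralZl// -RintegralZl//; last exact: intgZ.
    rewrite -EFin_Rint//; last by do 2 apply: intgZ => //.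
    apply: ge0_le_integral => //.
    - apply: measurableT_comp => //.
      exact: (measurableT_comp mf (pair1_measurable a)).
    - by apply/measurable_EFinP; do 2 apply: measurable_funM => //; exact: (intg_meas ah).
    move=> xi _; rewrite /= lee_fin !normrM -mulrA ler_wpM2l// mulrC.
    by rewrite ler_wpM2r.
  have : intg (leb n) setT (fun a => (C * \int[leb m]_xi `|h xi|) * `|p a|) by exact: intgZ.
  move=> /(EFin_Rint measurableT); under eq_integral do rewrite mulrC EFinM.
  by move=> ->; rewrite ltry.
rewrite /Rintegral; congr fine.
transitivity (\int[slebm n]_a \int[slebm m]_xi f (a, xi))%E.
  apply: eq_integral => a _.
  rewrite -(RintegralZl _ measurableT (ihK a)) -EFin_Rint//; last exact: intgZ.
  by apply: eq_integral => xi _; rewrite /f/= mulrA.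
rewrite (Fubini fi); apply: eq_integral => xi _.
rewrite -(RintegralZl _ measurableT (ipK xi)) -EFin_Rint//; last exact: intgZ.
by apply: eq_integral => a _; rewrite /f/= mulrA (mulrC (h xi)).
Qed.

Lemma ge0_integral_scale1 (g : R -> \bar R) (k : R) : 0 < k -> measurable_fun setT g ->
  (forall t, 0 <= g t)%E -> (k%:E * \int[lam]_t g (k * t)%R = \int[lam]_t g t)%E.
Proof.
move=> k0 mg g0.
have ms : measurable_fun setT (fun t : R => k * t : measurableTypeR R).
  by apply: measurable_funM.
rewrite -(@ge0_integral_pushforward _ _ (measurableTypeR R) (measurableTypeR R) R _ ms lam setT
  g)//.
pose kn := NngNum (ltW k0).
pose P := measure_function_pushforward__canonical__measure_function_Measure lam ms.
transitivity (\int[mscale kn P]_y g y)%E; first by rewrite ge0_integral_mscale.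
apply: eq_measure_integral => /= A mA _.
apply/esym; apply: (lebesgue_measure_unique (mu := mscale kn P)) => // X [[u v] _ <-].
rewrite /= /mscale/= /pushforward.
have -> : (fun t : R => k * t) @^-1` `]u, v]%classic = `](u / k), (v / k)]%classic.
  by apply/seteqP; split => t /=; rewrite !in_itv/= ltr_pdivrMr// ler_pdivlMr// (mulrC t).
rewrite /= !lebesgue_measure_itv/= !lte_fin ltr_pM2r ?invr_gt0//.
case: ifP => _; last by rewrite mule0.
by rewrite -!EFinB -EFinM; congr EFin; field; rewrite gt_eqF.
Qed.

Lemma pt_scaleb n (k : R) (y : 'rV[R]_n) t : pt (k *: y) (k * t) = k *: pt y t.
Proof. by apply/rowP => i; rewrite !mxE; case: unlift => //= j; rewrite mxE. Qed.

Lemma ge0_integral_scale n (f : 'rV[R]_n -> \bar R) (k : R) : 0 < k ->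
  measurable_fun setT f -> (forall x, 0 <= f x)%E ->
  ((k ^+ n)%:E * \int[leb n]_x f (k *: x)%R = \int[leb n]_x f x)%E.
Proof.
move=> k0; elim: n f => [|n IH] f mf f0.
  by rewrite expr0 mul1e; apply: eq_integral => x _; rewrite (rV0_eq (k *: x) x).
have msc : measurable_fun setT (fun x : 'rV[R]_n.+1 => k *: x).
  apply: measurable_to_rV => i; under eq_fun do rewrite mxE.
  by apply: measurable_funM => //; exact: coord_meas.
rewrite tonelli//; last exact: measurableT_comp.
rewrite tonelli// -(IH (fun y => \int[lam]_t f (pt y t))%E)//; last 2 first.
- exact: measurable_int_slice.
- by move=> y; exact: integral_ge0.
rewrite exprS mulrC EFinM -muleA; congr (_ * _)%E.
rewrite -ge0_integralZl//; last 3 first.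
- apply: (@measurable_int_slice _ n (fun x => f (k *: x))) => //.
  exact: measurableT_comp.
- by move=> y _; exact: integral_ge0.
- by rewrite lee_fin ltW.
apply: eq_integral => y _.
rewrite -(@ge0_integral_scale1 (fun t => f (pt (k *: y) t)) k)//; last first.
  exact: (measurableT_comp mf (measurable_pt_slice _)).
by congr (_ * _)%E; apply: eq_integral => t _; rewrite pt_scaleb.
Qed.

Lemma scale_meas n (k : R) : measurable_fun setT (fun x : 'rV[R]_n => k *: x).
Proof.
apply: measurable_to_rV => i; under eq_fun do rewrite mxE.
by apply: measurable_funM => //; exact: coord_meas.
Qed.

Lemma intg_scale n (f : 'rV[R]_n -> R) (k : R) : 0 < k -> intg (leb n) setT f ->
  intg (leb n) setT (fun x => f (k *: x)).
Proof.
move=> k0 fi; have mf := intg_meas fi.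
have mfk : measurable_fun setT (fun x : 'rV[R]_n => f (k *: x)).
  by apply: (measurableT_comp mf); exact: scale_meas.
apply/integrableP; split; first exact/measurable_EFinP.
have kn : 0 < k ^+ n by rewrite exprn_gt0.
move: fi => /integrableP[_ fi].
have : ((k ^+ n)%:E * \int[leb n]_x `|(f (k *: x))%:E| < +oo)%E.
  rewrite (@ge0_integral_scale n (fun x => `|(f x)%:E|%E))//.
  by apply: measurableT_comp => //; exact/measurable_EFinP.
case: (\int[leb n]_x _)%E => [t _|/=|_]; rewrite ?ltry ?ltNyr//.
by rewrite gt0_muley ?lte_fin.
Qed.

(** The nonnegative case is applied to |f| + f and to |f| - f; the formula for f is half the
    difference. *)
Lemma Rint_scale n (f : 'rV[R]_n -> R) (k : R) : 0 < k -> intg (leb n) setT f ->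
  k ^+ n * \int[leb n]_x f (k *: x) = \int[leb n]_x f x.
Proof.
move=> k0 fi; have afi := intg_abs measurableT fi.
have pos (g : 'rV[R]_n -> R) : (forall x, 0 <= g x) -> intg (leb n) setT g ->
    k ^+ n * \int[leb n]_x g (k *: x) = \int[leb n]_x g x.
  move=> g0 gi; apply: EFin_inj; rewrite EFinM -!EFin_Rint//; last exact: intg_scale.
  by apply: (@ge0_integral_scale n (fun x => (g x)%:E)) => //; apply/measurable_EFinP;
    exact: intg_meas gi.
have H1 : k ^+ n * \int[leb n]_x (`|f (k *: x)| + f (k *: x)) = \int[leb n]_x (`|f x| + f x).
  apply: (pos (fun x => `|f x| + f x)); last exact: intgD.
  by move=> x; have := ler_norm (- f x); rewrite normrN; lra.
have H2 : k ^+ n * \int[leb n]_x (`|f (k *: x)| - f (k *: x)) = \int[leb n]_x (`|f x| - f x).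
  apply: (pos (fun x => `|f x| - f x)); last exact: intgB.
  by move=> x; rewrite subr_ge0 ler_norm.
have fk := intg_scale k0 fi; have afk := intg_scale k0 afi.
move: H1 H2; rewrite (RintegralD measurableT afk fk) (RintegralB measurableT afk fk).
rewrite (RintegralD measurableT afi fi) (RintegralB measurableT afi fi).
by rewrite mulrDr mulrBr; lra.
Qed.

Lemma intg_exhaust n (f : 'rV[R]_n -> R) (r : nat -> R) (M : R) : measurable_fun setT f ->
  {homo r : i j / (i <= j)%N >-> i <= j} -> (forall i, i%:R <= r i) ->
  (forall i, intg (leb n) (cube n (r i)) f) ->
  (forall i, \int[leb n]_(x in cube n (r i)) `|f x| <= M) -> intg (leb n) setT f.
Proof.
move=> mf hr ri fi fM; apply/integrableP; split; first exact/measurable_EFinP.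
have cov : \bigcup_i cube n (r i) = setT.
  apply/seteqP; split=> // x _; have [k _ H] : (\bigcup_k cube n k%:R) x by rewrite cube_cover.
  by exists k => // i; apply: le_trans (H i) _.
rewrite -cov.
have mn i : measurable_fun (cube n (r i)) (fun x => `|(f x)%:E|%E).
  by apply: measurableT_comp => //; apply/measurable_EFinP; exact: measurable_funS mf.
have c : (\int[leb n]_(x in cube n (r i)) `|(f x)%:E|)%E @[i --> \oo] -->
    (\int[leb n]_(x in \bigcup_i cube n (r i)) `|(f x)%:E|)%E.
  apply: ge0_nondecreasing_set_cvg_integral => //.
  - move=> i j ij; apply/subsetPset => x Hx k; exact: le_trans (Hx k) (hr _ _ ij).
  - by move=> i; exact: measurable_cube.
apply: (@le_lt_trans _ _ M%:E); last exact: ltry.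
rewrite -(cvg_lim _ c)//; apply: lime_le; first exact: cvgP c.
apply: nearW => i; have := fM i; rewrite -lee_fin -EFin_Rint//.
- exact: measurable_cube.
- by apply: intg_abs => //; exact: measurable_cube.
Qed.

Lemma pow2_ge (i : nat) : i%:R <= 2 ^+ i :> R.
Proof. by rewrite -natrX ler_nat; apply: ltnW; exact: ltn_expl. Qed.

(** On dyadic shells, decay of one power more than the dimension leaves a geometric series. *)
Lemma intg_pow_decay n (f : 'rV[R]_n -> R) (C : R) : measurable_fun setT f ->
  (forall x, `|f x| <= C) -> (forall (x : 'rV[R]_n) (i : 'I_n), `|x 0 i| ^+ n.+1 * `|f x| <= C) ->
  intg (leb n) setT f.
Proof.
move=> mf bf df.
have C0 : 0 <= C by exact: le_trans (bf 0).
have mc i := @measurable_cube R n i.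
have ci i : intg (leb n) (cube n (2 ^+ i)) f.
  apply: (intg_bounded_fin (C := C)) => //; [exact: leb_cube_lty|exact: measurable_funS mf].
pose M := C * 2 ^+ n + C * 4 ^+ n * 2.
apply: (@intg_exhaust n f (fun i => 2 ^+ i) M) => //.
- by move=> i j ij; rewrite ler_weXn2l// ler1n.
- exact: pow2_ge.
(* The unit cube contributes at most C 2^n. The shell between 2^i and 2^(i+1) has volume at most (4
   2^i)^n and integrand at most C 2^(-i(n+1)), which gives C 4^n 2^-i; the last factor is the
   partial sum of these powers. *)
suff H i : \int[leb n]_(x in cube n (2 ^+ i)) `|f x| <=
    C * 2 ^+ n + C * 4 ^+ n * (2 - 2^-1 ^+ i * 2).
  move=> i; apply: le_trans (H i) _; rewrite lerD2l ler_wpM2l//.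
    by rewrite mulr_ge0// exprn_ge0.
  by rewrite gerBl mulr_ge0// exprn_ge0// invr_ge0.
have cst (D : set 'rV[R]_n) (c : R) : measurable D -> (leb n D < +oo)%E ->
    \int[leb n]_(x in D) c = c * fine (leb n D).
  by move=> mD lD; rewrite Rintegral_cst.
elim: i => [|i IH].
  rewrite expr0 mul1r subrr mulr0 addr0.
  apply: (@le_trans _ _ (\int[leb n]_(x in cube n 1) C)).
    apply: le_Rintegral => //.
    - by apply: intg_abs => //; have := ci 0%N; rewrite expr0.
    - by apply: intg_cst_fin => //; exact: leb_cube_lty.
  by rewrite cst ?leb_cube_lty// leb_cube//= mulr1.
have sub : (cube n (2 ^+ i) : set 'rV[R]_n) `<=` cube n (2 ^+ i.+1).
  by move=> x Hx j; apply: le_trans (Hx j) _; rewrite ler_weXn2l// ler1n.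
rewrite -(setDUK sub) Rintegral_setU//; last 3 first.
- exact: measurableD.
- by rewrite setDUK//; apply: intg_abs.
- by apply/disj_setPS => x [Hx [_ nx]].
have le1 : \int[leb n]_(x in cube n (2 ^+ i.+1) `\` cube n (2 ^+ i)) `|f x| <=
    C * 4 ^+ n * 2^-1 ^+ i.
  have p0 : 0 < 2 ^+ i :> R by rewrite exprn_gt0.
  have lD : (leb n (cube n (2 ^+ i.+1) `\` cube n (2 ^+ i)) <= leb n (cube n (2 ^+ i.+1) : set
    'rV[R]_n))%E.
    by apply: le_measure; rewrite ?inE//; first [exact: measurableD|exact: subDsetl].
  have lD' := le_lt_trans lD (leb_cube_lty n (2 ^+ i.+1)).
  have mD : measurable (cube n (2 ^+ i.+1) `\` cube n (2 ^+ i) : set 'rV[R]_n) by exact: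
    measurableD.
  apply: (@le_trans _ _ (\int[leb n]_(x in cube n (2 ^+ i.+1) `\` cube n (2 ^+ i)) (C / 2 ^+ i ^+
    n.+1))).
    apply: le_Rintegral => //.
    - apply: intg_abs => //; apply: intgS (ci i.+1) => //; exact: subDsetl.
    - exact: intg_cst_fin.
    move=> x [_ /existsNP[j /negP]]; rewrite -ltNge => xj.
    rewrite ler_pdivlMr ?exprn_gt0// mulrC; apply: le_trans (df x j).
    by rewrite ler_wpM2r// lerXn2r ?nnegrE// ltW.
  rewrite cst//.
  apply: (@le_trans _ _ (C / 2 ^+ i ^+ n.+1 * (2 * 2 ^+ i.+1) ^+ n)).
    rewrite ler_wpM2l ?divr_ge0 ?exprn_ge0//.
    rewrite -lee_fin fineK ?ge0_fin_numE// -leb_cube// exprn_ge0//.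
  rewrite (_ : 2 * 2 ^+ i.+1 = 4 * 2 ^+ i); last by rewrite exprS; ring.
  rewrite exprMn exprS exprVn; set a := 2 ^+ i; set b := a ^+ n.
  have a0 : a != 0 by rewrite gt_eqF.
  have b0 : b != 0 by rewrite expf_neq0.
  rewrite (_ : C / (a * b) * (4 ^+ n * b) = C * 4 ^+ n * a^-1)//; field; exact/andP.
apply: le_trans (lerD IH le1) _.
rewrite [2^-1 ^+ i.+1]exprS; set a := 2^-1 ^+ i.
by rewrite le_eqVlt; apply/orP; left; apply/eqP; field.
Qed.

End kernels.

(** * Fourier inversion *)

Section inversion.
Context {R : realType} {n : nat}.
Local Notation mu := (leb n).
Notation ee i := (delta_mx 0 i : 'rV[R]_ _).
Implicit Types (f g V : 'rV[R]_n -> R) (x y xi : 'rV[R]_n).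

Lemma cvg_scale_inv x : (fun k : nat => k.+1%:R^-1 *: x) @ \oo --> (0 : 'rV[R]_n).
Proof.
rewrite -[X in _ --> X](scale0r x).
have h : (fun k : nat => k.+1%:R^-1 : R) @ \oo --> (0 : R) by exact: cvg_harmonic.
apply: cvgZr_tmp; exact: h.
Qed.

(** The translate of f is cut at the unit cube. The inner part is bounded, so dominated convergence
    applies after a dilation. On the outer part f is merely integrable, but there the kernel K^n V(K
    x), with K = k+1, is at most C / K because V decays one power faster than the dimension. *)
Lemma approx_id f V x0 (C : R) : 0 <= C -> continuous f -> intg mu setT f ->
  intg mu setT V -> (forall (x : 'rV[R]_n) (i : 'I_n), `|x 0 i| ^+ n.+1 * `|V x| <= C) ->
  (fun k : nat => \int[mu]_x (f x * (k.+1%:R ^+ n * V (k.+1%:R *: (x - x0))))) @ \oo -->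
  f x0 * \int[mu]_x V x.
Proof.
move=> C0 cf fi Vi VC.
have mf := intg_meas fi; have mV := intg_meas Vi.
pose nu x := f (x + x0); have nui : intg mu setT nu by exact: intg_shift.
have mnu := intg_meas nui.
have cnu : continuous nu.
  apply: (@cont_comp _ _ _ (fun x => x + x0) f); last exact: cf.
  move=> x; apply: (@continuousD _ _ _ id (cst x0)); [exact: cvg_id|exact: cst_continuous].
pose Q := cube n 1 : set 'rV[R]_n.
have mQ : measurable Q by exact: measurable_cube.
pose nu1 x := nu x * \1_Q x; pose nu2 x := nu x * \1_(~` Q) x.
have nuE x : nu x = nu1 x + nu2 x.
  rewrite /nu1 /nu2 -mulrDr !indicE in_setC; case: (x \in Q) => /=; ring.
have [M M0 bM] := cont_compact_bounded (@compact_cube R n 1) cnu.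
have bnu1 x : `|nu1 x| <= M.
  rewrite /nu1 indicE; case: (boolP (x \in Q)) => [/set_mem /bM|_].
    by rewrite mulr1.
  by rewrite mulr0 normr0 ltW.
have mnu1 : measurable_fun setT nu1 by apply: measurable_funM => //; exact: measurable_indic.
have mnu2 : measurable_fun setT nu2.
  by apply: measurable_funM => //; apply: measurable_indic; exact: measurableC.
have kp (k : nat) : 0 < k.+1%:R :> R by rewrite ltr0n.
have Vk (k : nat) : intg mu setT (fun x => k.+1%:R ^+ n * V (k.+1%:R *: x)).
  by apply: intgZ => //; exact: intg_scale.
have i1 (k : nat) : intg mu setT (fun x => nu1 x * (k.+1%:R ^+ n * V (k.+1%:R *: x))).
  exact: (intgMb (C := M)).
have far (k : nat) x : `|nu2 x * (k.+1%:R ^+ n * V (k.+1%:R *: x))| <= C / k.+1%:R * `|nu x|.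
  rewrite /nu2 indicE; case: (boolP (x \in ~` Q)) => [|_]; last first.
    by rewrite mulr0 mul0r normr0 mulr_ge0// divr_ge0.
  move=> /set_mem /existsNP[i /negP]; rewrite -ltNge => xi1.
  rewrite mulr1 normrM mulrC ler_wpM2r// normrM ger0_norm ?exprn_ge0//.
  rewrite ler_pdivlMr// mulrAC -exprSr; apply: le_trans (VC (k.+1%:R *: x) i).
  rewrite ler_wpM2r// lerXn2r ?nnegrE// mxE normrM ger0_norm// ler_peMr// ltW//.
have i2 (k : nat) : intg mu setT (fun x => nu2 x * (k.+1%:R ^+ n * V (k.+1%:R *: x))).
  apply: (le_intg _ _ (fun x _ => far k x)) => //.
    by apply: measurable_funM => //; exact: (intg_meas (Vk k)).
  by apply: intgZ => //; exact: intg_abs.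
have E (k : nat) : \int[mu]_x (f x * (k.+1%:R ^+ n * V (k.+1%:R *: (x - x0)))) =
    \int[mu]_x (nu1 (k.+1%:R^-1 *: x) * V x) +
    \int[mu]_x (nu2 x * (k.+1%:R ^+ n * V (k.+1%:R *: x))).
  rewrite -(Rintegral_shift x0); last first.
    apply: measurable_funM => //; apply: measurable_funM => //.
    apply: (measurableT_comp mV).
    by apply: (measurableT_comp (@scale_meas R n k.+1%:R)); exact: measurable_shift.
  transitivity (\int[mu]_x (nu1 x * (k.+1%:R ^+ n * V (k.+1%:R *: x)) +
      nu2 x * (k.+1%:R ^+ n * V (k.+1%:R *: x)))).
    by apply: eq_Rintegral => x _; rewrite addrK -mulrDl -nuE.
  rewrite (RintegralD measurableT (i1 k) (i2 k)); congr (_ + _).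
  rewrite -(@Rint_scale R n (fun x => nu1 (k.+1%:R^-1 *: x) * V x) k.+1%:R)//; last first.
    apply: (intgMb (C := M)) => //.
    apply: (measurableT_comp mnu1); exact: scale_meas.
  rewrite -RintegralZl//; last first.
    under eq_fun do rewrite scalerA mulVf ?scale1r ?gt_eqF//.
    by apply: (intgMb (C := M)) => //; exact: intg_scale.
  apply: eq_Rintegral => x _; rewrite scalerA mulVf ?scale1r ?gt_eqF//; ring.
rewrite (funext E) -[X in _ --> X]addr0; apply: cvgD.
  have -> : f x0 * \int[mu]_x V x = \int[mu]_x (f x0 * V x) by rewrite RintegralZl.
  apply: (@Rdct _ _ _ _ setT _ _ (fun x => M * `|V x|)) => //.
  - move=> k; apply: measurable_funM => //.
    apply: (measurableT_comp mnu1); exact: scale_meas.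
  - by apply: intgZ => //; exact: intg_abs.
  - by move=> k x _; rewrite normrM ler_wpM2r.
  - move=> x _; apply: cvgM; last exact: cvg_cst.
    have -> : f x0 = nu 0 by rewrite /nu add0r.
    have c : (fun k : nat => nu (k.+1%:R^-1 *: x)) @ \oo --> nu 0.
      exact: (cvg_comp _ _ (cvg_scale_inv x) (cnu 0)).
    apply: cvg_trans c; apply: near_eq_cvg; near=> k.
    rewrite /nu1 indicE mem_set ?mulr1// => i.
    rewrite mxE normrM ger0_norm ?invr_ge0// mulrC ler_pdivrMr// mul1r.
    apply: (le_trans (coord_wgt x i)); apply: (@le_trans _ _ k%:R); last by rewrite ler_nat.
    by near: k; exact: nbhs_infty_ger.
apply/norm_cvg0P.
apply: (@squeeze_cvgr _ _ _ _ (fun=> 0) (fun k : nat => C * (\int[mu]_x `|nu x|) * k.+1%:R^-1)).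
- apply: nearW => k; rewrite normr_ge0/=.
  rewrite [leRHS](_ : _ = \int[mu]_x (C / k.+1%:R * `|nu x|)); last first.
    by rewrite RintegralZl//; [ring|exact: intg_abs].
  apply: ler_norm_Rint => //.
  by apply: intgZ => //; exact: intg_abs.
- exact: cvg_cst.
- rewrite -[X in _ --> X](mulr0 (C * \int[mu]_x `|nu x|)).
  by apply: cvgM; [exact: cvg_cst|exact: cvg_harmonic].
Unshelve. all: by end_near. Qed.

Lemma tile_even (r : R) x : tile 0 r (- x) = tile 0 r x.
Proof.
by apply: eq_bigr => i _; congr step; congr (_ - _ / _); rewrite !mxE; ring.
Qed.

Lemma tile_sym (r : R) x y : tile x r y = tile y r x.
Proof. by apply: eq_bigr => i _; congr step; congr (_ - _ / _); ring. Qed.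

Lemma tile_shift (r : R) a x : tile a r x = tile 0 r (x - a).
Proof. by apply: eq_bigr => i _; congr step; congr (_ - _ / _); rewrite !mxE; ring. Qed.

Local Opaque tile.

Lemma tile_cont (r : R) a : continuous (tile a r : 'rV[R]_n -> R).
Proof. exact: smooth_cont (smooth_tile a r). Qed.

Lemma tile_meas (r : R) a : measurable_fun setT (tile a r : 'rV[R]_n -> R).
Proof. exact: continuous_measurable_rV (@tile_cont r a). Qed.

Lemma test_tileT (r : R) a : 0 < r -> test_fun setT (tile a r : 'rV[R]_n -> R).
Proof. by move=> r0; exact: test_tile. Qed.

Lemma tile_intg (r : R) a : 0 < r -> intg mu setT (tile a r).
Proof. by move=> r0; exact: decay_intg (test_decay 0 (test_tileT a r0)). Qed.

Lemma tile_norm (r : R) a x : `|tile a r x| = tile a r x.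
Proof. by have /andP[? ?] := tile_ge0 a r x; rewrite ger0_norm. Qed.

Lemma tile_le1 (r : R) a x : `|tile a r x| <= 1.
Proof. by have /andP[? ?] := tile_ge0 a r x; rewrite ger0_norm. Qed.

Lemma tile_joint (r : R) :
  measurable_fun setT (fun z : 'rV[R]_n * 'rV[R]_n => tile z.1 r z.2).
Proof.
rewrite (_ : (fun z => _) = tile 0 r \o (fun z : 'rV[R]_n * 'rV[R]_n => z.2 - z.1)).
  apply: measurableT_comp; first exact: tile_meas.
  apply: measurable_to_rV => i; under eq_fun do rewrite !mxE.
  apply: measurable_funB.
    by apply: (measurableT_comp (coord_meas i)); exact: measurable_snd.
  by apply: (measurableT_comp (coord_meas i)); exact: measurable_fst.
by apply/funext => z; rewrite /= tile_shift.
Qed.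

Lemma Rint_tile (r : R) a : \int[mu]_x tile a r x = \int[mu]_x tile 0 r x.
Proof.
rewrite -(Rintegral_shift a (tile_meas r a)).
by apply: eq_Rintegral => x _; rewrite tile_shift addrK.
Qed.

Lemma cosmeas y : measurable_fun setT (fun x => cos (2 * pi * dot x y)).
Proof.
apply: (@measurableT_comp _ _ _ _ _ _ (@cos R)).
  by apply: continuous_measurable_fun; exact: continuous_cos.
by apply: measurable_funM => //; exact: dot_meas.
Qed.

Lemma sinmeas y : measurable_fun setT (fun x => sin (2 * pi * dot x y)).
Proof.
apply: (@measurableT_comp _ _ _ _ _ _ (@sin R)).
  by apply: continuous_measurable_fun; exact: continuous_sin.
by apply: measurable_funM => //; exact: dot_meas.
Qed.

Lemma intg_mulcos f y : intg mu setT f ->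
  intg mu setT (fun x => f x * cos (2 * pi * dot x y)).
Proof.
move=> fi; under eq_fun do rewrite mulrC.
by apply: (intgMb (C := 1)) => //; [exact: cosmeas|move=> ? _; exact: cos_max].
Qed.

Lemma intg_mulsin f y : intg mu setT f ->
  intg mu setT (fun x => f x * sin (2 * pi * dot x y)).
Proof.
move=> fi; under eq_fun do rewrite mulrC.
by apply: (intgMb (C := 1)) => //; [exact: sinmeas|move=> ? _; exact: sin_max].
Qed.

Lemma fsin_tile0 (r : R) y : 0 < r -> fsin (tile 0 r) y = 0.
Proof.
move=> r0; have si := intg_mulsin y (tile_intg 0 r0).
have : fsin (tile 0 r) y = - fsin (tile 0 r) y.
  rewrite {1}/fsin -Rintegral_opp; last exact: intg_meas si.
  rewrite -[RHS]mulN1r -RintegralZl//.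
  apply: eq_Rintegral => x _; rewrite tile_even mulN1r -mulrN -sinN; congr (_ * sin _).
  by rewrite dotC -scaleN1r dotZr dotC; ring.
move=> /eqP; rewrite -addr_eq0 -mulr2n mulrn_eq0/= => /eqP; exact.
Qed.

Lemma dotDl a x y : dot (x + a) y = dot x y + dot a y.
Proof. by rewrite dotC dotDr !(dotC y). Qed.

Lemma fcos_tile (r : R) a y : 0 < r ->
  fcos (tile a r) y = cos (2 * pi * dot a y) * fcos (tile 0 r) y.
Proof.
move=> r0; have b0 := tile_intg 0 r0; have ba := tile_intg a r0.
rewrite {1}/fcos -(Rintegral_shift a); last exact: intg_meas (intg_mulcos y ba).
transitivity (\int[mu]_x (cos (2 * pi * dot a y) * (tile 0 r x * cos (2 * pi * dot x y)) -
   sin (2 * pi * dot a y) * (tile 0 r x * sin (2 * pi * dot x y)))).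
  apply: eq_Rintegral => x _; rewrite tile_shift addrK dotDl mulrDr cosD; ring.
have ic := intg_mulcos y b0; have is_ := intg_mulsin y b0.
rewrite RintegralB//; [|exact: intgZ|exact: intgZ].
rewrite RintegralZl// RintegralZl// -/(fsin _ _) fsin_tile0// mulr0 subr0//.
Qed.

Lemma fsin_tile (r : R) a y : 0 < r ->
  fsin (tile a r) y = sin (2 * pi * dot a y) * fcos (tile 0 r) y.
Proof.
move=> r0; have b0 := tile_intg 0 r0; have ba := tile_intg a r0.
rewrite {1}/fsin -(Rintegral_shift a); last exact: intg_meas (intg_mulsin y ba).
transitivity (\int[mu]_x (sin (2 * pi * dot a y) * (tile 0 r x * cos (2 * pi * dot x y)) +
   cos (2 * pi * dot a y) * (tile 0 r x * sin (2 * pi * dot x y)))).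
  apply: eq_Rintegral => x _; rewrite tile_shift addrK dotDl mulrDr sinD; ring.
have ic := intg_mulcos y b0; have is_ := intg_mulsin y b0.
rewrite RintegralD//; [|exact: intgZ|exact: intgZ].
rewrite RintegralZl// RintegralZl// -/(fsin _ _) fsin_tile0// mulr0 addr0//.
Qed.

(** On the support of the tile the phase is at most 1/2, where the cosine is at least 1/2; the cube
    on which the tile equals 1 then gives half its volume. *)
Lemma fcos_tile_ge (r : R) y : 0 < r ->
  (forall xi, cube n (2 * r) xi -> `|2 * pi * dot xi y| <= 2^-1) ->
  (2 * r) ^+ n / 2 <= fcos (tile 0 r) y.
Proof.
move=> r0 H.
have c2 xi : cube n (2 * r) xi -> 2^-1 <= cos (2 * pi * dot xi y).
  move=> /H h; have := cos_lip 0 (2 * pi * dot xi y); rewrite cos0 subr0.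
  by move=> /le_trans/(_ h); rewrite ler_distl => /andP[]; lra.
have ic := intg_mulcos y (tile_intg 0 r0).
have mc : measurable (cube n r : set 'rV[R]_n) by exact: measurable_cube.
apply: (@le_trans _ _ (\int[mu]_(x in cube n r) (tile 0 r x * cos (2 * pi * dot x y)))); last first.
  apply: Rint_subset => // x _.
  have [/c2 h|/(tile0 r0)] := pselect (cube n (2 * r) (x - 0)); last first.
    by move=> ->; rewrite mul0r.
  have /andP[h0 _] := tile_ge0 0 r x; rewrite subr0 in h; rewrite mulr_ge0//.
  by apply: le_trans h; rewrite invr_ge0.
have -> : (2 * r) ^+ n / 2 = \int[mu]_(x in cube n r) (2^-1).
  by rewrite Rintegral_cst// ?leb_cube_lty// leb_cube ?(ltW r0)//= mulrC.
apply: le_Rintegral => //.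
- by apply: intg_cst_fin => //; exact: leb_cube_lty.
- exact: intgS ic.
move=> x cx; rewrite (tile1 r0) ?mul1r; last by rewrite subr0.
by apply: c2 => i; apply: le_trans (cx i) _; rewrite ler_peMl ?(ltW r0)// ler1n.
Qed.

(** The autocorrelation of the unit tile. Since the tile is even, the transform is the square of the
    real function [fcos (tile 0 1)]: a nonnegative kernel whose mass cannot cancel. *)
Definition autocor a : R := \int[mu]_b (tile 0 1 b * tile a 1 b).

Lemma autocor_meas : measurable_fun setT autocor.
Proof. by apply: meas_ker; [exact: tile_meas|exact: tile_joint]. Qed.

Lemma autocor_bound a : `|autocor a| <= \int[mu]_x tile 0 1 x.
Proof.
have b0 := tile_intg (0 : 'rV[R]_n) (@ltr01 R).
have ib : intg mu setT (fun b => tile 0 1 b * tile a 1 b).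
  under eq_fun do rewrite mulrC.
  by apply: (intgMb (C := 1)) => //; [exact: tile_meas|move=> x _; exact: tile_le1].
apply: ler_norm_Rint => // x _.
by rewrite normrM tile_norm ler_piMr ?tile_le1//; have /andP[] := tile_ge0 0 1 x.
Qed.

Lemma tile0_cube2 a b : tile 0 1 b != 0 :> R -> tile a 1 b != 0 :> R -> cube n 4 a.
Proof.
move=> nb na i.
have h : cube n (2 * 1) (b - 0) by apply: contrapT => /(tile0 ltr01) h; rewrite h eqxx in nb.
have h' : cube n (2 * 1) (b - a) by apply: contrapT => /(tile0 ltr01) h'; rewrite h' eqxx in na.
have := h i; have := h' i; rewrite !mxE subr0 mulr1 => h1 h2.
rewrite (_ : a 0 i = b 0 i - (b 0 i - a 0 i)); last by ring.
by apply: le_trans (ler_normB _ _) _; lra.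
Qed.

Lemma autocor_supp : supported 4 autocor.
Proof.
move=> a na; rewrite /autocor (_ : (fun b => _) = fun=> 0).
  by rewrite Rintegral_cst// mul0r.
apply/funext => b; have [->|nb] := eqVneq (tile 0 1 b) (0 : R); first by rewrite mul0r.
have [->|nab] := eqVneq (tile a 1 b) (0 : R); first by rewrite mulr0.
by exfalso; apply: na; exact: tile0_cube2 nb nab.
Qed.

Lemma autocor_intg : intg mu setT autocor.
Proof.
exact: intg_cube autocor_meas autocor_bound autocor_supp.
Qed.

Lemma autocor_hat y : fcos autocor y = fcos (tile 0 1) y ^+ 2.
Proof.
have b0 := tile_intg (0 : 'rV[R]_n) (@ltr01 R).
(* The cosine is restricted to a cube containing the support of [autocor]; this makes it an
   integrable factor in [swap_ker]. *)
pose p a := \1_(cube n 4) a * cos (2 * pi * dot a y).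
have mc4 : measurable (cube n 4 : set 'rV[R]_n) by exact: measurable_cube.
have mp : measurable_fun setT p.
  by apply: measurable_funM; [exact: measurable_indic|exact: cosmeas].
have ip : intg mu setT p.
  apply: (@intg_cube _ n 4 1) => // x; first by rewrite /p normrM mulr_ile1// ?cos_max// indicE;
    case: (x \in _); rewrite ?normr1 ?normr0.
  by move=> nx; rewrite /p indicE memNset// mul0r.
have SW := @swap_ker R n n p (tile 0 1) (fun a b => tile a 1 b) 1 ip b0 (tile_joint 1) (fun a b =>
  tile_le1 1 a b).
have E1 : fcos autocor y = \int[mu]_a (p a * \int[mu]_xi (tile 0 1 xi * tile a 1 xi)).
  apply: eq_Rintegral => a _; rewrite -/(autocor a) /p indicE.
  case: (boolP (a \in cube n 4)) => [_|/negP na]; first by rewrite mul1r mulrC.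
  have a0 : autocor a = 0 by apply: autocor_supp => h; apply: na; exact: mem_set.
  rewrite a0 mul0r mulr0; exact: erefl.
rewrite E1 SW.
transitivity (\int[mu]_x (fcos (tile 0 1) y * (tile 0 1 x * cos (2 * pi * dot x y)))).
  apply: eq_Rintegral => b _.
  have [->|nb] := eqVneq (tile 0 1 b) (0 : R); first by rewrite !mul0r mulr0.
  rewrite [RHS]mulrCA; apply: (congr1 (fun t => tile 0 1 b * t)).
  rewrite [RHS]mulrC -(fcos_tile b y ltr01).
  apply: eq_Rintegral => a _; rewrite (tile_sym _ b a) /p indicE.
  case: (boolP (a \in cube n 4)) => [_|/negP na]; first by rewrite mul1r mulrC.
  have [->|nab] := eqVneq (tile a 1 b) (0 : R); first by rewrite mulr0 mul0r.
  by exfalso; apply: na; apply: mem_set; exact: tile0_cube2 nb nab.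
rewrite (RintegralZl _ measurableT (intg_mulcos y b0)) expr2 -/(fcos (tile 0 1) y).
exact: erefl.
Qed.

Local Opaque autocor.

(** Dilation flattens the autocorrelation towards the constant [autocor 0], while its transform
    concentrates at the origin with constant mass. *)
Definition acut (k : nat) a : R := autocor (k.+1%:R^-1 *: a).

Lemma acut_intg k : intg mu setT (acut k).
Proof. by apply: intg_scale autocor_intg; rewrite invr_gt0. Qed.

Lemma acut_bound k a : `|acut k a| <= \int[mu]_x tile 0 1 x.
Proof. exact: autocor_bound. Qed.

Lemma acut_hat k y : \int[mu]_a (acut k a * cos (2 * pi * dot a y)) =
  k.+1%:R ^+ n * fcos (tile 0 1) (k.+1%:R *: y) ^+ 2.
Proof.
have k0 : 0 < k.+1%:R :> R by rewrite ltr0n.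
have ai : intg mu setT (acut k) by apply: intg_scale autocor_intg; rewrite invr_gt0.
rewrite -(Rint_scale k0 (intg_mulcos y ai)) -autocor_hat; congr (_ * _).
apply: eq_Rintegral => a _; rewrite /acut scalerA mulVf ?gt_eqF// scale1r.
by congr (_ * cos (_ * _)); rewrite dotC !dotZr dotC.
Qed.

Local Transparent autocor.
Lemma acut_cvg a : (fun k => acut k a) @ \oo --> autocor 0.
Proof.
have b0 := tile_intg (0 : 'rV[R]_n) (@ltr01 R).
apply: (@Rdct _ _ _ _ setT _ _ (fun x => tile 0 1 x)) => //.
- by move=> k; apply: measurable_funM; exact: tile_meas.
- by move=> k x _; rewrite normrM tile_norm ler_piMr ?tile_le1//; have /andP[] := tile_ge0 0 1 x.
- move=> b _; apply: cvgM; first exact: cvg_cst.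
  under eq_fun do rewrite tile_sym; rewrite (tile_sym _ 0).
  exact: (cvg_comp _ _ (cvg_scale_inv a) (@tile_cont 1 b 0)).
Qed.

Local Opaque acut autocor.

(** The integrals are exchanged first. For fixed xi the variable a then ranges over the support of
    one tile, where [acut k] is bounded and tends to [autocor 0]; dominated convergence is applied
    in a and then in xi, with |F| as majorant up to a constant. *)
Lemma acut_lim (F c : 'rV[R]_n -> R) (r : R) : 0 < r -> intg mu setT F -> measurable_fun setT c ->
  (forall a, `|c a| <= 1) ->
  (fun k => \int[mu]_a (acut k a * \int[mu]_xi (F xi * (tile a r xi * c a)))) @ \oo -->
  autocor 0 * \int[mu]_xi (F xi * \int[mu]_a (tile xi r a * c a)).
Proof.
move=> r0 Fi mc c1; have mF := intg_meas Fi.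
have ai := acut_intg.
pose G := \int[mu]_x tile (0 : 'rV[R]_n) 1 x.
have aG k a : `|acut k a| <= G by exact: acut_bound.
have G0 : 0 <= G by apply: le_trans (aG 0%N 0).
have br a := tile_intg a r0.
have bc xi : intg mu setT (fun a => tile xi r a * c a).
  by under eq_fun do rewrite mulrC; apply: (intgMb (C := 1)).
have mK : measurable_fun setT (fun z : 'rV[R]_n * 'rV[R]_n => tile z.1 r z.2 * c z.1).
  apply: measurable_funM; first exact: tile_joint.
  by apply: (measurableT_comp mc); exact: measurable_fst.
have mK' : measurable_fun setT (fun z : 'rV[R]_n * 'rV[R]_n => tile z.1 r z.2 * c z.2).
  apply: measurable_funM; first exact: tile_joint.
  by apply: (measurableT_comp mc); exact: measurable_snd.
have E k : \int[mu]_a (acut k a * \int[mu]_xi (F xi * (tile a r xi * c a))) =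
    \int[mu]_xi (F xi * \int[mu]_a (acut k a * (tile xi r a * c a))).
  have bK a xi : `|tile a r xi * c a| <= 1 by rewrite normrM mulr_ile1// tile_le1.
  transitivity (\int[mu]_xi (F xi * \int[mu]_a (acut k a * (tile a r xi * c a)))).
    exact: (@swap_ker R n n (acut k) F (fun a xi => tile a r xi * c a) 1 (ai k) Fi mK bK).
  apply: eq_Rintegral => xi _; apply: (congr1 (fun t => F xi * t)).
  by apply: eq_Rintegral => a _; rewrite tile_sym.
rewrite (funext E).
have ibc k xi : intg mu setT (fun a => acut k a * (tile xi r a * c a)).
  by apply: (intgMb (C := G)) => //; exact: intg_meas (ai k).
pose X := \int[mu]_x tile (0 : 'rV[R]_n) r x.
have inner xi : (fun k => \int[mu]_a (acut k a * (tile xi r a * c a))) @ \oo -->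
    autocor 0 * \int[mu]_a (tile xi r a * c a).
  refine (eq_ind _ (fun t : R => (fun k => \int[mu]_a (acut k a * (tile xi r a * c a))) @ \oo --> t)
    _ _ (RintegralZl (autocor 0) measurableT (bc xi))).
  apply: (@Rdct _ _ _ _ setT _ _ (fun a => G * tile xi r a) measurableT).
  - by move=> k; exact: intg_meas (ibc k xi).
  - exact: (intgZ _ measurableT (br xi)).
  - move=> k a _; rewrite !normrM tile_norm; apply: ler_pM; [exact: normr_ge0| |exact: aG|].
      by rewrite mulr_ge0//; have /andP[] := tile_ge0 xi r a.
    by rewrite ler_piMr//; have /andP[] := tile_ge0 xi r a.
  - by move=> a _; apply: cvgM; [exact: acut_cvg|exact: cvg_cst].
have bnd k xi : `|\int[mu]_a (acut k a * (tile xi r a * c a))| <= G * X.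
  rewrite /X -(Rint_tile r xi) -(RintegralZl _ measurableT (br xi)).
  apply: (ler_norm_Rint measurableT (ibc k xi) (intgZ _ measurableT (br xi))).
  move=> a _; rewrite !normrM tile_norm; apply: ler_pM; [exact: normr_ge0| |exact: aG|].
    by rewrite mulr_ge0//; have /andP[] := tile_ge0 xi r a.
  by rewrite ler_piMr//; have /andP[] := tile_ge0 xi r a.
have bnd' xi : `|\int[mu]_a (tile xi r a * c a)| <= X.
  rewrite /X -(Rint_tile r xi).
  apply: (ler_norm_Rint measurableT (bc xi) (br xi)) => a _.
  by rewrite normrM tile_norm ler_piMr//; have /andP[] := tile_ge0 xi r a.
have bo : intg mu setT (fun xi => F xi * \int[mu]_a (tile xi r a * c a)).
  under eq_fun do rewrite mulrC.
  apply: (intgMb (C := X) measurableT _ (fun xi _ => bnd' xi) Fi).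
  under eq_fun do under eq_Rintegral do rewrite mulrC.
  by apply: (@meas_ker R n n c (fun xi a => tile xi r a)) => //; exact: tile_joint.
refine (eq_ind _ (fun t : R => (fun k => \int[mu]_xi (F xi * \int[mu]_a (acut k a *
  (tile xi r a * c a)))) @ \oo --> t) _ _ (RintegralZl (autocor 0) measurableT bo)).
apply: (@Rdct _ _ _ _ setT _ _ (fun xi => G * X * `|F xi|) measurableT).
- move=> k; apply: measurable_funM => //.
  exact: (@meas_ker R n n (acut k) (fun xi a => tile xi r a * c a)) (intg_meas (ai k)) mK'.
- exact: (intgZ _ measurableT (intg_abs measurableT Fi)).
- by move=> k xi _; rewrite normrM mulrC; apply: ler_wpM2r; [exact: normr_ge0|exact: bnd].
- move=> xi _; refine (eq_ind _ (fun t : R => (fun k => F xi * \int[mu]_a (acut k a *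
    (tile xi r a * c a))) @ \oo --> t) _ _ (mulrCA (F xi) (autocor 0) _)).
  by apply: cvgM; [exact: cvg_cst|exact: inner].
Qed.

Let V y : R := fcos (tile 0 1) y ^+ 2.

Lemma hatsq_decay : exists2 C, 0 <= C &
  (forall y, `|V y| <= C) /\ forall (y : 'rV[R]_n) (i : 'I_n), `|y 0 i| ^+ n.+1 * `|V y| <= C.
Proof.
have tb := test_tileT (0 : 'rV[R]_n) (@ltr01 R).
have [sA dA] := trig_schwartz 0 tb.
pose G := \int[mu]_x `|tile (0 : 'rV[R]_n) 1 x|.
have bG y : `|fcos (tile 0 1) y| <= G.
  by rewrite fcosE; apply: trig_bound; exact: tile_intg.
have G0 : 0 <= G by exact: le_trans (bG 0).
have /choice[C HC] : forall i : 'I_n, exists C : R, forall y : 'rV[R]_n,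
    `|y 0 i| ^+ n.+1 * `|fcos (tile 0 1) y| <= C.
  move=> i; have [C HC] := dA (nseq n.+1 i) [::]; exists C => y.
  have := HC y; rewrite big_nseq iter_mulr_1 /= -fcosE normrM normrX; exact.
have C0 i : 0 <= C i by apply: le_trans (HC i 0); rewrite mulr_ge0// exprn_ge0.
exists (G ^+ 2 + (\sum_i C i) * G).
  by rewrite addr_ge0 ?sqr_ge0// mulr_ge0// sumr_ge0.
split=> [y|y i]; rewrite /V normrX.
  apply: ler_wpDr; first by rewrite mulr_ge0// sumr_ge0.
  by rewrite lerXn2r ?nnegrE.
apply: ler_wpDl; first exact: sqr_ge0.
rewrite expr2 mulrA; apply: ler_pM; [by rewrite mulr_ge0// exprn_ge0|by []| |exact: bG].
apply: le_trans (HC i y) _; rewrite (bigD1 i)//= lerDl sumr_ge0//.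
Qed.

Lemma fcos_tile_cont (r : R) : 0 < r -> continuous (fcos (tile (0 : 'rV[R]_n) r)).
Proof.
by move=> r0; rewrite fcosE; apply: trig_cont; exact: test_decay (test_tileT _ r0).
Qed.

Lemma hatsq_intg : intg mu setT V.
Proof.
have [C C0 [H1 H2]] := hatsq_decay; apply: (intg_pow_decay _ H1 H2).
apply: measurable_funX; apply: continuous_measurable_rV.
exact: (@fcos_tile_cont 1 ltr01).
Qed.

Lemma Rint_hatsq_gt0 : 0 < \int[mu]_y V y.
Proof.
(* For y in the cube of half-side e and xi in the support of the unit tile, the phase is at most 2
   pi n (2 e) = n / (2 (n + 1)) < 1/2. *)
pose e : R := (8 * pi * n.+1%:R)^-1.
have P0 : 0 < 8 * pi * n.+1%:R :> R by rewrite !mulr_gt0// ?pi_gt0// ltr0n.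
have e0 : 0 < e by rewrite invr_gt0.
have mc : measurable (cube n e : set 'rV[R]_n) by exact: measurable_cube.
have V0 y : 0 <= V y by exact: sqr_ge0.
apply: (@lt_le_trans _ _ (\int[mu]_(y in cube n e) V y)); last first.
  by apply: Rint_subset => //; exact: hatsq_intg.
have c0 : 0 < ((2 * 1) ^+ n / 2 : R) by rewrite divr_gt0// exprn_gt0// mulr_gt0.
apply: (@lt_le_trans _ _ (\int[mu]_(y in cube n e) (((2 * 1) ^+ n / 2) ^+ 2))).
  rewrite Rintegral_cst ?leb_cube_lty// leb_cube ?(ltW e0)//=.
  by rewrite mulr_gt0// exprn_gt0// mulr_gt0.
apply: le_Rintegral => //.
- by apply: intg_cst_fin => //; exact: leb_cube_lty.
- by apply: intgS hatsq_intg.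
have H y : cube n e y -> (2 * 1) ^+ n / 2 <= fcos (tile 0 1) y.
  move=> cy; apply: fcos_tile_ge => // xi cxi.
  have -> : `|2 * pi * dot xi y| = 2 * pi * `|dot xi y|.
    by rewrite normrM ger0_norm// mulr_ge0// pi_ge0.
  have d1_ : `|dot xi y| <= n%:R * (2 * e).
    apply: le_trans (ler_norm_sum _ _ _) _.
    rewrite mulr_natl -[X in _ *+ X](card_ord n) -sumr_const; apply: ler_sum => i _.
    by rewrite normrM ler_pM//; have := cxi i; rewrite mulr1.
  have E1 : 8 * pi * n.+1%:R * e = 1 by rewrite mulfV// gt_eqF.
  have n1 : n%:R <= n.+1%:R :> R by rewrite ler_nat.
  have pe : 0 < pi * e by rewrite mulr_gt0// pi_gt0.
  have h1 : 2 * pi * `|dot xi y| <= 2 * pi * (n%:R * (2 * e)).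
    by rewrite ler_wpM2l// mulr_ge0// pi_ge0.
  have h2 : n%:R * (pi * e) <= n.+1%:R * (pi * e) by rewrite ler_wpM2r// ltW.
  move: E1 h1 h2; set t := pi * e; rewrite (_ : 2 * pi * (n%:R * (2 * e)) = 4 * (n%:R * t));
    last by rewrite /t; ring.
  rewrite (_ : 8 * pi * n.+1%:R * e = 8 * (n.+1%:R * t)); last by rewrite /t; ring.
  lra.
move=> y cy; rewrite /V lerXn2r ?nnegrE ?(ltW c0)//; last exact: H.
by apply: le_trans (ltW c0) _; exact: H.
Qed.

Local Transparent autocor.
Lemma autocor0_gt0 : 0 < autocor 0.
Proof.
have b0 := tile_intg (0 : 'rV[R]_n) (@ltr01 R).
have ib : intg mu setT (fun b : 'rV[R]_n => tile 0 1 b * tile 0 1 b : R).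
  by apply: (intgMb (C := 1)) => //; [exact: tile_meas|move=> x _; exact: tile_le1].
have mc : measurable (cube n 1 : set 'rV[R]_n) by exact: measurable_cube.
apply: (@lt_le_trans _ _ (\int[mu]_(b in cube n 1) (tile 0 1 b * tile 0 1 b))); last first.
  by apply: Rint_subset => // x _; rewrite -expr2 sqr_ge0.
apply: (@lt_le_trans _ _ (\int[mu]_(b in cube n 1) 1)).
  have -> : \int[mu]_(b in cube n 1) 1 = (2 * 1) ^+ n :> R.
    by rewrite Rintegral_cst ?leb_cube_lty// leb_cube// mul1r.
  by rewrite exprn_gt0// mulr_gt0.
apply: le_Rintegral => //.
- by apply: intg_cst_fin => //; exact: leb_cube_lty.
- exact: intgS ib.
by move=> x cx; rewrite !(tile1 ltr01) ?mulr1// subr0.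
Qed.

Local Opaque autocor.
(* Test the transform on tile a 1 modulated by the phase of x0, multiply by the
   autocorrelation acut k at a, and integrate in a. The transform of acut k is a
   square, so on one side it is a positive kernel of mass independent of k that
   concentrates at x0; on the other side acut k tends to a constant. The value
   of c (which is 1) is never needed. *)
Lemma fourier_inversion (eta : 'rV[R]_n -> R)
    (F : ('rV[R]_n -> R) * ('rV[R]_n -> R)) : continuous eta ->
  (forall phi, schwartz phi -> mu.-integrable setT (fun x => (eta x * phi x)%:E)) ->
  is_fourier (distr eta) F -> intg mu setT F.1 -> intg mu setT F.2 ->
  exists c, forall x, eta x = c * (trig F.1 0 x + trig F.2 (pi / 2) x).
Proof.
move=> ceta etas [_ _ HF] i1 i2.
have c0 := Rint_hatsq_gt0; have w0 := autocor0_gt0.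
exists (autocor 0 / \int[mu]_y V y) => x0.
(* Tiles are taken so small that the phase 2 pi xi . x0 stays below 1/2 on their support. The
   transform [A] is then positive at x0 and can be divided out at the end. *)
pose r : R := (8 * pi * wgt x0)^-1.
have wx : 0 < wgt x0 by exact: lt_le_trans (wgt_ge1 x0).
have P0 : 0 < 8 * pi * wgt x0 by rewrite !mulr_gt0// pi_gt0.
have r0 : 0 < r by rewrite invr_gt0.
pose A := fcos (tile (0 : 'rV[R]_n) r).
have Ax0 : 0 < A x0.
  apply: (@lt_le_trans _ _ ((2 * r) ^+ n / 2)).
    by rewrite divr_gt0// exprn_gt0// mulr_gt0.
  apply: fcos_tile_ge => // xi cxi.
  rewrite normrM ger0_norm ?mulr_ge0 ?pi_ge0//.
  have d1_ : `|dot xi x0| <= 2 * r * wgt x0.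
    apply: le_trans (ler_norm_sum _ _ _) _; rewrite mulrDr mulr_sumr.
    apply: ler_wpDl; first by rewrite mulr1 mulr_ge0// ltW.
    by apply: ler_sum => i _; rewrite normrM ler_wpM2r.
  have E1 : 8 * pi * wgt x0 * r = 1 by rewrite mulfV// gt_eqF.
  have h1 : 2 * pi * `|dot xi x0| <= 2 * pi * (2 * r * wgt x0).
    by rewrite ler_wpM2l// mulr_ge0// pi_ge0.
  by apply: le_trans h1 _; rewrite (_ : 2 * pi * _ = (8 * pi * wgt x0 * r) / 2);
    [rewrite E1 mul1r|field].
have cA : continuous A by exact: fcos_tile_cont.
have sA : schwartz A by rewrite /A fcosE; apply: trig_schwartz; exact: test_tileT.
(* [A] is a Schwartz function, so this product is integrable although [eta] need not be. *)
pose f x := eta x * A x.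
have fi : intg mu setT f by exact: etas sA.
have cf : continuous f by exact: contM ceta cA.
have mf := intg_meas fi.
pose I a := \int[mu]_x (f x * cos (2 * pi * dot a (x - x0))).
have ai := acut_intg.
(* This is the defining identity of the transform tested on [tile a r], its two components combined
   with the cosine and sine of 2 pi a . x0. *)
have IE a : I a = \int[mu]_xi (F.1 xi * (tile a r xi * cos (2 * pi * dot a x0))) -
    \int[mu]_xi (F.2 xi * (tile a r xi * sin (2 * pi * dot a x0))).
  have ta := test_tileT a r0; have [H1 H2] := HF _ ta.
  have iF (G : 'rV[R]_n -> R) : intg mu setT G -> intg mu setT (fun xi => G xi * tile a r xi).
    move=> Gi; under eq_fun do rewrite mulrC.
    by apply: (intgMb (C := 1)) => //; [exact: tile_meas|move=> ? _; exact: tile_le1].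
  under [in RHS]eq_Rintegral do rewrite mulrA mulrC.
  rewrite RintegralZl//; last exact: iF.
  under [X in _ - X]eq_Rintegral do rewrite mulrA mulrC.
  rewrite RintegralZl//; last exact: iF.
  rewrite -H1 -H2 mulrN opprK.
  have E1 : distr eta (fcos (tile a r)) = \int[mu]_x (f x * cos (2 * pi * dot x a)).
    by apply: eq_Rintegral => x _; rewrite fcos_tile// (dotC a) /f /A; ring.
  have E2 : distr eta (fsin (tile a r)) = \int[mu]_x (f x * sin (2 * pi * dot x a)).
    by apply: eq_Rintegral => x _; rewrite fsin_tile// (dotC a) /f /A; ring.
  rewrite E1 E2 -RintegralZl//; last exact: intg_mulcos.
  rewrite -RintegralZl//; last exact: intg_mulsin.
  rewrite -RintegralD//; last 2 first.
  - by apply: intgZ => //; exact: intg_mulcos.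
  - by apply: intgZ => //; exact: intg_mulsin.
  by apply: eq_Rintegral => x _; rewrite dotBr mulrBr cosB !(dotC a); ring.
pose S k := \int[mu]_a (acut k a * I a).
have lim1 : S @ \oo --> f x0 * \int[mu]_y V y.
  have [C C0 [HC1 HC2]] := hatsq_decay.
  have := approx_id (x0 := x0) C0 cf fi hatsq_intg HC2.
  apply: cvg_trans; apply: near_eq_cvg; apply: nearW => k.
  transitivity (\int[mu]_x (f x * \int[mu]_a (acut k a * cos (2 * pi * dot a (x - x0))))).
    by apply: eq_Rintegral => x _; rewrite acut_hat.
  apply/esym; apply: (@swap_ker R n n (acut k) f (fun a x =>
    cos (2 * pi * dot a (x - x0))) 1 (ai k) fi).
  - apply: (@measurableT_comp _ _ _ _ _ _ (@cos R)).
      by apply: continuous_measurable_fun; exact: continuous_cos.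
    apply: measurable_funM => //; apply: measurable_sum => i; apply: measurable_funM.
      by apply: (measurableT_comp (coord_meas i)); exact: measurable_fst.
    under eq_fun do rewrite !mxE; apply: measurable_funB => //.
    by apply: (measurableT_comp (coord_meas i)); exact: measurable_snd.
  - by move=> a x; exact: cos_max.
have mcos : measurable_fun setT (fun a => cos (2 * pi * dot a x0)) by exact: cosmeas.
have msin : measurable_fun setT (fun a => sin (2 * pi * dot a x0)) by exact: sinmeas.
have l1 := acut_lim r0 i1 mcos (fun a => cos_max _).
have l2 := acut_lim r0 i2 msin (fun a => sin_max _).
have kI (G : 'rV[R]_n -> R) (c : 'rV[R]_n -> R) k : intg mu setT G -> measurable_fun setT c ->
    (forall a, `|c a| <= 1) ->
    intg mu setT (fun a => acut k a * \int[mu]_xi (G xi * (tile a r xi * c a))).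
  move=> Gi mc c1; under eq_fun do rewrite mulrC.
  apply: (intgMb (C := \int[mu]_xi `|G xi|)) => //.
    apply: (@meas_ker R n n G (fun a xi => tile a r xi * c a)); first exact: intg_meas Gi.
    apply: measurable_funM; first exact: tile_joint.
    by apply: (measurableT_comp mc); exact: measurable_fst.
  move=> a _; apply: ler_norm_Rint => //; last first.
  - by move=> x _; rewrite normrM ler_piMr// normrM mulr_ile1// tile_le1.
  - exact: intg_abs.
  under eq_fun do rewrite mulrC; apply: (intgMb (C := 1)) => //.
    by apply: measurable_funM => //; exact: tile_meas.
  by move=> x _; rewrite normrM mulr_ile1// tile_le1.
have lim2 : S @ \oo --> autocor 0 * (A x0 * trig F.1 0 x0) + autocor 0 * (A x0 * trig F.2 (pi / 2)
  x0).
  have -> : autocor 0 * (A x0 * trig F.1 0 x0) =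
      autocor 0 * \int[mu]_xi (F.1 xi * \int[mu]_a (tile xi r a * cos (2 * pi * dot a x0))).
    congr (_ * _); rewrite /trig -RintegralZl//; last exact: trig_intg.
    by apply: eq_Rintegral => xi _; rewrite -/(fcos _ _) fcos_tile// addr0 /A; ring.
  have -> : autocor 0 * (A x0 * trig F.2 (pi / 2) x0) =
      - (autocor 0 * \int[mu]_xi (F.2 xi * \int[mu]_a (tile xi r a * sin (2 * pi * dot a x0)))).
    rewrite -mulrN; congr (_ * _); rewrite /trig -RintegralZl//; last exact: trig_intg.
    rewrite -mulN1r -RintegralZl//; last first.
      under eq_fun do rewrite -/(fsin _ _) fsin_tile// mulrA mulrC.
      by apply: intgZ => //; exact: intg_mulsin.
    by apply: eq_Rintegral => xi _; rewrite -/(fsin _ _) fsin_tile// cosDpihalf /A; ring.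
  apply: cvg_trans (cvgB l1 l2); apply: near_eq_cvg; apply: nearW => k.
  rewrite /S /=; under [in RHS]eq_Rintegral do rewrite IE mulrBr.
  rewrite RintegralB//; [exact: kI i1 mcos (fun a => cos_max _)|exact: kI i2 msin (fun a =>
    sin_max _)].
have E := cvg_unique (@Rhausdorff R) lim1 lim2.
have vn : \int[mu]_y V y != 0 by rewrite gt_eqF.
have an : A x0 != 0 by rewrite gt_eqF.
apply: (mulIf an); apply: (mulIf vn); rewrite -/(f x0) E -mulrDr; field.
exact: vn.
Qed.

End inversion.

(** * Regularity and approximation of the surface function *)

Section regularity.
Context {R : realType} {n : nat}.
Local Notation mu := (leb n).
Notation ee i := (delta_mx 0 i : 'rV[R]_ _).
Implicit Types (f g : 'rV[R]_n -> R) (x y xi : 'rV[R]_n).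

Lemma sqnorm_cont : continuous (fun xi : 'rV[R]_n => sqnorm xi).
Proof. by apply: smooth_cont; exact: smooth_sqnorm. Qed.

Lemma omega_meas (s : R) : measurable_fun setT (fun xi : 'rV[R]_n => omega s xi).
Proof.
have msq : measurable_fun setT (fun xi : 'rV[R]_n => sqnorm xi).
  exact: continuous_measurable_rV sqnorm_cont.
apply: measurable_fun_ifT.
- exact: measurable_fun_ltr.
- rewrite (_ : (fun xi => _) = fun xi : 'rV[R]_n =>
    (dot xi (e1 n) ^+ 2 + sqnorm xi ^+ 2) * (sqnorm xi `^ (-1))); last first.
    by apply/funext => xi; rewrite powR_inv1// sqnorm_ge0.
  apply: measurable_funM.
    by apply: measurable_funD; apply: measurable_funX => //; exact: dot_meas.
  by apply: (measurableT_comp (measurable_powR _)).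
- apply: (measurableT_comp (measurable_powR _)).
  exact: measurable_funD.
Qed.

Lemma omega_ge0 (s : R) xi : 0 <= omega s xi.
Proof.
rewrite /omega; case: ifP => _; last exact: powR_ge0.
by rewrite divr_ge0// ?sqnorm_ge0// addr_ge0// sqr_ge0.
Qed.

(* Low frequencies are harmless because F is locally integrable; at high ones
   |xi|^3 |g| <= (omega g^2 + h) / 2 with h an integrable power of |xi|. *)
Lemma omega_decay (s : nat) (F : ('rV[R]_n -> R) * ('rV[R]_n -> R)) g :
  (n.+2 <= s.*2)%N -> L1loc setT F.1 -> L1loc setT F.2 ->
  (omega_int (s%:R + 5 / 2) F < +oo)%E ->
  L1loc setT g -> (forall xi, g xi ^+ 2 <= F.1 xi ^+ 2 + F.2 xi ^+ 2) -> decay 3 g.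
Proof.
move=> ns [m1 _] [m2 _] wF [mg lg] gF.
have msq : measurable_fun setT (fun xi : 'rV[R]_n => sqnorm xi).
  exact: continuous_measurable_rV sqnorm_cont.
pose w := s%:R + 5 / 2 : R.
pose om xi := omega w xi * (F.1 xi ^+ 2 + F.2 xi ^+ 2).
have mom : measurable_fun setT om.
  apply: measurable_funM; first exact: omega_meas.
  by apply: measurable_funD; apply: measurable_funX.
have iom : intg mu setT om.
  apply/intg_ge0P => // xi _; rewrite mulr_ge0 ?omega_ge0//.
  by rewrite addr_ge0// sqr_ge0.
pose r xi := Num.sqrt (1 + sqnorm xi).
have r1 xi : 1 <= r xi.
  by rewrite -[leLHS]sqrtr1 ler_wsqrtr// lerDl sqnorm_ge0.
have r0 xi : 0 < r xi by exact: lt_le_trans (r1 xi).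
have rc xi i : `|xi 0 i| <= r xi.
  rewrite -sqrtr_sqr ler_wsqrtr//; apply: le_trans (coord_sqnorm xi i) _.
  by rewrite lerDr.
have mr : measurable_fun setT r.
  apply: (@measurableT_comp _ _ _ _ _ _ (@Num.sqrt R)).
    by apply: continuous_measurable_fun; exact: sqrt_continuous.
  exact: measurable_funD.
(* The exponent 2s - 1 is at least n + 1, so this power is integrable. The weight is r^(2s+5), and
   in 2s + 5 = (2s - 1) + 6 the last six powers pay for the square of three moments. *)
pose h xi := (r xi)^-1 ^+ (s.*2.-1).
have mh : measurable_fun setT h.
  apply: measurable_funX.
  rewrite (_ : (fun xi => _) = fun xi => r xi `^ (-1)).
    by apply: (measurableT_comp (measurable_powR _)).
  by apply/funext => xi; rewrite powR_inv1// ltW.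
have h0 xi : 0 <= h xi by rewrite exprn_ge0// invr_ge0 ltW.
have rV1 xi : (r xi)^-1 <= 1 by rewrite invf_le1.
have ih : intg mu setT h.
  apply: (intg_pow_decay (C := 1)) => // [xi|xi i].
    by rewrite ger0_norm// exprn_ile1// invr_ge0 ltW.
  rewrite (ger0_norm (h0 xi)) /h.
  have -> : (s.*2.-1 = n.+1 + (s.*2.-1 - n.+1))%N by rewrite subnKC// -ltnS prednK// (leq_trans _
    ns).
  rewrite exprD mulrA -exprMn mulr_ile1 ?mulr_ge0 ?exprn_ge0 ?invr_ge0 ?(ltW (r0 _))//.
    by rewrite mulr_ge0// invr_ge0 ltW.
  - by apply: exprn_ile1; rewrite ?mulr_ge0 ?invr_ge0 ?(ltW (r0 _))// ler_pdivrMr// mul1r.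
  - by apply: exprn_ile1; rewrite ?invr_ge0 ?(ltW (r0 _)).
pose Q := cube n 1 : set 'rV[R]_n.
have mQ : measurable Q by exact: measurable_cube.
have iQ : intg mu setT (fun xi => `|g xi| * \1_Q xi).
  apply: (intg_restr mQ).
  - by apply: measurable_funM; [exact: measurableT_comp|exact: measurable_indic].
  - by move=> xi nQ; rewrite indicE memNset// mulr0.
  have gQ : intg mu Q g by apply: lg => //; exact: compact_cube.
  apply: (le_intg mQ _ _ (intg_abs mQ gQ)).
    by apply: measurable_funTS; apply: measurable_funM;
      [exact: measurableT_comp|exact: measurable_indic].
  by move=> xi _; rewrite normrM normr_id ler_piMr// indicE; case: (xi \in Q);
    rewrite ?normr1 ?normr0.
pose N : R := n.+1%:R; have N1 : 1 <= N by rewrite ler1n.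
have N0 : 0 <= N by rewrite ler0n.
have NE : N = n%:R + 1 by rewrite natr1.
have wr xi : wgt xi <= N * r xi.
  rewrite NE [leRHS]mulrDl mul1r [leRHS]addrC lerD// mulr_natl.
  by rewrite -[X in _ *+ X](card_ord n) -sumr_const ler_sum.
split=> //.
have iG := intgD measurableT (intgZ (N ^+ 3) measurableT iQ)
  (intgD measurableT iom (intgZ (N ^+ 6) measurableT ih)).
apply: (le_intg _ _ _ iG) => //.
  by apply: measurable_funM => //; apply: measurable_funX; exact: wgt_meas.
move=> xi _; rewrite normrM (ger0_norm (exprn_ge0 _ (wgt_ge0 xi))).
have om0 : 0 <= om xi.
  by rewrite mulr_ge0 ?omega_ge0// addr_ge0// sqr_ge0.
have [s1|s1] := ltP (sqnorm xi) 1.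
  have Qxi : Q xi.
    move=> i; rewrite -(@ler_pXn2r _ 2)// ?nnegrE// real_normK ?num_real// expr1n.
    exact: le_trans (coord_sqnorm xi i) (ltW s1).
  apply: ler_wpDr; first by rewrite addr_ge0// mulr_ge0// exprn_ge0.
  rewrite indicE mem_set// mulr1 ler_wpM2r// lerXn2r ?nnegrE ?wgt_ge0//.
  rewrite NE addrC lerD2l -[X in X%:R](card_ord n) -sumr_const.
  exact: ler_sum.
apply: ler_wpDl; first by rewrite mulr_ge0 ?exprn_ge0// mulr_ge0// indicE.
have omE : omega w xi = r xi ^+ (s.*2 + 5).
  rewrite /omega ltNge s1/= -powR_mulrn ?(ltW (r0 _))// /r -powR12_sqrt; last first.
    by rewrite addr_ge0// sqnorm_ge0.
  rewrite -powRrM; congr (_ `^ _); by rewrite /w natrD -mul2n natrM; field.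
apply: (@le_trans _ _ (N ^+ 3 * (r xi ^+ 3 * `|g xi|))).
  rewrite mulrA -exprMn ler_wpM2r// lerXn2r ?nnegrE ?wgt_ge0//.
  by rewrite mulr_ge0// ltW.
rewrite /om omE /h.
have -> : (s.*2 + 5 = s.*2.-1 + 6)%N by rewrite -[in LHS](prednK (leq_trans (ltn0Sn _) ns)) addSnnS.
have g2 : r xi ^+ (s.*2.-1 + 6) * g xi ^+ 2 <= r xi ^+ (s.*2.-1 + 6) * (F.1 xi ^+ 2 + F.2 xi ^+ 2).
  by rewrite ler_wpM2l// exprn_ge0// ltW.
apply: (@le_trans _ _ (r xi ^+ (s.*2.-1 + 6) * g xi ^+ 2 + N ^+ 6 * (r xi)^-1 ^+ s.*2.-1));
  last by rewrite lerD2r.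
rewrite -(real_normK (num_real (g xi))).
have rn0 : r xi != 0 by rewrite gt_eqF.
set p := s.*2.-1; set a := `|g xi|.
have rp : 0 < r xi ^+ p by rewrite exprn_gt0.
(* After multiplication by r^p the claim reads u v <= v^2 + u^2, with u = N^3 and v = r^(p+3)
   |g|. *)
rewrite -(ler_pM2l rp) mulrDr [r xi ^+ p * (N ^+ 6 * _)]mulrCA exprVn mulfV ?gt_eqF// mulr1.
rewrite exprD (_ : r xi ^+ p * (N ^+ 3 * _) = N ^+ 3 * (r xi ^+ p * r xi ^+ 3 * a)); last by ring.
rewrite (_ : r xi ^+ p * (r xi ^+ p * r xi ^+ 6 * a ^+ 2) = (r xi ^+ p * r xi ^+ 3 * a) ^+ 2);
  last first.
  by move: (r xi ^+ p) => P; ring.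
rewrite (_ : N ^+ 6 = (N ^+ 3) ^+ 2); last by rewrite -exprM.
set u := N ^+ 3; set v := r xi ^+ p * r xi ^+ 3 * a.
by have := sqr_ge0 (u - v); have := sqr_ge0 u; have := sqr_ge0 v; nra.
Qed.

(** The form in which membership in X is used from here on: the real part of an absolutely
    convergent inverse Fourier integral. Two of the three moments pay for two derivatives, the third
    for the continuity of the second derivatives. *)
Definition nice (eta : 'rV[R]_n -> R) := exists f1 f2, [/\ decay 3 f1, decay 3 f2 &
  forall x, eta x = trig f1 0 x + trig f2 (pi / 2) x].

Lemma trigZ (c : R) f th x : intg mu setT f -> trig (fun xi => c * f xi) th x = c * trig f th x.
Proof.
move=> fi; rewrite /trig -(RintegralZl c measurableT (trig_intg th x fi)).
by apply: eq_Rintegral => xi _; rewrite mulrA.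
Qed.

Lemma decayZ m (c : R) f : decay m f -> decay m (fun xi => c * f xi).
Proof.
move=> [mf fi]; split; first exact: measurable_funM.
by under eq_fun do rewrite mulrCA; exact: intgZ.
Qed.

Lemma in_X_nice (s : nat) (eta : 'rV[R]_n -> R) : (n.+2 <= s.*2)%N -> continuous eta ->
  in_X (s%:R + 5 / 2) eta -> nice eta.
Proof.
move=> ns ceta [_ etas [_ [F [HF wF]]]].
have [l1 l2 _] := HF.
have d1' : decay 3 F.1.
  by apply: (omega_decay ns l1 l2 wF l1) => xi; rewrite lerDl sqr_ge0.
have d2' : decay 3 F.2.
  by apply: (omega_decay ns l1 l2 wF l2) => xi; rewrite lerDr sqr_ge0.
have [c Hc] := fourier_inversion ceta etas HF (decay_intg d1') (decay_intg d2').
exists (fun xi => c * F.1 xi), (fun xi => c * F.2 xi); split; [exact: decayZ|exact: decayZ|].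
move=> x; rewrite Hc mulrDr (trigZ c 0 x (decay_intg d1')).
by rewrite (trigZ c (pi / 2) x (decay_intg d2')).
Qed.

Lemma trigD2_der f1 f2 (a b : R) x i : decay 2 f1 -> decay 2 f2 ->
  derivable (fun x => trig f1 a x + trig f2 b x) x (ee i) /\
  'D_(ee i) (fun x => trig f1 a x + trig f2 b x) x =
  trig (fun xi => f1 xi * (2 * pi * xi 0 i)) (a + pi / 2) x +
  trig (fun xi => f2 xi * (2 * pi * xi 0 i)) (b + pi / 2) x.
Proof.
move=> h1 h2; have [e1 E1] := trig_der a x i h1; have [e2 E2] := trig_der b x i h2.
split; first exact: (derivableD e1 e2).
by rewrite -E1 -E2; exact: (deriveD e1 e2).
Qed.

Record C2 (eta : 'rV[R]_n -> R) : Prop := MkC2 {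
  C2_cont : continuous eta;
  C2_der : forall x i, derivable eta x (ee i);
  C2_dcont : forall i, continuous (fun x => 'D_(ee i) eta x);
  C2_bound : exists2 M, 0 < M & forall x i, `|'D_(ee i) eta x| <= M;
  C2_der2 : forall x i j, derivable (fun y => 'D_(ee i) eta y) x (ee j);
  C2_d2cont : forall i j, continuous (fun x => 'D_(ee j) (fun y => 'D_(ee i) eta y) x);
  C2_sym : forall x i j, 'D_(ee j) (fun y => 'D_(ee i) eta y) x =
                         'D_(ee i) (fun y => 'D_(ee j) eta y) x }.

Lemma nice_C2 eta : nice eta -> C2 eta.
Proof.
move=> [f1 [f2 [d1_ d2_ E]]].
have {E}-> : eta = fun x => trig f1 0 x + trig f2 (pi / 2) x by exact/funext.
have D1 := decay_le (isT : (2 <= 3)%N) d1_; have D2 := decay_le (isT : (2 <= 3)%N) d2_.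
have D1' := decay_le (isT : (1 <= 3)%N) d1_; have D2' := decay_le (isT : (1 <= 3)%N) d2_.
pose g1 i xi := f1 xi * (2 * pi * xi 0 i); pose g2 i xi := f2 xi * (2 * pi * xi 0 i).
have G1 i : decay 2 (g1 i) by exact: decay_mul.
have G2 i : decay 2 (g2 i) by exact: decay_mul.
have G1' i := decay_le (isT : (1 <= 2)%N) (G1 i).
have G2' i := decay_le (isT : (1 <= 2)%N) (G2 i).
have DE i : (fun x => 'D_(ee i) (fun x => trig f1 0 x + trig f2 (pi / 2) x) x) =
    fun x => trig (g1 i) (0 + pi / 2) x + trig (g2 i) (pi / 2 + pi / 2) x.
  by apply/funext => x; exact: (trigD2_der 0 (pi / 2) x i D1 D2).2.
have DDE i j : (fun x => 'D_(ee j) (fun x => 'D_(ee i) (fun x =>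
  trig f1 0 x + trig f2 (pi / 2) x) x) x) =
    fun x => trig (fun xi => g1 i xi * (2 * pi * xi 0 j)) (0 + pi / 2 + pi / 2) x +
      trig (fun xi => g2 i xi * (2 * pi * xi 0 j)) (pi / 2 + pi / 2 + pi / 2) x.
  by apply/funext => x; rewrite DE; exact: (trigD2_der _ _ x j (G1 i) (G2 i)).2.
split.
- by apply: contD; apply: trig_cont.
- by move=> x i; exact: (trigD2_der 0 (pi / 2) x i D1 D2).1.
- by move=> i; rewrite DE; apply: contD; apply: trig_cont; [exact: G1'|exact: G2'].
- pose M i := \int[mu]_xi `|g1 i xi| + \int[mu]_xi `|g2 i xi|.
  have M0 i : 0 <= M i by rewrite addr_ge0// Rintegral_ge0.
  exists (1 + \sum_i M i); first by rewrite ltr_pwDl// sumr_ge0.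
  move=> x i; rewrite (congr1 (fun h => h x) (DE i)).
  apply: ler_wpDl => //; apply: le_trans (ler_normD _ _) _.
  rewrite (bigD1 i)//=; apply: ler_wpDr; first exact: sumr_ge0.
  by rewrite lerD//; apply: trig_bound; [exact: decay_intg (G1 i)|exact: decay_intg (G2 i)].
- by move=> x i j; rewrite DE; exact: (trigD2_der _ _ x j (G1 i) (G2 i)).1.
- move=> i j; rewrite DDE; apply: contD; apply: trig_cont; apply: decay_mul.
    exact: G1.
  exact: G2.
- move=> x i j; apply: (etrans (congr1 (fun h => h x) (DDE i j))).
  apply: (etrans _ (esym (congr1 (fun h => h x) (DDE j i)))) => /=.
  have S1 : (fun xi => g1 i xi * (2 * pi * xi 0 j)) = (fun xi => g1 j xi * (2 * pi * xi 0 i)).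
    by apply/funext => xi; rewrite /g1 mulrAC.
  have S2 : (fun xi => g2 i xi * (2 * pi * xi 0 j)) = (fun xi => g2 j xi * (2 * pi * xi 0 i)).
    by apply/funext => xi; rewrite /g2 mulrAC.
  rewrite S1 S2; exact: erefl.
Qed.

(** Truncation in frequency makes all moments finite, hence the transform smooth, while the
    transform changes by at most the L^1 norm of the discarded part, uniformly in x. *)
Definition lowpass (k : nat) f xi := f xi * \1_(cube n k%:R) xi.

Lemma lowpass_decay k m f : intg mu setT f -> decay m (lowpass k f).
Proof.
move=> fi; have mf := intg_meas fi.
have mc : measurable (cube n k%:R : set 'rV[R]_n) by exact: measurable_cube.
have ml : measurable_fun setT (lowpass k f).
  by apply: measurable_funM => //; exact: measurable_indic.
split=> //.
have [C C0 bC] := cont_compact_bounded (@compact_cube R n k%:R) (@wgt_cont R n).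
apply: (le_intg _ _ _ (intgZ (C ^+ m) measurableT (intg_abs measurableT fi))) => //.
  by apply: measurable_funM => //; apply: measurable_funX; exact: wgt_meas.
move=> xi _; rewrite /lowpass indicE.
case: (boolP (xi \in _)) => [/set_mem /bC h|_]; last first.
  by rewrite !mulr0 normr0 mulr_ge0// exprn_ge0// ltW.
rewrite mulr1 normrM ler_wpM2r// normrX lerXn2r ?nnegrE// ltW//.
Qed.

Lemma lowpass_cvg f : intg mu setT f ->
  (fun k => \int[mu]_xi `|lowpass k f xi - f xi|) @ \oo --> (0 : R).
Proof.
move=> fi; have mf := intg_meas fi.
have -> : (0 : R) = \int[mu]_xi (0 * f xi) by rewrite (RintegralZl _ measurableT fi) mul0r.
apply: (@Rdct _ _ _ _ setT _ _ (fun xi => `|f xi|) measurableT).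
- move=> k; apply: measurableT_comp => //; apply: measurable_funB => //.
  by case: (lowpass_decay k 0 fi).
- exact: intg_abs.
- move=> k xi _; rewrite normr_id /lowpass indicE; case: (xi \in _).
    by rewrite mulr1 subrr normr0.
  by rewrite mulr0 sub0r normrN.
- move=> xi _; rewrite mul0r; apply: cvg_trans (@cvg_cst _ (0 : R) _ \oo _).
  apply: near_eq_cvg; near=> k; rewrite /lowpass indicE mem_set ?mulr1 ?subrr ?normr0// => i.
  apply: (le_trans (coord_wgt xi i)); near: k; exact: nbhs_infty_ger.
Unshelve. all: by end_near. Qed.

Lemma trig_lowpass k f th x : intg mu setT f ->
  `|trig (lowpass k f) th x - trig f th x| <= \int[mu]_xi `|lowpass k f xi - f xi|.
Proof.
move=> fi; have li := decay_intg (lowpass_decay k 0 fi).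
rewrite /trig -(RintegralB measurableT (trig_intg th x li) (trig_intg th x fi)).
apply: ler_norm_Rint => //.
- by apply: intgB => //; exact: trig_intg.
- by apply: intg_abs => //; exact: intgB.
by move=> xi _; rewrite -mulrBl normrM ler_piMr// cos_max.
Qed.

(** Frequency truncation commutes with multiplication by 2 pi xi_i, so one truncated density
    approximates both [eta] and its gradient uniformly. *)
Lemma nice_approx eta : nice eta -> forall e : R, 0 < e -> exists h : 'rV[R]_n -> R,
  [/\ smooth h, forall x, `|h x - eta x| <= e &
     forall x i, `|'D_(ee i) h x - 'D_(ee i) eta x| <= e].
Proof.
move=> [f1 [f2 [d1_ d2_ E]]] e e0.
have {E}-> : eta = fun x => trig f1 0 x + trig f2 (pi / 2) x by exact/funext.
have D1 := decay_le (isT : (2 <= 3)%N) d1_; have D2 := decay_le (isT : (2 <= 3)%N) d2_.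
have i1 := decay_intg d1_; have i2 := decay_intg d2_.
pose g1 i xi := f1 xi * (2 * pi * xi 0 i); pose g2 i xi := f2 xi * (2 * pi * xi 0 i).
have G1 i : intg mu setT (g1 i) by apply: decay_intg (decay_mul i D1).
have G2 i : intg mu setT (g2 i) by apply: decay_intg (decay_mul i D2).
have e2 : 0 < e / 2 by rewrite divr_gt0.
have ev f : intg mu setT f -> \forall k \near \oo, \int[mu]_xi `|lowpass k f xi - f xi| < e / 2.
  move=> /lowpass_cvg /cvgrPdist_lt /(_ _ e2); apply: filterS => k.
  by rewrite sub0r normrN ger0_norm// Rintegral_ge0.
have [k [K1 K2 K3]] : exists k, [/\ \int[mu]_xi `|lowpass k f1 xi - f1 xi| < e / 2,
    \int[mu]_xi `|lowpass k f2 xi - f2 xi| < e / 2 &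
    forall i, \int[mu]_xi `|lowpass k (g1 i) xi - g1 i xi| < e / 2 /\
              \int[mu]_xi `|lowpass k (g2 i) xi - g2 i xi| < e / 2].
  have H3 : \forall k \near \oo, forall i, \int[mu]_xi `|lowpass k (g1 i) xi - g1 i xi| < e / 2 /\
              \int[mu]_xi `|lowpass k (g2 i) xi - g2 i xi| < e / 2.
    apply: filter_forall => i; have h1 := ev _ (G1 i); have h2 := ev _ (G2 i).
    by near=> k; split; near: k.
  have h1 := ev _ i1; have h2 := ev _ i2.
  near \oo => k; exists k; split; near: k; [exact: h1|exact: h2|exact: H3].
have L1 := lowpass_decay k 2 i1; have L2' := lowpass_decay k 2 i2.
exists (fun x => trig (lowpass k f1) 0 x + trig (lowpass k f2) (pi / 2) x); split.
- by apply: smoothD; apply: trig_smooth => m; exact: lowpass_decay.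
- move=> x; rewrite opprD addrACA; apply: le_trans (ler_normD _ _) _.
  have := trig_lowpass k 0 x i1; have := trig_lowpass k (pi / 2) x i2; lra.
- move=> x i; rewrite (trigD2_der 0 (pi / 2) x i L1 L2').2 (trigD2_der 0 (pi / 2) x i D1 D2).2.
  have -> : (fun xi => lowpass k f1 xi * (2 * pi * xi 0 i)) = lowpass k (g1 i).
    by apply/funext => xi; rewrite /lowpass /g1 mulrAC.
  have -> : (fun xi => lowpass k f2 xi * (2 * pi * xi 0 i)) = lowpass k (g2 i).
    by apply/funext => xi; rewrite /lowpass /g2 mulrAC.
  rewrite opprD addrACA; apply: le_trans (ler_normD _ _) _.
  have := trig_lowpass k (0 + pi / 2) x (G1 i).
  have := trig_lowpass k (pi / 2 + pi / 2) x (G2 i).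
  have [] := K3 i; rewrite /g1 /g2; lra.
Unshelve. all: by end_near. Qed.

(** From cos t = 1 - 2 sin(t/2)^2: the sine equals cos c times t/2 for some c with |c| <= 1/2, and
    cos c >= 1/2 there. *)
Lemma cos_le_quad (t : R) : `|t| <= 1 -> cos t <= 1 - t ^+ 2 / 8.
Proof.
move=> t1; have [c ct E] := mvt_dist 0 (t / 2) (@is_derive_sin R).
rewrite sin0 !subr0 in E ct.
have c2 : `|c| <= 2^-1.
  by apply: le_trans ct _; rewrite normrM [X in _ * X]ger0_norm ?invr_ge0//; lra.
have cc : 2^-1 <= cos c.
  have := cos_lip 0 c; rewrite cos0 subr0 => /le_trans/(_ c2).
  by rewrite ler_distl => /andP[]; lra.
have -> : cos t = cos (t / 2) ^+ 2 *+ 2 - 1.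
  by rewrite -cos_mulr2n; congr cos; rewrite -mulr_natr; field.
have := sin2cos2 (t / 2); rewrite E => E'.
have : 2^-1 ^+ 2 <= cos c ^+ 2 by rewrite lerXn2r ?nnegrE ?invr_ge0//; apply: le_trans cc.
have t0 := sqr_ge0 t; set q := cos c ^+ 2 => Hq.
have : (cos c * (t / 2)) ^+ 2 = q * t ^+ 2 / 4 by rewrite /q; field.
by move=> E2; rewrite E2 in E'; nra.
Qed.

(** Bernoulli's inequality in reciprocal form: it bounds (1 - y)^m by 1 / (1 + m y). *)
Lemma pow_le_inv (y : R) m : 0 <= y <= 1 -> (1 - y) ^+ m * (1 + m%:R * y) <= 1.
Proof.
move=> /andP[y0 y1]; elim: m => [|m IH]; first by rewrite expr0 mul0r addr0 mulr1.
apply: le_trans IH; rewrite exprSr -mulrA; apply: ler_wpM2l.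
  by rewrite exprn_ge0// subr_ge0.
rewrite -natr1; have m0 : 0 <= m%:R :> R by [].
have : 0 <= m%:R * y ^+ 2 by rewrite mulr_ge0// sqr_ge0.
by have := sqr_ge0 y; nra.
Qed.

Lemma trig_avg f th x i (a : R) : intg mu setT f ->
  trig f th (x + a *: ee i) + trig f th (x - a *: ee i) =
  2 * trig (fun xi => f xi * cos (2 * pi * a * xi 0 i)) th x.
Proof.
move=> fi; rewrite /trig -(RintegralD measurableT (trig_intg th _ fi) (trig_intg th _ fi)).
have ci : intg mu setT (fun xi => f xi * cos (2 * pi * a * xi 0 i)).
  under eq_fun do rewrite mulrC; apply: (intgMb (C := 1)) => //; last first.
    by move=> ? _; exact: cos_max.
  apply: (@measurableT_comp _ _ _ _ _ _ (@cos R)).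
    by apply: continuous_measurable_fun; exact: continuous_cos.
  by apply: measurable_funM => //; exact: coord_meas.
rewrite -(RintegralZl 2 measurableT (trig_intg th x ci)).
apply: eq_Rintegral => xi _; rewrite dotDr dotBr dotZr dot_delta.
rewrite (_ : 2 * pi * (dot xi x + a * xi 0 i) + th = 2 * pi * dot xi x + th + 2 * pi * a * xi 0 i);
  last by ring.
rewrite (_ : 2 * pi * (dot xi x - a * xi 0 i) + th = 2 * pi * dot xi x + th - 2 * pi * a * xi 0 i);
  last by ring.
by rewrite cosD cosB; ring.
Qed.

Lemma der0_line (eta : 'rV[R]_n -> R) i : (forall x, derivable eta x (ee i)) ->
  (forall x, 'D_(ee i) eta x = 0) -> forall x (t : R), eta (x + t *: ee i) = eta x.
Proof.
move=> de D0 x t.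
have D (u : R) : is_derive u 1 (fun t : R => eta (x + t *: ee i)) 0.
  apply: DeriveDef; first by apply/derivable_line; exact: de.
  by rewrite derive_line D0.
have [c _] := mvt_dist 0 t D.
by rewrite mul0r scale0r addr0 => /eqP; rewrite subr_eq0 => /eqP.
Qed.

(* Averaging over translates along e_i multiplies the transform by
   cos(2 pi xi_i / N) ^ (N^3), which tends to 0 off the hyperplane xi_i = 0. *)
Lemma nice_der0 eta i : nice eta -> (forall x, 'D_(ee i) eta x = 0) -> forall x, eta x = 0.
Proof.
move=> ne D0 x; have CE := nice_C2 ne.
have line := der0_line (fun x => @C2_der _ CE x i) D0.
case: ne => f1 [f2 [d1_ d2_ E]].
have i1 := decay_intg d1_; have i2 := decay_intg d2_.
have mc (a : R) : measurable_fun setT (fun xi : 'rV[R]_n => cos (2 * pi * a * xi 0 i)).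
  apply: (@measurableT_comp _ _ _ _ _ _ (@cos R)).
    by apply: continuous_measurable_fun; exact: continuous_cos.
  by apply: measurable_funM => //; exact: coord_meas.
have ic (a : R) m f : intg mu setT f ->
    intg mu setT (fun xi => f xi * cos (2 * pi * a * xi 0 i) ^+ m).
  move=> fi; under eq_fun do rewrite mulrC; apply: (intgMb (C := 1)) => //.
    exact: measurable_funX.
  by move=> xi _; rewrite normrX exprn_ile1// cos_max.
have step (a : R) m y : eta y =
    trig (fun xi => f1 xi * cos (2 * pi * a * xi 0 i) ^+ m) 0 y +
    trig (fun xi => f2 xi * cos (2 * pi * a * xi 0 i) ^+ m) (pi / 2) y.
  elim: m y => [|m IH] y.
    rewrite E; congr (trig _ _ y + trig _ _ y); apply/funext => xi;
    by rewrite expr0 mulr1.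
  have := trig_avg 0 y i a (ic a m f1 i1); have := trig_avg (pi / 2) y i a (ic a m f2 i2).
  have -> : (fun xi => f1 xi * cos (2 * pi * a * xi 0 i) ^+ m * cos (2 * pi * a * xi 0 i)) =
    (fun xi => f1 xi * cos (2 * pi * a * xi 0 i) ^+ m.+1).
    by apply/funext => xi; rewrite exprSr mulrA.
  have -> : (fun xi => f2 xi * cos (2 * pi * a * xi 0 i) ^+ m * cos (2 * pi * a * xi 0 i)) =
    (fun xi => f2 xi * cos (2 * pi * a * xi 0 i) ^+ m.+1).
    by apply/funext => xi; rewrite exprSr mulrA.
  have H1 := IH (y + a *: ee i); have H2 := IH (y - a *: ee i).
  have L1 := line y a; have L2' := line y (- a); rewrite scaleNr in L2'.
  move: H1 H2; rewrite L1 L2'; lra.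
pose Z := [set xi : 'rV[R]_n | xi 0 i = 0].
have mZ : measurable Z.
  rewrite (_ : Z = setT `&` (fun xi : 'rV[R]_n => xi 0 i) @^-1` [set 0]); last first.
    by apply/seteqP; split=> xi /=; [move=> ?; split|case].
  by apply: coord_meas.
have lim f th : intg mu setT f ->
    (fun N : nat => trig (fun xi => f xi * cos (2 * pi * N.+1%:R^-1 * xi 0 i) ^+ (N.+1 ^ 3)) th x)
    @ \oo --> (0 : R).
  move=> fi.
  have -> : (0 : R) = \int[mu]_xi (f xi * \1_Z xi * cos (2 * pi * dot xi x + th)).
    rewrite (@ae_Rint _ _ R mu setT _ (fun=> 0))//.
    - by rewrite Rintegral_cst// mul0r.
    - apply: measurable_funM; last exact: cosarg_meas.
      by apply: measurable_funM; [exact: (intg_meas fi)|exact: measurable_indic].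
    - exists Z; split=> //; first exact: leb_hyperplane.
      move=> xi /=; apply: contra_notP => nZ _.
      by rewrite indicE memNset// mulr0 mul0r.
  apply: (@Rdct _ _ _ _ setT _ _ (fun xi => `|f xi|) measurableT).
  - move=> N; apply: measurable_funM; last exact: cosarg_meas.
    by apply: measurable_funM; [exact: (intg_meas fi)|exact: measurable_funX].
  - exact: intg_abs.
  - move=> N xi _; rewrite !normrM -mulrA ler_piMr// mulr_ile1// ?cos_max//.
    by rewrite normrX exprn_ile1// cos_max.
  - move=> xi _; apply: cvgM; last exact: cvg_cst.
    apply: cvgM; first exact: cvg_cst.
    have [z|nz] := pselect (Z xi).
      rewrite indicE mem_set//; apply: cvg_trans (@cvg_cst _ (1 : R) _ \oo _).
      by apply: near_eq_cvg; apply: nearW => N; rewrite z mulr0 cos0 expr1n.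
    rewrite indicE memNset//; apply/norm_cvg0P.
    pose q := (2 * pi * xi 0 i) ^+ 2 / 8.
    have q0 : 0 < q.
      rewrite divr_gt0// lt_neqAle sqr_ge0 andbT eq_sym sqrf_eq0 mulf_neq0//.
        by rewrite mulf_neq0// gt_eqF// pi_gt0.
      exact/eqP.
    apply: (@squeeze_cvgr _ _ _ _ (fun=> 0) (fun N : nat => q^-1 * N.+1%:R^-1)).
    + near=> N.
      have N0 : 0 < N.+1%:R :> R by rewrite ltr0n.
      have tN : `|2 * pi * xi 0 i| <= N.+1%:R.
        apply: (@le_trans _ _ N%:R); last by rewrite ler_nat.
        by near: N; exact: nbhs_infty_ger.
      rewrite normr_ge0/= normrX.
      set t := 2 * pi * N.+1%:R^-1 * xi 0 i.
      have t1 : `|t| <= 1.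
        rewrite /t mulrAC normrM [X in _ * X]ger0_norm ?invr_ge0 ?(ltW N0)//.
        by rewrite ler_pdivrMr// mul1r.
      have tq : t ^+ 2 / 8 = q * N.+1%:R^-1 ^+ 2 by rewrite /t /q; ring.
      have y01 : 0 <= t ^+ 2 / 8 <= 1.
        rewrite divr_ge0 ?sqr_ge0//= -(real_normK (num_real t)).
        have t2 : `|t| ^+ 2 <= 1 by apply: exprn_ile1.
        by lra.
      have cn : 0 <= cos t.
        have := cos_lip 0 t; rewrite cos0 subr0 => /le_trans/(_ t1).
        by rewrite ler_distl => /andP[]; lra.
      have ct : `|cos t| <= 1 - t ^+ 2 / 8 by rewrite ger0_norm//; exact: cos_le_quad.
      (* Writing N for [N.+1]: here y = q / N^2, so N^3 factors give the bound 1 / (1 + q N). A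
         number of factors of order N^2 would not make the power tend to 0. *)
      have := pow_le_inv (N.+1 ^ 3) y01.
      have le1 : `|cos t| ^+ (N.+1 ^ 3) <= (1 - t ^+ 2 / 8) ^+ (N.+1 ^ 3).
        by rewrite lerXn2r ?nnegrE// subr_ge0; case/andP: y01.
      have c0 : 0 <= `|cos t| ^+ (N.+1 ^ 3) by rewrite exprn_ge0.
      rewrite tq natrX (_ : N.+1%:R ^+ 3 * (q * N.+1%:R^-1 ^+ 2) = q * N.+1%:R); last first.
        by field; rewrite gt_eqF.
      have qN : 0 < q * N.+1%:R by exact: mulr_gt0.
      rewrite -tq => H; rewrite -invfM -[leRHS]mul1r ler_pdivlMr//.
      apply: le_trans H; apply: ler_pM => //; first exact: ltW.
      by rewrite lerDr.
    + exact: cvg_cst.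
    + rewrite -[X in _ --> X](mulr0 q^-1).
      by apply: cvgM; [exact: cvg_cst|exact: cvg_harmonic].
have c1 := lim f1 0 i1; have c2 := lim f2 (pi / 2) i2.
have c : (fun N : nat =>
    trig (fun xi => f1 xi * cos (2 * pi * N.+1%:R^-1 * xi 0 i) ^+ (N.+1 ^ 3)) 0 x +
    trig (fun xi => f2 xi * cos (2 * pi * N.+1%:R^-1 * xi 0 i) ^+ (N.+1 ^ 3)) (pi / 2) x)
    @ \oo --> (0 : R).
  by rewrite -[X in _ --> X](addr0 0); exact: cvgD c1 c2.
apply: (cvg_unique (@Rhausdorff R) _ c).
apply: cvg_trans (@cvg_cst _ (eta x) _ \oo _); apply: near_eq_cvg; apply: nearW => N.
exact: step.
Unshelve. all: by end_near. Qed.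

End regularity.

(** * Traces and the divergence theorem *)

Section slices.
Context {R : realType} {d : nat}.
Local Notation lam := (@lebesgue_measure R).
Notation ee i := (delta_mx 0 i : 'rV[R]_ _).
Implicit Types (A Om : set 'rV[R]_d.+1) (zeta top : 'rV[R]_d -> R).

Lemma hpart_pt (y : 'rV[R]_d) t : hpart (pt y t) = y.
Proof. by apply/rowP => j; rewrite mxE pt_lift. Qed.

Lemma vpart_pt (y : 'rV[R]_d) t : vpart (pt y t) = t.
Proof. exact: pt_ord_max. Qed.

Lemma hpart_cont : continuous (fun x : 'rV[R]_d.+1 => hpart x).
Proof.
apply: cont_to_rV => j; rewrite (_ : (fun x => _) = fun x : 'rV[R]_d.+1 => x 0 (lift ord_max j)).
  exact: cont_coord.
by apply/funext => x; rewrite mxE.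
Qed.

Lemma vpart_cont : continuous (fun x : 'rV[R]_d.+1 => vpart x).
Proof. exact: cont_coord. Qed.

Lemma hpart_meas : measurable_fun setT (fun x : 'rV[R]_d.+1 => hpart x).
Proof.
by apply: measurable_to_rV => j; under eq_fun do rewrite mxE; exact: coord_meas.
Qed.

Lemma vpart_meas : measurable_fun setT (fun x : 'rV[R]_d.+1 => vpart x).
Proof. exact: coord_meas. Qed.

Lemma ptop_meas top : measurable_fun setT top ->
  measurable_fun setT (fun x : 'rV[R]_d.+1 => pt (hpart x) (top (hpart x))).
Proof.
move=> mt; apply: measurable_to_rV; apply: ptP => [|j].
  under eq_fun do rewrite pt_ord_max.
  by apply: (measurableT_comp mt); exact: hpart_meas.
by under eq_fun do rewrite pt_lift mxE; exact: coord_meas.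
Qed.

Lemma slice_meas A (y : 'rV[R]_d) : measurable A -> measurable [set t | A (pt y t)].
Proof. by move=> mA; rewrite -[X in measurable X]setTI; exact: measurable_pt_slice. Qed.

Lemma int_slices A (g : 'rV[R]_d.+1 -> \bar R) : measurable A -> measurable_fun A g ->
  (forall x, A x -> 0 <= g x)%E ->
  (\int[leb d.+1]_(x in A) g x =
   \int[leb d]_y \int[lam]_(t in [set t | A (pt y t)]) g (pt y t))%E.
Proof.
move=> mA mg g0; rewrite integral_mkcond tonelli.
- apply: eq_integral => y _; rewrite [RHS]integral_mkcond; apply: eq_integral => t _.
  rewrite !patchE; have -> : (t \in [set t | A (pt y t)]) = (pt y t \in A).
    by apply/idP/idP => /set_mem h; apply/mem_set.
  exact: erefl.
- exact: ((measurable_restrictT _ mA).1 mg).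
- exact: erestrict_ge0.
Qed.

Lemma int_slices_meas A (g : 'rV[R]_d.+1 -> \bar R) : measurable A -> measurable_fun A g ->
  (forall x, A x -> 0 <= g x)%E ->
  measurable_fun setT (fun y => (\int[lam]_(t in [set t | A (pt y t)]) g (pt y t))%E).
Proof.
move=> mA mg g0.
rewrite (_ : (fun y => _) = fun y => (\int[lam]_t ((g \_ A) (pt y t)))%E).
  apply: measurable_int_slice; first exact: ((measurable_restrictT _ mA).1 mg).
  exact: erestrict_ge0.
apply/funext => y; rewrite integral_mkcond; apply: eq_integral => t _.
rewrite !patchE; have -> : (t \in [set t | A (pt y t)]) = (pt y t \in A).
  by apply/idP/idP => /set_mem h; apply/mem_set.
exact: erefl.
Qed.

Lemma slice_ineq (F : R -> R) (x c : R) : (forall t, derivable F t 1) ->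
  continuous (fun t => 'D_1 F t) ->
  (F x - F c) ^+ 2 <=
  `|x - c| * \int[lam]_(t in `]Num.min x c, Num.max x c[) ('D_1 F t) ^+ 2.
Proof.
wlog cx : x c / c <= x.
  move=> H dF cF; case/orP: (le_total c x) => [cx|xc].
    by apply: H; [exact: cx|exact: dF|exact: cF].
  by rewrite -sqrrN opprB distrC minC maxC; apply: H; [exact: xc|exact: dF|exact: cF].
move=> dF cF; rewrite min_r// max_l// ger0_norm ?subr_ge0//.
rewrite -(ftc cx dF cF).
have m : measurable (`[c, x] : set R) by [].
have mF D : measurable_fun D (fun t => 'D_1 F t).
  by apply: measurable_funTS; apply: continuous_measurable_fun; exact: cF.
have c2 : continuous (fun t => 'D_1 F t ^+ 2).
  by under eq_fun do rewrite expr2; apply: contM; exact: cF.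
have l1 : @L2 _ (measurableTypeR R) R lam `[c, x] (fun=> 1).
  split; first exact: measurable_cst.
  by apply: intg_itv_cont; exact: cont_cst.
have l2 : @L2 _ (measurableTypeR R) R lam `[c, x] (fun t => 'D_1 F t).
  by split; [exact: mF|exact: intg_itv_cont].
have := @CS' _ (measurableTypeR R) R lam _ m _ _ l1 l2; under eq_Rintegral do rewrite mul1r.
move=> H; rewrite -(real_normK (num_real (\int[lam]_(t in _) _))).
apply: (@le_trans _ _ ((@N2 _ (measurableTypeR R) R lam `[c,
  x] (fun=> 1) * @N2 _ (measurableTypeR R) R lam `[c, x] (fun t => 'D_1 F t)) ^+ 2)).
  by rewrite lerXn2r ?nnegrE// mulr_ge0// N2_ge0.
rewrite exprMn !N2_sq; under eq_Rintegral do rewrite expr1n.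
have io (D : set (measurableTypeR R)) : measurable D -> D `<=` `[c, x] ->
  intg lam D (fun t => 'D_1 F t ^+ 2).
  by move=> mD Dc; exact: (@integrableS _ (measurableTypeR R) R lam _ _ _ m mD Dc (intg_itv_cont _
    _ c2)).
rewrite Rintegral_cst//= lebesgue_measure_itv/= lte_fin mul1r.
rewrite -Rintegral_itv_bndo_bndc; last by apply: io => // t /=;
  rewrite !in_itv/= => /andP[-> /ltW ->].
rewrite -Rintegral_itv_obnd_cbnd; last by apply: io => // t /=;
  rewrite !in_itv/= => /andP[/ltW -> /ltW ->].
by move: cx; rewrite le_eqVlt => /predU1P[->|cx]; rewrite ?ltxx ?subrr ?mul0r// cx.
Qed.

(* The one-dimensional estimate behind the trace: fundamental theorem of calculus
   and Cauchy-Schwarz along the vertical line through a boundary point. *)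
Lemma slice_sq (S : set (measurableTypeR R)) (F G : R -> R) (c h : R) : measurable S ->
  continuous F -> continuous G -> (forall t, 0 <= G t) -> (forall t, (F t - F c) ^+ 2 <=
     `|t - c| * \int[lam]_(u in `]Num.min t c, Num.max t c[) G u) -> 0 <= h ->
  (forall t, S t -> `|t - c| <= h /\ [set` `]Num.min t c, Num.max t c[] `<=` S) ->
  (\int[lam]_(t in S) ((F t - F c) ^+ 2)%:E <=
   h%:E * \int[lam]_(t in S) (G t)%:E * lam S)%E.
Proof.
move=> mS cF c2 G0 Hs h0 HS.
rewrite -[X in (_ <= X)%E]integral_cst//.
apply: (@ge0_le_integral _ (measurableTypeR R) R lam S mS).
- by move=> t _; rewrite lee_fin sqr_ge0.
- apply: measurable_funTS; apply/measurable_EFinP; apply: measurable_funX.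
  apply: measurable_funB; last exact: measurable_cst.
  exact: continuous_measurable_fun cF.
- exact: measurable_cst.
move=> t St; have [th tS] := HS t St.
have m4 : measurable ([set` `]Num.min t c, Num.max t c[] : set (measurableTypeR R)) by [].
have m5 : measurable ([set` `[Num.min t c, Num.max t c]] : set (measurableTypeR R)) by [].
have i4 : @intg _ (measurableTypeR R) R lam `]Num.min t c, Num.max t c[ G.
  refine (@integrableS _ (measurableTypeR R) R lam _ _ _ m5 m4 _ (intg_itv_cont _ _ c2)).
  by move=> u /=; rewrite !in_itv/= => /andP[/ltW -> /ltW ->].
apply: (@le_trans _ _ ((`|t - c|)%:E *
    (\int[lam]_(t in `]Num.min t c, Num.max t c[) (G t)%:E))%E).
  by rewrite (EFin_Rint m4 i4) -EFinM lee_fin; exact: Hs.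
apply: lee_pmul.
- by rewrite lee_fin normr_ge0.
- by apply: integral_ge0 => u _; rewrite lee_fin.
- by rewrite lee_fin.
apply: ge0_subset_integral => //.
  by apply: measurable_funTS; apply/measurable_EFinP; exact: continuous_measurable_fun c2.
by move=> u _; rewrite lee_fin.
Qed.

Lemma sqint_add (A : set 'rV[R]_d.+1) (f g : 'rV[R]_d.+1 -> R) :
  measurable A -> measurable_fun A f -> measurable_fun A g ->
  (sqint A (fun x => f x + g x)%R <= 2%:E * (sqint A f + sqint A g))%E.
Proof.
move=> mA mf mg; rewrite /sqint.
have m1 : measurable_fun A (fun x => (f x ^+ 2)%:E).
  by apply/measurable_EFinP; exact: measurable_funX.
have m2 : measurable_fun A (fun x => (g x ^+ 2)%:E).
  by apply/measurable_EFinP; exact: measurable_funX.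
rewrite -ge0_integralD//; try by move=> x _; rewrite lee_fin sqr_ge0.
rewrite -ge0_integralZl//; last 2 first.
- exact: emeasurable_funD.
- by move=> x _; rewrite adde_ge0// lee_fin sqr_ge0.
apply: ge0_le_integral => //.
- by move=> x _; rewrite lee_fin sqr_ge0.
- by apply/measurable_EFinP; apply: measurable_funX; exact: measurable_funD.
- by apply: emeasurable_funM => //; exact: emeasurable_funD.
move=> x _; rewrite -EFinD -EFinM lee_fin.
by have := sqr_ge0 (f x - g x); nra.
Qed.

Lemma sqint_subset (A B : set 'rV[R]_d.+1) (f : 'rV[R]_d.+1 -> R) : measurable A -> measurable B ->
  A `<=` B -> measurable_fun B f -> (sqint A f <= sqint B f)%E.
Proof.
move=> mA mB AB mf; apply: ge0_subset_integral => //.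
  by apply/measurable_EFinP; exact: measurable_funX.
by move=> x _; rewrite lee_fin sqr_ge0.
Qed.

Definition cyl (rho : R) : set 'rV[R]_d.+1 := [set x | sqnorm (hpart x) < rho ^+ 2].

Lemma ball_meas (rho : R) : measurable [set y : 'rV[R]_d | sqnorm y < rho ^+ 2].
Proof.
apply: open_measurable_rV.
apply: (@open_comp _ _ (fun y : 'rV[R]_d => sqnorm y) [set t | t < rho ^+ 2]); last exact: open_lt.
by move=> y _; exact: sqnorm_cont.
Qed.

Lemma cyl_meas rho : measurable (cyl rho).
Proof.
have := hpart_meas measurableT (ball_meas rho); rewrite setTI; exact.
Qed.

Lemma Omega_meas zeta : measurable_fun setT zeta -> measurable (Omega zeta).
Proof.
move=> mz; rewrite (_ : Omega zeta = [set x | 0 < vpart x] `&` [set x | vpart x < zeta (hpart x)]);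
  last first.
  by apply/seteqP; split=> x /=; [move=> /andP[]|move=> [h1 h2]; apply/andP].
apply: measurableI.
  have := measurable_fun_ltr (measurable_cst (0 : R)) vpart_meas => /(_ measurableT [set true] I).
  by rewrite setTI; congr measurable; apply/seteqP; split => x.
have mzh : measurable_fun setT (fun x : 'rV[R]_d.+1 => zeta (hpart x)).
  by apply: (measurableT_comp mz); exact: hpart_meas.
have := measurable_fun_ltr vpart_meas mzh => /(_ measurableT [set true] I).
by rewrite setTI; congr measurable; apply/seteqP; split => x.
Qed.

Section layer.
Variables (zeta top : 'rV[R]_d -> R) (rho h : R).
Hypotheses (mz : measurable_fun setT zeta) (mt : measurable_fun setT top).
Hypotheses (top01 : forall y, 0 <= top y <= zeta y) (h0 : 0 < h).
Let Om := Omega zeta.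

(** Distances to the graph of [top] are measured vertically, so that vertical slices are intervals
    of length at most 2h; [top] will be 0 or [zeta]. *)
Definition layer : set 'rV[R]_d.+1 :=
  Omega zeta `&` cyl rho `&` [set x | `|vpart x - top (hpart x)| < h].

Lemma layer_meas : measurable layer.
Proof.
apply: measurableI; first by apply: measurableI; [exact: Omega_meas|exact: cyl_meas].
have mth : measurable_fun setT (fun x : 'rV[R]_d.+1 => `|vpart x - top (hpart x)|).
  apply: measurableT_comp => //; apply: measurable_funB; first exact: vpart_meas.
  by apply: (measurableT_comp mt); exact: hpart_meas.
have := measurable_fun_ltr mth (measurable_cst h) => /(_ measurableT [set true] I).
by rewrite setTI; congr measurable; apply/seteqP; split => x.
Qed.

Lemma layer_slice y : [set t | layer (pt y t)] `<=` `]top y - h, top y + h[.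
Proof.
move=> t [_ /=]; rewrite hpart_pt vpart_pt in_itv/= ltr_distl; exact.
Qed.

Lemma layer_slice_measure y : (lam [set t | layer (pt y t)] <= (2 * h)%:E)%E.
Proof.
apply: (@le_trans _ _ (lam `]top y - h, top y + h[)).
  apply: le_measure; rewrite ?inE//; last exact: layer_slice.
  by apply: slice_meas; exact: layer_meas.
rewrite lebesgue_measure_itv/= lte_fin; case: ifP => _; last first.
  by rewrite lee_fin mulr_ge0// ltW.
by rewrite -EFinB lee_fin le_eqVlt; apply/orP; left; apply/eqP; ring.
Qed.

Lemma layer_hpart (g : 'rV[R]_d -> R) : measurable_fun setT g -> (forall y, 0 <= g y) ->
  (\int[leb d.+1]_(x in layer) (g (hpart x))%:E <=
   (2 * h)%:E * \int[leb d]_(y in [set y | (sqnorm y < rho ^+ 2)%R]) (g y)%:E)%E.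
Proof.
move=> mg g0.
rewrite int_slices//; last 3 first.
- exact: layer_meas.
- apply: measurable_funTS; apply/measurable_EFinP; apply: (measurableT_comp mg); exact: hpart_meas.
- by move=> x _; rewrite lee_fin.
have mB := ball_meas rho.
have mgB : measurable_fun [set y : 'rV[R]_d | sqnorm y < rho ^+ 2] (fun y => (g y)%:E).
  by apply: measurable_funTS; exact/measurable_EFinP.
rewrite [X in (_ <= _ * X)%E]integral_mkcond -ge0_integralZl//; last 3 first.
- exact: ((measurable_restrictT _ mB).1 mgB).
- by move=> y _; apply: erestrict_ge0 => z _; rewrite lee_fin.
- by rewrite lee_fin mulr_ge0// ltW.
apply: ge0_le_integral => //.
- by move=> y _; apply: integral_ge0 => t _; rewrite lee_fin.
- apply: (@int_slices_meas layer (fun x => (g (hpart x))%:E)).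
  + exact: layer_meas.
  + apply: measurable_funTS; apply/measurable_EFinP; apply: (measurableT_comp mg);
    exact: hpart_meas.
  + by move=> x _; rewrite lee_fin.
- apply: emeasurable_funM => //.
  exact: ((measurable_restrictT _ mB).1 mgB).
move=> y _; rewrite patchE; case: (boolP (y \in _)) => [/set_mem yB|/negP nyB].
  under eq_integral do rewrite hpart_pt.
  rewrite integral_cst; last by apply: slice_meas; exact: layer_meas.
  rewrite muleC; apply: lee_wpmul2r; first by rewrite lee_fin.
  exact: layer_slice_measure.
rewrite mule0 (_ : [set t | layer (pt y t)] = set0) ?integral_set0//.
apply/seteqP; split=> // t [[_ yB] _]; apply: nyB; apply/mem_set.
by move: yB; rewrite /cyl/= hpart_pt.
Qed.

(** [slice_sq] on each vertical slice, with distance to the boundary point at most h and length at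
    most 2h. The bounds on [top] keep the segment between a point of the layer and the boundary
    point inside the layer. *)
Lemma layer_smooth (w : 'rV[R]_d.+1 -> R) : smooth w ->
  (sqint layer (fun x => w x - w (pt (hpart x) (top (hpart x))))%R <=
   (2 * h ^+ 2)%:E * sqint layer (fun x => 'D_(ee ord_max) w x))%E.
Proof.
move=> sw; have cw := smooth_cont sw; have mw := continuous_measurable_rV cw.
have cdw := smooth_cont (smooth_der ord_max sw); have mdw := continuous_measurable_rV cdw.
have mL := layer_meas.
have m1 : measurable_fun layer (fun x => ((w x - w (pt (hpart x) (top (hpart x)))) ^+ 2)%:E).
  apply: measurable_funTS; apply/measurable_EFinP; apply: measurable_funX.
  apply: measurable_funB => //; apply: (measurableT_comp mw); exact: ptop_meas.
have m2 : measurable_fun layer (fun x => ('D_(ee ord_max) w x ^+ 2)%:E).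
  by apply: measurable_funTS; apply/measurable_EFinP; exact: measurable_funX.
have p1 (x : 'rV[R]_d.+1) : layer x -> (0 <= ((w x - w (pt (hpart x) (top (hpart x)))) ^+ 2)%:E)%E.
  by rewrite lee_fin sqr_ge0.
have p2 (x : 'rV[R]_d.+1) : layer x -> (0 <= ('D_(ee ord_max) w x ^+ 2)%:E)%E.
  by rewrite lee_fin sqr_ge0.
rewrite /sqint (int_slices mL m1 p1) (int_slices mL m2 p2).
rewrite -ge0_integralZl//; last 3 first.
- exact: (int_slices_meas mL m2 p2).
- by move=> y _; apply: integral_ge0 => t _; rewrite lee_fin sqr_ge0.
- by rewrite lee_fin mulr_ge0// sqr_ge0.
apply: ge0_le_integral => //.
- by move=> y _; apply: integral_ge0 => t _; rewrite lee_fin sqr_ge0.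
- exact: (int_slices_meas mL m1 p1).
- by apply: emeasurable_funM => //; exact: (int_slices_meas mL m2 p2).
move=> y _.
have mS : measurable [set t | layer (pt y t)] by exact: slice_meas.
pose F t := w (pt y t).
have FE : F = fun t => w (pt y 0 + t *: ee ord_max) by apply/funext => t; rewrite /F pt_line.
have dF t : derivable F t 1.
  by rewrite FE; apply/derivable_line; exact: smooth_drv.
have DF t : 'D_1 F t = 'D_(ee ord_max) w (pt y t) by rewrite FE derive_line -pt_line.
have cDF : continuous (fun t => 'D_1 F t).
  rewrite (funext DF); apply: (@cont_comp _ _ _ (fun t => pt y t) (fun x =>
    'D_(ee ord_max) w x)) => //.
  exact: continuous_pt_r.
set S := [set t | layer (pt y t)].
have cF : continuous F.
  by apply: (@cont_comp _ _ _ (fun t => pt y t) w); [exact: continuous_pt_r|exact: cw].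
set I := (\int[lam]_(t in S) ('D_(ee ord_max) w (pt y t) ^+ 2)%:E)%E.
have IE : I = (\int[lam]_(t in S) ('D_1 F t ^+ 2)%:E)%E.
  by apply: eq_integral => t _; rewrite DF.
have I0 : (0 <= I)%E by apply: integral_ge0 => t _; rewrite lee_fin sqr_ge0.
have -> : (\int[lam]_(t in S) ((w (pt y t) - w (pt (hpart (pt y t)) (top (hpart (pt y t))))) ^+
  2)%:E
   = \int[lam]_(t in S) ((F t - F (top y)) ^+ 2)%:E)%E.
  by apply: eq_integral => t _; rewrite /F hpart_pt.
apply: (@le_trans _ _ (h%:E * I * lam S)%E).
  have c2 : continuous (fun t => 'D_1 F t ^+ 2).
    by under eq_fun do rewrite expr2; apply: contM; exact: cDF.
  have Hs t := @slice_ineq F t (top y) dF cDF.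
  have G0 t : 0 <= 'D_1 F t ^+ 2 by exact: sqr_ge0.
  rewrite IE; apply: (slice_sq mS cF c2 G0 Hs (ltW h0)); clear -top01.
  move=> t [[/= /andP[t0 tz] tr] th].
  rewrite /= !hpart_pt !vpart_pt in t0 tz th; split; first exact: ltW.
  have /andP[T0 T1] := top01 y.
  move=> u /=; rewrite in_itv/= => /andP[u1 u2]; split; first split.
  - rewrite /Omega/= hpart_pt vpart_pt; apply/andP; split.
      by apply: le_lt_trans u1; rewrite le_min (ltW t0).
    by apply: lt_le_trans u2 _; rewrite ge_max (ltW tz).
  - by move: tr; rewrite /cyl/= !hpart_pt.
  - rewrite /= hpart_pt vpart_pt; apply: le_lt_trans th.
    move: u1 u2; rewrite lt_max gt_min.
    case: (leP t (top y)) => tt u1 u2.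
      have a1 : u < top y by case/orP: u2 => // u2; lra.
      have a2 : t < u by case/orP: u1 => // u1; lra.
      by rewrite ltr0_norm ?subr_lt0// ler0_norm ?subr_le0//; lra.
    have a1 : u < t by case/orP: u2 => // u2; lra.
    have a2 : top y < u by case/orP: u1 => // u1; lra.
    by rewrite !gtr0_norm ?subr_gt0//; lra.
have -> : ((2 * h ^+ 2)%:E * I = (h%:E * I) * (2 * h)%:E)%E.
  by rewrite muleAC -EFinM; congr (_%:E * _)%E; ring.
apply: lee_wpmul2l; last exact: layer_slice_measure.
apply: mule_ge0; last exact: I0.
by rewrite lee_fin; exact: ltW h0.
Qed.

(** Through this estimate the trace hypotheses act. The approximants supplied by [has_trace] satisfy
    [layer_smooth], and they are close to u in the layer and to t on the boundary. The factor h^2 in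
    front of the vertical derivative will compensate the factor 1/h produced by the gradient of a
    plateau. *)
Lemma trace_layer (u : 'rV[R]_d.+1 -> R) (t : 'rV[R]_d -> R) : 0 < rho ->
  measurable_fun (Omega zeta) u -> has_trace (Omega zeta) top u t ->
  (sqint layer (fun x => u x - t (hpart x))%R <=
   (16 * h ^+ 2)%:E * sqint layer (wD (Omega zeta) [:: ord_max] u))%E.
Proof.
move=> r0 mu_ [mtt [w [sw /(_ _ r0) /= [c1 c2 c3]]]].
have mL := layer_meas; have mO := Omega_meas mz; have mC := cyl_meas rho.
set D := Omega zeta `&` cyl rho; have mD : measurable D by exact: measurableI.
have LD : layer `<=` D by move=> x [].
have LO : layer `<=` Omega zeta by move=> x [[]].
have DO : D `<=` Omega zeta by move=> x [].
set Y := sqint layer (wD _ _ u); set X := sqint _ _.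
have mdu : measurable_fun (Omega zeta) (wD (Omega zeta) [:: ord_max] u) by exact: wD_meas.
have Y0 : (0 <= Y)%E by apply: integral_ge0 => x _; rewrite lee_fin sqr_ge0.
have mth : measurable_fun setT (fun x : 'rV[R]_d.+1 => t (hpart x)).
  by apply: (measurableT_comp mtt); exact: hpart_meas.
apply/lee_addgt0Pr => e e0.
(* [C] collects the coefficients of the approximation error [e'] in the chain of inequalities (a +
   b)^2 <= 2 a^2 + 2 b^2 below; the same chain turns 2 h^2 into 16 h^2. *)
pose C := 2 + 16 * h ^+ 2 + 8 * h.
have C0 : 0 < C by rewrite /C !addr_gt0 ?mulr_gt0 ?exprn_gt0.
pose e' := e / C; have e'0 : 0 < e' by rewrite divr_gt0.
have sm (f : nat -> \bar R) : f @ \oo --> 0%E -> \forall k \near \oo, (f k < e'%:E)%E.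
  move=> cf; apply: (cf [set x | (x < e'%:E)%E]); apply: open_nbhs_nbhs; split.
    exact: open_ereal_lt_ereal.
  by rewrite /= lte_fin.
have [k [k1 k2 k3]] : exists k, [/\ (sqint D (fun x => w k x - u x)%R <= e'%:E)%E,
   (sqint D (fun x => pD [:: ord_max] (w k) x - wD (Omega zeta) [:: ord_max] u x)%R <= e'%:E)%E &
   (sqint [set y | (sqnorm y < rho ^+ 2)%R] (fun y => w k (pt y (top y)) - t y)%R <= e'%:E)%E].
  have h1 := sm _ c1; have h2 := sm _ (c2 ord_max); have h3 := sm _ c3.
  near \oo => k; exists k; split; apply: ltW; near: k; [exact: h1|exact: h2|exact: h3].
have cw := smooth_cont (sw k); have mw := continuous_measurable_rV cw.
have cdw := smooth_cont (smooth_der ord_max (sw k)); have mdw := continuous_measurable_rV cdw.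
have mwt : measurable_fun setT (fun x : 'rV[R]_d.+1 => w k (pt (hpart x) (top (hpart x)))).
  by apply: (measurableT_comp mw); exact: ptop_meas.
have mLu : measurable_fun layer u by exact: measurable_funS mu_.
have mDu : measurable_fun D u by exact: measurable_funS mu_.
have mLw : measurable_fun layer (w k) by exact: measurable_funTS.
have mLd : measurable_fun layer (wD (Omega zeta) [:: ord_max] u) by exact: measurable_funS mdu.
have mDd : measurable_fun D (wD (Omega zeta) [:: ord_max] u) by exact: measurable_funS mdu.
have mLdw : measurable_fun layer (fun x => 'D_(ee ord_max) (w k) x) by exact: measurable_funTS.
have mLwt : measurable_fun layer (fun x =>
  w k (pt (hpart x) (top (hpart x)))) by exact: measurable_funTS.
have mLt : measurable_fun layer (fun x => t (hpart x)) by exact: measurable_funTS.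
have b1 : (sqint layer (fun x => u x - w k x)%R <= e'%:E)%E.
  rewrite (_ : sqint _ _ = sqint layer (fun x => w k x - u x)%R); last first.
    by apply: eq_integral => x _; rewrite -sqrrN opprB.
  apply: le_trans k1; apply: sqint_subset => //.
  by apply: measurable_funB => //; exact: measurable_funTS.
have b3 : (sqint layer (fun x => w k (pt (hpart x) (top (hpart x))) - t (hpart x))%R <= (2 * h)%:E
  * e'%:E)%E.
  have mg : measurable_fun setT (fun y => (w k (pt y (top y)) - t y) ^+ 2).
    apply: measurable_funX; apply: measurable_funB => //.
    apply: (measurableT_comp mw); apply: measurable_to_rV; apply: ptP => [|j].
      by under eq_fun do rewrite pt_ord_max.
    by under eq_fun do rewrite pt_lift; exact: coord_meas.
  apply: le_trans (layer_hpart mg (fun y => sqr_ge0 _)) _.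
  by apply: lee_wpmul2l => //; rewrite lee_fin mulr_ge0// ltW.
have b2' : (sqint layer (fun x => 'D_(ee ord_max) (w k) x) <= 2%:E * (e'%:E + Y))%E.
  rewrite (_ : sqint _ _ = sqint layer (fun x => ('D_(ee ord_max) (w k) x -
     wD (Omega zeta) [:: ord_max] u x) + wD (Omega zeta) [:: ord_max] u x)%R); last first.
    by apply: eq_integral => x _; rewrite subrK.
  apply: le_trans (sqint_add _ _ _) _ => //; first exact: measurable_funB.
  apply: lee_wpmul2l => //; apply: leeD => //; apply: le_trans k2.
  apply: sqint_subset => //.
  by apply: measurable_funB => //; exact: measurable_funTS.
have b2 : (sqint layer (fun x => w k x - w k (pt (hpart x) (top (hpart x))))%R <=
    (2 * h ^+ 2)%:E * (2%:E * (e'%:E + Y)))%E.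
  apply: le_trans (layer_smooth (sw k)) _; apply: lee_wpmul2l => //.
  by rewrite lee_fin mulr_ge0// sqr_ge0.
have s1 : (X <= 2%:E * (sqint layer (fun x => u x - w k x)%R +
    sqint layer (fun x => w k x - t (hpart x))%R))%E.
  rewrite /X (_ : sqint _ _ = sqint layer (fun x => (u x - w k x) + (w k x - t (hpart x)))%R);
    last first.
    by apply: eq_integral => x _; rewrite addrA subrK.
  by apply: sqint_add => //; exact: measurable_funB.
have s2 : (sqint layer (fun x => w k x - t (hpart x))%R <= 2%:E *
    (sqint layer (fun x => w k x - w k (pt (hpart x) (top (hpart x))))%R +
     sqint layer (fun x => w k (pt (hpart x) (top (hpart x))) - t (hpart x))%R))%E.
  rewrite (_ : sqint layer (fun x => w k x - t (hpart x))%R = sqint layer (fun x =>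
    (w k x - w k (pt (hpart x) (top (hpart x)))) + (w k (pt (hpart x) (top (hpart x))) - t (hpart
    x)))%R); last first.
    by apply: eq_integral => x _; rewrite addrA subrK.
  by apply: sqint_add => //; exact: measurable_funB.
have : (X <= 2%:E * (e'%:E + 2%:E * ((2 * h ^+ 2)%:E * (2%:E * (e'%:E + Y)) + (2 * h)%:E *
  e'%:E)))%E.
  apply: le_trans s1 _; apply: lee_wpmul2l => //; apply: leeD => //.
  apply: le_trans s2 _; apply: lee_wpmul2l => //; exact: leeD.
case: (Y) Y0 => [Y'| |]//= Y0.
  move=> /le_trans; apply.
  have -> : (2%:E * (e'%:E + 2%:E * ((2 * h ^+ 2)%:E * (2%:E * (e'%:E + Y'%:E)) + (2 * h)%:E *
    e'%:E)))%E
    = (2 * (e' + 2 * ((2 * h ^+ 2) * (2 * (e' + Y')) + (2 * h) * e')))%:E by [].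
  have -> : ((16 * h ^+ 2)%:E * Y'%:E + e%:E)%E = ((16 * h ^+ 2) * Y' + e)%:E by [].
  rewrite lee_fin; rewrite lee_fin in Y0.
  have ee' : e = e' * C by rewrite /e' divfK// gt_eqF.
  rewrite ee' /C le_eqVlt; apply/orP; left; apply/eqP; ring.
move=> _; rewrite gt0_muley ?leey// lte_fin mulr_gt0// exprn_gt0//.
Unshelve. all: by end_near. Qed.

End layer.
End slices.

(** * Bounded pieces of the domain and quantities vanishing at the boundary *)

Section domain.
Context {R : realType} {d : nat}.
Local Notation lam := (@lebesgue_measure R).
Local Notation mu := (leb d.+1).
Notation ee i := (delta_mx 0 i : 'rV[R]_ _).
Implicit Types (A : set 'rV[R]_d.+1).

Lemma open_Omega (zeta : 'rV[R]_d -> R) : continuous zeta -> open (Omega zeta).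
Proof.
move=> cz; rewrite (_ : Omega zeta = [set x | 0 < vpart x] `&` [set x | 0 < zeta (hpart x) - vpart
  x]); last first.
  by apply/seteqP; split=> x; rewrite /Omega/= subr_gt0; [move=> /andP[]|move=> [-> ->]].
apply: openI.
  apply: (@open_comp _ _ (fun x : 'rV[R]_d.+1 => vpart x) [set t | 0 < t]); last exact: open_gt.
  by move=> x _; exact: vpart_cont.
apply: (@open_comp _ _ (fun x : 'rV[R]_d.+1 => zeta (hpart x) - vpart x) [set t | 0 < t]);
  last exact: open_gt.
move=> x _; apply: (@contB _ _ (fun x : 'rV[R]_d.+1 => zeta (hpart x)) (fun x : 'rV[R]_d.+1 =>
  vpart x)).
  by apply: (@cont_comp _ _ _ (fun x : 'rV[R]_d.+1 => hpart x) zeta); [exact: hpart_cont|exact: cz].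
exact: vpart_cont.
Qed.

Lemma Rint_indic A D (f : 'rV[R]_d.+1 -> R) : measurable A -> measurable D -> A `<=` D ->
  \int[mu]_(x in A) f x = \int[mu]_(x in D) (\1_A x * f x).
Proof.
move=> mA mD AD; rewrite Rintegral_mkcond [RHS]Rintegral_mkcond; congr fine.
apply: eq_integral => x _; congr (_%:E); rewrite !patchE indicE.
case: (boolP (x \in A)) => [xA|_]; last by case: ifP; rewrite ?mul0r.
by rewrite (mem_set (AD _ (set_mem xA))) mul1r.
Qed.

Lemma sqint_N2 A (f : 'rV[R]_d.+1 -> R) : measurable A -> L2 mu A f ->
  sqint A f = (N2 mu A f ^+ 2)%:E.
Proof.
by move=> mA [mf fi]; rewrite N2_sq // /sqint (EFin_Rint mA fi).
Qed.

Lemma sqint_L2 A (f : 'rV[R]_d.+1 -> R) : measurable A -> measurable_fun A f ->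
  (sqint A f < +oo)%E -> L2 mu A f.
Proof. by move=> mA mf h; apply/in_L2P. Qed.

Section zeta.
Variables (zeta : 'rV[R]_d -> R) (M : R).
Hypotheses (cz : continuous zeta) (zM : forall y, 0 < zeta y <= M).
Let Om := Omega zeta.

Let mz : measurable_fun setT zeta. Proof. exact: continuous_measurable_rV. Qed.
Let mO : measurable Om. Proof. exact: Omega_meas. Qed.

Definition Dr (rho : R) : set 'rV[R]_d.+1 := Omega zeta `&` cyl rho.

Lemma Dr_meas rho : measurable (Dr rho).
Proof. by apply: measurableI => //; exact: cyl_meas. Qed.
Hint Resolve Dr_meas : core.

Lemma Dr_Om rho : Dr rho `<=` Om. Proof. by move=> x []. Qed.

Lemma Dr_cube rho : 0 < rho -> Dr rho `<=` cube d.+1 (rho + M).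
Proof.
move=> r0 x [/andP[x0 xz] xr] i.
have /andP[z0 z1] := zM (hpart x).
move: i; apply: ptP => [|j].
  by rewrite gtr0_norm//; move: x0 xz; rewrite /vpart; lra.
have : x 0 (lift ord_max j) ^+ 2 < rho ^+ 2.
  by have := coord_sqnorm (hpart x) j; rewrite mxE => /le_lt_trans; apply.
rewrite -real_normK ?num_real// ltr_pXn2r ?nnegrE// ?(ltW r0)//; lra.
Qed.

Lemma Dr_fin rho : 0 < rho -> (mu (Dr rho) < +oo)%E.
Proof.
move=> r0; apply: le_lt_trans (leb_cube_lty d.+1 (rho + M)).
apply: le_measure; rewrite ?inE//; last exact: Dr_cube.
exact: measurable_cube.
Qed.

Lemma Dr_bounded_L2 rho (f : 'rV[R]_d.+1 -> R) C : 0 < rho -> measurable_fun (Dr rho) f ->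
  (forall x, Dr rho x -> `|f x| <= C) -> L2 mu (Dr rho) f.
Proof.
move=> r0 mf fC; split => //; apply: (@intg_bounded_fin _ _ _ _ _ _ (C ^+ 2)) => //.
- exact: Dr_fin.
- exact: measurable_funX.
by move=> x Dx; rewrite normrX lerXn2r ?nnegrE ?normr_ge0 ?fC//; exact: le_trans (fC _ Dx).
Qed.

Lemma Dr_cont_L2 rho (f : 'rV[R]_d.+1 -> R) : 0 < rho -> continuous f -> L2 mu (Dr rho) f.
Proof.
move=> r0 cf; have [C C0 fC] := cont_compact_bounded (@compact_cube R d.+1 (rho + M)) cf.
apply: (@Dr_bounded_L2 _ _ C) => //.
  by apply: measurable_funTS; exact: continuous_measurable_rV.
by move=> x Dx; apply: fC; exact: Dr_cube Dx.
Qed.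

(** Width 3 / K with K = k+1: the derivative of a plateau lives where the rescaled height lies
    between 1 and 2, and the smooth substitute for [zeta] is off by at most 1 / (2 K). *)
Definition lay top rho (k : nat) := layer zeta top rho (3 * k.+1%:R^-1).

(* Membership in L^1 with a layer average of order o(1): the form in which a
   boundary value zero on x_n = top x' enters the divergence theorem. *)
Definition vanish (top : 'rV[R]_d -> R) (f : 'rV[R]_d.+1 -> R) := forall rho, 0 < rho ->
  intg mu (Dr rho) f /\
  (fun k => k.+1%:R * \int[mu]_(x in lay top rho k) `|f x|) @ \oo --> (0 : R).

Section top.
Variable top : 'rV[R]_d -> R.
Hypotheses (ct : continuous top) (top01 : forall y, 0 <= top y <= zeta y).
Hypothesis ntop : forall x, Om x -> vpart x != top (hpart x).

Let mt : measurable_fun setT top. Proof. exact: continuous_measurable_rV. Qed.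

Lemma lay_meas rho k : measurable (lay top rho k).
Proof. exact: layer_meas. Qed.

Lemma lay_Dr rho k : lay top rho k `<=` Dr rho. Proof. by move=> x []. Qed.

(** Heights and [top] both lie between 0 and M, so a sufficiently thick layer is the whole bounded
    piece, and layer estimates become global ones. *)
Lemma layer_full rho : layer zeta top rho (M + M) = Dr rho.
Proof.
apply/seteqP; split=> [x []//|x Dx]; split => //=.
have /andP[z0 z1] := zM (hpart x); have /andP[t0 t1] := top01 (hpart x).
case: Dx => /andP[x0 xz] _; rewrite ltr_distl; apply/andP; split; lra.
Qed.

(** The layers shrink to the empty set, because the domain contains no point of the graph of
    [top]. *)
Lemma lay_cvg0 rho (f : 'rV[R]_d.+1 -> R) : intg mu (Dr rho) f ->
  (fun k => \int[mu]_(x in lay top rho k) f x) @ \oo --> (0 : R).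
Proof.
move=> fi.
have E : (fun k => \int[mu]_(x in lay top rho k) f x) =
   (fun k => \int[mu]_(x in Dr rho) (\1_(lay top rho k) x * f x)).
  apply/funext => k; apply: Rint_indic; [exact: lay_meas|exact: Dr_meas|exact: lay_Dr].
rewrite E.
have -> : (0 : R) = \int[mu]_(x in Dr rho) 0 by rewrite Rintegral_cst ?mul0r.
have mf := intg_meas fi.
apply: (@Rdct _ _ _ _ (Dr rho) _ _ (fun x => `|f x|)) => //.
- by move=> k; apply: measurable_funM => //; apply: measurable_funTS;
  exact: measurable_indic (lay_meas _ _).
- exact: intg_abs.
- by move=> k x _; rewrite normrM indicE; case: (_ \in _); rewrite ?normr1 ?mul1r// normr0 mul0r.
move=> x [Ox _]; apply: (@cvg_near_cst _ _ _ _ _ _ _).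
have dx : 0 < `|vpart x - top (hpart x)| by rewrite normr_gt0 subr_eq0; exact: ntop.
have c3 : (fun k : nat => 3 * k.+1%:R^-1) @ \oo --> (0 : R).
  by rewrite -[X in _ --> X](mulr0 3); apply: cvgM; [exact: cvg_cst|exact: cvg_harmonic].
have := cvgr_lt _ c3 _ dx => H; near=> k;
  have hk : 3 * k.+1%:R^-1 < `|vpart x - top (hpart x)| by near: k; exact: H.
rewrite indicE memNset ?mul0r// => -[_ /=]; apply/negP; rewrite -leNgt; exact: ltW.
Unshelve. all: by end_near. Qed.

Lemma lay_N2_0 rho (f : 'rV[R]_d.+1 -> R) : L2 mu (Dr rho) f ->
  (fun k => N2 mu (lay top rho k) f) @ \oo --> (0 : R).
Proof.
move=> [_ fi]; have h := @lay_cvg0 rho (fun x => f x ^+ 2) fi.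
have := cvg_comp _ _ h (@sqrt_continuous R 0); rewrite sqrtr0; exact.
Qed.

(** The smooth approximants are bounded on the bounded piece, and at some index they differ from u
    and its weak gradient by square integrable functions. For u - t, [trace_layer] is applied to the
    layer that fills the piece. *)
Lemma has_trace_L2 (u : 'rV[R]_d.+1 -> R) (t : 'rV[R]_d -> R) rho : 0 < rho ->
  measurable_fun Om u -> has_trace Om top u t ->
  [/\ L2 mu (Dr rho) u, forall j, L2 mu (Dr rho) (wD Om [:: j] u) &
      L2 mu (Dr rho) (fun x => u x - t (hpart x))].
Proof.
move=> r0 mu_ tr; have [mtt [w [sw /(_ _ r0) /= [c1 c2 c3]]]] := tr.
have mD := Dr_meas rho.
have L2lim (W : nat -> 'rV[R]_d.+1 -> R) (f : 'rV[R]_d.+1 -> R) : (forall k, continuous (W k)) ->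
  measurable_fun (Dr rho) f ->
    (fun k => sqint (Dr rho) (fun x => W k x - f x)%R) @ \oo --> 0%E -> L2 mu (Dr rho) f.
  move=> cW mf cf.
  have [k hk] : exists k, (sqint (Dr rho) (fun x => W k x - f x)%R < 1%:E)%E.
    have h : \forall k \near \oo, (sqint (Dr rho) (fun x => W k x - f x)%R < 1%:E)%E.
      apply: (cf [set x | (x < 1%:E)%E]); apply: open_nbhs_nbhs; split;
        first exact: open_ereal_lt_ereal.
      by rewrite /= lte_fin.
    by near \oo => k; exists k; near: k; exact: h.
  have lW : L2 mu (Dr rho) (W k) by exact: Dr_cont_L2.
  have lB : L2 mu (Dr rho) (fun x => W k x - f x).
    apply: sqint_L2 => //; last by apply: lt_trans hk _; rewrite ltry.
    by apply: measurable_funB => //; case: lW.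
  have -> : f = (fun x => W k x - (W k x - f x)) by apply/funext => x; rewrite subKr.
  exact: L2B.
have lu : L2 mu (Dr rho) u.
  apply: (L2lim w) => //; first by move=> k; exact: smooth_cont.
  by apply: measurable_funS mu_ => //; exact: Dr_Om.
have lw j : L2 mu (Dr rho) (wD Om [:: j] u).
  apply: (L2lim (fun k => pD [:: j] (w k))) => //; first by move=> k;
    exact: (smooth_cont (smooth_der j (sw k))).
    have mw : measurable_fun Om (wD Om [:: j] u) by exact: wD_meas.
    by apply: measurable_funS mw => //; exact: Dr_Om.
  exact: c2.
split => //.
have mut : measurable_fun (Dr rho) (fun x => u x - t (hpart x)).
  apply: measurable_funB; first by case: lu.
  by apply: measurable_funTS; apply: (measurableT_comp mtt); exact: hpart_meas.
apply: sqint_L2 => //.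
have M0 : 0 < M + M by have /andP[] := zM 0; lra.
have := trace_layer mz mt top01 M0 r0 mu_ tr; rewrite layer_full => /le_lt_trans; apply.
rewrite (sqint_N2 mD (lw _)) -EFinM; exact: ltry.
Unshelve. all: by end_near. Qed.

(** By [trace_layer] the L^2 norm of u - t on the layer is O(1/k) times that of the vertical
    derivative. Cauchy-Schwarz with g cancels the factor k, and the two remaining norms tend to 0
    with the layer. *)
Lemma vanish_mul (u : 'rV[R]_d.+1 -> R) (t : 'rV[R]_d -> R) (g : 'rV[R]_d.+1 ->
  R) : measurable_fun Om u -> has_trace Om top u t ->
  (forall rho, 0 < rho -> L2 mu (Dr rho) g) ->
  vanish top (fun x => (u x - t (hpart x)) * g x).
Proof.
move=> mu_ tr lg rho r0; have [lu lw lut] := has_trace_L2 r0 mu_ tr.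
have lgr := lg _ r0; have mD := Dr_meas rho.
have ml k := lay_meas rho k.
split; first exact: (L2_intM mD).
have lS f k : L2 mu (Dr rho) f -> L2 mu (lay top rho k) f.
  by move=> lf; apply: (L2S mD (ml k)) lf; exact: lay_Dr.
have b k : k.+1%:R * \int[mu]_(x in lay top rho k) `|(u x - t (hpart x)) * g x| <=
    12 * (N2 mu (lay top rho k) (wD Om [:: ord_max] u) * N2 mu (lay top rho k) g).
  have h0 : 0 < 3 * k.+1%:R^-1 :> R by rewrite mulr_gt0.
  have c1 := CS (ml k) (lS _ k lut) (lS _ k lgr).
  (* 12 is the square root of 16 times the 3 in the width of the layer. *)
  have c2 : N2 mu (lay top rho k) (fun x => u x - t (hpart x)) <=
      12 * k.+1%:R^-1 * N2 mu (lay top rho k) (wD Om [:: ord_max] u).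
    rewrite -(@ler_pXn2r _ 2)// ?nnegrE ?N2_ge0//; last by rewrite !mulr_ge0// N2_ge0.
    have := trace_layer mz mt top01 h0 r0 mu_ tr.
    rewrite (sqint_N2 (ml k) (lS _ k lut)) (sqint_N2 (ml k) (lS _ k (lw _))) -EFinM lee_fin.
    move=> /le_trans; apply; rewrite [leRHS]exprMn le_eqVlt; apply/orP; left; apply/eqP; ring.
  apply: le_trans (ler_wpM2l _ c1) _; first by rewrite ler0n.
  apply: (@le_trans _ _ (k.+1%:R * (12 * k.+1%:R^-1 * N2 mu (lay top rho k) (wD Om [:: ord_max] u)
    * N2 mu (lay top rho k) g))).
    apply: ler_wpM2l; first by rewrite ler0n.
    by apply: ler_wpM2r => //; exact: N2_ge0.
  have k0 : k.+1%:R != 0 :> R by rewrite pnatr_eq0.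
  move: (N2 _ _ _) (N2 _ _ _) => a c; rewrite le_eqVlt; apply/orP; left; apply/eqP.
  by move: k0; move: (k.+1%:R : R) => K K0; field.
have lim : (fun k => 12 * (N2 mu (lay top rho k) (wD Om [:: ord_max] u) * N2 mu (lay top rho k) g))
  @ \oo --> (0 : R).
  have -> : (0 : R) = 12 * (0 * 0) by rewrite mul0r mulr0.
  apply: cvgM; first exact: cvg_cst.
  by apply: cvgM; [exact: lay_N2_0 (lw _)|exact: lay_N2_0 lgr].
apply: (squeeze_cvgr _ (cvg_cst 0) lim); apply: nearW => k; apply/andP; split; last exact: b.
apply: mulr_ge0; first by rewrite ler0n.
by apply: Rintegral_ge0 => x _; exact: normr_ge0.
Qed.

Lemma vanishD f g : vanish top f -> vanish top g -> vanish top (fun x => f x + g x).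
Proof.
move=> vf vg rho r0; have [fi fc] := vf _ r0; have [gi gc] := vg _ r0.
have mD := Dr_meas rho; split; first exact: intgD.
have lim : (fun k => k.+1%:R * \int[mu]_(x in lay top rho k) `|f x| +
    k.+1%:R * \int[mu]_(x in lay top rho k) `|g x|) @ \oo --> (0 : R).
  by rewrite -[X in _ --> X](addr0 0); apply: cvgD; [exact: fc|exact: gc].
apply: (squeeze_cvgr _ (cvg_cst 0) lim); apply: nearW => k; apply/andP; split.
  by apply: mulr_ge0; rewrite ?ler0n//; apply: Rintegral_ge0 => x _; exact: normr_ge0.
have lD := @lay_Dr rho k; have ml := lay_meas rho k.
have sub h : intg mu (Dr rho) h -> intg mu (lay top rho k) (fun x => `|h x|).
  by move=> hi; exact: (intgS mD ml lD (intg_abs mD hi)).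
have fa := sub _ fi; have ga := sub _ gi.
rewrite /= -mulrDr -(RintegralD ml fa ga); apply: ler_wpM2l; first by rewrite ler0n.
apply: (le_Rintegral ml (sub _ (intgD mD fi gi)) (intgD ml fa ga)).
by move=> x _; exact: ler_normD.
Qed.

Lemma vanish0 : vanish top (fun=> 0).
Proof.
move=> rho r0; split; first exact: intg0.
rewrite (_ : (fun k : nat => _) = fun=> 0); first exact: cvg_cst.
apply/funext => k; rewrite Rintegral_cst ?normr0 ?mul0r ?mulr0//; exact: lay_meas.
Qed.

Lemma vanish_sum (I : Type) (s : seq I) (F : I -> 'rV[R]_d.+1 -> R) :
  (forall i, vanish top (F i)) -> vanish top (fun x => \sum_(i <- s) F i x).
Proof.
move=> vF; elim: s => [|a s IH].
  by under eq_fun do rewrite big_nil; exact: vanish0.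
by under eq_fun do rewrite big_cons; apply: vanishD.
Qed.

End top.
End zeta.
End domain.

(** * Plateau test functions *)

Section divergence.
Context {R : realType} {d : nat}.
Local Notation lam := (@lebesgue_measure R).
Local Notation mu := (leb d.+1).
Notation ee i := (delta_mx 0 i : 'rV[R]_ _).

(** The integrand is the derivative of - step((h - t) K), which has reached -1 at t = 0 and is still
    0 at t = z since z is within 1 / (2K) of h. *)
Lemma slice_step (h z K : R) : 0 < z -> 0 < K -> `|h - z| * K <= 2^-1 -> 2 <= h * K ->
  \int[lam]_(t in `]0, z[) (K * d1 step ((h - t) * K)) = 1.
Proof.
move=> z0 K0 hz hK.
pose F (t : R) := - step ((h - t) * K).
have dF (t : R) : is_derive t 1 F (K * d1 step ((h - t) * K)).
  have dl : is_derive t 1 (fun t : R => (h - t) * K) (- K).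
    have -> : - K = (0 - 1) * K + (h - t) * 0 by ring.
    apply: is_derive_eq; rewrite /GRing.scale/=; ring.
  have ds : is_derive ((h - t) * K) 1 (step : R -> R) (d1 step ((h - t) * K)).
    by apply: DeriveDef => //; exact: derivable_step.
  have := @is_derive1_comp _ step (fun t : R => (h - t) * K) t _ _ ds dl.
  move=> H; have -> : K * d1 step ((h - t) * K) = - (d1 step ((h - t) * K) * - K) by ring.
  exact: (@is_deriveN _ _ _ (fun t : R => step ((h - t) * K)) t 1 _ H).
have DF : (fun t => 'D_1 F t) = (fun t => K * d1 step ((h - t) * K)).
  by apply/funext => t; case: (dF t).
have cDF : continuous (fun t : R => K * d1 step ((h - t) * K)).
  apply: contM; first exact: cont_cst.
  apply: (@cont_comp _ _ _ (fun t : R => (h - t) * K) (d1 step)); last exact: continuous_dstep.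
  by apply: contM; [apply: contB; [exact: cont_cst|move=> x; exact: cvg_id]|exact: cont_cst].
have m5 : measurable ([set` `[0, z]] : set (measurableTypeR R)) by [].
have io (D : set (measurableTypeR R)) : measurable D -> D `<=` `[0, z] ->
    @intg _ (measurableTypeR R) R lam D (fun t => K * d1 step ((h - t) * K)).
  move=> mD Dc; exact: (@integrableS _ (measurableTypeR R) R lam _ _ _ m5 mD Dc (intg_itv_cont _ _
    cDF)).
rewrite Rintegral_itv_obnd_cbnd; last first.
  by apply: io => // t /=; rewrite !in_itv/= => /andP[/ltW -> /ltW ->].
rewrite Rintegral_itv_bndo_bndc; last first.
  by apply: io => // t /=; rewrite !in_itv/= => /andP[-> /ltW ->].
have /= := @ftc R F 0 z (ltW z0); rewrite DF => ->; last exact: cDF; last first.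
  by move=> t; case: (dF t).
rewrite /F subr0 opprK (step_ge2 hK) step_le1 ?oppr0 ?add0r//.
by apply: le_trans (ler_wpM2r (ltW K0) (ler_norm _)) _; apply: le_trans hz _; lra.
Qed.

Lemma derive_plateau n (H V X : 'rV[R]_n -> R) (x v : 'rV[R]_n) (K a c e : R) :
  is_derive x v H a -> is_derive x v V c -> is_derive x v X e ->
  is_derive x v (fun x => (step ((H x - V x) * K) + step (V x * K) - 1) * X x)
    ((step ((H x - V x) * K) + step (V x * K) - 1) * e +
     K * (d1 step ((H x - V x) * K) * (a - c) + d1 step (V x * K) * c) * X x).
Proof.
move=> dH dV dX.
have st L l : is_derive x v L l -> is_derive x v (fun x => step (L x)) (d1 step (L x) * l).
  move=> dL; have [h1 h2] := @chain_rule _ _ step L x v (@ex_derive _ _ _ _ _ _ _ dL)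
    (@derivable_step R (L x)).
  by apply: DeriveDef => //; rewrite h2 (@derive_val _ _ _ _ _ _ _ dL).
have sc (L : 'rV[R]_n -> R) (l : R) : is_derive x v L l -> is_derive x v (fun x => L x * K) (K * l).
  move=> dL; have H1 := @is_deriveM _ _ L (cst K) x v _ _ dL (@is_derive_cst _ _ _ K x v).
  by apply: is_derive_eq H1 _; rewrite scaler0 add0r.
have d1' := st _ _ (sc _ _ (@is_deriveB _ _ _ H V x v _ _ dH dV)).
have d2' := st _ _ (sc _ _ dV).
have dP := @is_deriveB _ _ _ _ _ x v _ _ (@is_deriveD _ _ _ _ _ x v _ _ d1' d2') (@is_derive_cst _
  _ _ (1 : R) x v).
apply: is_derive_eq (@is_deriveM _ _ _ X x v _ _ dP dX) _.
rewrite /GRing.scale/= /cst; rewrite !fctE; ring.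
Qed.

Section zeta.
Variables (zeta : 'rV[R]_d -> R) (M zm : R).
Hypotheses (cz : continuous zeta) (zM : forall y, 0 < zeta y <= M).
Hypotheses (zm0 : 0 < zm) (zmz : forall y, zm <= zeta y).
Let Om := Omega zeta.

Let mz : measurable_fun setT zeta. Proof. exact: continuous_measurable_rV. Qed.
Let mO : measurable Om. Proof. exact: Omega_meas. Qed.
Let mDr rho : measurable (Dr zeta rho). Proof. exact: Dr_meas. Qed.

Lemma Om_Dr rho (f : 'rV[R]_d.+1 -> R) : (forall x, Om x -> ~ cyl rho x -> f x = 0) ->
  \int[mu]_(x in Om) f x = \int[mu]_(x in Dr zeta rho) f x.
Proof.
move=> f0; rewrite Rintegral_mkcond [RHS]Rintegral_mkcond; congr fine.
apply: eq_integral => x _; congr (_%:E); rewrite !patchE.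
case: (boolP (x \in Om)) => [/set_mem xO|xO].
  case: (boolP (x \in Dr zeta rho)) => [//|/negP xD]; apply: f0 => // xc.
  by apply: xD; apply/mem_set.
case: ifP => // /set_mem [xO' _]; by rewrite (mem_set xO') in xO.
Qed.

Lemma intg_Om_Dr rho (f : 'rV[R]_d.+1 -> R) : (forall x, Om x -> ~ cyl rho x -> f x = 0) ->
  intg mu (Dr zeta rho) f -> intg mu Om f.
Proof.
move=> f0; apply: intg_supp => //; first exact: Dr_Om.
by move=> x xO nD; apply: f0 => // xc; apply: nD.
Qed.

Lemma cube_cyl (r : R) : exists2 rho, 0 < rho &
  forall y : 'rV[R]_d, rho ^+ 2 <= sqnorm y -> ~ cube d r y.
Proof.
exists (d.+1%:R * (`|r| + 1)); first by rewrite mulr_gt0// ltr_wpDl.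
move=> y hy yc; have : sqnorm y <= d%:R * `|r| ^+ 2.
  rewrite /sqnorm /dot; apply: (@le_trans _ _ (\sum_(i < d) `|r| ^+ 2)).
    apply: ler_sum => i _; rewrite -expr2 -real_normK ?num_real//.
    by rewrite lerXn2r ?nnegrE ?normr_ge0//; apply: le_trans (yc i) (ler_norm _).
  by rewrite sumr_const card_ord mulr_natl.
apply/negP; rewrite -ltNge; apply: lt_le_trans hy; rewrite exprMn -natrX.
apply: (@le_lt_trans _ _ ((d.+1 ^ 2)%:R * `|r| ^+ 2)).
  apply: ler_wpM2r; first exact: sqr_ge0.
  by rewrite ler_nat; apply: (@leq_trans d.+1) => //; rewrite expnS expn1 leq_pmulr.
rewrite ltr_pM2l ?ltr0n ?expn_gt0// ltrXn2r//; have := normr_ge0 r; lra.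
Qed.

Lemma test_cyl (chi : 'rV[R]_d -> R) : test_fun setT chi -> exists2 rho, 0 < rho &
  forall y, rho ^+ 2 <= sqnorm y -> chi y = 0 /\ forall j, 'D_(ee j) chi y = 0.
Proof.
move=> /test_supp[r r0 sr]; have [rho rho0 hr] := cube_cyl r; exists rho => // y /hr ny.
by split; [exact: sr|move=> j; exact: (supported_derive (ee j) sr)].
Qed.

Lemma Dr_cont_intg rho (f : 'rV[R]_d.+1 -> R) : 0 < rho -> continuous f -> intg mu (Dr zeta rho) f.
Proof.
move=> r0 cf; have [C C0 fC] := cont_compact_bounded (@compact_cube R d.+1 (rho + M)) cf.
apply: (@intg_bounded_fin _ _ _ _ _ _ C) => //; first exact: (Dr_fin cz zM).
  by apply: measurable_funTS; exact: continuous_measurable_rV.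
by move=> x Dx; apply: fC; exact: (Dr_cube zM) Dx.
Qed.

Lemma slice_Om y : [set t | Om (pt y t)] = [set` `]0, zeta y[].
Proof.
by apply/seteqP; split=> t; rewrite /Om /Omega/= vpart_pt hpart_pt in_itv.
Qed.

(** The vertical derivative of a plateau near the top integrates to one along every vertical line,
    so it reproduces the integral over R^d exactly, whatever the width of the layer. *)
Lemma Rint_step_top (h g : 'rV[R]_d -> R) (K r : R) : 0 < K -> continuous h ->
  (forall y, `|h y - zeta y| * K <= 2^-1) -> (forall y, 2 <= h y * K) ->
  continuous g -> supported r g ->
  \int[mu]_(x in Om) (K * d1 step ((h (hpart x) - vpart x) * K) * g (hpart x)) =
  \int[leb d]_y g y.
Proof.
move=> K0 ch hz h2 cg sg.
set f := (fun x => _).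
have cf : continuous f.
  have chh : continuous (fun x : 'rV[R]_d.+1 => h (hpart x)).
    by apply: (@cont_comp _ _ _ (fun x : 'rV[R]_d.+1 => hpart x) h); [exact: hpart_cont|exact: ch].
  have cgh : continuous (fun x : 'rV[R]_d.+1 => g (hpart x)).
    by apply: (@cont_comp _ _ _ (fun x : 'rV[R]_d.+1 => hpart x) g); [exact: hpart_cont|exact: cg].
  apply: contM; last exact: cgh.
  apply: contM; first exact: cont_cst.
  apply: (@cont_comp _ _ _ (fun x : 'rV[R]_d.+1 => (h (hpart x) - vpart x) * K) (d1 step));
    last exact: continuous_dstep.
  by apply: contM; [apply: contB; [exact: chh|exact: vpart_cont]|exact: cont_cst].
have [rho rho0 hr] := cube_cyl r.
have fi : intg mu Om f.
  apply: (@intg_Om_Dr rho); last exact: Dr_cont_intg.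
  move=> x xO /negP xc; rewrite /f (_ : g _ = 0) ?mulr0//; apply: sg; apply: hr.
  by move: xc; rewrite -leNgt.
rewrite Rintegral_mkcond; congr fine.
have fi' : intg mu setT (f \_ Om).
  by have := (integrable_mkcond (EFin \o f) mO).1 fi; rewrite restrict_EFin.
rewrite fubini; last exact: fi'.
apply: eq_integral => y _.
rewrite (_ : (\int[lam]_t _)%E = (\int[lam]_(t in `]0%R,
  zeta y[) ((K * d1 step ((h y - t) * K) * g y)%R)%:E)%E); last first.
  rewrite [RHS]integral_mkcond; apply: eq_integral => t _.
  rewrite /= !patchE -slice_Om.
  have -> : (t \in [set t | Om (pt y t)]) = (pt y t \in Om).
    by apply/idP/idP => /set_mem h'; apply/mem_set.
  by case: ifP => // _; rewrite /f hpart_pt vpart_pt.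
have cS : continuous (fun t : R => K * d1 step ((h y - t) * K)).
  apply: contM; first exact: cont_cst.
  apply: (@cont_comp _ _ _ (fun t : R => (h y - t) * K) (d1 step)); last exact: continuous_dstep.
  by apply: contM; [apply: contB; [exact: cont_cst|move=> x; exact: cvg_id]|exact: cont_cst].
have m5 : measurable ([set` `[0, zeta y]] : set (measurableTypeR R)) by [].
have m4 : measurable ([set` `]0, zeta y[] : set (measurableTypeR R)) by [].
have S45 : [set` `]0, zeta y[] `<=` [set` `[0, zeta y]].
  by move=> t /=; rewrite !in_itv/= => /andP[/ltW -> /ltW ->].
have iS : @intg _ (measurableTypeR R) R lam `]0, zeta y[ (fun t => K * d1 step ((h y - t) * K)).
  exact: (@integrableS _ (measurableTypeR R) R lam _ _ _ m5 m4 S45 (intg_itv_cont _ _ cS)).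
have iS' : @intg _ (measurableTypeR R) R lam `]0,
  zeta y[ (fun t => K * d1 step ((h y - t) * K) * g y).
  rewrite (_ : (fun t => _) = fun t => g y * (K * d1 step ((h y - t) * K)));
    last by apply/funext => t; rewrite mulrC.
  exact: (intgZ (g y) m4 iS).
rewrite (EFin_Rint m4 iS'); congr (_%:E).
rewrite (RintegralZr _ m4 iS) slice_step ?mul1r//.
by have /andP[] := zM y.
Qed.

(* div F = G in the sense of distributions. *)
Definition divid (F : 'I_d.+1 -> 'rV[R]_d.+1 -> R) (G : 'rV[R]_d.+1 -> R) :=
  forall phi, test_fun (Omega zeta) phi ->
  \sum_j \int[mu]_(x in Omega zeta) (F j x * 'D_(ee j) phi x) =
  - \int[mu]_(x in Omega zeta) (G x * phi x).

(* A test function equal to chi away from the two boundaries: h is a smooth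
   approximation of zeta, and 1 / K the width of the transition layers. *)
Definition plateau (h chi : 'rV[R]_d -> R) (K : R) (x : 'rV[R]_d.+1) : R :=
  (step ((h (hpart x) - vpart x) * K) + step (vpart x * K) - 1) * chi (hpart x).

Lemma smooth_plateau h chi K : smooth h -> smooth chi -> smooth (plateau h chi K).
Proof.
move=> sh sc.
have sv : smooth (fun x : 'rV[R]_d.+1 => vpart x) by exact: smooth_coord.
have sK : smooth (fun _ : 'rV[R]_d.+1 => K) by exact: smooth_cst.
apply: smoothM; last exact: smooth_hpart.
apply: smoothB; last exact: smooth_cst.
apply: smoothD.
  apply: (@smooth_comp _ _ step (fun x : 'rV[R]_d.+1 => (h (hpart x) - vpart x) * K));
    first exact: smooth1_step.
  apply: smoothM; last exact: sK.
  by apply: smoothB; [exact: smooth_hpart|exact: sv].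
apply: (@smooth_comp _ _ step (fun x : 'rV[R]_d.+1 => vpart x * K)); first exact: smooth1_step.
by apply: smoothM; [exact: sv|exact: sK].
Qed.

Lemma plateau_der h chi K x : smooth h -> smooth chi ->
  (forall j, 'D_(ee (lift ord_max j)) (plateau h chi K) x =
    (step ((h (hpart x) - vpart x) * K) + step (vpart x * K) - 1) * 'D_(ee j) chi (hpart x) +
    K * d1 step ((h (hpart x) - vpart x) * K) * 'D_(ee j) h (hpart x) * chi (hpart x)) /\
  'D_(ee ord_max) (plateau h chi K) x =
    K * (d1 step (vpart x * K) - d1 step ((h (hpart x) - vpart x) * K)) * chi (hpart x).
Proof.
move=> sh sc.
have dV i : is_derive x (ee i) (fun x : 'rV[R]_d.+1 => vpart x) (i == ord_max)%:R.
  by have [h1 h2] := derive_coord ord_max i x; apply: DeriveDef.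
split=> [j|].
  have dh (g : 'rV[R]_d -> R) : smooth g ->
    is_derive x (ee (lift ord_max j)) (fun x => g (hpart x)) ('D_(ee j) g (hpart x)).
    move=> sg; apply: DeriveDef; last exact: derive_hpart.
    by apply: derivable_hpart; exact: smooth_drv.
  have := derive_plateau K (dh _ sh) (dV _) (dh _ sc).
  have -> : lift ord_max j == ord_max = false by apply/negbTE; rewrite eq_sym neq_lift.
  move=> H; rewrite (@derive_val _ _ _ _ _ _ _ H) /= subr0 mulr0 addr0 mulrA; exact: erefl.
have dh (g : 'rV[R]_d -> R) : is_derive x (ee ord_max) (fun x : 'rV[R]_d.+1 => g (hpart x)) 0.
  by have [h1 h2] := derive_hpart_max g x; apply: DeriveDef.
have := derive_plateau K (dh h) (dV _) (dh chi); rewrite eqxx.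
move=> H; rewrite (@derive_val _ _ _ _ _ _ _ H) /=; ring.
Qed.

(** The bound 4 <= h K separates the two transitions: where one step is still 0 the other has
    already reached 1, and their sum minus 1 vanishes. *)
Lemma plateau_zero h chi K x : 0 < K -> 4 <= h (hpart x) * K ->
  ~ (1 <= vpart x * K /\ 1 <= (h (hpart x) - vpart x) * K) -> plateau h chi K x = 0.
Proof.
move=> K0 h4; rewrite /plateau mulrBl; move: (vpart x * K) (h _ * K) h4 => v k h4 nh.
have [v1|v1] := leP v 1.
  by rewrite (step_le1 v1) step_ge2 ?addr0 ?subrr ?mul0r//; lra.
have [k1|k1] := leP (k - v) 1.
  by rewrite (step_le1 k1) (@step_ge2 _ v) ?add0r ?subrr ?mul0r//; lra.
by case: nh; split; exact: ltW.
Qed.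

(** The support stays at height at least 1/K above the bottom and 1/K below h; since h exceeds
    [zeta] by at most 1 / (2K), it lies inside the domain. *)
Lemma test_plateau h chi K : smooth h -> test_fun setT chi -> 0 < K ->
  (forall y, `|h y - zeta y| * K <= 2^-1) -> (forall y, 4 <= h y * K) ->
  test_fun Om (plateau h chi K).
Proof.
move=> sh tc K0 hz h4; have [r r0 sr] := test_supp tc; have sc := test_smooth tc.
have ch := smooth_cont sh.
pose S : set 'rV[R]_d.+1 := cube d.+1 (r + M) `&` ([set x | 1 <= vpart x * K] `&`
   [set x | 1 <= (h (hpart x) - vpart x) * K]).
have SO x : 1 <= vpart x * K -> 1 <= (h (hpart x) - vpart x) * K -> Om x.
  move=> s1 s2; apply/andP; split; first by rewrite -(pmulr_lgt0 _ K0); lra.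
  rewrite -(ltr_pM2r K0); have := hz (hpart x); have := ler_norm (h (hpart x) - zeta (hpart x)).
  rewrite -(ler_pM2r K0) => /le_trans h1 /h1; rewrite !mulrBl in s2 *; lra.
apply: (@mk_test _ _ _ S).
- exact: smooth_plateau.
- apply: compact_closedI; first exact: compact_cube.
  have cvK : continuous (fun x : 'rV[R]_d.+1 => vpart x * K).
    by apply: contM; [exact: vpart_cont|exact: cont_cst].
  have chK : continuous (fun x : 'rV[R]_d.+1 => (h (hpart x) - vpart x) * K).
    apply: contM; last exact: cont_cst.
    apply: contB; last exact: vpart_cont.
    by apply: (@cont_comp _ _ _ (fun x : 'rV[R]_d.+1 => hpart x) h); [exact: hpart_cont|exact: ch].
  apply: closedI.
    apply: (@closed_comp _ _ (fun x : 'rV[R]_d.+1 => vpart x * K) [set u | 1 <= u]);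
      last exact: closed_ge.
    by move=> x _; exact: cvK.
  apply: (@closed_comp _ _ (fun x : 'rV[R]_d.+1 => (h (hpart x) - vpart x) * K) [set u | 1 <= u]);
    last exact: closed_ge.
  by move=> x _; exact: chK.
- by move=> x [_ [s1 s2]]; exact: SO.
move=> x nS; have [s|ns] := pselect (1 <= vpart x * K /\ 1 <= (h (hpart x) - vpart x) * K);
  last exact: plateau_zero.
rewrite /plateau (_ : chi _ = 0) ?mulr0//; apply: sr => xr; apply: nS; split; last exact: s.
have /andP[x0 xz] := SO _ s.1 s.2; have /andP[z0 z1] := zM (hpart x).
apply: ptP => [|j]; first by rewrite gtr0_norm//; move: x0 xz; rewrite /vpart; lra.
by have := xr j; rewrite mxE; lra.
Qed.

End zeta.
End divergence.

(** * The divergence theorem *)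

Section divergence_theorem.
Context {R : realType} {d : nat}.
Local Notation mu := (leb d.+1).
Notation ee i := (delta_mx 0 i : 'rV[R]_ _).
Variables (zeta : 'rV[R]_d -> R) (M zm : R).
Hypotheses (cz : continuous zeta) (zM : forall y, 0 < zeta y <= M).
Hypotheses (zm0 : 0 < zm) (zmz : forall y, zm <= zeta y).
Hypothesis az : forall e : R, 0 < e -> exists h : 'rV[R]_d -> R,
  [/\ smooth h, forall x, `|h x - zeta x| <= e &
     forall x i, `|'D_(ee i) h x - 'D_(ee i) zeta x| <= e].
Let Om := Omega zeta.

Let mz : measurable_fun setT zeta. Proof. exact: continuous_measurable_rV. Qed.
Let mO : measurable Om. Proof. exact: Omega_meas. Qed.
Let mDr rho : measurable (Dr zeta rho). Proof. exact: Dr_meas. Qed.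

Lemma sum_lift (f : 'I_d.+1 -> R) : \sum_j f j = f ord_max + \sum_(j < d) f (lift ord_max j).
Proof. by rewrite (bigD1_ord ord_max). Qed.

Lemma top0 y : 0 <= (fun _ : 'rV[R]_d => (0 : R)) y <= zeta y.
Proof. by rewrite lexx /=; have /andP[/ltW] := zM y. Qed.

Lemma topz y : 0 <= zeta y <= zeta y.
Proof. by rewrite lexx andbT; have /andP[/ltW] := zM y. Qed.

Lemma plateau_cvg (h : nat -> 'rV[R]_d -> R) x : Om x ->
  (forall k y, `|h k y - zeta y| <= k.+1%:R^-1) ->
  (fun k => step ((h k (hpart x) - vpart x) * k.+1%:R) + step (vpart x * k.+1%:R) - 1) @ \oo --> (1
    : R).
Proof.
move=> /andP[x0 xz] hk.
have big (e : R) : 0 < e -> \forall k \near \oo, 3 <= e * k.+1%:R.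
  move=> e0; near=> k.
  have : 3 / e <= k%:R by near: k; exact: nbhs_infty_ger.
  rewrite ler_pdivrMr// mulrC => /le_trans; apply; rewrite ler_pM2l// ler_nat; exact: leqW.
apply: cvg_near_cst; near=> k.
have k1 : 3 <= vpart x * k.+1%:R by near: k; exact: big.
have k2 : 3 <= (zeta (hpart x) - vpart x) * k.+1%:R by near: k; apply: big; rewrite subr_gt0.
have K0 : 0 < k.+1%:R :> R by rewrite ltr0n.
rewrite (@step_ge2 _ (vpart x * _)); last by lra.
rewrite step_ge2 ?addrK//.
have := hk k (hpart x); rewrite -(ler_pM2r K0) mulVf ?gt_eqF// => h1.
have : (zeta (hpart x) - h k (hpart x)) * k.+1%:R <= 1.
  by apply: le_trans h1; rewrite ler_pM2r// distrC; exact: ler_norm.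
rewrite !mulrBl in k2 *; lra.
Unshelve. all: by end_near. Qed.

Lemma plateau_bound (h : 'rV[R]_d -> R) (K : R) (x : 'rV[R]_d.+1) :
  `|step ((h (hpart x) - vpart x) * K) + step (vpart x * K) - 1| <= 1.
Proof.
move: (step_ge0 ((h (hpart x) - vpart x) * K)) (step_le ((h (hpart x) - vpart x) * K)).
move: (step_ge0 (vpart x * K)) (step_le (vpart x * K)) => a1 a2 b1 b2.
by rewrite ler_norml; apply/andP; split; lra.
Qed.

Section one.
Variables (F : 'I_d.+1 -> 'rV[R]_d.+1 -> R) (G : 'rV[R]_d.+1 -> R) (t chi : 'rV[R]_d -> R).
(** The flux through the top per unit of dx', namely F . (- grad zeta, 1), minus its prescribed
    value. *)
Let N x := F ord_max x - \sum_(j < d) F (lift ord_max j) x * 'D_(ee j) zeta (hpart x)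
  - t (hpart x).

(** In the gradient of the plateau the terms of size K assemble into [N] in the top layer and into
    the last component of F in the bottom one. Replacing grad h by grad zeta leaves the third term,
    small because the gradients agree up to K^-2. *)
Lemma flux_error (h : 'rV[R]_d -> R) (K Cs Cx rho P : R) x :
  0 < K -> smooth h -> smooth chi ->
  (forall y, `|h y - zeta y| * K <= 2^-1) ->
    (forall y i, `|'D_(ee i) h y - 'D_(ee i) zeta y| * K <= K^-1) ->
  (forall u, `|d1 step u| <= Cs) -> (forall y, `|chi y| <= Cx) -> Dr zeta rho x ->
  P = step ((h (hpart x) - vpart x) * K) + step (vpart x * K) - 1 ->
  `|\sum_j F j x * 'D_(ee j) (plateau h chi K) x + G x * plateau h chi K x
    - P * (G x * chi (hpart x) + \sum_(j < d) F (lift ord_max j) x * 'D_(ee j) chi (hpart x))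
    + K * d1 step ((h (hpart x) - vpart x) * K) * (t (hpart x) * chi (hpart x))| <=
  Cs * Cx * (K * (\1_(layer zeta zeta rho (3 * K^-1)) x * `|N x|) +
             K * (\1_(layer zeta (fun=> 0) rho (3 * K^-1)) x * `|F ord_max x|) +
             K^-1 * \sum_(j < d) `|F (lift ord_max j) x|).
Proof.
move=> K0 sh sc hz hdz Cs1 Cx1 Dx PE; have [pd1 pd2] := plateau_der K x sh sc.
rewrite sum_lift pd2.
set s1 := d1 step ((h (hpart x) - vpart x) * K); set s2 := d1 step (vpart x * K).
have Cs0 : 0 <= Cs by apply: le_trans (Cs1 0); exact: normr_ge0.
have Cx0 : 0 <= Cx by apply: le_trans (Cx1 0); exact: normr_ge0.
have -> : \sum_(j < d) F (lift ord_max j) x * 'D_(ee (lift ord_max j)) (plateau h chi K) x =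
   P * (\sum_(j < d) F (lift ord_max j) x * 'D_(ee j) chi (hpart x)) +
   K * s1 * chi (hpart x) * (\sum_(j < d) F (lift ord_max j) x * 'D_(ee j) zeta (hpart x)) +
   s1 * chi (hpart x) * (\sum_(j < d) F (lift ord_max j) x * (('D_(ee j) h (hpart x) - 'D_(ee j)
     zeta (hpart x)) * K)).
  rewrite !mulr_sumr -!big_split/=; apply: eq_bigr => j _; rewrite pd1 -PE -/s1; ring.
set SZ := \sum_(j < d) F (lift ord_max j) x * 'D_(ee j) zeta (hpart x).
set SE := \sum_(j < d) F (lift ord_max j) x * (_ * K).
set SC := \sum_(j < d) F (lift ord_max j) x * 'D_(ee j) chi (hpart x).
have SEb : `|SE| <= K^-1 * \sum_(j < d) `|F (lift ord_max j) x|.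
  rewrite mulr_sumr; apply: le_trans (ler_norm_sum _ _ _) _; apply: ler_sum => j _.
  rewrite normrM mulrC; apply: ler_wpM2r; first exact: normr_ge0.
  by rewrite normrM (gtr0_norm K0); exact: hdz.
have xO := Dx.1; have xc := Dx.2; have /andP[x0 xz] := xO.
have b1 : K * `|s1| * `|N x| <= Cs * (K * (\1_(layer zeta zeta rho (3 * K^-1)) x * `|N x|)).
  rewrite indicE; case: (boolP (x \in _)) => [_|nx].
    rewrite mul1r mulrA; apply: ler_wpM2r; first exact: normr_ge0.
    by rewrite [Cs * K]mulrC; apply: ler_wpM2l; [exact: ltW|exact: Cs1].
  rewrite mul0r !mulr0 (_ : s1 = 0) ?normr0 ?mulr0 ?mul0r//; apply: dstep0;
    apply/negP => /andP[a1 a2].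
  move/negP: nx; apply; apply/mem_set; split; first exact: Dx.
  rewrite /= -(ltr_pM2r K0) -mulrA mulVf ?gt_eqF// mulr1 -[K in _ * K](gtr0_norm K0) -normrM.
  have := hz (hpart x); rewrite -[K in _ * K](gtr0_norm K0) -normrM ler_norml ltr_norml !mulrBl.
  rewrite !mulrBl in a1 a2; move=> /andP[c1 c2]; apply/andP; split; lra.
have b2 : K * `|s2| * `|F ord_max x| <= Cs * (K * (\1_(layer zeta (fun=> 0) rho (3 * K^-1)) x * `|F
  ord_max x|)).
  rewrite indicE; case: (boolP (x \in _)) => [_|nx].
    rewrite mul1r mulrA; apply: ler_wpM2r; first exact: normr_ge0.
    by rewrite [Cs * K]mulrC; apply: ler_wpM2l; [exact: ltW|exact: Cs1].
  rewrite mul0r !mulr0 (_ : s2 = 0) ?normr0 ?mulr0 ?mul0r//; apply: dstep0;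
    apply/negP => /andP[a1 a2].
  move/negP: nx; apply; apply/mem_set; split; first exact: Dx.
  rewrite /= subr0 (gtr0_norm x0) -(ltr_pM2r K0) -mulrA mulVf ?gt_eqF// mulr1; lra.
have -> : K * (s2 - s1) * chi (hpart x) = K * s2 * chi (hpart x) - K * s1 * chi (hpart x) by ring.
rewrite /plateau -PE.
have -> : F ord_max x * (K * s2 * chi (hpart x) - K * s1 * chi (hpart x)) +
   (P * SC + K * s1 * chi (hpart x) * SZ + s1 * chi (hpart x) * SE) +
   G x * (P * chi (hpart x)) - P * (G x * chi (hpart x) + SC) +
   K * s1 * (t (hpart x) * chi (hpart x)) =
   chi (hpart x) * (- (K * s1 * N x) + K * s2 * F ord_max x + s1 * SE).
  by rewrite /N -/SZ; ring.
rewrite normrM -[leRHS]mulrA [leRHS]mulrCA; apply: ler_pM;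
  [exact: normr_ge0|exact: normr_ge0|exact: Cx1|].
apply: le_trans (ler_normD _ _) _; rewrite [Cs * _]mulrDr; apply: lerD; last first.
  by rewrite normrM; apply: ler_pM; [exact: normr_ge0|exact: normr_ge0|exact: Cs1|exact: SEb].
rewrite [Cs * _]mulrDr; apply: le_trans (ler_normD _ _) _; apply: lerD.
  by rewrite normrN !normrM (gtr0_norm K0).
by rewrite !normrM (gtr0_norm K0).
Qed.

Hypothesis ct : continuous t.
Hypothesis iG : forall rho, 0 < rho -> intg mu (Dr zeta rho) G.
Hypothesis iF : forall rho j, 0 < rho -> intg mu (Dr zeta rho) (F j).
Hypothesis dFG : divid zeta F G.
Hypothesis bot : vanish zeta (fun=> 0) (F ord_max).
Hypothesis topN : vanish zeta zeta N.
Hypothesis tc : test_fun setT chi.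

Lemma vanish_indic (top : 'rV[R]_d -> R) (f : 'rV[R]_d.+1 -> R) rho k : continuous top ->
  0 < rho -> vanish zeta top f ->
  intg mu (Dr zeta rho) (fun x => \1_(layer zeta top rho (3 * k.+1%:R^-1)) x * `|f x|) /\
  \int[mu]_(x in Dr zeta rho) (\1_(layer zeta top rho (3 * k.+1%:R^-1)) x * `|f x|) =
  \int[mu]_(x in lay zeta top rho k) `|f x|.
Proof.
move=> ctop r0 /(_ _ r0)[fi _].
have ml : measurable (layer zeta top rho (3 * k.+1%:R^-1)).
  by apply: layer_meas => //; exact: continuous_measurable_rV.
split; last by rewrite -Rint_indic// => x [].
apply: (@intgMb _ _ _ _ _ _ _ 1) => //.
- by move=> x _; rewrite indicE; case: (_ \in _); rewrite ?normr1// normr0.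
exact: intg_abs.
Qed.

(** The weak identity is tested on plateaus with K = k+1. The error of [flux_error] tends to 0 by
    the two [vanish] hypotheses, the surface term is exact, and the plateaus tend to [chi] at every
    point of the domain. *)
Lemma divergence : \int[mu]_(x in Om) (G x * chi (hpart x) +
    \sum_(j < d) F (lift ord_max j) x * 'D_(ee j) chi (hpart x)) =
  \int[leb d]_y (t y * chi y).
Proof.
have sc := test_smooth tc; have cc := smooth_cont sc.
have [rho r0 hr] := test_cyl tc.
have [Cx Cx0 hCx] := test_bounded tc; have [Cs Cs0 hCs] := @dstep_bound R.
have mD := mDr rho; set D := Dr zeta rho.
(* Two powers of K are asked for: one is absorbed by the gradient of the plateau, the other makes
   the error tend to 0. The factor 1/2 gives |h - zeta| K <= 1/2. *)
have hE (k : nat) : exists h : 'rV[R]_d -> R, [/\ smooth h,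
   forall x, `|h x - zeta x| <= 2^-1 * k.+1%:R^-1 ^+ 2 &
   forall x i, `|'D_(ee i) h x - 'D_(ee i) zeta x| <= 2^-1 * k.+1%:R^-1 ^+ 2].
  by apply: az; rewrite mulr_gt0 ?exprn_gt0 ?invr_gt0.
have [h hP] := choice hE.
have sh k : smooth (h k) by case: (hP k).
have K0 k : 0 < k.+1%:R :> R by rewrite ltr0n.
have Ki k : k.+1%:R^-1 <= 1 :> R by rewrite invf_le1// ler1n.
have Ki0 k : 0 < k.+1%:R^-1 :> R by rewrite invr_gt0.
have KK k : k.+1%:R^-1 * k.+1%:R = 1 :> R by rewrite mulVf// gt_eqF.
have hz k y : `|h k y - zeta y| * k.+1%:R <= 2^-1.
  have [_ hk _] := hP k; apply: le_trans (ler_wpM2r (ltW (K0 k)) (hk y)) _.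
  by rewrite expr2 -!mulrA KK mulr1 -[leRHS]mulr1 ler_wpM2l.
have hdz k y i : `|'D_(ee i) (h k) y - 'D_(ee i) zeta y| * k.+1%:R <= k.+1%:R^-1.
  have [_ _ hk] := hP k; apply: le_trans (ler_wpM2r (ltW (K0 k)) (hk y i)) _.
  rewrite expr2 -!mulrA KK mulr1 -[leRHS]mul1r; apply: ler_wpM2r; first exact: ltW.
  lra.
have hz' k y : `|h k y - zeta y| <= k.+1%:R^-1.
  rewrite -(ler_pM2r (K0 k)) KK; apply: le_trans (hz k y) _; lra.
pose P k x := step ((h k (hpart x) - vpart x) * k.+1%:R) + step (vpart x * k.+1%:R) - 1 : R.
pose W x := G x * chi (hpart x) + \sum_(j < d) F (lift ord_max j) x * 'D_(ee j) chi (hpart x).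
have chh (g : 'rV[R]_d -> R) : continuous g -> continuous (fun x : 'rV[R]_d.+1 => g (hpart x)).
  by move=> cg; apply: (@cont_comp _ _ _ (fun x : 'rV[R]_d.+1 => hpart x) g);
    [exact: hpart_cont|exact: cg].
have mulD f (g : 'rV[R]_d.+1 -> R) : intg mu D f -> continuous g -> intg mu D (fun x => f x * g x).
  move=> fi cg; have [C C0 gC] := cont_compact_bounded (@compact_cube R d.+1 (rho + M)) cg.
  under eq_fun do rewrite mulrC; apply: (@intgMb _ _ _ _ _ _ _ C mD _ _ fi).
    by apply: measurable_funTS; exact: continuous_measurable_rV.
  by move=> x Dx; apply: gC; exact: (Dr_cube zM) Dx.
have iW : intg mu D W.
  apply: (intgD mD); first by apply: mulD; [exact: iG|exact: (chh chi cc)].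
  apply: (@intg_sum _ _ _ mu _ _ _ _ D mD) => j _; apply: mulD; first exact: iF.
  exact: (chh (fun y => 'D_(ee j) chi y) (smooth_cont (smooth_der j sc))).
have cP k : continuous (P k).
  have chk := chh _ (smooth_cont (sh k)).
  have cK : continuous (fun _ : 'rV[R]_d.+1 => k.+1%:R : R) by exact: cont_cst.
  have cv := @vpart_cont R d.
  apply: contB; last exact: cont_cst.
  apply: contD.
    apply: (@cont_comp _ _ _ (fun x : 'rV[R]_d.+1 => (h k (hpart x) - vpart x) * k.+1%:R) step);
      last exact: continuous_step.
    by apply: contM; [apply: contB; [exact: chk|exact: cv]|exact: cK].
  apply: (@cont_comp _ _ _ (fun x : 'rV[R]_d.+1 => vpart x * k.+1%:R) step);
    last exact: continuous_step.
  by apply: contM; [exact: cv|exact: cK].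
have iPW k : intg mu D (fun x => P k x * W x).
  by under eq_fun do rewrite mulrC; exact: mulD.
pose phi k := plateau (h k) chi k.+1%:R.
have sphi k : smooth (phi k) by exact: smooth_plateau.
pose S k x := \sum_j F j x * 'D_(ee j) (phi k) x + G x * phi k x.
have iS k : intg mu D (S k).
  apply: (intgD mD); last by apply: mulD; [exact: iG|exact: smooth_cont].
  apply: (@intg_sum _ _ _ mu _ _ _ _ D mD) => j _; apply: mulD; first exact: iF.
  exact: smooth_cont (smooth_der j (sphi k)).
(* The part of the plateau gradient that carries the surface integral; by [Rint_step_top] its
   integral is that of [t chi]. *)
pose U k x := k.+1%:R * d1 step ((h k (hpart x) - vpart x) * k.+1%:R) * (t (hpart x) * chi (hpart
  x)).
have ctx : continuous (fun y => t y * chi y) by exact: contM.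
have cU k : continuous (U k).
  apply: contM; last exact: (chh (fun y => t y * chi y) ctx).
  apply: contM; first exact: cont_cst.
  apply: (@cont_comp _ _ _ (fun x : 'rV[R]_d.+1 => (h k (hpart x) - vpart x) * k.+1%:R) (d1 step));
    last exact: continuous_dstep.
  apply: contM; last exact: cont_cst.
  by apply: contB; [exact: (chh (h k) (smooth_cont (sh k)))|exact: vpart_cont].
have iU k : intg mu D (U k) by exact: (Dr_cont_intg cz zM).
have cylN (x : 'rV[R]_d.+1) : ~ cyl rho x -> rho ^+ 2 <= sqnorm (hpart x).
  by move=> /negP; rewrite -leNgt.
pose B k x := Cs * Cx * (k.+1%:R * (\1_(layer zeta zeta rho (3 * k.+1%:R^-1)) x * `|N x|) +
   k.+1%:R * (\1_(layer zeta (fun=> 0) rho (3 * k.+1%:R^-1)) x * `|F ord_max x|) +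
   k.+1%:R^-1 * \sum_(j < d) `|F (lift ord_max j) x|).
pose A := \int[mu]_(x in D) \sum_(j < d) `|F (lift ord_max j) x|.
have iA : intg mu D (fun x => \sum_(j < d) `|F (lift ord_max j) x|).
  by apply: (@intg_sum _ _ _ mu _ _ _ _ D mD) => j _; apply: (intg_abs mD); exact: iF.
have iB k : intg mu D (B k) /\ \int[mu]_(x in D) B k x =
    Cs * Cx * (k.+1%:R * \int[mu]_(x in lay zeta zeta rho k) `|N x| +
    k.+1%:R * \int[mu]_(x in lay zeta (fun=> 0) rho k) `|F ord_max x| + k.+1%:R^-1 * A).
  have [i1 e1] := vanish_indic k cz r0 topN.
  have [i2 e2] := vanish_indic k (@cont_cst R 'rV[R]_d 0) r0 bot.
  have j1 := intgZ k.+1%:R mD i1; have j2 := intgZ k.+1%:R mD i2; have j3 := intgZ k.+1%:R^-1 mD iA.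
  split; first by apply: (intgZ _ mD); apply: (intgD mD) j3; exact: (intgD mD).
  rewrite (RintegralZl _ mD (intgD mD (intgD mD j1 j2) j3)) (RintegralD mD (intgD mD j1 j2) j3)
    (RintegralD mD j1 j2).
  by rewrite (RintegralZl _ mD i1) (RintegralZl _ mD i2) (RintegralZl _ mD iA) e1 e2.
pose E k x := S k x - P k x * W x + U k x.
have iE k : intg mu D (E k) by apply: (intgD mD) (iU k); exact: (intgB mD).
have EB k : `|\int[mu]_(x in D) E k x| <= Cs * Cx * (k.+1%:R * \int[mu]_(x in lay zeta zeta rho k)
  `|N x| +
    k.+1%:R * \int[mu]_(x in lay zeta (fun=> 0) rho k) `|F ord_max x| + k.+1%:R^-1 * A).
  have [i1 <-] := iB k; apply: (ler_norm_Rint mD (iE k) i1) => x Dx.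
  exact: (flux_error (K0 k) (sh k) sc (hz k) (hdz k) hCs hCx Dx).
have limE : (fun k => \int[mu]_(x in D) E k x) @ \oo --> (0 : R).
  apply: norm_cvg0.
  have lim : (fun k => Cs * Cx * (k.+1%:R * \int[mu]_(x in lay zeta zeta rho k) `|N x| +
    k.+1%:R * \int[mu]_(x in lay zeta (fun=> 0) rho k) `|F ord_max x| + k.+1%:R^-1 * A)) @ \oo -->
      (0 : R).
    rewrite -[X in _ --> X](_ : Cs * Cx * (0 + 0 + 0 * A) = 0); last by rewrite mul0r !addr0 mulr0.
    apply: cvgM; first exact: cvg_cst.
    apply: cvgD; first by apply: cvgD; [exact: (topN r0).2|exact: (bot r0).2].
    by apply: cvgM; [exact: cvg_harmonic|exact: cvg_cst].
  apply: (squeeze_cvgr _ (cvg_cst 0) lim); apply: nearW => k.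
  by rewrite normr_ge0 EB.
have limPW : (fun k => \int[mu]_(x in D) (P k x * W x)) @ \oo --> \int[mu]_(x in D) W x.
  apply: (@Rdct _ _ _ _ D _ _ (fun x => `|W x|) mD).
  - by move=> k; exact: intg_meas (iPW k).
  - exact: (intg_abs mD).
  - move=> k x _; rewrite normrM -[leRHS]mul1r; apply: ler_wpM2r; first exact: normr_ge0.
    exact: plateau_bound.
  move=> x [Ox _]; rewrite -[X in _ --> X]mul1r; apply: cvgM; last exact: cvg_cst.
  exact: plateau_cvg.
have key : \forall k \near \oo, \int[mu]_(x in D) (P k x * W x) =
   \int[leb d]_y (t y * chi y) - \int[mu]_(x in D) E k x.
  near=> k.
  (* For large k one has zeta K >= 5, and h K differs from it by at most 1/2. Before that the
     plateau need not be an admissible test function. *)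
  have h4 y : 4 <= h k y * k.+1%:R.
    have : 5 / zm <= k%:R by near: k; exact: nbhs_infty_ger.
    rewrite ler_pdivrMr// mulrC => k5.
    have k6 : zm * k%:R <= zeta y * k.+1%:R.
      by apply: ler_pM => //; [exact: ltW|rewrite ler_nat].
    have := hz k y; rewrite -[X in `|_| * X](gtr0_norm (K0 k)) -normrM ler_norml mulrBl =>
      /andP[q1 q2].
    lra.
  have T : test_fun Om (phi k) by apply: (test_plateau zM).
  have := dFG T.
  have out x : ~ cyl rho x -> phi k x = 0 /\ forall j, 'D_(ee j) (phi k) x = 0.
    move=> /cylN /hr[c1 c2]; split; first by rewrite /phi /plateau c1 mulr0.
    have [q1 q2] := plateau_der k.+1%:R x (sh k) sc.
    by apply: ptP => [|j]; rewrite ?q1 ?q2 c1 ?c2 !mulr0 ?addr0.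
  rewrite (@Om_Dr _ _ _ rho) => [|x _ /out[-> _]]; last by rewrite mulr0.
  have eF j : \int[mu]_(x in Omega zeta) (F j x * 'D_(ee j) (phi k) x) =
      \int[mu]_(x in D) (F j x * 'D_(ee j) (phi k) x).
    by apply: Om_Dr => x _ /out[_ ->]; rewrite mulr0.
  rewrite (eq_bigr _ (fun j _ => eF j)).
  have iFj j : intg mu D (fun x => F j x * 'D_(ee j) (phi k) x).
    by apply: mulD; [exact: iF|exact: smooth_cont (smooth_der j (sphi k))].
  have iGp : intg mu D (fun x => G x * phi k x) by apply: mulD; [exact: iG|exact: smooth_cont].
  rewrite -(@Rintegral_sum _ _ _ mu _ (index_enum _) xpredT _ D mD (fun j _ => iFj j)) => e1.
  have e0 : \int[mu]_(x in D) S k x = 0.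
    rewrite (RintegralD mD (@intg_sum _ _ _ mu _ (index_enum _) xpredT _ D mD (fun j _ =>
      iFj j)) iGp) e1 addNr; exact: erefl.
  have eU : \int[mu]_(x in D) U k x = \int[leb d]_y (t y * chi y).
    have [r _ sr] := test_supp tc.
    rewrite -(@Rint_step_top R d zeta M cz zM (h k) (fun y =>
      t y * chi y) k.+1%:R r (K0 k) (smooth_cont (sh k)) (hz k)).
    + rewrite (@Om_Dr _ _ _ rho) => [//|x _ /cylN /hr[-> _]]; by rewrite !mulr0.
    + by move=> y; apply: le_trans (h4 y); rewrite ler_nat.
    + exact: ctx.
    + by move=> y /sr ->; rewrite mulr0.
  rewrite (RintegralD mD (intgB mD (iS k) (iPW k)) (iU k)) (RintegralB mD (iS k) (iPW k)) e0 eU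
    sub0r.
  by rewrite opprD opprK addrCA subrr addr0.
rewrite (@Om_Dr _ _ _ rho); last first.
  by move=> x _ /cylN /hr[-> c2]; rewrite mulr0 add0r big1// => j _; rewrite c2 mulr0.
have l2 : (fun k => \int[mu]_(x in D) (P k x * W x)) @ \oo --> \int[leb d]_y (t y * chi y).
  rewrite -[X in _ --> X]subr0.
  apply: (@cvg_trans _ ((fun k => \int[leb d]_y (t y * chi y) - \int[mu]_(x in D) E k x) @ \oo)).
    by apply: near_eq_cvg; near=> k; apply/esym; near: k.
  by apply: cvgB; [exact: cvg_cst|exact: limE].
exact: (@cvg_unique _ (@Rhausdorff R) _ _ _ _ limPW l2).
Unshelve. all: by end_near. Qed.

End one.
End divergence_theorem.

(** * Local H^1 approximation and the product rule *)

Section approximation.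
Context {R : realType} {d : nat}.
Local Notation mu := (leb d.+1).
Notation ee i := (delta_mx 0 i : 'rV[R]_ _).

Section L2limits.
Context dd (T : measurableType dd) (nu : {measure set T -> \bar R}) (D : set T).
Hypothesis mD : measurable D.

Lemma N2_lim (f u : T -> R) (W : nat -> T -> R) : L2 nu D f -> L2 nu D u ->
  (forall k, L2 nu D (W k)) -> (fun k => N2 nu D (fun x => W k x - u x)) @ \oo --> (0 : R) ->
  (fun k => \int[nu]_(x in D) (f x * W k x)) @ \oo --> \int[nu]_(x in D) (f x * u x).
Proof.
move=> lf lu lW c0; apply/subr_cvg0; apply: norm_cvg0.
have lim : (fun k => N2 nu D f * N2 nu D (fun x => W k x - u x)) @ \oo --> (0 : R).
  by rewrite -[X in _ --> X](mulr0 (N2 nu D f)); apply: cvgM; [exact: cvg_cst|exact: c0].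
apply: (squeeze_cvgr _ (cvg_cst 0) lim); apply: nearW => k; rewrite normr_ge0 /=.
have l := L2B mD (lW k) lu.
rewrite -(RintegralB mD (L2_intM mD lf (lW k)) (L2_intM mD lf lu)).
under eq_Rintegral do rewrite -mulrBr.
exact: (CS' mD lf l).
Qed.

(** Split at a height m: the part of f above m has small integral and meets a bounded g, while below
    m the product is at most a multiple of g. This takes the place of extracting an almost
    everywhere convergent subsequence. *)
Lemma intM_cvg0 (f : T -> R) (g : nat -> T -> R) (C : R) : intg nu D f ->
  (forall x, D x -> 0 <= f x) -> (forall k, intg nu D (g k)) ->
  (forall k x, D x -> 0 <= g k x <= C) ->
  (fun k => \int[nu]_(x in D) g k x) @ \oo --> (0 : R) ->
  (fun k => \int[nu]_(x in D) (f x * g k x)) @ \oo --> (0 : R).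
Proof.
move=> fi f0 gi gC g0; have mf := intg_meas fi.
pose tr m x : R := if m%:R < f x then 1 else 0.
have mt m : measurable_fun D (tr m).
  rewrite (_ : tr m = (fun b : bool => if b then 1 else 0 : R) \o (fun x => m%:R < f x)) //.
  by apply: measurableT_comp => //; exact: measurable_fun_ltr.
have tb m x : `|tr m x| <= 1 by rewrite /tr; case: ifP; rewrite ?normr1 ?normr0.
have ti m : intg nu D (fun x => tr m x * f x) by exact: (@intgMb _ _ _ nu D f _ 1).
have tc : (fun m : nat => \int[nu]_(x in D) (tr m x * f x)) @ \oo --> (0 : R).
  have -> : (0 : R) = \int[nu]_(x in D) 0 by rewrite Rintegral_cst ?mul0r.
  apply: (@Rdct _ _ _ _ D _ _ (fun x => `|f x|) mD).
  - by move=> m; exact: measurable_funM.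
  - exact: intg_abs.
  - by move=> m x _; rewrite normrM -[leRHS]mul1r ler_wpM2r.
  move=> x Dx; apply: cvg_near_cst; near=> m.
  rewrite /tr ltNge (_ : f x <= m%:R) ?mul0r//.
  by near: m; exact: nbhs_infty_ger.
apply/cvgrPdist_lt => e e0.
have C0 : 0 < `|C| + 1 by rewrite ltr_wpDl.
have [m hm] : exists m : nat, \int[nu]_(x in D) (tr m x * f x) < e / 2 / (`|C| + 1).
  have h := cvgr_lt _ tc (e / 2 / (`|C| + 1)).
  have e1 : 0 < e / 2 / (`|C| + 1) by rewrite !divr_gt0.
  by near \oo => m; exists m; near: m; exact: h.
have e2 : 0 < e / 2 / m.+1%:R by rewrite !divr_gt0.
have h := cvgr_lt _ g0 (e / 2 / m.+1%:R) e2.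
near=> k; rewrite sub0r normrN.
have fg : intg nu D (fun x => f x * g k x).
  under eq_fun do rewrite mulrC; apply: (@intgMb _ _ _ nu D f _ `|C|) => //;
    first exact: intg_meas (gi k).
  by move=> x Dx; have /andP[q0 q1] := gC k x Dx; rewrite ger0_norm//;
    apply: le_trans q1 (ler_norm _).
rewrite ger0_norm; last first.
  by apply: Rintegral_ge0 => x Dx; rewrite mulr_ge0 ?f0//; case/andP: (gC k x Dx).
have ib1 := intgZ (`|C| + 1) mD (ti m); have ib2 := intgZ m.+1%:R mD (gi k).
apply: (@le_lt_trans _ _ (\int[nu]_(x in D) ((`|C| + 1) * (tr m x * f x) + m.+1%:R * g k x))).
  apply: (le_Rintegral mD fg (intgD mD ib1 ib2)) => x Dx.
  have /andP[q0 q1] := gC k x Dx; have q2 := ler_norm C; have q3 := f0 x Dx.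
  rewrite /tr; case: ltP => fm.
    rewrite mul1r; apply: (@le_trans _ _ ((`|C| + 1) * f x)); last by rewrite lerDl mulr_ge0.
    by rewrite mulrC; apply: ler_wpM2r => //; lra.
  rewrite mul0r mulr0 add0r; apply: ler_wpM2r => //; apply: le_trans fm _.
  by rewrite ler_nat.
rewrite (RintegralD mD ib1 ib2) (RintegralZl _ mD (ti m)) (RintegralZl _ mD (gi k)).
rewrite [e]splitr; apply: ltrD.
  by rewrite mulrC -ltr_pdivlMr.
by rewrite mulrC -ltr_pdivlMr ?ltr0n//; near: k; exact: h.
Unshelve. all: by end_near. Qed.

End L2limits.

Section zeta.
Variables (zeta : 'rV[R]_d -> R) (M : R).
Hypotheses (cz : continuous zeta) (zM : forall y, 0 < zeta y <= M).
Let Om := Omega zeta.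

Let mz : measurable_fun setT zeta. Proof. exact: continuous_measurable_rV. Qed.
Let mO : measurable Om. Proof. exact: Omega_meas. Qed.
Let mDr rho : measurable (Dr zeta rho). Proof. exact: Dr_meas. Qed.

(* u is a local H^1 limit of functions smooth up to the boundary, with gradient du. *)
Definition appr (u : 'rV[R]_d.+1 -> R) (du : 'I_d.+1 -> 'rV[R]_d.+1 -> R) :=
  (forall rho, 0 < rho -> L2 mu (Dr zeta rho) u /\ forall j, L2 mu (Dr zeta rho) (du j)) /\
  exists w : nat -> 'rV[R]_d.+1 -> R, (forall k, smooth (w k)) /\
    forall rho, 0 < rho ->
    (fun k => N2 mu (Dr zeta rho) (fun x => w k x - u x)) @ \oo --> (0 : R) /\
    forall j, (fun k => N2 mu (Dr zeta rho) (fun x =>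
      'D_(ee j) (w k) x - du j x)) @ \oo --> (0 : R).

Lemma sqint_N2_cvg0 (D : set 'rV[R]_d.+1) (W : nat -> 'rV[R]_d.+1 -> R) : measurable D ->
  (forall k, L2 mu D (W k)) -> (fun k => sqint D (W k)) @ \oo --> 0%E ->
  (fun k => N2 mu D (W k)) @ \oo --> (0 : R).
Proof.
move=> mD lW cW.
have c2 : (fun k => N2 mu D (W k) ^+ 2) @ \oo --> (0 : R).
  have -> : (fun k => N2 mu D (W k) ^+ 2) = fine \o (fun k => sqint D (W k)).
    by apply/funext => k; rewrite /= (sqint_N2 mD (lW k)).
  exact: fine_cvg cW.
have := cvg_comp _ _ c2 (@sqrt_continuous R 0); rewrite sqrtr0.
rewrite (_ : Num.sqrt \o _ = fun k => N2 mu D (W k)); first exact.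
by apply/funext => k /=; rewrite sqrtr_sqr ger0_norm// N2_ge0.
Qed.

Lemma has_trace_appr (top : 'rV[R]_d -> R) (u : 'rV[R]_d.+1 -> R) (t : 'rV[R]_d ->
  R) : continuous top ->
  (forall y, 0 <= top y <= zeta y) -> measurable_fun Om u -> has_trace Om top u t ->
  appr u (fun j => wD Om [:: j] u).
Proof.
move=> ct top01 mu_ tr.
have l rho (r0 : 0 < rho) := has_trace_L2 cz zM ct top01 r0 mu_ tr.
split=> [rho r0|]; first by have [l1 l2 _] := l _ r0.
have [mtt [w [sw wc]]] := tr; exists w; split => // rho r0.
have [l1 l2 _] := l _ r0; have [c1 c2 _] := wc _ r0.
split=> [|j]; apply: sqint_N2_cvg0 => //.
- by move=> k; apply: (L2B (mDr rho)) l1; apply: (Dr_cont_L2 cz zM r0); exact: smooth_cont.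
- by move=> k; apply: (L2B (mDr rho)) (l2 j); apply: (Dr_cont_L2 cz zM r0);
  exact: smooth_cont (smooth_der j (sw k)).
exact: c2.
Qed.

(** The gradient error is beta'(w)(Dw - du) + (beta'(w) - beta'(u)) du. The first term is controlled
    by the bound on beta'. In the second, du is only square integrable; the squared difference of
    beta' is bounded and tends to 0 in L^1, so [intM_cvg0] applies. *)
Lemma appr_comp (beta : R -> R) (C L : R) u du : smooth1 beta -> beta 0 = 0 ->
  (forall s, `|d1 beta s| <= C) -> (forall s r, `|beta s - beta r| <= C * `|s - r|) ->
  (forall s r, `|d1 beta s - d1 beta r| <= L * `|s - r|) ->
  appr u du -> appr (fun x => beta (u x)) (fun j x => d1 beta (u x) * du j x).
Proof.
move=> sb b0 bC bL dbL [lu [w [sw wc]]].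
have cb := smooth1_continuous sb; have cdb := smooth1_continuous (smooth1_derive sb).
have C0 : 0 <= C by apply: le_trans (bC 0); exact: normr_ge0.
have mb (D : set 'rV[R]_d.+1) (f : 'rV[R]_d.+1 -> R) : measurable_fun D f ->
  measurable_fun D (fun x => beta (f x)).
  by move=> mf; apply: measurableT_comp mf; exact: continuous_measurable_fun.
have mdb (D : set 'rV[R]_d.+1) (f : 'rV[R]_d.+1 -> R) : measurable_fun D f ->
  measurable_fun D (fun x => d1 beta (f x)).
  by move=> mf; apply: measurableT_comp mf; exact: continuous_measurable_fun.
split.
  move=> rho r0; have [l1 l2] := lu _ r0; split.
    apply: (L2_dom (mDr rho) _ (L2Z (mDr rho) C l1)); first by apply: mb; case: l1.
    by move=> x _; rewrite normrM (ger0_norm C0); have := bL (u x) 0; rewrite b0 !subr0.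
  move=> j; apply: (L2Mb (mDr rho) _ (fun x _ => bC (u x)) (l2 j)).
  by apply: mdb; case: l1.
exists (fun k x => beta (w k x)); split; first by move=> k; exact: smooth_comp.
move=> rho r0; have [l1 l2] := lu _ r0; have [c1 c2] := wc _ r0; have mD := mDr rho.
have lw k : L2 mu (Dr zeta rho) (w k) by apply: (Dr_cont_L2 cz zM r0); exact: smooth_cont.
have ldw k j : L2 mu (Dr zeta rho) (fun x => 'D_(ee j) (w k) x).
  by apply: (Dr_cont_L2 cz zM r0); exact: smooth_cont (smooth_der j (sw k)).
have lwu k := L2B mD (lw k) l1.
split.
  have lim : (fun k => C * N2 mu (Dr zeta rho) (fun x => w k x - u x)) @ \oo --> (0 : R).
    by rewrite -[X in _ --> X](mulr0 C); apply: cvgM; [exact: cvg_cst|exact: c1].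
  apply: (squeeze_cvgr _ (cvg_cst 0) lim); apply: nearW => k; rewrite N2_ge0 /=.
  have lC := L2Z mD C (lwu k).
  have mbb : measurable_fun (Dr zeta rho) (fun x => beta (w k x) - beta (u x)).
    by apply: measurable_funB; apply: mb; [case: (lw k)|case: l1].
  have le x : Dr zeta rho x -> `|beta (w k x) - beta (u x)| <= `|C * (w k x - u x)|.
    by move=> _; rewrite normrM (ger0_norm C0).
  rewrite -[X in _ <= X * _](ger0_norm C0) -(N2Z mD C (lwu k)).
  exact: (N2_le mD (L2_dom mD mbb lC le) lC le).
move=> j.
have DE k x : 'D_(ee j) (fun x => beta (w k x)) x = d1 beta (w k x) * 'D_(ee j) (w k) x.
  have [_ ->//] := @chain_rule _ _ beta (w k) x (ee j) (@smooth_drv _ _ _ j x (sw k)) (sb 0%N (w k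
    x)).
pose A k x := d1 beta (w k x) * ('D_(ee j) (w k) x - du j x).
pose B k x := (d1 beta (w k x) - d1 beta (u x)) * du j x.
have lB0 k := L2B mD (ldw k j) (l2 j).
have lA k : L2 mu (Dr zeta rho) (A k).
  by apply: (L2Mb mD _ (fun x _ => bC (w k x)) (lB0 k)); apply: mdb; case: (lw k).
have mdd k : measurable_fun (Dr zeta rho) (fun x => d1 beta (w k x) - d1 beta (u x)).
  by apply: measurable_funB; apply: mdb; [case: (lw k)|case: l1].
have dd2C k x : `|d1 beta (w k x) - d1 beta (u x)| <= 2 * C.
  by have := ler_normB (d1 beta (w k x)) (d1 beta (u x)); have := bC (w k x); have := bC (u x); lra.
have lB k : L2 mu (Dr zeta rho) (B k).
  exact: (L2Mb mD (mdd k) (fun x _ => dd2C k x) (l2 j)).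
have limA : (fun k => C * N2 mu (Dr zeta rho) (fun x =>
  'D_(ee j) (w k) x - du j x)) @ \oo --> (0 : R).
  by rewrite -[X in _ --> X](mulr0 C); apply: cvgM; [exact: cvg_cst|exact: c2].
have limB : (fun k => N2 mu (Dr zeta rho) (B k)) @ \oo --> (0 : R).
  have g2 k : intg mu (Dr zeta rho) (fun x => (d1 beta (w k x) - d1 beta (u x)) ^+ 2).
    apply: (@intg_bounded_fin _ _ _ _ _ _ ((2 * C) ^+ 2)) => //; first exact: (Dr_fin cz zM).
      exact: measurable_funX.
    by move=> x _; rewrite normrX lerXn2r ?nnegrE ?normr_ge0 ?mulr_ge0.
  have c3 : (fun k => \int[mu]_(x in Dr zeta rho) ((d1 beta (w k x) - d1 beta (u x)) ^+ 2)) @ \oo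
    --> (0 : R).
    have lim : (fun k => L ^+ 2 * N2 mu (Dr zeta rho) (fun x =>
      w k x - u x) ^+ 2) @ \oo --> (0 : R).
      rewrite -[X in _ --> X](_ : L ^+ 2 * (0 * 0) = 0); last by rewrite !mulr0.
      apply: cvgM; first exact: cvg_cst.
      by under eq_fun do rewrite expr2; apply: cvgM; exact: c1.
    apply: (squeeze_cvgr _ (cvg_cst 0) lim); apply: nearW => k; apply/andP; split.
      by apply: Rintegral_ge0 => x _; exact: sqr_ge0.
    have iw := (lwu k).2.
    rewrite N2_sq // -(RintegralZl _ mD iw).
    apply: (le_Rintegral mD (g2 k) (intgZ _ mD iw)) => x _.
    by rewrite -exprMn -real_normK ?num_real// -[leRHS]real_normK ?num_real// lerXn2r ?nnegrE
      ?normr_ge0// normrM;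
      apply: le_trans (dbL _ _) _; apply: ler_wpM2r => //; exact: ler_norm.
  have := @intM_cvg0 _ _ mu (Dr zeta rho) mD (fun x => du j x ^+ 2)
    (fun k x => (d1 beta (w k x) - d1 beta (u x)) ^+ 2) ((2 * C) ^+ 2) (l2 j).2.
  move=> /(_ (fun x _ => sqr_ge0 _) g2) H.
  have H2 := H _ c3.
  have {H2}: (fun k => \int[mu]_(x in Dr zeta rho) (du j x ^+ 2 * (d1 beta (w k x) - d1 beta (u x))
    ^+ 2)) @ \oo --> (0 : R).
    apply: H2 => k x _; rewrite sqr_ge0 -real_normK ?num_real//=.
    by rewrite lerXn2r ?nnegrE ?normr_ge0 ?mulr_ge0.
  move=> H3; have := cvg_comp _ _ H3 (@sqrt_continuous R 0); rewrite sqrtr0.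
  rewrite (_ : Num.sqrt \o _ = fun k => N2 mu (Dr zeta rho) (B k)); first exact.
  apply/funext => k /=; rewrite /N2; congr Num.sqrt; apply: eq_Rintegral => x _.
  by rewrite /B exprMn mulrC.
have lim : (fun k => C * N2 mu (Dr zeta rho) (fun x =>
  'D_(ee j) (w k) x - du j x) + N2 mu (Dr zeta rho) (B k)) @ \oo --> (0 : R).
  by rewrite -[X in _ --> X](addr0 0); apply: cvgD; [exact: limA|exact: limB].
apply: (squeeze_cvgr _ (cvg_cst 0) lim); apply: nearW => k; rewrite N2_ge0 /=.
rewrite (_ : N2 _ _ _ = N2 mu (Dr zeta rho) (fun x => A k x + B k x)); last first.
  by congr (N2 _ _); apply/funext => x; rewrite DE /A /B; ring.
apply: le_trans (N2D mD (lA k) (lB k)) _; apply: lerD => //.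
rewrite -[X in _ <= X * _](ger0_norm C0) -(N2Z mD C (lB0 k)).
apply: (N2_le mD (lA k) (L2Z mD C (lB0 k))) => x _.
by rewrite !normrM (ger0_norm C0); apply: ler_wpM2r.
Qed.

(** Uniform closeness of values and gradients on R^d becomes L^2 closeness on each bounded piece of
    the domain after extension constant in x_n. *)
Lemma appr_hpart (psi : 'rV[R]_d -> R) : continuous psi ->
  (forall j, continuous (fun y => 'D_(ee j) psi y)) ->
  (forall e : R, 0 < e -> exists h : 'rV[R]_d -> R,
    [/\ smooth h, forall x, `|h x - psi x| <= e &
     forall x i, `|'D_(ee i) h x - 'D_(ee i) psi x| <= e]) ->
  appr (fun x => psi (hpart x)) (fun j x => 'D_(ee j) (fun x => psi (hpart x)) x).
Proof.
move=> cp cdp ap.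
have chh (g : 'rV[R]_d -> R) : continuous g -> continuous (fun x : 'rV[R]_d.+1 => g (hpart x)).
  by move=> cg; apply: (@cont_comp _ _ _ (fun x : 'rV[R]_d.+1 => hpart x) g);
    [exact: hpart_cont|exact: cg].
have cD j : continuous (fun x : 'rV[R]_d.+1 => 'D_(ee j) (fun x => psi (hpart x)) x).
  move: j; apply: ptP => [|j].
    by under eq_fun do rewrite (derive_hpart_max _ _).2; exact: cont_cst.
  by under eq_fun do rewrite derive_hpart; exact: (chh (fun y => 'D_(ee j) psi y)).
split.
  move=> rho r0; split; first by apply: (Dr_cont_L2 cz zM r0); exact: (chh psi).
  by move=> j; apply: (Dr_cont_L2 cz zM r0); exact: cD.
have hE (k : nat) : exists h : 'rV[R]_d -> R, [/\ smooth h, forall x, `|h x - psi x| <= k.+1%:R^-1 &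
   forall x i, `|'D_(ee i) h x - 'D_(ee i) psi x| <= k.+1%:R^-1].
  by apply: ap; rewrite invr_gt0.
have [h hP] := choice hE.
have sh k : smooth (h k) by case: (hP k).
exists (fun k x => h k (hpart x)); split; first by move=> k; exact: smooth_hpart.
move=> rho r0; have mD := mDr rho.
have l1 : L2 mu (Dr zeta rho) (fun=> 1) by apply: (Dr_cont_L2 cz zM r0); exact: cont_cst.
have lim : (fun k : nat => k.+1%:R^-1 * N2 mu (Dr zeta rho) (fun=> 1)) @ \oo --> (0 : R).
  by rewrite -[X in _ --> X](mul0r (N2 mu (Dr zeta rho) (fun=> 1))); apply: cvgM;
    [exact: cvg_harmonic|exact: cvg_cst].
have gen (W : nat -> 'rV[R]_d.+1 -> R) : (forall k, continuous (W k)) ->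
    (forall k x, `|W k x| <= k.+1%:R^-1) -> (fun k => N2 mu (Dr zeta rho) (W k)) @ \oo --> (0 : R).
  move=> cW Wk; apply: (squeeze_cvgr _ (cvg_cst 0) lim); apply: nearW => k; rewrite N2_ge0 /=.
  have k0 : 0 <= k.+1%:R^-1 :> R by rewrite invr_ge0.
  rewrite -[X in _ <= X * _](ger0_norm k0) -(N2Z mD _ l1).
  apply: (N2_le mD (Dr_cont_L2 cz zM r0 (cW k)) (L2Z mD _ l1)) => x _.
  by rewrite mulr1 (ger0_norm k0).
split.
  apply: (gen (fun k x => h k (hpart x) - psi (hpart x))) => [k|k x]; last by case: (hP k).
  by apply: contB; [exact: (chh (h k) (smooth_cont (sh k)))|exact: (chh psi)].
move=> j; apply: (gen (fun k x => 'D_(ee j) (fun x => h k (hpart x)) x - 'D_(ee j) (fun x =>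
  psi (hpart x)) x)).
  move=> k; apply: contB; last exact: cD.
  exact: smooth_cont (smooth_der j (smooth_hpart (sh k))).
move=> k x; move: j; apply: ptP => [|j].
  by rewrite !(derive_hpart_max _ _).2 subrr normr0.
by rewrite !derive_hpart; have [_ _] := hP k; apply.
Qed.

(** The product of a test function with a smooth approximant of u is again a test function. Each
    term of the resulting identity is an L^2 pairing, so the limit may be taken. *)
Lemma divid_mul (F : 'I_d.+1 -> 'rV[R]_d.+1 -> R) (G u : 'rV[R]_d.+1 -> R) du :
  (forall rho j, 0 < rho -> L2 mu (Dr zeta rho) (F j)) ->
  (forall rho, 0 < rho -> L2 mu (Dr zeta rho) G) -> divid zeta F G -> appr u du ->
  divid zeta (fun j x => F j x * u x) (fun x => G x * u x + \sum_j F j x * du j x).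
Proof.
move=> lF lG dFG [lu [w [sw wc]]] phi tphi.
have [r _ sr] := test_supp tphi; have [rho r0 hr] := @cube_cyl R d r.
have mD := mDr rho.
have out (f : 'rV[R]_d.+1 -> R) : supported r f -> forall x, Om x -> ~ cyl rho x -> f x = 0.
  move=> sf x _ /negP; rewrite /cyl/= -leNgt => /hr n; apply: sf => xr; apply: n => j.
  by rewrite mxE; exact: xr.
have sdr j : supported r (fun x => 'D_(ee j) phi x) by exact: (supported_derive (ee j) sr).
have OmD (f g : 'rV[R]_d.+1 -> R) : supported r g ->
    \int[mu]_(x in Om) (f x * g x) = \int[mu]_(x in Dr zeta rho) (f x * g x).
  by move=> sg; apply: Om_Dr => x xO xc; rewrite (out _ sg x xO xc) mulr0.
have [l1 l2] := lu _ r0; have [c1 c2] := wc _ r0.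
have lw k : L2 mu (Dr zeta rho) (w k) by apply: (Dr_cont_L2 cz zM r0); exact: smooth_cont.
have ldw k j : L2 mu (Dr zeta rho) (fun x => 'D_(ee j) (w k) x).
  by apply: (Dr_cont_L2 cz zM r0); exact: smooth_cont (smooth_der j (sw k)).
have Lb (f : 'rV[R]_d.+1 -> R) psi : L2 mu (Dr zeta rho) f -> test_fun Om psi ->
  L2 mu (Dr zeta rho) (fun x => f x * psi x).
  move=> lf tp; have [C _ hC] := test_bounded tp; under eq_fun do rewrite mulrC.
  apply: (L2Mb mD _ (fun x _ => hC x) lf).
  by apply: measurable_funTS; exact: continuous_measurable_rV (test_cont tp).
have td j : test_fun Om (fun x => 'D_(ee j) phi x) by exact: test_der.
have lFd j := Lb _ _ (lF rho j r0) (td j).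
have lFp j := Lb _ _ (lF rho j r0) tphi.
have lGp := Lb _ _ (lG rho r0) tphi.
pose a k := \sum_j (\int[mu]_(x in Dr zeta rho) (F j x * 'D_(ee j) phi x * w k x) +
   \int[mu]_(x in Dr zeta rho) (F j x * phi x * 'D_(ee j) (w k) x)) +
   \int[mu]_(x in Dr zeta rho) (G x * phi x * w k x).
have a0 k : a k = 0.
  have := dFG _ (test_mulr tphi (sw k)).
  have DE j x : 'D_(ee j) (fun x =>
    phi x * w k x) x = 'D_(ee j) phi x * w k x + phi x * 'D_(ee j) (w k) x.
    have := @deriveM _ _ phi (w k) x (ee j) (@smooth_drv _ _ _ j x (test_smooth tphi)) (@smooth_drv
      _ _ _ j x (sw k)).
    rewrite /GRing.scale/= => H; rewrite [LHS]H addrC; congr (_ + _); exact: mulrC.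
  have E1 j : \int[mu]_(x in Omega zeta) (F j x * 'D_(ee j) (fun x => phi x * w k x) x) =
     \int[mu]_(x in Dr zeta rho) (F j x * 'D_(ee j) phi x * w k x) +
     \int[mu]_(x in Dr zeta rho) (F j x * phi x * 'D_(ee j) (w k) x).
    rewrite OmD; last by apply: (supported_derive (ee j)) => x nx; rewrite sr// mul0r.
    rewrite -(RintegralD mD (L2_intM mD (lFd j) (lw k)) (L2_intM mD (lFp j) (ldw k j))).
    by apply: eq_Rintegral => x _; rewrite DE mulrDr !mulrA.
  rewrite (eq_bigr _ (fun j _ => E1 j)) /a => ->.
  rewrite OmD; last by move=> x nx; rewrite sr// mul0r.
  by under eq_Rintegral do rewrite mulrA; rewrite addNr.
have lim : a @ \oo --> \sum_j (\int[mu]_(x in Dr zeta rho) (F j x * 'D_(ee j) phi x * u x) +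
   \int[mu]_(x in Dr zeta rho) (F j x * phi x * du j x)) +
   \int[mu]_(x in Dr zeta rho) (G x * phi x * u x).
  apply: cvgD; last exact: (N2_lim mD lGp l1 lw c1).
  apply: cvg_big => [|j _]; first exact: add_continuous.
  apply: cvgD; first exact: (N2_lim mD (lFd j) l1 lw c1).
  exact: (N2_lim mD (lFp j) (l2 j) (fun k => ldw k j) (c2 j)).
have e0 : \sum_j (\int[mu]_(x in Dr zeta rho) (F j x * 'D_(ee j) phi x * u x) +
   \int[mu]_(x in Dr zeta rho) (F j x * phi x * du j x)) +
   \int[mu]_(x in Dr zeta rho) (G x * phi x * u x) = 0.
  apply: (@cvg_unique _ (@Rhausdorff R) _ _ _ _ lim).
  by rewrite (_ : a = fun=> 0); [exact: cvg_cst|exact/funext].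
have iFp j := L2_intM mD (lFp j) (l2 j); have iGp := L2_intM mD lGp l1.
have iS := @intg_sum _ _ _ mu _ (index_enum 'I_d.+1) xpredT _ _ mD (fun j _ => iFp j).
rewrite OmD //.
rewrite (_ : \int[mu]_(x in Dr zeta rho) _ = \int[mu]_(x in Dr zeta rho) (G x * phi x * u x +
  \sum_j F j x * phi x * du j x)); last first.
  apply: eq_Rintegral => x _; rewrite mulrDl mulr_suml mulrAC; congr (_ + _); apply: eq_bigr => j _.
  exact: mulrAC.
rewrite (RintegralD mD iGp iS) (@Rintegral_sum _ _ _ mu _ (index_enum 'I_d.+1) xpredT _ _ mD (fun j
  _ => iFp j)).
have E2 j : \int[mu]_(x in Omega zeta) (F j x * u x * 'D_(ee j) phi x) =
   \int[mu]_(x in Dr zeta rho) (F j x * 'D_(ee j) phi x * u x).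
  by rewrite OmD; [apply: eq_Rintegral => x _; exact: mulrAC|exact: sdr].
rewrite (eq_bigr _ (fun j _ => E2 j)); apply/eqP; rewrite -subr_eq0 opprK addrA.
by rewrite addrAC -big_split/= e0.
Qed.

End zeta.
End approximation.

(** * Decay at infinity *)

Section horizontal.
Context {R : realType} {d : nat}.
Local Notation lam := (@lebesgue_measure R).
Local Notation mu := (leb d.+1).
Notation ee i := (delta_mx 0 i : 'rV[R]_ _).

Lemma cont_shift n (c : 'rV[R]_n) : continuous (fun y : 'rV[R]_n => y + c).
Proof.
apply: cont_to_rV => j; rewrite (_ : (fun y => _) = fun y : 'rV[R]_n => y 0 j + c 0 j).
  by apply: contD; [exact: cont_coord|exact: cont_cst].
by apply/funext => y; rewrite mxE.
Qed.

Lemma cont_ray n (y e : 'rV[R]_n) : continuous (fun t : R => y + t *: e).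
Proof.
apply: cont_to_rV => j; rewrite (_ : (fun t => _) = fun t : R => y 0 j + t * e 0 j).
  apply: contD; first exact: cont_cst.
  by apply: contM; [move=> t; exact: cvg_id|exact: cont_cst].
by apply/funext => t; rewrite !mxE.
Qed.

Lemma nice_bounded (eta : 'rV[R]_d -> R) : nice eta -> exists C, forall y, `|eta y| <= C.
Proof.
move=> [f1 [f2 [d1 d2 E]]].
exists (\int[leb d]_xi `|f1 xi| + \int[leb d]_xi `|f2 xi|) => y; rewrite E.
apply: le_trans (ler_normD _ _) _; apply: lerD; apply: trig_bound.
  exact: (decay_intg d1).
exact: (decay_intg d2).
Qed.

Lemma test_cutoff (r : R) : 0 < r -> test_fun setT (cutoff r : 'rV[R]_d -> R).
Proof.
move=> r0; apply: (@mk_test _ _ _ (cube d (2 * r))) => //.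
- exact: smooth_cutoff.
- exact: compact_cube.
move=> x nx; apply: cutoff0 => //; rewrite leNgt; apply/negP => sx; apply: nx => i.
rewrite -(@ler_pXn2r _ 2)// ?nnegrE ?mulr_ge0 ?(ltW r0)// real_normK ?num_real//.
apply: le_trans (coord_sqnorm x i) _; apply: le_trans (ltW sx) _.
by rewrite exprMn ler_wpM2r ?sqr_ge0// expr2; lra.
Qed.

Lemma hpart_intg (zeta : 'rV[R]_d -> R) (M : R) (g : 'rV[R]_d -> R) : continuous zeta ->
  (forall y, 0 < zeta y <= M) -> intg (leb d) setT g -> (forall y, 0 <= g y) ->
  intg mu (Omega zeta) (fun x => g (hpart x)) /\
  \int[mu]_(x in Omega zeta) g (hpart x) = \int[leb d]_y (zeta y * g y).
Proof.
move=> cz zM gi g0.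
have mz : measurable_fun setT zeta by exact: continuous_measurable_rV.
have mO := Omega_meas mz; have mg := intg_meas gi.
have mgh : measurable_fun (Omega zeta) (fun x : 'rV[R]_d.+1 => g (hpart x)).
  by apply: measurable_funTS; apply: (measurableT_comp mg); exact: hpart_meas.
have E : (\int[mu]_(x in Omega zeta) (g (hpart x))%:E = \int[leb d]_y (zeta y * g y)%:E)%E.
  rewrite int_slices //; last 2 first.
  - exact/measurable_EFinP.
  - by move=> x _; rewrite lee_fin.
  apply: eq_integral => y _; rewrite slice_Om.
  under eq_integral do rewrite hpart_pt.
  have /andP[z0 _] := zM y.
  by rewrite integral_cst//= lebesgue_measure_itv/= lte_fin z0 -EFinB subr0 -EFinM mulrC.
have zgi : intg (leb d) setT (fun y => zeta y * g y).
  apply: (@intgMb _ _ _ _ _ _ _ M) => // y _.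
  by have /andP[z0 z1] := zM y; rewrite gtr0_norm.
split.
  apply/intg_ge0P => //; rewrite E; apply/intg_ge0P => //; last 1 first.
  - by move=> y _; rewrite mulr_ge0//; have /andP[/ltW] := zM y.
  exact: intg_meas zgi.
by rewrite /Rintegral E.
Qed.

Lemma hpart_L2 (zeta : 'rV[R]_d -> R) (M : R) (g : 'rV[R]_d -> R) : continuous zeta ->
  (forall y, 0 < zeta y <= M) -> L2 (leb d) setT g ->
  L2 mu (Omega zeta) (fun x => g (hpart x)) /\
  N2 mu (Omega zeta) (fun x => g (hpart x)) <= Num.sqrt M * N2 (leb d) setT g.
Proof.
move=> cz zM [mg gi].
have mz : measurable_fun setT zeta by exact: continuous_measurable_rV.
have [gh E] := hpart_intg cz zM gi (fun y => sqr_ge0 (g y)).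
have M0 : 0 <= M by have /andP[] := zM 0; lra.
split.
  by split => //; apply: measurable_funTS; apply: (measurableT_comp mg); exact: hpart_meas.
rewrite -(@ler_pXn2r _ 2)// ?nnegrE ?mulr_ge0 ?N2_ge0 ?sqrtr_ge0// exprMn (sqr_sqrtr M0) !N2_sq E.
rewrite -(RintegralZl _ measurableT gi).
apply: le_Rintegral => //.
- apply: (@intgMb _ _ _ _ _ _ _ M) => // y _.
  by have /andP[z0 z1] := zM y; rewrite gtr0_norm.
- exact: (intgZ _ measurableT gi).
by move=> y _; rewrite ler_wpM2r ?sqr_ge0//; have /andP[_] := zM y.
Qed.

Lemma N2_tail n (D : set 'rV[R]_n) (f : 'rV[R]_n -> R) (i : 'I_n) : measurable D ->
  L2 (leb n) D f ->
  (forall k : nat, L2 (leb n) D (fun x => (if k%:R / 2 <= `|x 0 i| then 1 else 0) * f x)) /\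
  (fun k : nat => N2 (leb n) D (fun x =>
    (if k%:R / 2 <= `|x 0 i| then 1 else 0) * f x)) @ \oo --> (0 : R).
Proof.
move=> mD lf; have [mf fi] := lf.
have mt (k : nat) (A : set 'rV[R]_n) : measurable_fun A (fun x : 'rV[R]_n =>
  if k%:R / 2 <= `|x 0 i| then 1 else 0 : R).
  apply: measurable_funTS.
  rewrite (_ : (fun x => _) = (fun b : bool => if b then 1 else 0 : R) \o (fun x : 'rV[R]_n =>
    k%:R / 2 <= `|x 0 i|)) //.
  apply: measurableT_comp => //; apply: measurable_fun_ler => //.
  by apply: measurableT_comp => //; exact: coord_meas.
have tb (k : nat) (x : 'rV[R]_n) : `|(if k%:R / 2 <= `|x 0 i| then 1 else 0 : R)| <= 1.
  by case: ifP; rewrite ?normr1 ?normr0.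
have l k := L2Mb mD (mt k D) (fun x _ => tb k x) lf.
split => //.
have c : (fun k : nat => \int[leb n]_(x in D) ((if k%:R / 2 <= `|x 0 i| then 1 else 0) * f x) ^+ 2)
  @ \oo --> (0 : R).
  rewrite -[X in _ --> X](_ : \int[leb n]_(x in D) (0 : R) = 0);
    last by rewrite Rintegral_cst ?mul0r.
  have mF (k : nat) : measurable_fun D (fun x : 'rV[R]_n =>
    ((if k%:R / 2 <= `|x 0 i| then 1 else 0) * f x) ^+ 2).
    by apply: measurable_funX; apply: measurable_funM => //; exact: mt.
  apply: (@Rdct _ _ _ (leb n) D (fun (k : nat) (x : 'rV[R]_n) =>
    ((if k%:R / 2 <= `|x 0 i| then 1 else 0) * f x) ^+ 2) _ (fun x => f x ^+ 2) mD).
  - exact: mF.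
  - exact: fi.
  - move=> k x _; rewrite normrX -[leRHS]real_normK ?num_real//.
    rewrite lerXn2r ?nnegrE ?normr_ge0// normrM -[leRHS]mul1r; apply: ler_wpM2r;
      first exact: normr_ge0.
    exact: tb.
  move=> x Dx; apply: cvg_near_cst; near=> k.
  rewrite ifF ?mul0r ?expr0n//; apply/negbTE; rewrite -ltNge.
  have : 2 * `|x 0 i| + 1 <= k%:R by near: k; exact: nbhs_infty_ger.
  by have := normr_ge0 (x 0 i); lra.
have := cvg_comp _ _ c (@sqrt_continuous R 0); rewrite sqrtr0; exact.
Unshelve. all: by end_near. Qed.

(** A translate by k escapes to infinity. Where |x_i| >= k/2 the tail of f is small; elsewhere the
    translated argument has i-th coordinate at least k/2 in absolute value, and the tail of g is
    small. *)
Lemma translate_cvg0 (zeta : 'rV[R]_d -> R) (M : R) (f : 'rV[R]_d.+1 -> R) (g : 'rV[R]_d -> R)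
    (i : 'I_d) (s : R) : continuous zeta -> (forall y, 0 < zeta y <= M) ->
  `|s| = 1 -> L2 mu (Omega zeta) f -> L2 (leb d) setT g ->
  (fun k : nat => \int[mu]_(x in Omega zeta) (f x * g (hpart x + (s * k%:R) *: ee i))) @ \oo --> (0
    : R).
Proof.
move=> cz zM s1 lf lg.
have mz : measurable_fun setT zeta by exact: continuous_measurable_rV.
have mO := Omega_meas mz.
pose I := lift ord_max i.
have [lft cft] := N2_tail I mO lf; have [lgt cgt] := N2_tail i measurableT lg.
pose gs k := fun y : 'rV[R]_d => g (y + (s * k%:R) *: ee i).
have lgs k : L2 (leb d) setT (gs k) by exact: L2_shift.
pose ft (k : nat) (x : 'rV[R]_d.+1) := (if k%:R / 2 <= `|x 0 I| then 1 else 0) * f x.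
pose gt (k : nat) (y : 'rV[R]_d) := (if k%:R / 2 <= `|y 0 i| then 1 else 0) * g y.
pose gts k := fun y : 'rV[R]_d => gt k (y + (s * k%:R) *: ee i).
have lgts k : L2 (leb d) setT (gts k) by exact: (L2_shift _ (lgt k)).
have [C [lim b]] : exists C : R,
   (fun k => N2 mu (Omega zeta) (ft k) * C + N2 mu (Omega zeta) f * (Num.sqrt M * N2 (leb d) setT
     (gt k))) @ \oo --> (0 : R) /\
   forall k, `|\int[mu]_(x in Omega zeta) (f x * gs k (hpart x))| <=
     N2 mu (Omega zeta) (ft k) * C + N2 mu (Omega zeta) f * (Num.sqrt M * N2 (leb d) setT (gt k)).
  exists (Num.sqrt M * N2 (leb d) setT g); split.
    rewrite -[X in _ --> X](_ : 0 * (Num.sqrt M * N2 (leb d) setT g) +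
      N2 mu (Omega zeta) f * (Num.sqrt M * 0) = 0); last by rewrite !mulr0 mul0r addr0.
    apply: cvgD; first by apply: cvgM; [exact: cft|exact: cvg_cst].
    apply: cvgM; first exact: cvg_cst.
    by apply: cvgM; [exact: cvg_cst|exact: cgt].
  move=> k.
  have [l1 n1] := hpart_L2 cz zM (lgs k); have [l2 n2] := hpart_L2 cz zM (lgts k).
  have E1 : N2 (leb d) setT (gs k) = N2 (leb d) setT g by exact: (N2_shift _ lg).
  have E2 : N2 (leb d) setT (gts k) = N2 (leb d) setT (gt k) by exact: (N2_shift _ (lgt k)).
  rewrite E1 in n1; rewrite E2 in n2.
  have i1 := L2_intM mO (lft k) l1; have i2 := L2_intM mO lf l2.
  have a1 := intg_abs mO i1; have a2 := intg_abs mO i2.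
  apply: (@le_trans _ _ (\int[mu]_(x in Omega zeta) (`|ft k x * gs k (hpart x)| + `|f x * gts k
    (hpart x)|))).
    apply: (ler_norm_Rint mO (L2_intM mO lf l1) (intgD mO a1 a2)) => x _.
    rewrite /ft; case: ifP => [_|h]; first by rewrite mul1r lerDl.
    rewrite mul0r mul0r normr0 add0r /gts /gt.
    rewrite ifT ?mul1r//.
    have -> : (hpart x + (s * k%:R) *: ee i) 0 i = x 0 I + s * k%:R.
      by rewrite !mxE !eqxx /= mulr1.
    move: h => /negbT; rewrite -ltNge => h.
    have := lerB_normD (s * k%:R) (x 0 I).
    rewrite [s * k%:R + x 0 I]addrC normrM s1 mul1r (ger0_norm (ler0n _ k)).
    lra.
  rewrite (RintegralD mO a1 a2); apply: lerD.
    apply: le_trans (CS mO (lft k) l1) _; apply: ler_wpM2l => //; exact: N2_ge0.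
  apply: le_trans (CS mO lf l2) _; apply: ler_wpM2l => //; exact: N2_ge0.
apply: norm_cvg0; apply: (squeeze_cvgr _ (cvg_cst 0) lim); apply: nearW => k.
by rewrite normr_ge0 b.
Qed.

(** Cauchy-Schwarz along the segment from y to y + a e_i bounds the square of the difference by |a|
    times an integral of (d_i eta)^2; integration in y and translation invariance finish. No
    integrability of [eta] itself enters. *)
Lemma shift_L2 (eta : 'rV[R]_d -> R) (i : 'I_d) (a : R) : continuous eta ->
  (forall x, derivable eta x (ee i)) -> continuous (fun x => 'D_(ee i) eta x) ->
  L2 (leb d) setT (fun x => 'D_(ee i) eta x) ->
  L2 (leb d) setT (fun y => eta (y + a *: ee i) - eta y).
Proof.
move=> ce de cde [_ li].
pose I := [set` `]Num.min a 0, Num.max a 0[] : set R.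
have csh : continuous (fun y : 'rV[R]_d => eta (y + a *: ee i)).
  clear de cde li.
  apply: (@cont_comp _ _ _ (fun y : 'rV[R]_d => y + a *: ee i) eta); last exact: ce.
  exact: cont_shift.
have cd : continuous (fun y : 'rV[R]_d => eta (y + a *: ee i) - eta y) by exact: contB.
have md := continuous_measurable_rV cd; split => //.
(* The parameter along the segment is stored as the last coordinate, so that [tonelli] and
   [tonelli_sym] exchange it with y. *)
pose g (x : 'rV[R]_d.+1) : R := \1_I (vpart x) * ('D_(ee i) eta (hpart x + vpart x *: ee i)) ^+ 2.
have cl : continuous (fun x : 'rV[R]_d.+1 => hpart x + vpart x *: ee i).
  apply: cont_to_rV => j; rewrite (_ : (fun x => _) = fun x : 'rV[R]_d.+1 =>
    x 0 (lift ord_max j) + vpart x * ee i 0 j); last first.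
    by apply/funext => x; rewrite !mxE.
  apply: contD; first exact: cont_coord.
  by apply: contM; [exact: vpart_cont|exact: cont_cst].
have mI : measurable I by exact: measurable_itv.
have mg : measurable_fun setT g.
  apply: measurable_funM.
    by apply: (measurableT_comp (measurable_indic mI)); exact: vpart_meas.
  apply: measurable_funX; apply: continuous_measurable_rV.
  exact: (@cont_comp _ _ _ (fun x : 'rV[R]_d.+1 => hpart x + vpart x *: ee i) (fun x =>
    'D_(ee i) eta x) cl cde).
have g0 x : 0 <= g x by rewrite /g mulr_ge0 ?sqr_ge0// indicE.
have mgE : measurable_fun setT (fun x => (g x)%:E) by exact/measurable_EFinP.
have gE0 x : (0 <= (g x)%:E)%E by rewrite lee_fin.
apply/intg_ge0P; first exact: measurable_funX.
  by move=> y _; exact: sqr_ge0.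
have m2 : measurable_fun setT (fun y : 'rV[R]_d => ((eta (y + a *: ee i) - eta y) ^+ 2)%:E).
  by apply/measurable_EFinP; exact: measurable_funX.
have mS := measurable_int_slice mgE gE0.
apply: (@le_lt_trans _ _ ((`|a|)%:E * \int[leb d]_y \int[lam]_t (g (pt y t))%:E)%E).
  rewrite -ge0_integralZl//; last first.
    by move=> y _; apply: integral_ge0 => t _.
  apply: ge0_le_integral => //.
  - by move=> y _; rewrite lee_fin sqr_ge0.
  - by apply: emeasurable_funM.
  move=> y _.
  pose F (t : R) := eta (y + t *: ee i).
  have dF t : derivable F t 1 by apply/derivable_line; exact: de.
  have DF t : 'D_1 F t = 'D_(ee i) eta (y + t *: ee i) by rewrite derive_line.
  have cDF : continuous (fun t => 'D_1 F t).
    rewrite (funext DF); apply: (@cont_comp _ _ _ (fun t : R => y + t *: ee i) (fun x =>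
      'D_(ee i) eta x)) => //.
    exact: cont_ray.
  have := @slice_ineq R F a 0 dF cDF; clear dF.
  rewrite {1 2}/F scale0r addr0 subr0 -lee_fin => /le_trans; apply; rewrite EFinM.
  apply: lee_wpmul2l; first by rewrite lee_fin.
  have c2 : continuous (fun t => 'D_1 F t ^+ 2).
    by under eq_fun do rewrite expr2; apply: contM; exact: cDF.
  have m4 : measurable ([set` `]Num.min a 0, Num.max a 0[] : set (measurableTypeR R)) by [].
  have m5 : measurable ([set` `[Num.min a 0, Num.max a 0]] : set (measurableTypeR R)) by [].
  have i4 : @intg _ (measurableTypeR R) R lam `]Num.min a 0, Num.max a 0[ (fun t => 'D_1 F t ^+ 2).
    refine (@integrableS _ (measurableTypeR R) R lam _ _ _ m5 m4 _ (intg_itv_cont _ _ c2)).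
    by move=> u /=; rewrite !in_itv/= => /andP[/ltW -> /ltW ->].
  rewrite -(EFin_Rint m4 i4) integral_mkcond le_eqVlt; apply/orP; left; apply/eqP.
  apply: eq_integral => t _; rewrite /g !patchE vpart_pt hpart_pt DF indicE.
  by rewrite -/I; case: ifP => _; rewrite ?mul1r ?mul0r.
rewrite -(tonelli mgE gE0) (tonelli_sym mgE gE0); clear de.
have E t : (\int[leb d]_y (g (pt y t))%:E = (\1_I t)%:E * (\int[leb d]_y ('D_(ee i) eta y ^+
  2)%:E))%E.
  under eq_integral do rewrite /g vpart_pt hpart_pt EFinM.
  have mq : measurable_fun setT (fun y : 'rV[R]_d => ('D_(ee i) eta (y + t *: ee i) ^+ 2)%:E).
    apply/measurable_EFinP; apply: measurable_funX.
    have mcde := continuous_measurable_rV cde.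
    by apply: (measurableT_comp mcde); exact: measurable_shift.
  have q0 (y : 'rV[R]_d) : setT y -> (0 <= ('D_(ee i) eta (y + t *: ee i) ^+ 2)%:E)%E.
    by move=> _; rewrite lee_fin; exact: sqr_ge0.
  have k0 : (0 <= (\1_I t : R)%:E)%E by rewrite lee_fin indicE.
  rewrite (@ge0_integralZl _ _ R (leb d) setT measurableT _ mq _ q0 k0).
  have ms : measurable_fun setT (fun y : 'rV[R]_d => ('D_(ee i) eta y ^+ 2)%:E).
    by apply/measurable_EFinP; apply: measurable_funX; exact: continuous_measurable_rV.
  have ps (y : 'rV[R]_d) : (0 <= ('D_(ee i) eta y ^+ 2)%:E)%E by rewrite lee_fin; exact: sqr_ge0.
  have := @ge0_integral_shift_rV R d (fun y => ('D_(ee i) eta y ^+ 2)%:E) (t *: ee i) ms ps.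
  move=> ->; exact: erefl.
under eq_integral do rewrite E.
rewrite (EFin_Rint measurableT li); set A := \int[leb d]_y _.
have m1 : measurable_fun (setT : set (measurableTypeR R)) (fun t : measurableTypeR R =>
  (\1_I t : R)%:E).
  by apply/measurable_EFinP; exact: measurable_indic.
have p1 (t : measurableTypeR R) : setT t -> (0 <= (\1_I t : R)%:E)%E by move=> _;
  rewrite lee_fin indicE.
have A0 : (0 <= A%:E)%E by rewrite lee_fin; apply: Rintegral_ge0 => y _; exact: sqr_ge0.
rewrite (@ge0_integralZr _ (measurableTypeR R) R lam setT measurableT _ m1 _ p1 A0).
have [r rE] : exists r : R, lam I = r%:E.
  rewrite /I lebesgue_measure_itv/= lte_fin; case: ifP => _; last by exists 0.
  by exists (Num.max a 0 - Num.min a 0); rewrite EFinB.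
have -> : (\int[lam]_x (\1_I x)%:E = r%:E)%E.
  by rewrite -rE; have := @integral_indic _ (measurableTypeR R) R lam setT measurableT I mI;
    rewrite setIT.
by rewrite -!EFinM ltry.
Qed.

End horizontal.

(** * Horizontal cutoffs, second differences and mean curvature *)

Section decay_at_infinity.
Context {R : realType} {d : nat}.
Local Notation mu := (leb d.+1).
Notation ee i := (delta_mx 0 i : 'rV[R]_ _).
Local Notation chi k := (cutoff k.+1%:R).

Section cut.
Context dd (T : measurableType dd) (nu : {measure set T -> \bar R}) (D : set T).
Variable h : T -> 'rV[R]_d.
Hypotheses (mD : measurable D) (mh : forall g : 'rV[R]_d -> R, continuous g ->
  measurable_fun D (fun x => g (h x))).

Lemma cutoff_cvg1 (y : 'rV[R]_d) : (fun k : nat => chi k y) @ \oo --> (1 : R).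
Proof.
apply: cvg_near_cst; near=> k; apply: cutoff1 => //.
have : sqnorm y <= k%:R by near: k; exact: nbhs_infty_ger.
move=> /le_trans; apply; rewrite -natrX ler_nat expnS expn1.
by apply: (@leq_trans k.+1) => //; rewrite leq_pmulr.
Unshelve. all: by end_near. Qed.

(** The map [h] will be the horizontal projection for integrals over the fluid domain and the
    identity for integrals over R^d. *)
Lemma cutoff_cvg (f : T -> R) : intg nu D f ->
  (fun k : nat => \int[nu]_(x in D) (f x * chi k (h x))) @ \oo --> \int[nu]_(x in D) f x.
Proof.
move=> fi.
apply: (@Rdct _ _ _ nu D (fun (k : nat) x => f x * chi k (h x)) f (fun x => `|f x|) mD).
- move=> k; apply: measurable_funM; first exact: intg_meas fi.
  exact: (mh (smooth_cont (@smooth_cutoff R d k.+1%:R))).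
- exact: intg_abs.
- move=> k x _; rewrite normrM -[leRHS]mulr1; apply: ler_wpM2l; first exact: normr_ge0.
  by rewrite ger0_norm ?cutoff_ge0// cutoff_le1.
move=> x _; rewrite -[X in _ --> X]mulr1; apply: cvgM; first exact: cvg_cst.
exact: cutoff_cvg1.
Qed.

(** The gradient of the cutoff is O(1/k) everywhere, so an integrable flux has no contribution at
    infinity. *)
Lemma cutoff_der_cvg (f : T -> R) (j : 'I_d) : intg nu D f ->
  (fun k : nat => \int[nu]_(x in D) (f x * 'D_(ee j) (chi k) (h x))) @ \oo --> (0 : R).
Proof.
move=> fi; have [C C0 hC] := @derive_cutoff R d.
have a := intg_abs mD fi.
have lim : (fun k : nat => C * k.+1%:R^-1 * \int[nu]_(x in D) `|f x|) @ \oo --> (0 : R).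
  rewrite -[X in _ --> X](_ : C * 0 * \int[nu]_(x in D) `|f x| = 0); last by rewrite mulr0 mul0r.
  by apply: cvgM; [apply: cvgM; [exact: cvg_cst|exact: cvg_harmonic]|exact: cvg_cst].
have b k x : `|'D_(ee j) (chi k) (h x)| <= C * k.+1%:R^-1 by apply: hC; rewrite ltr0n.
have md k : measurable_fun D (fun x => 'D_(ee j) (chi k) (h x)).
  exact: (mh (smooth_cont (smooth_der j (@smooth_cutoff R d k.+1%:R)))).
apply: norm_cvg0; apply: (squeeze_cvgr _ (cvg_cst 0) lim); apply: nearW => k; rewrite normr_ge0 /=.
rewrite -(RintegralZl _ mD a).
apply: (ler_norm_Rint mD _ (intgZ _ mD a)) => [|x Dx].
  under eq_fun do rewrite mulrC.
  exact: (intgMb mD (md k) (fun x _ => b k x) fi).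
rewrite normrM mulrC; apply: ler_wpM2r; first exact: normr_ge0.
exact: b.
Qed.

End cut.

Definition C1f (f : 'rV[R]_d -> R) := [/\ continuous f, forall i x, derivable f x (ee i) &
  forall i, continuous (fun x => 'D_(ee i) f x)].

Lemma C1f_cont f : C1f f -> continuous f.
Proof. by case. Qed.

Lemma C1f_dcont f i : C1f f -> continuous (fun x => 'D_(ee i) f x).
Proof. case=> _ _; exact. Qed.

Lemma C1fM f g : C1f f -> C1f g -> C1f (fun x => f x * g x) /\
  forall i x, 'D_(ee i) (fun x => f x * g x) x = 'D_(ee i) f x * g x + f x * 'D_(ee i) g x.
Proof.
move=> [cf df cdf] [cg dg cdg].
have E i x : 'D_(ee i) (fun x => f x * g x) x = 'D_(ee i) f x * g x + f x * 'D_(ee i) g x.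
  have := @deriveM _ _ f g x (ee i) (df i x) (dg i x).
  rewrite /GRing.scale/= => H; rewrite [LHS]H addrC; congr (_ + _); exact: mulrC.
split; last exact: E.
split.
- by apply: contM; [exact: cf|exact: cg].
- move=> i x; exact: (@derivableM _ _ f g x (ee i) (df i x) (dg i x)).
move=> i; rewrite (funext (E i)); apply: contD; apply: contM.
- exact: cdf.
- exact: cg.
- exact: cf.
exact: cdg.
Qed.

Lemma C1fB f g : C1f f -> C1f g -> C1f (fun x => f x - g x) /\
  forall i x, 'D_(ee i) (fun x => f x - g x) x = 'D_(ee i) f x - 'D_(ee i) g x.
Proof.
move=> [cf df cdf] [cg dg cdg].
have E i x : 'D_(ee i) (fun x => f x - g x) x = 'D_(ee i) f x - 'D_(ee i) g x.
  exact: (@deriveB _ _ _ f g x (ee i) (df i x) (dg i x)).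
split; last exact: E.
split.
- by apply: contB; [exact: cf|exact: cg].
- move=> i x; exact: (@derivableB _ _ _ f g x (ee i) (df i x) (dg i x)).
by move=> i; rewrite (funext (E i)); apply: contB; [exact: cdf|exact: cdg].
Qed.

Lemma C1f_cst c : C1f (fun=> c).
Proof.
split; first exact: cont_cst.
  by move=> i x; exact: derivable_cst.
move=> i; have -> : (fun x : 'rV[R]_d => 'D_(ee i) (fun=> c) x) = (fun=> 0 : R).
  by apply/funext => x; rewrite derive_cst.
exact: (@cont_cst R 'rV[R]_d 0).
Qed.

Lemma C1fD f g : C1f f -> C1f g -> C1f (fun x => f x + g x) /\
  forall i x, 'D_(ee i) (fun x => f x + g x) x = 'D_(ee i) f x + 'D_(ee i) g x.
Proof.
move=> [cf df cdf] [cg dg cdg].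
have E i x : 'D_(ee i) (fun x => f x + g x) x = 'D_(ee i) f x + 'D_(ee i) g x.
  exact: (@deriveD _ _ _ f g x (ee i) (df i x) (dg i x)).
split; last exact: E.
split.
- by apply: contD; [exact: cf|exact: cg].
- move=> i x; exact: (@derivableD _ _ _ f g x (ee i) (df i x) (dg i x)).
by move=> i; rewrite (funext (E i)); apply: contD; [exact: cdf|exact: cdg].
Qed.

Lemma C1f_sum (I : Type) (s : seq I) (F : I -> 'rV[R]_d -> R) : (forall j, C1f (F j)) ->
  C1f (fun x => \sum_(j <- s) F j x) /\
  forall i x, 'D_(ee i) (fun x => \sum_(j <- s) F j x) x = \sum_(j <- s) 'D_(ee i) (F j) x.
Proof.
move=> cF; elim: s => [|a s [IH1 IH2]].
  split; first by under eq_fun do rewrite big_nil; exact: C1f_cst.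
  move=> i x; rewrite big_nil (_ : (fun x => _) = fun=> 0); first by rewrite derive_cst.
  by apply/funext => y; rewrite big_nil.
have E : (fun x => \sum_(j <- a :: s) F j x) = fun x => F a x + \sum_(j <- s) F j x.
  by apply/funext => x; rewrite big_cons.
have [h1 h2] := C1fD (cF a) IH1.
by rewrite E; split => // i x; rewrite h2 IH2 big_cons.
Qed.

Lemma C1f_comp (phi : R -> R) f : C1f f -> (forall x, derivable phi (f x) 1) ->
  continuous (fun x => phi (f x)) -> continuous (fun x => 'D_1 phi (f x)) ->
  C1f (fun x => phi (f x)) /\
  forall i x, 'D_(ee i) (fun x => phi (f x)) x = 'D_1 phi (f x) * 'D_(ee i) f x.
Proof.
move=> [cf df cdf] dp cp cdp.
have E i x : derivable (fun x => phi (f x)) x (ee i) /\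
    'D_(ee i) (fun x => phi (f x)) x = 'D_1 phi (f x) * 'D_(ee i) f x.
  exact: (@chain_rule _ _ phi f x (ee i) (df i x) (dp x)).
split; last by move=> i x; case: (E i x).
split; [exact: cp|move=> i x; exact: (E i x).1|].
by move=> i; rewrite (funext (fun x => (E i x).2)); apply: contM; [exact: cdp|exact: cdf].
Qed.

Lemma smooth_C1f f : smooth f -> C1f f.
Proof.
move=> sf; split; first exact: smooth_cont.
  by move=> i x; exact: (@smooth_drv _ _ _ i x sf).
by move=> i; exact: smooth_cont (smooth_der i sf).
Qed.

Lemma cont_test_intg (f c : 'rV[R]_d -> R) : continuous f -> test_fun setT c ->
  intg (leb d) setT (fun x => f x * c x).
Proof.
move=> cf tc; have [r _ sr] := test_supp tc.
apply: (@cont_intg _ _ r); last by move=> x /sr ->; rewrite mulr0.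
by apply: contM; [exact: cf|exact: test_cont tc].
Qed.

Lemma ibp f c i : C1f f -> test_fun setT c ->
  \int[leb d]_x ('D_(ee i) f x * c x) = - \int[leb d]_x (f x * 'D_(ee i) c x).
Proof.
move=> cf tc; have [r _ sr] := test_supp tc.
have [[c1 c2 c3] E] := C1fM cf (smooth_C1f (test_smooth tc)).
have sfc : supported r (fun x => f x * c x) by move=> x /sr ->; rewrite mulr0.
have := @ibp0 R d (fun x => f x * c x) r i c1 (c2 i) (c3 i) sfc.
rewrite (_ : (fun x => 'D_(ee i) (fun x => f x * c x) x) = fun x =>
  'D_(ee i) f x * c x + f x * 'D_(ee i) c x); last first.
  by apply/funext => x; rewrite E.
case: cf => cf df cdf.
rewrite (RintegralD measurableT (cont_test_intg (cdf i) tc) (cont_test_intg cf (test_der i tc))).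
by move/eqP; rewrite addr_eq0 => /eqP.
Qed.

(** The integrand is half of d_i (f^2). Integrated by parts against the cutoffs it leaves f^2, which
    is integrable, times the gradient of the cutoff. *)
Lemma int_self_der f i : C1f f -> L2 (leb d) setT f -> L2 (leb d) setT (fun x => 'D_(ee i) f x) ->
  \int[leb d]_x (f x * 'D_(ee i) f x) = 0.
Proof.
move=> cf lf ldf; have ff := L2_intM measurableT lf ldf.
have mid (g : 'rV[R]_d -> R) : continuous g ->
  measurable_fun setT (fun x => g x) by exact: continuous_measurable_rV.
have l1 := @cutoff_cvg _ _ (leb d) setT (fun x => x) measurableT mid _ ff.
have l2 := @cutoff_der_cvg _ _ (leb d) setT (fun x => x) measurableT mid _ i lf.2.
have [cff E] := C1fM cf cf; have [cf1 cf2 cf3] := cf.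
have e k : \int[leb d]_x (f x * 'D_(ee i) f x * chi k x) =
    - 2^-1 * \int[leb d]_x (f x ^+ 2 * 'D_(ee i) (chi k) x).
  have tk : test_fun setT (chi k : 'rV[R]_d -> R) by apply: test_cutoff; rewrite ltr0n.
  have := ibp i cff tk.
  have i1 : intg (leb d) setT (fun x => f x * 'D_(ee i) f x * chi k x).
    by apply: cont_test_intg => //; apply: contM; [exact: cf1|exact: cf3].
  rewrite (_ : (fun x => 'D_(ee i) (fun x => f x * f x) x * chi k x) = fun x =>
    2 * (f x * 'D_(ee i) f x * chi k x)); last first.
    by apply/funext => x; rewrite E; ring.
  rewrite (RintegralZl _ measurableT i1) => H.
  have -> : \int[leb d]_x (f x ^+ 2 * 'D_(ee i) (chi k) x) = \int[leb d]_x (f x * f x * 'D_(ee i)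
    (chi k) x).
    by under eq_Rintegral do rewrite expr2.
  rewrite mulNr -mulrN -H mulrA mulVf ?mul1r// pnatr_eq0; exact: erefl.
have l3 : (fun k => \int[leb d]_x (f x * 'D_(ee i) f x * chi k x)) @ \oo --> (0 : R).
  rewrite (funext e) -[X in _ --> X](mulr0 (- 2^-1)).
  by apply: cvgM; [exact: cvg_cst|exact: l2].
exact: (@cvg_unique _ (@Rhausdorff R) _ _ _ _ l1 l3).
Qed.

Lemma shift_C1f f (a : 'rV[R]_d) : C1f f -> C1f (fun x => f (x + a)) /\
  forall i x, 'D_(ee i) (fun x => f (x + a)) x = 'D_(ee i) f (x + a).
Proof.
move=> [cf df cdf].
have Q (i : 'I_d) x : (fun h : R => h^-1 *: (f (h *: ee i + x + a) - f (x + a))) =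
    (fun h : R => h^-1 *: (f (h *: ee i + (x + a)) - f (x + a))).
  by apply/funext => h; rewrite addrA.
have E i x : 'D_(ee i) (fun x => f (x + a)) x = 'D_(ee i) f (x + a).
  by rewrite /derive /= Q.
split; last exact: E.
split.
- by apply: (@cont_comp _ _ _ (fun x : 'rV[R]_d => x + a) f); [exact: cont_shift|exact: cf].
- move=> i x; have := df i (x + a); rewrite /derivable /= Q; exact.
move=> i; rewrite (funext (E i)).
by apply: (@cont_comp _ _ _ (fun x : 'rV[R]_d => x + a) (fun x => 'D_(ee i) f x));
  [exact: cont_shift|exact: cdf].
Qed.

(* Although eta itself need not lie in L^2, its second differences do; the second
   identity holds because the translates to the left and to the right pair with
   d_i eta to opposite values. *)
Lemma second_difference (eta : 'rV[R]_d -> R) (i : 'I_d) (a : R) : C1f eta ->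
  L2 (leb d) setT (fun x => 'D_(ee i) eta x) ->
  let psi y := eta y - 2^-1 * (eta (y + a *: ee i) + eta (y + (- a) *: ee i)) in
  L2 (leb d) setT psi /\ \int[leb d]_y (psi y * 'D_(ee i) eta y) = 0.
Proof.
move=> ce lp psi; have [ce1 ce2 ce3] := ce.
pose de y := eta (y + a *: ee i) - eta y.
have [csh Esh] := shift_C1f (a *: ee i) ce.
have [cde Ede] := C1fB csh ce.
have lde : L2 (leb d) setT de by exact: shift_L2.
have ldes : L2 (leb d) setT (fun y => de (y + (- a) *: ee i)) by exact: L2_shift.
have pE y : psi y = 2^-1 * (de (y + (- a) *: ee i) - de y).
  by rewrite /psi /de scaleNr subrK; clear; field.
have lpsi : L2 (leb d) setT psi.
  rewrite (funext pE); apply: (L2Z measurableT); exact: (L2B measurableT).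
split; first exact: lpsi.
have lps : L2 (leb d) setT (fun y => 'D_(ee i) eta (y + a *: ee i)) by exact: (L2_shift _ lp).
have i1 := L2_intM measurableT ldes lp; have i2 := L2_intM measurableT lde lp.
have i3 := L2_intM measurableT lde lps.
have ldde : L2 (leb d) setT (fun y => 'D_(ee i) de y).
  have -> : (fun y => 'D_(ee i) de y) = fun y => 'D_(ee i) eta (y + a *: ee i) - 'D_(ee i) eta y.
    by apply/funext => y; rewrite (Ede i y) (Esh i y).
  exact: (L2B measurableT).
have z := int_self_der cde lde ldde.
have s : \int[leb d]_y (de (y + (- a) *: ee i) * 'D_(ee i) eta y) =
    \int[leb d]_y (de y * 'D_(ee i) eta (y + a *: ee i)).
  rewrite -(@Rintegral_shift _ _ _ (a *: ee i) (intg_meas i1)).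
  by apply: eq_Rintegral => y _; rewrite scaleNr addrK.
rewrite (_ : \int[leb d]_y (psi y * 'D_(ee i) eta y) =
  \int[leb d]_y (2^-1 * (de (y + (- a) *: ee i) * 'D_(ee i) eta y - de y * 'D_(ee i) eta y)));
    last first.
  by apply: eq_Rintegral => y _; rewrite pE; ring.
rewrite (RintegralZl _ measurableT (intgB measurableT i1 i2)) (RintegralB measurableT i1 i2) s.
rewrite -(RintegralB measurableT i3 i2).
have -> : \int[leb d]_y (de y * 'D_(ee i) eta (y + a *: ee i) - de y * 'D_(ee i) eta y) =
    \int[leb d]_y (de y * 'D_(ee i) de y).
  by apply: eq_Rintegral => y _; rewrite (Ede i y) (Esh i y) mulrBr.
rewrite z mulr0; exact: erefl.
Qed.

(* W is the surface element and A the unit normal's horizontal part, so that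
   H(eta) d_i eta = div' (A d_i eta) - d_i W. *)
Lemma slope (eta : 'rV[R]_d -> R) : C2 eta ->
  let p j := fun y : 'rV[R]_d => 'D_(ee j) eta y in
  exists (W : 'rV[R]_d -> R) (A : 'I_d -> 'rV[R]_d -> R),
  [/\ C1f W /\ (forall j, C1f (A j)), forall y, curvature eta y = \sum_j 'D_(ee j) (A j) y,
    forall i y, 'D_(ee i) W y = \sum_j A j y * 'D_(ee j) (p i) y,
    forall y, 1 <= W y /\ W y ^+ 2 = 1 + \sum_j p j y ^+ 2 &
    forall j y, A j y = p j y * (W y)^-1].
Proof.
move=> CE; move=> p.
have cp j : C1f (p j).
  split; first exact: (@C2_dcont _ _ _ CE j).
    by move=> k x; exact: (@C2_der2 _ _ _ CE x j k).
  by move=> k; exact: (@C2_d2cont _ _ _ CE j k).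
have [cS ES] := @C1f_sum _ (index_enum 'I_d) (fun j y => p j y * p j y) (fun j =>
  (C1fM (cp j) (cp j)).1).
have [cT ET] := C1fD (C1f_cst 1) cS.
pose S := fun y => 1 + \sum_j p j y * p j y.
have S1 y : 1 <= S y by rewrite /S lerDl; apply: sumr_ge0 => j _; rewrite -expr2 sqr_ge0.
have S0 y : 0 < S y by exact: lt_le_trans (S1 y).
pose W y := Num.sqrt (S y).
have W1 y : 1 <= W y by rewrite /W -[leLHS]sqrtr1 ler_wsqrtr.
have W0 y : 0 < W y by exact: lt_le_trans (W1 y).
have W2 y : W y ^+ 2 = S y by rewrite sqr_sqrtr// ltW.
have cSc : continuous S := C1f_cont cT.
have cW : continuous W by apply: (@cont_comp _ _ _ S Num.sqrt); [exact: cSc|exact: sqrt_continuous].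
have dsq y : derivable Num.sqrt (S y) 1 /\ 'D_1 Num.sqrt (S y) = (2 * W y)^-1.
  have H := is_derive1_sqrt (S0 y); split; first exact: (@ex_derive _ _ _ _ _ _ _ H).
  exact: (@derive_val _ _ _ _ _ _ _ H).
have cWi : continuous (fun y => (W y)^-1).
  move=> y; have n0 : W y != 0 by rewrite gt_eqF.
  exact: (cvgV n0 (cW y)).
have cdsq : continuous (fun y => 'D_1 (Num.sqrt : R -> R) (S y)).
  rewrite (funext (fun y => (dsq y).2)) (_ : (fun y => _) = fun y => 2^-1 * (W y)^-1).
    by apply: contM; [exact: cont_cst|exact: cWi].
  by apply/funext => y; rewrite invfM.
have [cWW EW] := C1f_comp cT (fun y => (dsq y).1) cW cdsq.
have dinv y : derivable (fun r : R => r^-1) (W y) 1 /\ 'D_1 (fun r : R => r^-1) (W y) = - (W y)^-2.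
  have n0 : W y != 0 by rewrite gt_eqF.
  split; first exact: (@derivableV _ _ (fun r : R => r) (W y) 1 n0 (@derivable_id _ _ _ _)).
  rewrite (@deriveV _ _ (fun r : R => r) (W y) 1 n0 (@derivable_id _ _ _ _)) derive_id.
  by rewrite /GRing.scale/= mulr1.
have cdinv : continuous (fun y => 'D_1 (fun r : R => r^-1) (W y)).
  rewrite (funext (fun y => (dinv y).2)) (_ : (fun y => _) = fun y => (-1) * ((W y)^-1 * (W y)^-1)).
    apply: contM; first exact: cont_cst.
    by apply: contM; exact: cWi.
  by apply/funext => y; rewrite mulN1r -invfM -expr2.
have [cVV EV] := C1f_comp cWW (fun y => (dinv y).1) cWi cdinv.
pose A j := fun y => p j y * (W y)^-1.
have cA j : C1f (A j) by exact: (C1fM (cp j) cVV).1.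
have HA y : curvature eta y = \sum_j 'D_(ee j) (A j) y.
  have FE j : (fun z => hgrad eta z 0 j / Num.sqrt (1 + sqnorm (hgrad eta z))) = A j.
    apply/funext => z; rewrite /A /W /S /p /sqnorm /dot mxE.
    by under eq_bigr do rewrite !mxE.
  by rewrite /curvature; apply: eq_bigr => j _; rewrite FE.
have EWi i y : 'D_(ee i) W y = \sum_j A j y * 'D_(ee j) (p i) y.
  rewrite (EW i y) (dsq y).2 (ET i y) (ES i y).
  have -> : 'D_(ee i) (fun=> 1 : R) y = 0 by rewrite derive_cst.
  rewrite add0r mulr_sumr; apply: eq_bigr => j _.
  rewrite ((C1fM (cp j) (cp j)).2 i y) /A -(@C2_sym _ _ _ CE y j i) -/(p j) invfM.
  have n0 : W y != 0 by rewrite gt_eqF.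
  by field.
exists W, A; split; [split; [exact: cWW|exact: cA]|exact: HA|exact: EWi| |by []].
move=> y; split; [exact: W1|rewrite W2 /S; congr (_ + _)].
Qed.

Lemma curvature_cont (eta : 'rV[R]_d -> R) : C2 eta -> continuous (curvature eta).
Proof.
move=> /slope[W [A [[_ cA] HA _ _ _]]]; rewrite (funext HA).
have h (s : seq 'I_d) : continuous (fun y => \sum_(j <- s) 'D_(ee j) (A j) y).
  elim: s => [|j s IH].
    by under eq_fun do rewrite big_nil; exact: (@cont_cst R 'rV[R]_d 0).
  by under eq_fun do rewrite big_cons; apply: contD; [exact: C1f_dcont (cA j)|exact: IH].
exact: h.
Qed.

(** The integrand without the cutoff is div'(A d_i eta) - d_i (W - 1). Subtracting 1 from W matters:
    W - 1 <= W^2 - 1 = |grad eta|^2 is integrable, while W is at least 1. The result is a limit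
    along cutoffs, since integrability of the product itself is not claimed. *)
Lemma curvature_flux (eta : 'rV[R]_d -> R) (i : 'I_d) : C2 eta ->
  (forall j, L2 (leb d) setT (fun x => 'D_(ee j) eta x)) ->
  (fun k : nat => \int[leb d]_y (curvature eta y * 'D_(ee i) eta y * chi k y)) @ \oo --> (0 : R).
Proof.
move=> CE lp.
pose p j := fun y : 'rV[R]_d => 'D_(ee j) eta y.
have cp j : C1f (p j).
  split; first exact: (@C2_dcont _ _ _ CE j).
    by move=> k x; exact: (@C2_der2 _ _ _ CE x j k).
  by move=> k; exact: (@C2_d2cont _ _ _ CE j k).
have [W [A [[cWW cA] HA EWi WS AE]]] := slope CE.
have W1 y : 1 <= W y by case: (WS y).
have W0 y : 0 < W y by exact: lt_le_trans (W1 y).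
have [cW1 EW1] := C1fB cWW (C1f_cst 1).
have e k : \int[leb d]_y (curvature eta y * p i y * chi k y) =
   \int[leb d]_y ((W y - 1) * 'D_(ee i) (chi k) y) -
   \sum_j \int[leb d]_y (A j y * p i y * 'D_(ee j) (chi k) y).
  have tk : test_fun setT (chi k : 'rV[R]_d -> R) by apply: test_cutoff; rewrite ltr0n.
  have J j := ibp j (C1fM (cA j) (cp i)).1 tk.
  have J0 := ibp i cW1 tk.
  have ci j : intg (leb d) setT (fun y => 'D_(ee j) (fun x => A j x * p i x) y * chi k y).
    exact: (cont_test_intg (C1f_dcont (i := j) (C1fM (cA j) (cp i)).1) tk).
  have ci0 : intg (leb d) setT (fun y => 'D_(ee i) (fun x => W x - 1) y * chi k y).
    exact: (cont_test_intg (C1f_dcont (i := i) cW1) tk).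
  rewrite (_ : \int[leb d]_y (curvature eta y * p i y * chi k y) =
    \int[leb d]_y (\sum_j 'D_(ee j) (fun x => A j x * p i x) y * chi k y - 'D_(ee i) (fun x =>
      W x - 1) y * chi k y)); last first.
    apply: eq_Rintegral => y _; rewrite HA (EW1 i y) (EWi i y).
    have -> : 'D_(ee i) (fun=> 1 : R) y = 0 by rewrite derive_cst.
    rewrite subr0 -!mulr_suml -mulrBl; congr (_ * _); rewrite mulr_suml.
    apply/eqP; rewrite -subr_eq0 opprB addrA -big_split/= subr_eq0; apply/eqP;
      apply: eq_bigr => j _.
    by rewrite ((C1fM (cA j) (cp i)).2 j y).
  rewrite (RintegralB measurableT (@intg_sum _ _ _ (leb d) _ (index_enum 'I_d) xpredT _ _
    measurableT (fun j _ => ci j)) ci0).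
  rewrite (@Rintegral_sum _ _ _ (leb d) _ (index_enum 'I_d) xpredT _ _ measurableT (fun j _ =>
    ci j)).
  by rewrite (eq_bigr _ (fun j _ => J j)) J0 opprK sumrN addrC.
have mid (g : 'rV[R]_d -> R) : continuous g ->
  measurable_fun setT (fun x => g x) by exact: continuous_measurable_rV.
have iW : intg (leb d) setT (fun y => W y - 1).
  have iS : intg (leb d) setT (fun y => \sum_j p j y ^+ 2).
    by apply: (@intg_sum _ _ _ (leb d) _ (index_enum 'I_d) xpredT _ _ measurableT) => j _;
      case: (lp j).
  apply: (le_intg measurableT _ _ iS) => [|y _].
    exact: continuous_measurable_rV (C1f_cont cW1).
  rewrite ger0_norm ?subr_ge0//.
  have -> : \sum_j p j y ^+ 2 = W y ^+ 2 - 1 by rewrite (WS y).2 addrC addrA addNr add0r.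
  by have := W1 y; nra.
have iA j : intg (leb d) setT (fun y => A j y * p i y).
  apply: (L2_intM measurableT _ (lp i)).
  apply: (L2_dom measurableT _ (lp j)) => [|y _].
    exact: continuous_measurable_rV (C1f_cont (cA j)).
  rewrite AE normrM -[leRHS]mulr1; apply: ler_wpM2l; first exact: normr_ge0.
  by rewrite ger0_norm ?invr_ge0 ?(ltW (W0 y))// invf_le1.
rewrite (funext e) -[X in _ --> X](_ : 0 - \sum_(j < d) 0 = 0); last by rewrite big1// subr0.
apply: cvgB; first exact: (@cutoff_der_cvg _ _ (leb d) setT (fun x => x) measurableT mid _ i iW).
apply: cvg_big => [|j _]; first exact: add_continuous.
exact: (@cutoff_der_cvg _ _ (leb d) setT (fun x => x) measurableT mid _ j (iA j)).
Qed.

End decay_at_infinity.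

(** * Fluxes over the whole domain *)

Section flow_facts.
Context {R : realType} {d : nat}.
Local Notation mu := (leb d.+1).
Notation ee i := (delta_mx 0 i : 'rV[R]_ _).

Lemma L2_ae n (D : set 'rV[R]_n) (f g : 'rV[R]_n -> R) : measurable D -> measurable_fun D g ->
  L2 (leb n) D f -> {ae leb n, forall x, D x -> f x = g x} -> L2 (leb n) D g.
Proof.
move=> mD mg [mf fi] fg; split => //.
apply: (ae_intg mD _ fi); first exact: measurable_funX.
by apply: filterS fg => x h Dx; rewrite h.
Qed.

Lemma intg_ae_le n (D : set 'rV[R]_n) (f g : 'rV[R]_n -> R) : measurable D -> measurable_fun D f ->
  intg (leb n) D g -> (forall x, D x -> 0 <= f x) ->
  {ae leb n, forall x, D x -> f x <= g x} -> intg (leb n) D f.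
Proof.
move=> mD mf gi f0 fg; have mg := intg_meas gi.
have mm : measurable_fun D (fun x => Num.min (f x) `|g x|).
  by apply: measurable_minr => //; exact: measurableT_comp.
apply: (@ae_intg _ _ _ _ D (fun x => Num.min (f x) `|g x|) f mD mf).
  apply: (le_intg mD mm _ (intg_abs mD gi)) => x Dx.
  by rewrite ger0_norm ?ge_min ?lexx ?orbT// le_min f0 /=.
apply: filterS fg => x h Dx; apply/min_idPl; apply: le_trans (h Dx) _; exact: ler_norm.
Qed.

(** Vertical integration multiplies g by [zeta], which is at least [zm]; so integrability descends
    from the domain to R^d. *)
Lemma hpart_intg_inv (zeta : 'rV[R]_d -> R) (M zm : R) (g : 'rV[R]_d -> R) : continuous zeta ->
  (forall y, 0 < zeta y <= M) -> 0 < zm -> (forall y, zm <= zeta y) ->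
  measurable_fun setT g -> (forall y, 0 <= g y) ->
  intg mu (Omega zeta) (fun x => g (hpart x)) -> intg (leb d) setT g.
Proof.
move=> cz zM zm0 zmz mg g0 gi.
have mz : measurable_fun setT zeta by exact: continuous_measurable_rV.
have mO := Omega_meas mz; have mgh := intg_meas gi.
have gh0 (x : 'rV[R]_d.+1) : Omega zeta x -> (0 <= (g (hpart x))%:E)%E by rewrite lee_fin.
have E : (\int[mu]_(x in Omega zeta) (g (hpart x))%:E = \int[leb d]_y (zeta y * g y)%:E)%E.
  rewrite int_slices //; last by exact/measurable_EFinP.
  apply: eq_integral => y _; rewrite slice_Om.
  under eq_integral do rewrite hpart_pt.
  have /andP[z0 _] := zM y.
  by rewrite integral_cst//= lebesgue_measure_itv/= lte_fin z0 -EFinB subr0 -EFinM mulrC.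
have zgi : intg (leb d) setT (fun y => zeta y * g y).
  apply/intg_ge0P.
  - exact: measurable_funM.
  - by move=> y _; rewrite mulr_ge0//; have /andP[/ltW] := zM y.
  by rewrite -E; apply/intg_ge0P => //.
apply: (le_intg measurableT mg _ (intgZ zm^-1 measurableT zgi)) => y _.
rewrite ger0_norm// mulrA -[leLHS]mul1r; apply: ler_wpM2r => //.
by rewrite mulrC -ler_pdivrMr ?invr_gt0// invrK mul1r.
Qed.

Section flow.
Variables (gamma : R) (eta : 'rV[R]_d -> R) (b M zm : R).
Let zeta := fun y => b + eta y.
Hypothesis ne : nice eta.
Hypotheses (zM : forall y, 0 < zeta y <= M) (zm0 : 0 < zm) (zmz : forall y, zm <= zeta y).
Let Om := Omega zeta.

Let CE : C2 eta. Proof. exact: nice_C2. Qed.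

Lemma zeta_C1f : C1f zeta /\ forall j y, 'D_(ee j) zeta y = 'D_(ee j) eta y.
Proof.
have ce : C1f eta.
  by split; [exact: (@C2_cont _ _ _ CE)|move=> i x;
    exact: (@C2_der _ _ _ CE x i)|exact: (@C2_dcont _ _ _ CE)].
have [h1 h2] := C1fD (C1f_cst b) ce; split; first exact: h1.
by move=> j y; rewrite (h2 j y) derive_cst add0r.
Qed.

Lemma eta_C1f : C1f eta.
Proof.
by split; [exact: (@C2_cont _ _ _ CE)|move=> i x;
  exact: (@C2_der _ _ _ CE x i)|exact: (@C2_dcont _ _ _ CE)].
Qed.

Let cz : continuous zeta. Proof. exact: C1f_cont zeta_C1f.1. Qed.
Let mz : measurable_fun setT zeta. Proof. exact: continuous_measurable_rV. Qed.
Let mO : measurable Om. Proof. exact: Omega_meas. Qed.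
Let oO : open Om. Proof. exact: open_Omega. Qed.

Lemma zeta_approx (e : R) : 0 < e -> exists h : 'rV[R]_d -> R,
  [/\ smooth h, forall x, `|h x - zeta x| <= e &
     forall x i, `|'D_(ee i) h x - 'D_(ee i) zeta x| <= e].
Proof.
move=> e0; have [h [sh h1 h2]] := nice_approx ne e0.
exists (fun y => b + h y); split.
- by apply: smoothD; [exact: smooth_cst|exact: sh].
- by move=> y; rewrite /zeta opprD addrACA subrr add0r.
move=> y i; rewrite (zeta_C1f.2 i y).
have [_ E] := C1fD (C1f_cst b) (smooth_C1f sh).
by rewrite (E i y) derive_cst add0r.
Qed.

Lemma cont_hpart (g : 'rV[R]_d -> R) : continuous g ->
  continuous (fun x : 'rV[R]_d.+1 => g (hpart x)).
Proof. by move=> cg; apply: (@cont_comp _ _ _ (fun x : 'rV[R]_d.+1 => hpart x) g);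
  [exact: hpart_cont|exact: cg]. Qed.

Lemma meas_hpart (g : 'rV[R]_d -> R) (D : set 'rV[R]_d.+1) : continuous g ->
  measurable_fun D (fun x => g (hpart x)).
Proof. by move=> cg; apply: measurable_funTS; apply: continuous_measurable_rV;
  exact: cont_hpart. Qed.

Lemma L2_Dr (f : 'rV[R]_d.+1 -> R) rho : L2 mu Om f -> L2 mu (Dr zeta rho) f.
Proof. by apply: L2S => //; [exact: Dr_meas|exact: Dr_Om]. Qed.

Lemma intg_Dr (f : 'rV[R]_d.+1 -> R) rho : intg mu Om f -> intg mu (Dr zeta rho) f.
Proof. by apply: intgS => //; [exact: Dr_meas|exact: Dr_Om]. Qed.

Lemma intg_test (f phi : 'rV[R]_d.+1 -> R) : intg mu Om f -> test_fun Om phi ->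
  intg mu Om (fun x => f x * phi x).
Proof.
move=> fi tp; have [C _ hC] := test_bounded tp; under eq_fun do rewrite mulrC.
apply: (intgMb mO _ (fun x _ => hC x) fi).
by apply: measurable_funTS; exact: continuous_measurable_rV (test_cont tp).
Qed.

Lemma L2_test (f phi : 'rV[R]_d.+1 -> R) : L2 mu Om f -> test_fun Om phi ->
  intg mu Om (fun x => f x * phi x).
Proof. by move=> lf tp; apply: loc_intgM => //; exact: L2_L1loc. Qed.

Lemma divid_sum (I : finType) (F : I -> 'I_d.+1 -> 'rV[R]_d.+1 -> R) (G : I -> 'rV[R]_d.+1 -> R) :
  (forall i j, intg mu Om (F i j)) -> (forall i, intg mu Om (G i)) ->
  (forall i, divid zeta (F i) (G i)) ->
  divid zeta (fun j x => \sum_i F i j x) (fun x => \sum_i G i x).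
Proof.
move=> iF iG dFG phi tp.
have E1 j : \int[mu]_(x in Om) ((\sum_i F i j x) * 'D_(ee j) phi x) =
    \sum_i \int[mu]_(x in Om) (F i j x * 'D_(ee j) phi x).
  under eq_Rintegral do rewrite mulr_suml.
  apply: (@Rintegral_sum _ _ _ mu _ (index_enum I) xpredT _ _ mO) => i _.
  by apply: intg_test => //; exact: test_der.
have E2 : \int[mu]_(x in Om) ((\sum_i G i x) * phi x) = \sum_i \int[mu]_(x in Om) (G i x * phi x).
  under eq_Rintegral do rewrite mulr_suml.
  apply: (@Rintegral_sum _ _ _ mu _ (index_enum I) xpredT _ _ mO) => i _.
  exact: intg_test.
rewrite (eq_bigr _ (fun j _ => E1 j)) E2 exchange_big/= -sumrN.
by apply: eq_bigr => i _; exact: dFG.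
Qed.

(** [divergence] with the horizontal cutoffs: the integrable field meets their gradients, which are
    O(1/k). The surface term remains a limit because [t] is only assumed continuous. *)
Lemma flux_global (F : 'I_d.+1 -> 'rV[R]_d.+1 -> R) G t : continuous t ->
  intg mu Om G -> (forall j, intg mu Om (F j)) -> divid zeta F G ->
  vanish zeta (fun=> 0) (F ord_max) ->
  vanish zeta zeta (fun x => F ord_max x -
    \sum_(j < d) F (lift ord_max j) x * 'D_(ee j) eta (hpart x) - t (hpart x)) ->
  (fun k : nat => \int[leb d]_y (t y * cutoff k.+1%:R y)) @ \oo --> \int[mu]_(x in Om) G x.
Proof.
move=> ct iG iF dFG bot topN.
have tk k : test_fun setT (cutoff k.+1%:R : 'rV[R]_d -> R) by apply: test_cutoff; rewrite ltr0n.
have topN' : vanish zeta zeta (fun x => F ord_max x -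
    \sum_(j < d) F (lift ord_max j) x * 'D_(ee j) zeta (hpart x) - t (hpart x)).
  rewrite (_ : (fun x => _) = (fun x => F ord_max x -
    \sum_(j < d) F (lift ord_max j) x * 'D_(ee j) eta (hpart x) - t (hpart x))); first exact: topN.
  apply/funext => x; congr (_ - _ - _); apply: eq_bigr => j _; congr (_ * _); exact: zeta_C1f.2.
have e k := divergence cz zM zm0 zmz zeta_approx ct (fun rho _ => intg_Dr rho iG)
  (fun rho j _ => intg_Dr rho (iF j)) dFG bot topN' (tk k).
rewrite -(funext e).
have mh (g : 'rV[R]_d -> R) : continuous g ->
  measurable_fun Om (fun x => g (hpart x)) by exact: meas_hpart.
have c0 := @cutoff_cvg _ _ _ _ mu Om (fun x => hpart x) mO mh _ iG.
have cj j := @cutoff_der_cvg _ _ _ _ mu Om (fun x => hpart x) mO mh _ j (iF (lift ord_max j)).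
rewrite -[X in _ --> X](_ : \int[mu]_(x in Om) G x + \sum_(j < d) 0 = _);
  last by rewrite big1// addr0.
have cb (g : 'rV[R]_d -> R) f : continuous g -> (exists C, forall y, `|g y| <= C) ->
  intg mu Om f -> intg mu Om (fun x => f x * g (hpart x)).
  move=> cg [C hC] fi; under eq_fun do rewrite mulrC.
  exact: (intgMb mO (mh _ cg) (fun x _ => hC (hpart x)) fi).
have i0 k : intg mu Om (fun x => G x * cutoff k.+1%:R (hpart x)).
  apply: cb => //; first exact: test_cont (tk k).
  by exists 1 => y; rewrite ger0_norm ?cutoff_ge0// cutoff_le1.
have ij k j : intg mu Om (fun x => F (lift ord_max j) x * 'D_(ee j) (cutoff k.+1%:R) (hpart x)).
  apply: (cb (fun y => 'D_(ee j) (cutoff k.+1%:R) y)) => //;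
    first exact: test_cont (test_der j (tk k)).
  by have [C _ hC] := test_bounded (test_der j (tk k)); exists C.
have -> : (fun k : nat => \int[mu]_(x in Om) (G x * cutoff k.+1%:R (hpart x) +
    \sum_(j < d) F (lift ord_max j) x * 'D_(ee j) (cutoff k.+1%:R) (hpart x))) =
  (fun k : nat => \int[mu]_(x in Om) (G x * cutoff k.+1%:R (hpart x)) +
    \sum_(j < d) \int[mu]_(x in Om) (F (lift ord_max j) x * 'D_(ee j) (cutoff k.+1%:R) (hpart x))).
  apply/funext => k.
  rewrite (RintegralD mO (i0 k) (@intg_sum _ _ _ mu _ (index_enum 'I_d) xpredT _ _ mO (fun j _ =>
    ij k j))).
  by rewrite (@Rintegral_sum _ _ _ mu _ (index_enum 'I_d) xpredT _ _ mO (fun j _ => ij k j)).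
apply: cvgD; first exact: c0.
apply: cvg_big => [|j _]; first exact: add_continuous.
exact: cj.
Qed.

End flow.
End flow_facts.

(** * The energy identity *)

Section cosine_cutoff.
Context {R : realType}.

(* A truncation of s^2 / 2, its limit as e tends to 0, with bounded first and
   second derivatives. *)
Definition cosb (e s : R) : R := e^-1 ^+ 2 * (1 - cos (e * s)).

Lemma d1_trig (a c k e : R) (s : R) :
  is_derive s 1 (fun s => a * cos (e * s) + c * sin (e * s) + k)
    (c * e * cos (e * s) + (- (a * e)) * sin (e * s)).
Proof.
have de : is_derive s 1 (fun s : R => e * s) e.
  have := @is_deriveZ _ _ _ (fun s : R => s) e s 1 1 (is_derive_id _ _).
  by rewrite /GRing.scale/= mulr1.
have dc := @is_derive1_comp _ cos (fun s : R => e * s) s _ _ (is_derive_cos _) de.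
have ds := @is_derive1_comp _ sin (fun s : R => e * s) s _ _ (is_derive_sin _) de.
have := @is_deriveD _ _ _ _ _ s 1 _ _ (@is_deriveD _ _ _ _ _ s 1 _ _ (@is_deriveZ _ _ _ _ a s 1 _
  dc)
  (@is_deriveZ _ _ _ _ c s 1 _ ds)) (@is_derive_cst _ _ _ k s 1).
move=> H; apply: (is_derive_eq H); rewrite /GRing.scale/=; ring.
Qed.

Lemma cosbE e : cosb e = fun s => (- e^-1 ^+ 2) * cos (e * s) + 0 * sin (e * s) + e^-1 ^+ 2.
Proof. by apply/funext => s; rewrite /cosb; ring. Qed.

Lemma smooth1_cosb e : smooth1 (cosb e).
Proof.
move=> k x.
have [a [c [m ->]]] : exists a c m,
  iter k d1 (cosb e) = fun s => a * cos (e * s) + c * sin (e * s) + m.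
  elim: k => [|k [a [c [m IH]]]]; first by exists (- e^-1 ^+ 2), 0, (e^-1 ^+ 2); rewrite /= cosbE.
  exists (c * e), (- (a * e)), 0; rewrite iterS IH; apply/funext => s.
  by rewrite /d1 (@derive_val _ _ _ _ _ _ _ (d1_trig a c m e s)) addr0.
exact: (@ex_derive _ _ _ _ _ _ _ (d1_trig a c m e x)).
Qed.

Lemma d1_cosb e s : e != 0 -> d1 (cosb e) s = e^-1 * sin (e * s).
Proof.
move=> e0; rewrite /d1 cosbE (@derive_val _ _ _ _ _ _ _ (d1_trig _ _ _ e s)).
by move: (cos _) (sin _) => x y; field.
Qed.

Lemma cosb0 e : cosb e 0 = 0. Proof. by rewrite /cosb mulr0 cos0 subrr mulr0. Qed.

Variable e : R.
Hypothesis e0 : 0 < e.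
Let en : e != 0. Proof. by rewrite gt_eqF. Qed.

Lemma d1_cosb_le s : `|d1 (cosb e) s| <= `|s|.
Proof.
rewrite d1_cosb// normrM gtr0_norm ?invr_gt0//.
have := sin_lip 0 (e * s); rewrite sin0 !subr0 normrM (gtr0_norm e0) => h.
by rewrite mulrC ler_pdivrMr// [leRHS]mulrC.
Qed.

Lemma d1_cosb_bound s : `|d1 (cosb e) s| <= e^-1.
Proof.
rewrite d1_cosb// normrM gtr0_norm ?invr_gt0// -[leRHS]mulr1; apply: ler_wpM2l.
  by rewrite invr_ge0 ltW.
by rewrite ler_norml sin_geN1 sin_le1.
Qed.

Lemma cosb_lip s r : `|cosb e s - cosb e r| <= e^-1 * `|s - r|.
Proof.
rewrite /cosb -mulrBr opprB addrC addrA subrK normrM normrX gtr0_norm ?invr_gt0//.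
have := cos_lip (e * s) (e * r); rewrite -mulrBr normrM (gtr0_norm e0) (distrC r s) => h.
apply: le_trans (ler_wpM2l _ h) _; first by rewrite exprn_ge0// invr_ge0 ltW.
by rewrite expr2 -!mulrA [e^-1 * (e * _)]mulrA mulVf// mul1r.
Qed.

Lemma d1_cosb_lip s r : `|d1 (cosb e) s - d1 (cosb e) r| <= 1 * `|s - r|.
Proof.
rewrite !d1_cosb// -mulrBr normrM gtr0_norm ?invr_gt0//.
have := sin_lip (e * r) (e * s); rewrite -mulrBr normrM (gtr0_norm e0) => h.
by rewrite mul1r mulrC ler_pdivrMr// [leRHS]mulrC.
Qed.

Lemma cosb_sq s : `|cosb e s| <= s ^+ 2.
Proof.
rewrite /cosb normrM normrX gtr0_norm ?invr_gt0//.
have := cos_taylor 0 (e * s); rewrite add0r cos0 sin0 mulr0 addr0 distrC => h.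
apply: le_trans (ler_wpM2l _ h) _; first by rewrite exprn_ge0// invr_ge0 ltW.
by rewrite -exprMn mulrA mulVf// mul1r.
Qed.

Lemma d1_cosb_near s : `|d1 (cosb e) s - s| <= e * s ^+ 2.
Proof.
have [c hc hs] := @mvt_dist R sin cos 0 (e * s) (fun x => is_derive_sin x).
rewrite sin0 !subr0 in hc hs; rewrite d1_cosb// hs.
have -> : e^-1 * (cos c * (e * s)) - s = (cos c - 1) * s by field.
rewrite normrM; have := cos_lip 0 c; rewrite cos0 subr0 => h1.
apply: (@le_trans _ _ (e * `|s| * `|s|)); last by rewrite -mulrA -normrM -expr2 ger0_norm// sqr_ge0.
apply: ler_wpM2r => //; apply: le_trans h1 _; apply: le_trans hc _.
by rewrite normrM (gtr0_norm e0).
Qed.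

End cosine_cutoff.

(** By symmetry in i and j, contracting the symmetric part with [a] gives half of its square norm,
    while the multiple of the identity contributes the trace. *)
Lemma strain_algebra (R : realType) n (p : R) (a : 'I_n -> 'I_n -> R) :
  \sum_i \sum_j (p * (i == j)%:R - (a i j + a j i)) * a i j =
  p * \sum_i a i i - 2^-1 * \sum_i \sum_j (a i j + a j i) ^+ 2.
Proof.
have s2 : \sum_i \sum_j (a i j + a j i) * a j i = \sum_i \sum_j (a i j + a j i) * a i j.
  rewrite exchange_big/=; apply: eq_bigr => i _; apply: eq_bigr => j _; by rewrite addrC.
have s3 : \sum_i \sum_j (a i j + a j i) ^+ 2 =
    \sum_i \sum_j (a i j + a j i) * a i j + \sum_i \sum_j (a i j + a j i) * a j i.
  rewrite -big_split/=; apply: eq_bigr => i _; rewrite -big_split/=; apply: eq_bigr => j _.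
  by rewrite -mulrDr expr2.
have -> : 2^-1 * \sum_i \sum_j (a i j + a j i) ^+ 2 = \sum_i \sum_j (a i j + a j i) * a i j.
  by rewrite s3 s2; field.
rewrite mulr_sumr -sumrB; apply: eq_bigr => i _; under eq_bigr do rewrite mulrBl.
rewrite sumrB; congr (_ - _); rewrite (bigD1 i)//= eqxx mulr1 big1 ?addr0// => j.
by rewrite eq_sym => /negbTE ->; rewrite mulr0 mul0r.
Qed.

(** * Energy identities for the flow and rigidity *)

Section energy.
Context {R : realType} {d : nat}.
Local Notation mu := (leb d.+1).
Notation ee i := (delta_mx 0 i : 'rV[R]_ _).
Variables (gamma sigma : R) (eta : 'rV[R]_d -> R) (b M zm : R) (i0 : 'I_d).
Let zeta := fun y => b + eta y.
Hypothesis ne : nice eta.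
Hypotheses (zM : forall y, 0 < zeta y <= M) (zm0 : 0 < zm) (zmz : forall y, zm <= zeta y).
Let Om := Omega zeta.
Variables (V : 'I_d.+1 -> 'rV[R]_d.+1 -> R) (p : 'rV[R]_d.+1 -> R).
Let dv i j := wD Om [:: j] (V i).
Let lap i j := wD Om [:: j; j] (V i).
Let dp i := wD Om [:: i] p.
Let deta i (x : 'rV[R]_d.+1) := 'D_(ee i) (fun z : 'rV[R]_d.+1 => eta (hpart z)) x.
Let dh j (x : 'rV[R]_d.+1) := 'D_(ee j) eta (hpart x).
Let I0 : 'I_d.+1 := lift ord_max i0.
Let U j x := V j x - gamma * (j == I0)%:R.
Let h i x := \sum_j U j x * dv i j x.
Let S i j x := p x * (i == j)%:R - (dv i j x + dv j i x).
Let vN x := V ord_max x - \sum_(j < d) V (lift ord_max j) x * dh j x.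
Let tN (y : 'rV[R]_d) := - gamma * 'D_(ee i0) eta y.

Hypothesis lV : forall i, L2 mu Om (V i).
Hypothesis wdv : forall i j, weak_deriv Om [:: j] (V i) (dv i j).
Hypothesis ldv : forall i j, L2 mu Om (dv i j).
Hypothesis wlap : forall i j, weak_deriv Om [:: j; j] (V i) (lap i j).
Hypothesis llap : forall i j, L2 mu Om (lap i j).
Hypothesis lp : L2 mu Om p.
Hypothesis wdp : forall i, weak_deriv Om [:: i] p (dp i).
Hypothesis ldp : forall i, L2 mu Om (dp i).
Hypothesis incompressible : {ae mu, forall x, Om x -> \sum_j dv j j x = 0}.
Hypothesis momentum : forall i, {ae mu, forall x, Om x ->
  h i x - \sum_j lap i j x + dp i x + deta i x = 0}.
Hypothesis trV : forall i, has_trace Om (fun=> 0) (V i) (fun=> 0).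
Hypothesis trN : has_trace Om zeta vN tN.

Let CE : C2 eta. Proof. exact: nice_C2. Qed.
Let ce : C1f eta. Proof. exact: eta_C1f. Qed.
Let cz : continuous zeta. Proof. exact: C1f_cont (zeta_C1f b ne).1. Qed.
Let mz : measurable_fun setT zeta. Proof. exact: continuous_measurable_rV. Qed.
Let mO : measurable Om. Proof. exact: Omega_meas. Qed.
Let oO : open Om. Proof. exact: open_Omega. Qed.

Lemma detaE j x : deta (lift ord_max j) x = dh j x.
Proof. exact: derive_hpart. Qed.

Lemma deta_max x : deta ord_max x = 0.
Proof. exact: (derive_hpart_max eta x).2. Qed.

Lemma hE i x : h i x = \sum_j V j x * dv i j x - gamma * dv i I0 x.
Proof.
rewrite /h /U; under eq_bigr do rewrite mulrBl.
rewrite sumrB; congr (_ - _); rewrite (bigD1 I0)//= eqxx mulr1 big1 ?addr0// => j /negbTE ->.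
by rewrite mulr0 mul0r.
Qed.

Lemma meas_dh j (D : set 'rV[R]_d.+1) : measurable_fun D (dh j).
Proof. by apply: (@meas_hpart _ _ (fun y => 'D_(ee j) eta y)); exact: C1f_dcont ce. Qed.

(* The momentum equation writes the bounded function d_j eta as L - Q with L in
   L^2 and Q in L^1, so (d_j eta)^2 <= L^2 + 2 |d_j eta| |Q| is integrable. *)
Lemma slope_L2 j : L2 (leb d) setT (fun y => 'D_(ee j) eta y).
Proof.
have cd := C1f_dcont (i := j) ce; have md := continuous_measurable_rV cd.
have [Mg Mg0 hMg] := C2_bound CE.
split; first exact: md.
pose i := lift ord_max j : 'I_d.+1.
pose Q x := \sum_k V k x * dv i k x.
pose L x := gamma * dv i I0 x + \sum_k lap i k x - dp i x.
have iQ : intg mu Om Q.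
  by apply: (@intg_sum _ _ _ mu _ (index_enum 'I_d.+1) xpredT _ _ mO) => k _; exact: L2_intM.
have lL : L2 mu Om L.
  apply: (L2B mO) (ldp i); apply: (L2D mO); first exact: L2Z.
  by apply: (L2_sum mO) => k _; exact: llap.
apply: (hpart_intg_inv cz zM zm0 zmz (g := fun y => 'D_(ee j) eta y ^+ 2)).
- exact: measurable_funX.
- by move=> y; exact: sqr_ge0.
apply: (@intg_ae_le _ _ Om _ (fun x => 2 * Mg * `|Q x| + L x ^+ 2) mO).
- by apply: measurable_funX; exact: meas_dh.
- by apply: (intgD mO) lL.2; apply: (intgZ _ mO); exact: (intg_abs mO).
- by move=> x _; exact: sqr_ge0.
apply: filterS (momentum i) => x hx Ox; have := hx Ox; rewrite hE detaE -/(dh j x) => hx'.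
have E : dh j x = L x - Q x.
  by move: hx'; rewrite /L /Q; move: (\sum_k V k x * dv i k x) (gamma * dv i I0 x) (\sum_k lap i k
    x) (dp i x) (dh j x) => *; lra.
have hb : `|dh j x| <= Mg by exact: hMg.
have q : - (dh j x * Q x) <= Mg * `|Q x|.
  by rewrite -normrN in hb; apply: le_trans (ler_norm _) _; rewrite normrN normrM;
    apply: ler_wpM2r => //; rewrite -normrN.
change (dh j x ^+ 2 <= 2 * Mg * `|Q x| + L x ^+ 2).
have e : dh j x ^+ 2 = dh j x * L x - dh j x * Q x by rewrite -mulrBr -E expr2.
have := sqr_ge0 (dh j x - L x); rewrite -[2 * Mg * _]mulrA; move: e q;
  move: (dh j x) (L x) (Q x) (Mg * `|Q x|) => a l qq m; nra.
Qed.

Lemma deta_L2 i : L2 mu Om (deta i).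
Proof.
move: i; apply: ptP => [|j].
  by rewrite (funext deta_max); exact: L20.
by rewrite (funext (detaE j)); have [l _] := hpart_L2 cz zM (slope_L2 j).
Qed.

(** As a sum of products of L^2 functions, plus an L^2 term, the convective term would only be
    locally integrable; its square integrability is read off the momentum equation, in which all the
    other terms are in L^2. *)
Lemma hL2 i : L2 mu Om (h i).
Proof.
have l : L2 mu Om (fun x => \sum_j lap i j x - dp i x - deta i x).
  apply: (L2B mO) (deta_L2 i); apply: (L2B mO) (ldp i).
  by apply: (L2_sum mO) => k _; exact: llap.
apply: (L2_ae mO _ l).
  rewrite (funext (hE i)); apply: measurable_funB; last by apply: measurable_funM => //;
    case: (ldv i I0).
  apply: (@intg_meas _ _ _ mu); apply: (@intg_sum _ _ _ mu _ (index_enum 'I_d.+1) xpredT _ _ mO) =>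
    k _.
  exact: L2_intM.
apply: filterS (momentum i) => x hx Ox; have := hx Ox.
move: (h i x) (\sum_j lap i j x) (dp i x) (deta i x) => *; lra.
Qed.

Lemma divid_V : divid zeta V (fun=> 0).
Proof.
move=> phi tp.
have E j : \int[mu]_(x in Om) (V j x * 'D_(ee j) phi x) = - \int[mu]_(x in Om) (dv j j x * phi x).
  by have [_ _ /(_ phi tp)] := wdv j j; rewrite /= expr1 mulN1r.
have ij j : intg mu Om (fun x => dv j j x * phi x) by exact: L2_test (ldv j j) tp.
rewrite (eq_bigr _ (fun j _ => E j)) sumrN; congr (- _).
rewrite -(@Rintegral_sum _ _ _ mu _ (index_enum 'I_d.+1) xpredT _ _ mO (fun j _ => ij j)).
have iS := @intg_sum _ _ _ mu _ (index_enum 'I_d.+1) xpredT _ _ mO (fun j _ => ij j).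
apply: (ae_Rint mO (intg_meas iS)); first by under eq_fun do rewrite mul0r; exact: measurable_cst.
apply: filterS incompressible => x hx Ox.
by rewrite -mulr_suml (hx Ox) !mul0r.
Qed.

Lemma divid_U : divid zeta U (fun=> 0).
Proof.
move=> phi tp; rewrite -(divid_V tp).
have z j : \int[mu]_(x in Om) 'D_(ee j) phi x = 0.
  have [r _ sr] := test_supp tp; have sp := test_smooth tp.
  rewrite -(@Rint_restr _ _ _ mu Om).
    apply: (@ibp0 _ _ phi r j (smooth_cont sp) _ (smooth_cont (smooth_der j sp)) sr).
    by move=> x; exact: (@smooth_drv _ _ _ j x sp).
  by move=> x nx; exact: (test0 (test_der j tp) nx).
have tj j := test_der j tp.
have i1 j : intg mu Om (fun x => V j x * 'D_(ee j) phi x) by exact: L2_test (lV j) (tj j).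
have i2 j : intg mu Om (fun x => 'D_(ee j) phi x).
  have [r _ sr] := test_supp (tj j).
  by apply: (intgS measurableT mO) => //; exact: (cont_intg (test_cont (tj j)) sr).
apply: eq_bigr => j _; rewrite /U.
under eq_Rintegral do rewrite mulrBl.
rewrite (RintegralB mO (i1 j) (intgZ (gamma * (j == I0)%:R) mO (i2 j))).
by rewrite (RintegralZl _ mO (i2 j)) z mulr0 subr0.
Qed.

Let top0' := top0 zM.
Let topz' := topz zM.
Let ntop0 x : Om x -> vpart x != (fun=> 0 : R) (hpart x).
Proof. by move=> /andP[x0 _]; rewrite gt_eqF. Qed.
Let ntopz x : Om x -> vpart x != zeta (hpart x).
Proof. by move=> /andP[_ xz]; rewrite lt_eqF. Qed.
Let c0 : continuous (fun _ : 'rV[R]_d => 0 : R). Proof. exact: cont_cst. Qed.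

Lemma vN_meas : measurable_fun Om vN.
Proof.
apply: measurable_funB; first by case: (lV ord_max).
apply: measurable_sum => j; apply: measurable_funM; first by case: (lV (lift ord_max j)).
exact: meas_dh.
Qed.

Lemma bottom_vanish i g : (forall rho, 0 < rho -> L2 mu (Dr zeta rho) g) ->
  vanish zeta (fun=> 0) (fun x => V i x * g x).
Proof.
move=> lg; have := vanish_mul cz zM c0 top0' ntop0 (lV i).1 (trV i) lg.
rewrite (_ : (fun x => _) = (fun x => V i x * g x)); first exact.
by apply/funext => x; rewrite subr0.
Qed.

Lemma top_vanish g : (forall rho, 0 < rho -> L2 mu (Dr zeta rho) g) ->
  vanish zeta zeta (fun x => (vN x - tN (hpart x)) * g x).
Proof. by move=> lg; exact: (vanish_mul cz zM cz topz' ntopz vN_meas trN lg). Qed.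

Lemma apprV i : appr zeta (V i) (fun j => dv i j).
Proof. exact: (has_trace_appr cz zM c0 top0' (lV i).1 (trV i)). Qed.

Lemma L2Dr f rho : L2 mu Om f -> L2 mu (Dr zeta rho) f.
Proof. by apply: L2_Dr. Qed.

(* The field B(v_i) (v - gamma e_1) is tangential on the top by the kinematic
   condition, and B(0) = 0 on the bottom. *)
Lemma cosb_flux i (e : R) : 0 < e -> \int[mu]_(x in Om) (d1 (cosb e) (V i x) * h i x) = 0.
Proof.
move=> e0.
have cb := smooth1_continuous (@smooth1_cosb R e).
have mb : measurable_fun Om (fun x => cosb e (V i x)).
  by apply: measurableT_comp (lV i).1; exact: continuous_measurable_fun.
(* The truncated square is in L^2 by its Lipschitz bound and, next, in L^1 by its quadratic bound.
   The first serves the products with v_j, the second the constant part gamma e_1 of the transport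
   field. *)
have lB : L2 mu Om (fun x => cosb e (V i x)).
  apply: (L2_dom mO mb (L2Z mO e^-1 (lV i))) => x _.
  have := cosb_lip e0 (V i x) 0; rewrite cosb0 !subr0 => /le_trans; apply.
  by rewrite normrM gtr0_norm ?invr_gt0.
have iB : intg mu Om (fun x => cosb e (V i x)).
  by apply: (le_intg mO mb _ (lV i).2) => x _; exact: cosb_sq.
have aB := appr_comp cz zM (@smooth1_cosb R e) (cosb0 e) (d1_cosb_bound e0) (cosb_lip e0)
  (d1_cosb_lip e0) (apprV i).
have lU rho j : 0 < rho -> L2 mu (Dr zeta rho) (U j).
  move=> r0; apply: (L2B (Dr_meas cz rho)); first exact: L2Dr.
  by apply: (Dr_cont_L2 cz zM r0); exact: cont_cst.
have l0 rho : 0 < rho -> L2 mu (Dr zeta rho) (fun=> 0) by move=> r0; exact: L20.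
have D := divid_mul cz zM lU l0 divid_U aB.
have GE x : 0 * cosb e (V i x) + \sum_j U j x * (d1 (cosb e) (V i x) * dv i j x) = d1 (cosb e) (V i
  x) * h i x.
  by rewrite mul0r add0r /h mulr_sumr; apply: eq_bigr => j _; rewrite mulrCA.
rewrite (funext GE) in D.
have mdb : measurable_fun Om (fun x => d1 (cosb e) (V i x)).
  by apply: measurableT_comp (lV i).1; apply: continuous_measurable_fun;
    exact: smooth1_continuous (smooth1_derive (@smooth1_cosb R e)).
have ldb : L2 mu Om (fun x => d1 (cosb e) (V i x)).
  by apply: (L2_dom mO mdb (lV i)) => x _; exact: d1_cosb_le.
have iG := L2_intM mO ldb (hL2 i).
have iF j : intg mu Om (fun x => U j x * cosb e (V i x)).
  rewrite (_ : (fun x => _) = fun x =>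
    V j x * cosb e (V i x) - gamma * (j == I0)%:R * cosb e (V i x)); last first.
    by apply/funext => x; rewrite /U mulrBl.
  by apply: (intgB mO); [exact: L2_intM|exact: intgZ].
have bot : vanish zeta (fun=> 0) (fun x => U ord_max x * cosb e (V i x)).
  rewrite (_ : (fun x => _) = fun x => V ord_max x * cosb e (V i x)).
    by apply: bottom_vanish => rho _; exact: L2Dr.
  by apply/funext => x; rewrite /U /I0 (_ : ord_max == lift ord_max i0 = false) ?mulr0 ?subr0//;
    apply/negbTE; rewrite neq_lift.
have topv : vanish zeta zeta (fun x => U ord_max x * cosb e (V i x) -
    \sum_(j < d) U (lift ord_max j) x * cosb e (V i x) * 'D_(ee j) eta (hpart x) - (fun=> 0) (hpart
      x)).
  rewrite (_ : (fun x => _) = fun x => (vN x - tN (hpart x)) * cosb e (V i x)).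
    by apply: top_vanish => rho _; exact: L2Dr.
  apply/funext => x; rewrite /U /vN /tN subr0 /I0.
  rewrite (_ : ord_max == lift ord_max i0 = false); last by apply/negbTE; rewrite neq_lift.
  rewrite mulr0 subr0.
  have -> : \sum_(j < d) (V (lift ord_max j) x - gamma * (lift ord_max j == lift ord_max i0)%:R) *
    cosb e (V i x) * 'D_(ee j) eta (hpart x) =
     (\sum_(j < d) V (lift ord_max j) x * dh j x - gamma * dh i0 x) * cosb e (V i x).
    transitivity (\sum_(j < d) (V (lift ord_max j) x * dh j x - gamma * ((j == i0)%:R * dh j x)) *
      cosb e (V i x)).
      by apply: eq_bigr => j _; rewrite (inj_eq lift_inj) /dh; ring.
    rewrite -mulr_suml sumrB -mulr_sumr; congr ((_ - gamma * _) * _).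
    by rewrite (bigD1 i0)//= eqxx mul1r big1 ?addr0// => j /negbTE ->; rewrite mul0r.
  rewrite /dh; ring.
have := flux_global ne zM zm0 zmz c0 iG iF D bot topv.
move=> lim; apply/esym; apply: (@cvg_unique _ (@Rhausdorff R) _ _ _ _ _ lim).
rewrite (_ : (fun k => _) = fun=> 0); first exact: cvg_cst.
by apply/funext => k; rewrite (_ : (fun y => _) = fun=> 0) ?Rintegral_cst ?mul0r//;
  apply/funext => y; rewrite mul0r.
Qed.

(** As e tends to 0 the derivative of [cosb e] at v_i tends to v_i and never exceeds it in absolute
    value; the product with [h i] is dominated because both v_i and [h i] are in L^2. *)
Lemma convection_energy i : \int[mu]_(x in Om) (V i x * h i x) = 0.
Proof.
have l : (fun k : nat => \int[mu]_(x in Om) (d1 (cosb k.+1%:R^-1) (V i x) * h i x)) @ \oo -->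
    \int[mu]_(x in Om) (V i x * h i x).
  have e0 k : 0 < k.+1%:R^-1 :> R by rewrite invr_gt0.
  have iVh := L2_intM mO (lV i) (hL2 i).
  have mh : measurable_fun Om (h i) := (hL2 i).1.
  apply: (@Rdct _ _ _ mu Om (fun k x => d1 (cosb k.+1%:R^-1) (V i x) * h i x) _ (fun x =>
    `|V i x * h i x|) mO).
  - move=> k; apply: measurable_funM mh; apply: measurableT_comp (lV i).1.
    by apply: continuous_measurable_fun;
      exact: smooth1_continuous (smooth1_derive (@smooth1_cosb R _)).
  - exact: (intg_abs mO).
  - by move=> k x _; rewrite !normrM; apply: ler_wpM2r => //; exact: d1_cosb_le.
  move=> x _; apply: cvgM; last exact: cvg_cst.
  apply/subr_cvg0; apply: norm_cvg0.
  have lim : (fun k : nat => k.+1%:R^-1 * V i x ^+ 2) @ \oo --> (0 : R).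
    by rewrite -[X in _ --> X](mul0r (V i x ^+ 2)); apply: cvgM;
      [exact: cvg_harmonic|exact: cvg_cst].
  apply: (squeeze_cvgr _ (cvg_cst 0) lim); apply: nearW => k; rewrite normr_ge0 /=.
  exact: d1_cosb_near.
apply/esym; apply: (@cvg_unique _ (@Rhausdorff R) _ _ _ _ _ l).
rewrite (_ : (fun k => _) = fun=> 0); first exact: cvg_cst.
by apply/funext => k; rewrite cosb_flux// invr_gt0.
Qed.

Let H := curvature eta.
Let nrm i (y : 'rV[R]_d) : R := if unlift ord_max i is Some j then - 'D_(ee j) eta y else 1.
(** The full stress q I - Dv, as q = p + eta. The boundary condition concerns [T], the energy
    identity [S]. *)
Let T i j x := S i j x + eta (hpart x) * (i == j)%:R.
Let st i x := T i ord_max x - \sum_(j < d) T i (lift ord_max j) x * dh j x.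
Let ts i y := (eta y - sigma * H y) * nrm i y.
Hypothesis st_meas : forall i, measurable_fun Om (st i).
Hypothesis trS : forall i, has_trace Om zeta (st i) (ts i).
Let Gs i x := dp i x - \sum_j lap i j x.

Lemma lS i j : L2 mu Om (S i j).
Proof.
apply: (L2B mO); last by apply: (L2D mO).
rewrite (_ : (fun x => _) = fun x => (i == j)%:R * p x); first exact: L2Z.
by apply/funext => x; rewrite mulrC.
Qed.

Lemma lGs i : L2 mu Om (Gs i).
Proof. by apply: (L2B mO) (ldp i) _; apply: (L2_sum mO) => k _. Qed.

(** Row i of the stress has divergence d_i p - Lap v_i. The transposed gradient contributes nothing:
    moving d_i onto the test function and exchanging derivatives leaves v tested against the
    gradient of d_i phi, which is 0 by incompressibility. Thus mixed second weak derivatives of v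
    never appear. *)
Lemma divid_S i : divid zeta (S i) (Gs i).
Proof.
move=> phi tp.
have tj j := test_der j tp; have sp := test_smooth tp.
have ip j : intg mu Om (fun x => p x * (i == j)%:R * 'D_(ee j) phi x).
  rewrite (_ : (fun x => _) = fun x => (i == j)%:R * (p x * 'D_(ee j) phi x));
    last by apply/funext => x; ring.
  by apply: (intgZ _ mO); exact: L2_test lp (tj j).
have i1 k j : intg mu Om (fun x => dv k j x * 'D_(ee j) phi x) by exact: L2_test (ldv k j) (tj j).
have i2 j : intg mu Om (fun x => dv j i x * 'D_(ee j) phi x) by exact: L2_test (ldv j i) (tj j).
have il j : intg mu Om (fun x => lap i j x * phi x) by exact: L2_test (llap i j) tp.
have id : intg mu Om (fun x => dp i x * phi x) by exact: L2_test (ldp i) tp.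
have [A AE] : exists A : 'I_d.+1 ->
  R, forall j, A j = \int[mu]_(x in Om) (p x * (i == j)%:R * 'D_(ee j) phi x).
  by eexists => j; exact: erefl.
have [B BE] : exists B : 'I_d.+1 -> R, forall j, B j = \int[mu]_(x in Om) (lap i j x * phi x).
  by eexists => j; exact: erefl.
have [C CEE] : exists C : 'I_d.+1 ->
  R, forall j, C j = \int[mu]_(x in Om) (V j x * 'D_(ee i) (fun x => 'D_(ee j) phi x) x).
  by eexists => j; exact: erefl.
have E j : \int[mu]_(x in Om) (S i j x * 'D_(ee j) phi x) = A j + (B j + C j).
  rewrite AE BE CEE.
  have e1 : \int[mu]_(x in Om) (dv i j x * 'D_(ee j) phi x) = - \int[mu]_(x in Om) (lap i j x * phi
    x).
    have [_ _ w1] := wdv i j; have [_ _ w2] := wlap i j.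
    have a1 := w1 _ (tj j); rewrite expr1 mulN1r in a1.
    have a2 := w2 _ tp; rewrite expr2 mulrNN mulr1 mul1r in a2.
    by rewrite -a2; apply/eqP; rewrite -eqr_oppLR; apply/eqP; exact: (esym a1).
  have e2 : \int[mu]_(x in Om) (dv j i x * 'D_(ee j) phi x) = - \int[mu]_(x in Om) (V j x * 'D_(ee
    i) (fun x => 'D_(ee j) phi x) x).
    have [_ _ w1] := wdv j i.
    have a1 := w1 _ (tj j); rewrite expr1 mulN1r in a1.
    by apply/eqP; rewrite -eqr_oppLR; apply/eqP; exact: (esym a1).
  rewrite (_ : (fun x => S i j x * _) = fun x =>
    p x * (i == j)%:R * 'D_(ee j) phi x - (dv i j x * 'D_(ee j) phi x + dv j i x * 'D_(ee j) phi
    x)); last first.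
    by apply/funext => x; rewrite /S mulrBl mulrDl.
  refine (etrans (RintegralB mO (ip j) (intgD mO (i1 i j) (i2 j))) _); congr (_ + _).
  refine (etrans (congr1 -%R (RintegralD mO (i1 i j) (i2 j))) _).
  have oppNN (x y : R) : - (- x + - y) = x + y by ring.
  exact: (etrans (congr1 -%R (congr2 +%R e1 e2)) (oppNN _ _)).
(* The transposed gradient: after exchanging d_i and d_j on [phi], the sum is the weak divergence of
   v tested with d_i phi. *)
have sC : \sum_j C j = 0.
  have C' j : C j = \int[mu]_(x in Om) (V j x * 'D_(ee j) (fun x => 'D_(ee i) phi x) x).
    have sw x : 'D_(ee i) (fun x => 'D_(ee j) phi x) x = 'D_(ee j) (fun x => 'D_(ee i) phi x) x.
      exact: (@schwarz _ _ phi j i x sp).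
    by rewrite CEE; apply: eq_Rintegral => x _; rewrite sw.
  rewrite (eq_bigr _ (fun j _ => C' j)) (divid_V (tj i)); under eq_Rintegral do rewrite mul0r.
  by rewrite Rintegral_cst ?mul0r ?oppr0.
have sA : \sum_j A j = - \int[mu]_(x in Om) (dp i x * phi x).
  have A0 j : j != i -> A j = 0.
    rewrite eq_sym AE => /negbTE ->; under eq_Rintegral do rewrite mulr0 mul0r.
    by rewrite Rintegral_cst ?mul0r.
  rewrite (bigD1 i)//= (big1 _ _ _ A0) addr0 AE eqxx; under eq_Rintegral do rewrite mulr1.
  have [_ _ /(_ phi tp)] := wdp i; rewrite expr1 mulN1r; exact.
have sB : \sum_j B j = \int[mu]_(x in Om) \sum_j lap i j x * phi x.
  by rewrite (@Rintegral_sum _ _ _ mu _ (index_enum 'I_d.+1) xpredT _ _ mO (fun j _ =>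
    il j)) (eq_bigr _ (fun j _ => BE j)).
have iS := @intg_sum _ _ _ mu _ (index_enum 'I_d.+1) xpredT _ _ mO (fun j _ => il j).
have spl : \sum_j (A j + (B j + C j)) = \sum_j A j + (\sum_j B j + \sum_j C j) by rewrite
  !big_split.
rewrite (eq_bigr _ (fun j _ => E j)) spl sC sA sB addr0.
have e3 : \int[mu]_(x in Om) (Gs i x * phi x) = \int[mu]_(x in Om) (dp i x * phi x) -
    \int[mu]_(x in Om) \sum_j lap i j x * phi x.
  rewrite -(RintegralB mO id iS); apply: eq_Rintegral => x _.
  by rewrite /Gs mulrBl mulr_suml.
rewrite e3 opprB addrC; exact: erefl.
Qed.

(* The boundary term is sigma gamma times the integral of H(eta) d_1 eta, which
   vanishes by curvature_flux. *)
Lemma stress_energy : \int[mu]_(x in Om) (\sum_i (Gs i x * V i x + \sum_j S i j x * dv i j x)) = 0.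
Proof.
have lSD i rho j : 0 < rho -> L2 mu (Dr zeta rho) (S i j) by move=> _; apply: L2Dr; exact: lS.
have lGD i rho : 0 < rho -> L2 mu (Dr zeta rho) (Gs i) by move=> _; apply: L2Dr; exact: lGs.
have D i := divid_mul cz zM (lSD i) (lGD i) (@divid_S i) (apprV i).
have iSV i j : intg mu Om (fun x => S i j x * V i x) by apply: (L2_intM mO) (lV i); exact: lS.
have iGi i : intg mu Om (fun x => Gs i x * V i x + \sum_j S i j x * dv i j x).
  apply: (intgD mO); first exact: (L2_intM mO (lGs i) (lV i)).
  apply: (@intg_sum _ _ _ mu _ (index_enum 'I_d.+1) xpredT _ _ mO) => j _.
  exact: (L2_intM mO (lS i j) (ldv i j)).
have DS := divid_sum ne iSV iGi D.
have iG := @intg_sum _ _ _ mu _ (index_enum 'I_d.+1) xpredT _ _ mO (fun j _ => iGi j).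
have iF j : intg mu Om (fun x => \sum_i S i j x * V i x).
  exact: (@intg_sum _ _ _ mu _ (index_enum 'I_d.+1) xpredT _ _ mO (fun i _ => iSV i j)).
pose t y := sigma * gamma * (H y * 'D_(ee i0) eta y).
have cH : continuous H by exact: curvature_cont.
have cD0 : continuous (fun y => 'D_(ee i0) eta y) by exact: C1f_dcont ce.
have ct : continuous t by apply: contM; [exact: cont_cst|apply: contM; [exact: cH|exact: cD0]].
have bot : vanish zeta (fun=> 0) (fun x => \sum_i S i ord_max x * V i x).
  apply: (vanish_sum cz c0) => i.
  rewrite (_ : (fun x => _) = fun x => V i x * S i ord_max x); last by apply/funext => x;
    rewrite mulrC.
  by apply: bottom_vanish => rho r0; exact: lSD.
have topv : vanish zeta zeta (fun x => \sum_i S i ord_max x * V i x -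
    \sum_(j < d) (\sum_i S i (lift ord_max j) x * V i x) * 'D_(ee j) eta (hpart x) - t (hpart x)).
  (* Two replacements, each with a vanishing error. Putting the trace for T n, the eta n terms
     cancel and S n . v becomes - sigma H (v . n); then the kinematic condition turns v . n into -
     gamma d_1 eta, which leaves [t]. *)
  rewrite (_ : (fun x => _) = fun x =>
    \sum_i (st i x - ts i (hpart x)) * V i x + (vN x - tN (hpart x)) * (- sigma * H (hpart x))).
    apply: (vanishD cz cz).
      apply: (vanish_sum cz cz) => i.
      apply: (vanish_mul cz zM cz topz' ntopz (st_meas i) (trS i)) => rho _; exact: L2Dr.
    apply: top_vanish => rho r0; apply: (Dr_cont_L2 cz zM r0).
    by apply: contM; [exact: cont_cst|exact: (cont_hpart cH)].
  apply/funext => x.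
  have -> : \sum_i (st i x - ts i (hpart x)) * V i x = \sum_i S i ord_max x * V i x -
     \sum_(j < d) (\sum_i S i (lift ord_max j) x * V i x) * dh j x + sigma * H (hpart x) * vN x.
    have -> : \sum_(j < d) (\sum_i S i (lift ord_max j) x * V i x) * dh j x =
       \sum_i (\sum_(j < d) S i (lift ord_max j) x * dh j x) * V i x.
      under eq_bigr do rewrite mulr_suml; rewrite exchange_big/=.
      apply: eq_bigr => i _; rewrite mulr_suml; apply: eq_bigr => j _; exact: mulrAC.
    have -> : vN x = \sum_i nrm i (hpart x) * V i x.
      rewrite sum_lift /vN /nrm unlift_none mul1r; congr (_ + _); rewrite -sumrN;
        apply: eq_bigr => j _.
      by rewrite liftK mulNr mulrC.
    rewrite mulr_sumr -sumrB -big_split/=; apply: eq_bigr => i _.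
    have -> : st i x = S i ord_max x - \sum_(j < d) S i (lift ord_max j) x * dh j x + eta (hpart x)
      * nrm i (hpart x).
      rewrite /st /T; under eq_bigr do rewrite mulrDl; rewrite big_split/= opprD.
      have -> : nrm i (hpart x) = (i == ord_max)%:R - \sum_(j < d) (i == lift ord_max j)%:R * dh j
        x.
        rewrite /nrm; case: unliftP => [j ->|->].
          rewrite (_ : lift ord_max j == ord_max = false); last by apply/negbTE;
            rewrite eq_sym neq_lift.
          rewrite sub0r (bigD1 j)//= eqxx mul1r big1 ?addr0// => k kj.
          by rewrite (inj_eq lift_inj) eq_sym (negbTE kj) mul0r.
        by rewrite eqxx big1 ?subr0// => k _; rewrite (negbTE (neq_lift _ _)) mul0r.
      rewrite mulrBr mulr_sumr.
      have -> : \sum_(j < d) eta (hpart x) * (i == lift ord_max j)%:R * dh j x = \sum_(j < d) eta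
        (hpart x) * ((i == lift ord_max j)%:R * dh j x).
        by apply: eq_bigr => j _; rewrite mulrA.
      by move: (\sum_(j < d) _) (\sum_(j < d) _) => a c; ring.
    rewrite /ts; ring.
  rewrite /t /tN -/(dh i0 x); move: (\sum_(j < d) _) => a; rewrite /dh; ring.
have lim := flux_global ne zM zm0 zmz ct iG iF DS bot topv.
have cf := curvature_flux i0 CE slope_L2.
have E k : \int[leb d]_y (t y * cutoff k.+1%:R y) = sigma * gamma * \int[leb d]_y (curvature eta y
  * 'D_(ee i0) eta y * cutoff k.+1%:R y).
  have tk : test_fun setT (cutoff k.+1%:R : 'rV[R]_d -> R) by apply: test_cutoff; rewrite ltr0n.
  have cHD : continuous (fun y => H y * 'D_(ee i0) eta y) by apply: contM; [exact: cH|exact: cD0].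
  rewrite -(RintegralZl _ measurableT (cont_test_intg cHD tk)).
  by apply: eq_Rintegral => y _; rewrite /t /H !mulrA.
have lim0 : (fun k : nat => \int[leb d]_y (t y * cutoff k.+1%:R y)) @ \oo --> (0 : R).
  rewrite (funext E) -[X in _ --> X](mulr0 (sigma * gamma)).
  by apply: cvgM; [exact: cvg_cst|exact: cf].
exact: (@cvg_unique _ (@Rhausdorff R) _ _ _ _ lim lim0).
Qed.

Lemma smooth_shift (f : 'rV[R]_d -> R) a : smooth f -> smooth (fun y => f (y + a)).
Proof.
move=> sf; apply: (@smooth_coinduction _ _ (fun g => exists2 f : 'rV[R]_d ->
  R, smooth f & g = fun y => f (y + a))); last by exists f.
move=> _ [f' sf' ->]; have [[c1 c2 c3] E] := shift_C1f a (smooth_C1f sf').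
split; [exact: c1|exact: c2|move=> i; exists (fun y => 'D_(ee i) f' y); first exact: smooth_der].
exact/funext/(E i).
Qed.

Let psi (k : nat) y := eta y - 2^-1 * (eta (y + k%:R *: ee i0) + eta (y + (- k%:R) *: ee i0)).

Lemma psi_C1f k : C1f (psi k) /\ forall j y, 'D_(ee j) (psi k) y = 'D_(ee j) eta y -
  2^-1 * ('D_(ee j) eta (y + k%:R *: ee i0) + 'D_(ee j) eta (y + (- k%:R) *: ee i0)).
Proof.
have [s1 E1] := shift_C1f (k%:R *: ee i0) ce; have [s2 E2] := shift_C1f ((- k%:R) *: ee i0) ce.
have [s3 E3] := C1fD s1 s2; have [s4 E4] := C1fM (C1f_cst 2^-1) s3; have [s5 E5] := C1fB ce s4.
split; first exact: s5.
by move=> j y; rewrite (E5 j y) (E4 j y) (E3 j y) (E1 j y) (E2 j y) derive_cst mul0r add0r.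
Qed.

Lemma psi_approx k (e : R) : 0 < e -> exists g : 'rV[R]_d -> R,
  [/\ smooth g, forall x, `|g x - psi k x| <= e & forall x i,
    `|'D_(ee i) g x - 'D_(ee i) (psi k) x| <= e].
Proof.
move=> e0; have e2 : 0 < e / 2 by rewrite divr_gt0.
have tri (x x' y y' z z' : R) : `|x - x'| <= e / 2 -> `|y - y'| <= e / 2 -> `|z - z'| <= e / 2 ->
    `|x - 2^-1 * (y + z) - (x' - 2^-1 * (y' + z'))| <= e.
  by rewrite !ler_norml => /andP[? ?] /andP[? ?] /andP[? ?]; apply/andP; split; lra.
have [g [sg h1 h2]] := nice_approx ne e2.
have cg := smooth_C1f sg.
have [s1 E1] := shift_C1f (k%:R *: ee i0) cg; have [s2 E2] := shift_C1f ((- k%:R) *: ee i0) cg.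
have [s3 E3] := C1fD s1 s2; have [s4 E4] := C1fM (C1f_cst 2^-1) s3; have [s5 E5] := C1fB cg s4.
exists (fun y => g y - 2^-1 * (g (y + k%:R *: ee i0) + g (y + (- k%:R) *: ee i0))); split.
- apply: smoothB => //; apply: smoothM; first exact: smooth_cst.
  by apply: smoothD; exact: smooth_shift.
- by move=> y; exact: (tri _ _ _ _ _ _ (h1 y) (h1 (y + k%:R *: ee i0)) (h1 (y + (- k%:R) *: ee
  i0))).
move=> y i; rewrite ((psi_C1f k).2 i y) (E5 i y) (E4 i y) (E3 i y) (E1 i y) (E2 i y) derive_cst
  mul0r add0r.
exact: (tri _ _ _ _ _ _ (h2 y i) (h2 (y + k%:R *: ee i0) i) (h2 (y + (- k%:R) *: ee i0) i)).
Qed.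

(** The field psi v is integrable and its divergence is v . grad psi. Its flux through the top is -
    gamma psi d_1 eta, whose integral is 0 by [second_difference]. *)
Lemma psi_flux k : \int[mu]_(x in Om) (\sum_j V j x * 'D_(ee j) (fun x => psi k (hpart x)) x) = 0.
Proof.
have [cp Ep] := psi_C1f k; have cpc := C1f_cont cp.
have cDp j : continuous (fun y => 'D_(ee j) (psi k) y) by exact: C1f_dcont cp.
have ap := appr_hpart cz zM cpc cDp (@psi_approx k).
have [lpsi opsi] := second_difference k%:R ce (slope_L2 i0).
have lVD rho j : 0 < rho -> L2 mu (Dr zeta rho) (V j) by move=> _; exact: L2Dr.
have l0 rho : 0 < rho -> L2 mu (Dr zeta rho) (fun=> 0) by move=> r0; exact: L20.
have D := divid_mul cz zM lVD l0 divid_V ap.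
have GE x : 0 * psi k (hpart x) + \sum_j V j x * 'D_(ee j) (fun x =>
  psi k (hpart x)) x = \sum_j V j x * 'D_(ee j) (fun x => psi k (hpart x)) x.
  by rewrite mul0r add0r.
rewrite (funext GE) in D.
have [lph _] := hpart_L2 cz zM lpsi.
have ldp' j : L2 mu Om (fun x => 'D_(ee j) (fun x => psi k (hpart x)) x).
  move: j; apply: ptP => [|j].
    rewrite (_ : (fun x => _) = fun=> 0); first exact: L20.
    by apply/funext => x; exact: (derive_hpart_max (psi k) x).2.
  rewrite (_ : (fun x => _) = fun x : 'rV[R]_d.+1 => 'D_(ee j) (psi k) (hpart x)); last first.
    by apply/funext => x; exact: derive_hpart.
  have lq : L2 (leb d) setT (fun y => 'D_(ee j) (psi k) y).
    rewrite (funext (Ep j)); apply: (L2B measurableT (slope_L2 j)); apply: (L2Z measurableT).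
    exact: (L2D measurableT (L2_shift (k%:R *: ee i0) (slope_L2 j)) (L2_shift ((- k%:R) *: ee i0)
      (slope_L2 j))).
  exact: (hpart_L2 cz zM lq).1.
have iG : intg mu Om (fun x => \sum_j V j x * 'D_(ee j) (fun x => psi k (hpart x)) x).
  by apply: (@intg_sum _ _ _ mu _ (index_enum 'I_d.+1) xpredT _ _ mO) => j _;
    exact: (L2_intM mO (lV j) (ldp' j)).
have iF j : intg mu Om (fun x => V j x * psi k (hpart x)) by exact: (L2_intM mO (lV j) lph).
pose t y := - gamma * (psi k y * 'D_(ee i0) eta y).
have cD0 : continuous (fun y => 'D_(ee i0) eta y) by exact: C1f_dcont ce.
have ct : continuous t by apply: contM; [exact: cont_cst|apply: contM; [exact: cpc|exact: cD0]].
have lpD rho : 0 < rho -> L2 mu (Dr zeta rho) (fun x => psi k (hpart x)) by move=> _; exact: L2Dr.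
have bot := bottom_vanish ord_max lpD.
have topv : vanish zeta zeta (fun x => V ord_max x * psi k (hpart x) -
    \sum_(j < d) V (lift ord_max j) x * psi k (hpart x) * 'D_(ee j) eta (hpart x) - t (hpart x)).
  rewrite (_ : (fun x => _) = fun x => (vN x - tN (hpart x)) * psi k (hpart x));
    first exact: top_vanish.
  apply/funext => x; rewrite /vN /tN /t.
  have -> : \sum_(j < d) V (lift ord_max j) x * psi k (hpart x) * 'D_(ee j) eta (hpart x) =
     (\sum_(j < d) V (lift ord_max j) x * dh j x) * psi k (hpart x).
    by rewrite mulr_suml; apply: eq_bigr => j _; rewrite mulrAC.
  ring.
have lim := flux_global ne zM zm0 zmz ct iG iF D bot topv.
have ipe := L2_intM measurableT lpsi (slope_L2 i0).
have it := intgZ (- gamma) measurableT ipe.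
have mid (g : 'rV[R]_d -> R) : continuous g ->
  measurable_fun setT (fun x => g x) by exact: continuous_measurable_rV.
have lim2 := @cutoff_cvg _ _ _ _ (leb d) setT (fun x => x) measurableT mid _ it.
rewrite (RintegralZl _ measurableT ipe) opsi mulr0 in lim2.
exact: (@cvg_unique _ (@Rhausdorff R) _ _ _ _ lim lim2).
Qed.

(* Replace eta by eta minus the average of its translates by k e_1 and - k e_1:
   this is in L^2, its flux vanishes by antisymmetry, and as k grows the gradients
   of the translates tend weakly to zero. *)
Lemma gravity_flux : \int[mu]_(x in Om) (\sum_j V j x * deta j x) = 0.
Proof.
pose c (s : R) (k : nat) := \sum_(j < d) \int[mu]_(x in Om) (V (lift ord_max j) x * 'D_(ee j) eta
  (hpart x + (s * k%:R) *: ee i0)).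
have cl s : `|s| = 1 -> (fun k => c s k) @ \oo --> (0 : R).
  move=> s1; rewrite -[X in _ --> X](_ : \sum_(j < d) (0 : R) = 0); last by rewrite big1.
  apply: cvg_big => [|j _]; first exact: add_continuous.
  exact: (translate_cvg0 i0 cz zM s1 (lV (lift ord_max j)) (slope_L2 j)).
have lsh j (s : R) (k : nat) : L2 mu Om (fun x => 'D_(ee j) eta (hpart x + (s * k%:R) *: ee i0)).
  exact: (hpart_L2 cz zM (L2_shift ((s * k%:R) *: ee i0) (slope_L2 j))).1.
have i1 j : intg mu Om (fun x => V (lift ord_max j) x * dh j x).
  have := L2_intM mO (lV (lift ord_max j)) (deta_L2 (lift ord_max j)).
  by rewrite (_ : (fun x => V (lift ord_max j) x * deta (lift ord_max j) x) = fun x =>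
    V (lift ord_max j) x * dh j x)//; apply/funext => x; rewrite detaE.
have i2 j s k : intg mu Om (fun x =>
  V (lift ord_max j) x * 'D_(ee j) eta (hpart x + (s * k%:R) *: ee i0)).
  exact: (L2_intM mO (lV (lift ord_max j)) (lsh j s k)).
set A := \int[mu]_(x in Om) _.
have AE : A = \sum_(j < d) \int[mu]_(x in Om) (V (lift ord_max j) x * dh j x).
  rewrite -(@Rintegral_sum _ _ _ mu _ (index_enum 'I_d) xpredT _ _ mO (fun j _ => i1 j)).
  apply: eq_Rintegral => x _; rewrite sum_lift deta_max mulr0 add0r.
  by apply: eq_bigr => j _; rewrite detaE.
have key k : A = 2^-1 * (c 1 k + c (-1) k).
  have alg (x y z : 'I_d -> R) : \sum_j (x j - 2^-1 * (y j + z j)) = \sum_j x j - 2^-1 * (\sum_j y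
    j + \sum_j z j).
    by rewrite sumrB -mulr_sumr big_split.
  have i3 j := intgZ 2^-1 mO (intgD mO (i2 j 1 k) (i2 j (-1) k)).
  have e1 j : \int[mu]_(x in Om) (V (lift ord_max j) x * dh j x - 2^-1 *
      (V (lift ord_max j) x * 'D_(ee j) eta (hpart x + (1 * k%:R) *: ee i0) + V (lift ord_max j) x
        * 'D_(ee j) eta (hpart x + (-1 * k%:R) *: ee i0))) =
    \int[mu]_(x in Om) (V (lift ord_max j) x * dh j x) -
    2^-1 * (\int[mu]_(x in Om) (V (lift ord_max j) x * 'D_(ee j) eta (hpart x + (1 * k%:R) *: ee
      i0)) +
    \int[mu]_(x in Om) (V (lift ord_max j) x * 'D_(ee j) eta (hpart x + (-1 * k%:R) *: ee i0))).
    refine (etrans (RintegralB mO (i1 j) (i3 j)) (congr1 (fun z => _ - z) _)).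
    refine (etrans (RintegralZl _ mO (intgD mO (i2 j 1 k) (i2 j (-1) k))) (congr1 (fun z =>
      _ * z) _)).
    exact: (RintegralD mO (i2 j 1 k) (i2 j (-1) k)).
  have e2 := etrans (@Rintegral_sum _ _ _ mu _ (index_enum 'I_d) xpredT _ _ mO (fun j _ =>
    intgB mO (i1 j) (i3 j)))
    (etrans (eq_bigr _ (fun j _ => e1 j)) (alg _ _ _)).
  have e3 : \int[mu]_(x in Om) (\sum_(j < d) (V (lift ord_max j) x * dh j x - 2^-1 *
      (V (lift ord_max j) x * 'D_(ee j) eta (hpart x + (1 * k%:R) *: ee i0) + V (lift ord_max j) x
        * 'D_(ee j) eta (hpart x + (-1 * k%:R) *: ee i0)))) = 0.
    refine (etrans _ (psi_flux k)); apply: eq_Rintegral => x _.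
    rewrite sum_lift (derive_hpart_max (psi k) x).2 mulr0 add0r.
    apply: eq_bigr => j _; rewrite derive_hpart ((psi_C1f k).2 j (hpart x)) mul1r mulN1r /dh; ring.
  exact: (etrans AE (subr0_eq (etrans (esym e2) e3))).
have lim : (fun k : nat => 2^-1 * (c 1 k + c (-1) k)) @ \oo --> (0 : R).
  rewrite -[X in _ --> X](_ : 2^-1 * (0 + 0) = 0); last by rewrite addr0 mulr0.
  apply: cvgM; first exact: cvg_cst.
  by apply: cvgD; apply: cl; rewrite ?normrN normr1.
have lim2 : (fun k : nat => 2^-1 * (c 1 k + c (-1) k)) @ \oo --> A.
  by rewrite (_ : (fun k => _) = fun=> A); [exact: cvg_cst|apply/funext => k; rewrite -key].
exact: (@cvg_unique _ (@Rhausdorff R) _ _ _ _ lim2 lim).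
Qed.

Let E i j x := dv i j x + dv j i x.

(* The sum of the three energy identities is - |Dv|^2 / 2 integrated over Om. *)
Lemma strain_zero : {ae mu, forall x, Om x -> forall i j, E i j x = 0}.
Proof.
have lE i j : L2 mu Om (E i j) by apply: (L2D mO).
pose K x := \sum_i \sum_j E i j x ^+ 2.
have iK : intg mu Om K.
  apply: (@intg_sum _ _ _ mu _ (index_enum 'I_d.+1) xpredT _ _ mO) => i _.
  by apply: (@intg_sum _ _ _ mu _ (index_enum 'I_d.+1) xpredT _ _ mO) => j _; case: (lE i j).
have K0 x : 0 <= K x by apply: sumr_ge0 => i _; apply: sumr_ge0 => j _; exact: sqr_ge0.
have iVh i : intg mu Om (fun x => V i x * h i x) by exact: (L2_intM mO (lV i) (hL2 i)).
pose A x := \sum_i V i x * h i x.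
pose B x := \sum_i V i x * deta i x.
have iA : intg mu Om A by exact: (@intg_sum _ _ _ mu _ (index_enum 'I_d.+1) xpredT _ _ mO (fun i _
  => iVh i)).
have iB : intg mu Om B.
  by apply: (@intg_sum _ _ _ mu _ (index_enum 'I_d.+1) xpredT _ _ mO) => i _;
    exact: (L2_intM mO (lV i) (deta_L2 i)).
have zA : \int[mu]_(x in Om) A x = 0.
  rewrite (@Rintegral_sum _ _ _ mu _ (index_enum 'I_d.+1) xpredT _ _ mO (fun i _ =>
    iVh i)) big1// => i _.
  exact: convection_energy.
have zB : \int[mu]_(x in Om) B x = 0 by exact: gravity_flux.
have GE : {ae mu, forall x, Om x ->
  \sum_i (Gs i x * V i x + \sum_j S i j x * dv i j x) = - A x - B x - 2^-1 * K x}.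
  have mom : {ae mu, forall x, forall i, Om x -> h i x - \sum_j lap i j x + dp i x + deta i x = 0}.
    by apply: filter_forall => i; exact: momentum.
  apply: filterS2 mom incompressible => x mx ix Ox.
  have g i : Gs i x = - h i x - deta i x.
    have := mx i Ox; rewrite /Gs; move: (h i x) (\sum_j lap i j x) (dp i x) (deta i x) => *; lra.
  rewrite big_split /=.
  have -> : \sum_i Gs i x * V i x = - A x - B x.
    by rewrite /A /B -!sumrN -big_split/=; apply: eq_bigr => i _; rewrite g; ring.
  congr (_ + _).
  have := strain_algebra (p x) (fun i j => dv i j x); rewrite (ix Ox) mulr0 sub0r; exact.
have iGi i : intg mu Om (fun x => Gs i x * V i x + \sum_j S i j x * dv i j x).
  apply: (intgD mO); first exact: (L2_intM mO (lGs i) (lV i)).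
  apply: (@intg_sum _ _ _ mu _ (index_enum 'I_d.+1) xpredT _ _ mO) => j _.
  exact: (L2_intM mO (lS i j) (ldv i j)).
have iG := @intg_sum _ _ _ mu _ (index_enum 'I_d.+1) xpredT _ _ mO (fun j _ => iGi j).
have iNA := intgN mO iA; have iAB := intgB mO iNA iB; have iK2 := intgZ 2^-1 mO iK.
have iR := intgB mO iAB iK2.
have e1 := ae_Rint mO (intg_meas iG) (intg_meas iR) GE.
have e2 : \int[mu]_(x in Om) (- A x - B x - 2^-1 * K x) = - (2^-1 * \int[mu]_(x in Om) K x).
  refine (etrans (RintegralB mO iAB iK2) _).
  refine (etrans (congr2 (fun a c => a - c) (RintegralB mO iNA iB) (RintegralZl _ mO iK)) _).
  have -> : \int[mu]_(x in Om) (- A x) = 0.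
    by rewrite (_ : (fun x => - A x) = fun x => (-1) * A x) ?(RintegralZl _ mO iA) ?zA ?mulr0//;
      apply/funext => x; rewrite mulN1r.
  by rewrite zB subrr sub0r.
have zK : \int[mu]_(x in Om) K x = 0.
  have := etrans (esym stress_energy) (etrans e1 e2).
  move: (\int[mu]_(x in Om) K x) => k hk; lra.
have := Rint_ge0_eq0 mO iK (fun x _ => K0 x) zK.
apply: filterS => x kx Ox i j; have := kx Ox; rewrite /K => /eqP.
rewrite psumr_eq0 => [/allP /(_ i (mem_index_enum _)) /=|k _]; last by apply: sumr_ge0 => l _;
  exact: sqr_ge0.
rewrite psumr_eq0 => [/allP /(_ j (mem_index_enum _)) /=|k _]; last exact: sqr_ge0.
by rewrite sqrf_eq0 => /eqP.
Qed.

Lemma weak_deriv_ae l (u u' g : 'rV[R]_d.+1 -> R) : measurable_fun Om u' -> weak_deriv Om l u g ->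
  {ae mu, forall x, Om x -> u x = u' x} -> weak_deriv Om l u' g.
Proof.
move=> mu' [[mu_ lu] lg wu] uu'; split => //.
  split => // C cC CO; have mC := @compact_measurable R _ C cC.
  apply: (ae_intg mC _ (lu C cC CO)); first exact: measurable_funS mu'.
  by apply: filterS uu' => x h1 /CO; exact: h1.
move=> phi tp; rewrite -(wu phi tp).
have mp : measurable_fun Om (pD l phi).
  by apply: measurable_funTS; exact: continuous_measurable_rV (test_cont (test_pD l tp)).
apply: (ae_Rint mO); [exact: measurable_funM|exact: measurable_funM|].
by apply: filterS uu' => x h1 Ox; rewrite h1.
Qed.

Lemma wD_zero l (u : 'rV[R]_d.+1 -> R) : measurable_fun Om u ->
  {ae mu, forall x, Om x -> u x = 0} -> {ae mu, forall x, Om x -> wD Om l u x = 0}.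
Proof.
move=> mu_ u0.
have w0 : weak_deriv Om l (fun=> 0) (fun=> 0).
  have l0 : L1loc Om (fun=> 0 : R) by apply: cont_L1loc => //; exact: cont_cst.
  split => // phi _; under eq_Rintegral do rewrite mul0r.
  by under [in RHS]eq_Rintegral do rewrite mul0r; rewrite Rintegral_cst ?mul0r ?mulr0.
apply: (wD_ae oO (weak_deriv_ae mu_ w0 _)).
by apply: filterS u0 => x h1 Ox; rewrite h1.
Qed.

(** With a layer thick enough to fill the bounded piece, [trace_layer] bounds u - t by the vertical
    derivative, so a function without vertical variation coincides with its trace. *)
Lemma trace_rigid (top : 'rV[R]_d -> R) (u : 'rV[R]_d.+1 -> R) (t : 'rV[R]_d ->
  R) : continuous top ->
  (forall y, 0 <= top y <= zeta y) -> measurable_fun Om u -> has_trace Om top u t ->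
  {ae mu, forall x, Om x -> wD Om [:: ord_max] u x = 0} ->
  {ae mu, forall x, Om x -> u x = t (hpart x)}.
Proof.
move=> ct top01 mu_ tr w0; have mt := continuous_measurable_rV ct.
have M0 : 0 < M + M by have /andP[] := zM 0; lra.
have loc (k : nat) : {ae mu, forall x, Dr zeta k.+1%:R x -> u x - t (hpart x) = 0}.
  have k0 : 0 < k.+1%:R :> R by rewrite ltr0n.
  have mD := Dr_meas cz k.+1%:R.
  have [_ l1 l2] := has_trace_L2 cz zM ct top01 k0 mu_ tr.
  have := trace_layer mz mt top01 M0 k0 mu_ tr.
  rewrite (layer_full zM top01) (sqint_N2 mD (l1 _)) (sqint_N2 mD l2) -EFinM lee_fin.
  have -> : N2 mu (Dr zeta k.+1%:R) (wD (Omega zeta) [:: ord_max] u) ^+ 2 = 0.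
    rewrite N2_sq (@ae_Rint _ _ _ mu (Dr zeta k.+1%:R) _ (fun=> 0) mD);
      first by rewrite Rintegral_cst ?mul0r.
    - by apply: measurable_funX; case: (l1 ord_max).
    - exact: measurable_cst.
    by apply: filterS w0 => x h1 Dx; rewrite (h1 Dx.1) expr0n.
  rewrite mulr0 N2_sq => le0.
  have z : \int[mu]_(x in Dr zeta k.+1%:R) (u x - t (hpart x)) ^+ 2 = 0.
    by apply/eqP; rewrite eq_le le0 Rintegral_ge0// => x _; exact: sqr_ge0.
  have := Rint_ge0_eq0 mD l2.2 (fun x _ => sqr_ge0 _) z.
  by apply: filterS => x h1 Dx; apply/eqP; rewrite -sqrf_eq0; apply/eqP; exact: h1.
have : {ae mu, forall x, forall k : nat, Dr zeta k.+1%:R x -> u x - t (hpart x) = 0}.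
  exact/ae_foralln.
apply: filterS => x hx Ox.
apply/eqP; rewrite -subr_eq0; apply/eqP.
(* For this k, |x'|^2 < k + 1 <= (k + 1)^2, so x lies in the corresponding cylinder. *)
apply: (hx (Num.truncn (sqnorm (hpart x)))); split => //; rewrite /cyl /=.
have h1 := truncnS_gt (sqnorm (hpart x)).
apply: lt_le_trans h1 _; rewrite expr2 ler_peMr// ler1n.
exact: erefl.
Qed.

(* Dv = 0 gives d_n v_n = 0, hence v_n = 0 from the bottom condition, and then
   d_n v_j = - d_j v_n = 0. *)
Lemma velocity_zero i : {ae mu, forall x, Om x -> V i x = 0}.
Proof.
have n0 : {ae mu, forall x, Om x -> V ord_max x = 0}.
  apply: (trace_rigid c0 top0' (lV ord_max).1 (trV ord_max)).
  apply: filterS strain_zero => x hx Ox; have := hx Ox ord_max ord_max.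
  by rewrite /E /dv; move: (wD _ _ _ _) => a; lra.
have dn0 := wD_zero [:: i] (lV ord_max).1 n0.
apply: (trace_rigid c0 top0' (lV i).1 (trV i)).
apply: filterS2 strain_zero dn0 => x hx h0 Ox; have := hx Ox i ord_max.
by rewrite /E /dv (h0 Ox) addr0.
Qed.

(** Near a point where it is not 0, a continuous function has no zero on some cube, and cubes have
    positive measure. *)
Lemma cont_ae0 n (f : 'rV[R]_n -> R) : continuous f -> {ae leb n, forall x, f x = 0} ->
  forall x, f x = 0.
Proof.
move=> cf [N [mN N0 fN]] y; apply: contrapT => /eqP fy.
have cn : continuous (fun x => `|f x|) by move=> x; apply: continuous_comp;
  [exact: cf|exact: norm_continuous].
have oA : open [set x | 0 < `|f x|].
  by apply: (@open_comp _ _ (fun x => `|f x|) [set t | 0 < t]); [move=> x _;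
    exact: cn|exact: open_gt].
have Ay : [set x | 0 < `|f x|] y by rewrite /= normr_gt0.
have [e /= e0 eA] := (nbhs_ballP _ _).1 (open_nbhs_nbhs (conj oA Ay)).
pose C := [set x : 'rV[R]_n | cube n (e / 2) (x - y)].
have CN : C `<=` N.
  move=> x Cx; apply: fN => /= fx0.
  have : ball y e x.
    rewrite -ball_normE /= distrC; apply: mx_norm_lt => // i.
    by apply: le_lt_trans (Cx i) _; rewrite ltr_pdivrMr// mulr_natr mulr2n ltrDl.
  by move=> /eA /=; rewrite fx0 normr0 ltxx.
have mC : measurable C by exact: (@compact_measurable R n C (@compact_cube_shift R n y (e / 2))).
have C0 : leb n C = 0%E.
  by apply/eqP; rewrite eq_le measure_ge0 andbT -N0 le_measure ?inE.
have : leb n (cube n (e / 2)) = 0%E.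
  have mcube := @measurable_cube R n (e / 2).
  have m1 : measurable_fun setT (fun x : 'rV[R]_n => (\1_C x : R)%:E).
    by apply/measurable_EFinP; exact: measurable_indic.
  have p1 (x : 'rV[R]_n) : (0 <= (\1_C x : R)%:E)%E by rewrite lee_fin indicE.
  have e1 := @ge0_integral_shift_rV R n (fun x => (\1_C x : R)%:E) y m1 p1.
  have e2 := @integral_indic _ _ R (leb n) setT measurableT C mC; rewrite setIT C0 in e2.
  have e3 := @integral_indic _ _ R (leb n) setT measurableT _ mcube; rewrite setIT in e3.
  rewrite -e3 -e2 -e1; apply: eq_integral => x _; rewrite !indicE.
  have -> : (x \in cube n (e / 2)) = (x + y \in C); last exact: erefl.
  by apply/idP/idP => /set_mem h1; apply/mem_set; move: h1; rewrite /C /= addrK.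
rewrite leb_cube ?divr_ge0 ?(ltW e0)// => /eqP; rewrite eqe expf_eq0.
by rewrite mulf_eq0 mulf_eq0 invr_eq0 !pnatr_eq0/= orbF (gt_eqF e0) andbF.
Qed.

Hypothesis gamma0 : gamma != 0.

(** Since v . n vanishes in the domain, so does its trace by [trace_rigid]; that trace is - gamma
    d_1 eta. What remains is to pass from almost every point of the domain to every point of R^d. *)
Lemma surface_zero y : eta y = 0.
Proof.
apply: (nice_der0 (i := i0) ne) => {}y.
have Vall : {ae mu, forall x, forall i, Om x -> V i x = 0}.
  by apply: filter_forall => i; exact: velocity_zero.
have vN0 : {ae mu, forall x, Om x -> vN x = 0}.
  apply: filterS Vall => x hx Ox; rewrite /vN (hx _ Ox) sub0r big1 ?oppr0// => j _.
  by rewrite (hx _ Ox) mul0r.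
have t0 := trace_rigid cz topz' vN_meas trN (wD_zero [:: ord_max] vN_meas vN0).
have cd := C1f_dcont (i := i0) ce.
have d0 : {ae mu, forall x, Om x -> 'D_(ee i0) eta (hpart x) ^+ 2 = 0}.
  apply: filterS2 vN0 t0 => x h1 h2 Ox; have := h2 Ox; rewrite (h1 Ox) /tN => /esym /eqP.
  by rewrite mulf_eq0 oppr_eq0 (negbTE gamma0) => /eqP ->; rewrite expr0n.
have li := (slope_L2 i0).2.
(* Vertical integration transfers the information to R^d with the positive weight [zeta], where
   continuity makes it pointwise. *)
have [gi gE] := hpart_intg cz zM li (fun y => sqr_ge0 _).
have z : \int[mu]_(x in Om) ('D_(ee i0) eta (hpart x) ^+ 2) = 0.
  rewrite (@ae_Rint _ _ _ mu Om _ (fun=> 0) mO (intg_meas gi) (measurable_cst _) d0).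
  by rewrite Rintegral_cst ?mul0r.
rewrite gE in z.
have czd : continuous (fun y => zeta y * 'D_(ee i0) eta y ^+ 2).
  apply: contM; first exact: cz.
  by under eq_fun do rewrite expr2; apply: contM; exact: cd.
have zp w : 0 <= zeta w * 'D_(ee i0) eta w ^+ 2.
  by apply: mulr_ge0; [have /andP[/ltW] := zM w|exact: sqr_ge0].
have izd : intg (leb d) setT (fun y => zeta y * 'D_(ee i0) eta y ^+ 2).
  apply: (@intgMb _ _ _ (leb d) _ _ _ M measurableT mz _ li) => w _.
  by have /andP[z0 z1] := zM w; rewrite gtr0_norm.
have a0 := Rint_ge0_eq0 measurableT izd (fun w _ => zp w) z.
have a1 : {ae leb d, forall w, zeta w * 'D_(ee i0) eta w ^+ 2 = 0} by apply: filterS a0 => w; exact.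
have /eqP := cont_ae0 czd a1 y; rewrite mulf_eq0 sqrf_eq0.
by have /andP[z0 _] := zM y; rewrite (gt_eqF z0) => /eqP.
Qed.

(** With v = 0 and eta = 0 the momentum equation leaves d_n p = 0, and p coincides almost everywhere
    with the last component of the traction, whose trace on the top is 0. *)
Lemma pressure_zero : {ae mu, forall x, Om x -> p x = 0}.
Proof.
have e0 : eta = fun=> 0 by apply/funext => y; exact: surface_zero.
have dh0 j x : dh j x = 0 by rewrite /dh e0 derive_cst.
have Vall : {ae mu, forall x, forall i, Om x -> V i x = 0}.
  by apply: filter_forall => i; exact: velocity_zero.
have dv0 : {ae mu, forall x, forall i, forall j, Om x -> dv i j x = 0}.
  apply: filter_forall => i; apply: filter_forall => j.
  exact: (wD_zero [:: j] (lV i).1 (velocity_zero i)).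
have lap0 : {ae mu, forall x, forall i, forall j, Om x -> lap i j x = 0}.
  apply: filter_forall => i; apply: filter_forall => j.
  exact: (wD_zero [:: j; j] (lV i).1 (velocity_zero i)).
have dp0 : {ae mu, forall x, Om x -> dp ord_max x = 0}.
  apply: filterS3 (momentum ord_max) dv0 lap0 => x hx h1 h2 Ox; have := hx Ox.
  rewrite deta_max addr0 /h big1 => [|j _]; last by rewrite h1 // mulr0.
  by rewrite big1 => [|j _]; [rewrite subrr add0r|rewrite h2].
have stp : {ae mu, forall x, Om x -> p x = st ord_max x}.
  apply: filterS dv0 => x h1 Ox; rewrite /st big1 => [|j _]; last by rewrite dh0 mulr0.
  by rewrite /T /S !h1// eqxx addr0 !subr0 surface_zero mul0r addr0 mulr1.
have wst := weak_deriv_ae (st_meas ord_max) (wdp ord_max) stp.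
have st0 : {ae mu, forall x, Om x -> wD Om [:: ord_max] (st ord_max) x = 0}.
  apply: filterS2 (wD_ae oO wst) dp0 => x h1 h2 Ox; by rewrite (h1 Ox) (h2 Ox).
have := trace_rigid cz topz' (st_meas ord_max) (trS ord_max) st0.
have H0 y : H y = 0.
  rewrite /H /curvature big1// => j _; rewrite (_ : (fun z => _) = fun=> 0) ?derive_cst//.
  by apply/funext => z; rewrite mxE e0 derive_cst mul0r.
move=> trp; apply: filterS2 trp stp => x h1 h2 Ox; rewrite (h2 Ox) (h1 Ox) /ts surface_zero H0.
by rewrite mulr0 subrr mul0r.
Qed.

Lemma rigidity : [/\ forall i, {ae mu, forall x, Om x -> V i x = 0},
  forall y, eta y = 0 & {ae mu, forall x, Om x -> p x = 0}].
Proof. by split; [exact: velocity_zero|exact: surface_zero|exact: pressure_zero]. Qed.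

End energy.

(** * From the stated system to the rigidity statement *)

Lemma hpart_sum {R : realType} d (x : 'rV[R]_d.+1) (eta : 'rV[R]_d -> R) (f : 'I_d.+1 -> R) :
  \sum_j f j * normal eta (hpart x) 0 j =
  f ord_max - \sum_(j < d) f (lift ord_max j) * 'D_(delta_mx 0 j) eta (hpart x).
Proof.
rewrite sum_lift /normal pt_ord_max mulr1 -sumrN; congr (_ + _).
by apply: eq_bigr => j _; rewrite pt_lift !mxE mulrN.
Qed.

(* The dimension n is d.+1. *)
Theorem theorem1p2 (R : realType) (d : nat) (b gamma sigma : R) :
  (3 <= d.+1)%N -> 0 < b -> gamma != 0 -> 0 < sigma ->
  let s := ((d.+1)./2).+1 in
  exists2 r : R, 0 < r &
  forall (eta : 'rV[R]_d -> R) (v : 'rV[R]_d.+1 -> 'rV[R]_d.+1)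
    (q : 'rV[R]_d.+1 -> R),
  let zeta := fun y => b + eta y in
  let Om := Omega zeta in
  continuous eta ->
  in_X (s%:R + 5 / 2) eta ->
  ((- b)%:E < ereal_inf (range (EFin \o eta)))%E ->
  in_0H s.+2 Om v ->
  in_Y s.+1 Om q ->
  in_H s.+1 Om (fun x => q x - eta (hpart x)) ->
  {ae leb d.+1, forall x, Om x -> forall i : 'I_d.+1,
     \sum_(j < d.+1) (v x - gamma *: e1 d.+1) 0 j * wgrad Om v x i j
     - \sum_(j < d.+1) wD Om [:: j; j] (fun z => v z 0 i) x
     + wD Om [:: i] q x = 0} ->
  {ae leb d.+1, forall x, Om x -> \tr (wgrad Om v x) = 0} ->
  (forall i : 'I_d.+1, has_trace Om zeta
     (fun x => \sum_(j < d.+1)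
        ((q x)%:M - symgrad Om v x) i j * normal eta (hpart x) 0 j)
     (fun y => (eta y - sigma * curvature eta y) * normal eta y 0 i)) ->
  has_trace Om zeta
    (fun x => dot (v x) (normal eta (hpart x)))
    (fun y => - gamma * 'D_(e1 d) eta y) ->
  (forall i : 'I_d.+1,
     has_trace Om (fun=> 0) (fun x => v x 0 i) (fun=> 0)) ->
  [/\ {ae leb d.+1, forall x, Om x -> v x = 0},
      {ae leb d.+1, forall x, Om x -> q x = 0}
    & forall y, eta y = 0] \/
  (r%:E <= Hvec_norm s.+2 Om v + Y_norm s.+1 Om q
           + X_norm (s%:R + 5 / 2) eta
           + H_norm s.+1 Om (fun x => q x - eta (hpart x))%R)%E.
Proof.
move=> d2 b0 gamma0 sigma0 s; exists 1 =>
  // eta v q zeta Om ce eX etab vH qY pH momentum div trS trN trV.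
left.
have d0 : (0 < d)%N by exact: ltn_trans (ltn0Sn 0) d2.
pose i0 : 'I_d := Ordinal d0.
pose V i x := v x 0 i; pose p x := q x - eta (hpart x).
have ne : nice eta.
  (* The required d + 2 <= 2s holds because 2s = 2 floor((d+1)/2) + 2, with equality when d + 1 is
     odd. *)
  apply: (in_X_nice _ ce eX); rewrite /s doubleS; have := odd_double_half d.+1; lia.
have [C hC] := nice_bounded ne.
(* The strict inequality for the infimum yields a uniform positive depth. The infimum is a real
   number, being above -b and at most [eta 0]. *)
have [zm zm0 zmz] : exists2 zm, 0 < zm & forall y, zm <= zeta y.
  have [m hm]: exists m, ereal_inf (range (EFin \o eta)) = m%:E.
    case E : (ereal_inf _) etab => [m| |] // _; first by exists m.
    have : (ereal_inf (range (EFin \o eta)) <= (eta 0)%:E)%E.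
      by apply: ereal_inf_lbound; exists 0.
    by rewrite E.
  exists (b + m) => [|y]; first by move: etab; rewrite hm lte_fin -subr_gt0 opprK addrC.
  rewrite /zeta lerD2l -lee_fin -hm; apply: ereal_inf_lbound; by exists y.
have zM y : 0 < zeta y <= b + C.
  rewrite (lt_le_trans zm0 (zmz y))/= lerD2l; exact: le_trans (ler_norm _) (hC y).
have [cz _] := zeta_C1f b ne; have {}cz := C1f_cont cz.
have oO : open Om by exact: open_Omega.
have mO : measurable Om by exact: Omega_meas (continuous_measurable_rV cz).
have ceta := eta_C1f ne.
have lV i : L2 (leb d.+1) Om (V i) by apply/in_L2P; [exact: mO|exact: (vH i).1.1].
have w1 i j := @in_H_weak R _ s.+2 1 Om (V i) j oO isT (vH i).1.
have w2 i j := @in_H_weak R _ s.+2 2 Om (V i) j oO isT (vH i).1.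
have w3 j := @in_H_weak R _ s.+1 1 Om p j oO isT pH.
have lp : L2 (leb d.+1) Om p by apply/in_L2P; [exact: mO|exact: pH.1].
have e1E : e1 d = delta_mx 0 i0 :> 'rV[R]_d.
  by apply/rowP => j; rewrite !mxE eqxx /= (_ : (j == i0) = (j == 0 :> nat)).
have e1S j : (e1 d.+1 : 'rV[R]_d.+1) 0 j = (j == lift ord_max i0)%:R.
  by rewrite mxE -[j == lift _ _]val_eqE /= /bump leqNgt d0.
(* The hypotheses provide weak derivatives of p = q - eta, not of q. Since [wD] is a chosen
   representative, the sum rule holds only almost everywhere. *)
have wq i : {ae leb d.+1, forall x, Om x ->
    wD Om [:: i] q x = wD Om [:: i] p x + 'D_(delta_mx 0 i) (fun z => eta (hpart z)) x}.
  apply: (wD_ae oO); rewrite (_ : q = fun x => p x + eta (hpart x)); last first.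
    by apply/funext => x; rewrite subrK.
  apply: (weak_derivD oO (w3 i).1); apply: (weak_deriv_C1 oO (cont_hpart ce)).
    move=> x; case: (unliftP ord_max i) => [j|] ->; last exact: (derive_hpart_max eta x).1.
    by apply: derivable_hpart; case: ceta => _ h _; exact: h.
  case: (unliftP ord_max i) => [j|] ->.
    rewrite (_ : 'D_(delta_mx 0 (lift ord_max j)) _ = fun x => 'D_(delta_mx 0 j) eta (hpart x)).
      by apply: (@cont_hpart _ _ (fun y => 'D_(delta_mx 0 j) eta y)); exact: C1f_dcont ceta.
    by apply/funext => x; exact: derive_hpart.
  rewrite (_ : 'D_(delta_mx 0 ord_max) _ = fun=> 0); first exact: cont_cst.
  by apply/funext => x; exact: (derive_hpart_max eta x).2.
have mq : measurable_fun Om q by exact: qY.1.1.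
(* Writing q = p + eta on the diagonal separates a square integrable stress from [eta] times the
   identity. *)
have stE i x : \sum_(j < d.+1) ((q x)%:M - symgrad Om v x) i j * normal eta (hpart x) 0 j =
    \sum_(j < d.+1) (p x * (i == j)%:R - (wD Om [:: j] (V i) x + wD Om [:: i] (V j) x) +
      eta (hpart x) * (i == j)%:R) * normal eta (hpart x) 0 j.
  apply: eq_bigr => j _; congr (_ * _); rewrite /p !mxE -mulr_natr /V.
  by move: (wD _ _ _ x) (wD _ _ _ x) (q x) (eta _) => ? ? ? ?; ring.
pose T i j x := p x * (i == j)%:R - (wD Om [:: j] (V i) x + wD Om [:: i] (V j) x) +
      eta (hpart x) * (i == j)%:R.
have mT i j : measurable_fun Om (T i j).
  apply: measurable_funD; last by apply: measurable_funM => //; apply: (meas_hpart ce).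
  apply: measurable_funB; first by apply: measurable_funM => //; exact: lp.1.
  by apply: measurable_funD; exact: wD_meas.
have nE i y : normal eta y 0 i = if unlift ord_max i is Some j then - 'D_(delta_mx 0 j) eta y else
  1.
  by rewrite /normal mxE; case: (unlift _ _) => // j; rewrite !mxE.
have trS' i : has_trace Om zeta
    (fun x => T i ord_max x - \sum_(j < d) T i (lift ord_max j) x * 'D_(delta_mx 0 j) eta (hpart x))
    (fun y => (eta y - sigma * curvature eta y) *
              (if unlift ord_max i is Some j then - 'D_(delta_mx 0 j) eta y else 1)).
  have := trS i; rewrite (_ : (fun x => \sum_j _ * _) = fun x => T i ord_max x -
      \sum_(j < d) T i (lift ord_max j) x * 'D_(delta_mx 0 j) eta (hpart x)); last first.
    by apply/funext => x; rewrite stE hpart_sum.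
  by rewrite (_ : (fun y => _ * normal _ _ _ _) = fun y => (eta y - sigma * curvature eta y) *
      (if unlift ord_max i is Some j then - 'D_(delta_mx 0 j) eta y else 1)) //; apply/funext => y;
        rewrite nE.
have mS i : measurable_fun Om (fun x => T i ord_max x -
    \sum_(j < d) T i (lift ord_max j) x * 'D_(delta_mx 0 j) eta (hpart x)).
  apply: measurable_funB => //; apply: measurable_sum => j; apply: measurable_funM => //.
  by apply: (meas_hpart (C1f_dcont ceta)).
have trN' : has_trace Om zeta
    (fun x => V ord_max x - \sum_(j < d) V (lift ord_max j) x * 'D_(delta_mx 0 j) eta (hpart x))
    (fun y => - gamma * 'D_(delta_mx 0 i0) eta y).
  by move: trN; rewrite e1E (_ : (fun x => dot _ _) = fun x => V ord_max x -
    \sum_(j < d) V (lift ord_max j) x * 'D_(delta_mx 0 j) eta (hpart x))//; apply/funext => x;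
      exact: hpart_sum.
have div' : {ae leb d.+1, forall x, Om x -> \sum_j wD Om [:: j] (V j) x = 0}.
  by apply: filterS div => x h /h; rewrite /mxtrace => {2}<-; apply: eq_bigr => j _; rewrite mxE.
have mom' i : {ae leb d.+1, forall x, Om x ->
    \sum_j (V j x - gamma * (j == lift ord_max i0)%:R) * wD Om [:: j] (V i) x
    - \sum_j wD Om [:: j; j] (V i) x + wD Om [:: i] p x
    + 'D_(delta_mx 0 i) (fun z => eta (hpart z)) x = 0}.
  apply: filterS2 (wq i) momentum => x h1 h2 Ox; rewrite -addrA -(h1 Ox) -[RHS](h2 Ox i).
  by congr (_ - _ + _); apply: eq_bigr => j _; rewrite 2!mxE -e1S !mxE.
have [v0 eta0 p0] := @rigidity R d gamma sigma eta b (b + C) zm i0 ne zM zm0 zmz V p lV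
  (fun i j => (w1 i j).1) (fun i j => (w1 i j).2) (fun i j => (w2 i j).1) (fun i j => (w2 i j).2)
  lp (fun i => (w3 i).1) (fun i => (w3 i).2) div' mom' trV trN' mS trS' gamma0.
have {}v0 : {ae leb d.+1, forall x, forall i, Om x -> V i x = 0} by exact: filter_forall.
split=> //.
  by apply: filterS v0 => x h Ox; apply/rowP => i; rewrite mxE; exact: h.
by apply: filterS p0 => x h Ox; move: (h Ox); rewrite /p eta0 subr0.
Qed.
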